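(* Let $k \ge 3$. There exist $h_0>0$ and a constant $C>0$ independent of $h$ such that for every mesh $\mathcal{T}_h$ of the family with $h \le h_0$, the discrete problem: find $u_h \in V_h$ with $u_h = g_h$ on $\partial\Omega$ and $$A(u_h,\phi)=0 \quad \forall \phi \in V_h\cap H_0^1(\Omega),$$ has a unique solution $u_h$ in $B_h$, and $$\|u-u_h\|_{H^1(\Omega)} \le C h^k .$$
   Context: Continuous problem. $\Omega\subset\mathbb{R}^2$ is a convex polygonal domain, $f\in C^1(\overline\Omega)$ with $f\ge c_0$ for a constant $c_0>0$, and $g\in C(\partial\Omega)$ extends to a function $G\in C^3(\overline\Omega)$. The problem $\det(D^2u)=f$ in $\Omega$, $u=g$ on $\partial\Omega$, is assumed to have a strictly convex solution $u\in C^3(\overline\Omega)$, so that the cofactor matrix $\operatorname{cof} D^2u$ of the Hessian is uniformly positive definite: $\alpha_0|r|^2\le r^T(\operatorname{cof} D^2u(x))r\le\alpha_1|r|^2$ for all $x\in\overline\Omega$, $r\in\mathbb{R}^2$, with constants $\alpha_0,\alpha_1>0$. Moreover $u, G\in W^{k+1,\infty}(\Omega)$. Discretization. $\{\mathcal{T}_h\}$ is a family of conforming, shape regular, quasi-uniform triangulations of $\Omega$ into triangles $K$, $h=\max_K \operatorname{diam}K\le 1$; $\mathcal{E}_h^i$ is the set of interior edges. $V_h$ is the Lagrange finite element space of degree $k$ on $\mathcal{T}_h$ (continuous functions on $\overline{\Omega}$ that are polynomials of degree $\le k$ on each $K$), $I_h$ is the canonical Lagrange interpolant into $V_h$, and $g_h$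 is the canonical interpolant in $V_h$ of a continuous extension of $g$ (only its values on $\partial\Omega$ matter, so $g_h=I_hG=I_hu$ on $\partial\Omega$). Derivatives of piecewise smooth functions are taken element by element. For an interior edge $e=K^+\cap K^-$ with outward unit normals $n_{K^\pm}$: for a vector field $v$, $[\![v]\!]=v|_{K^+}\cdot n_{K^+}+v|_{K^-}\cdot n_{K^-}$; for a matrix field $E$, $\{\!\{E\}\!\}=\tfrac12(E|_{K^+}+E|_{K^-})$. Define $$A(v,\phi)=\sum_{K\in\mathcal{T}_h}\int_K (f-\det D^2v)\,\phi\,dx+\sum_{e\in\mathcal{E}_h^i}\int_e[\![\{\!\{\operatorname{cof}D^2v\}\!\}Dv]\!]\,\phi\,ds .$$ Set $A'(u;v,\phi)=\int_\Omega\big((\operatorname{cof}D^2u)Dv\big)\cdot D\phi\,dx$ (the Fréchet derivative of $A(\cdot,\phi)$ at $u$ in direction $v$). The set $B_h$. Let $\hat P_h:H_0^1(\Omega)\to V_h\cap H_0^1(\Omega)$ be the projection with respect to $A'(u;\cdot,\cdot)$, i.e. $A'(u;\hat P_hv-v,\phi)=0$ for all $\phi\in V_h\cap H_0^1(\Omega)$, and set $P_hu=\hat P_h(u-G)+I_hG$. For $z\in\Omega\setminus\bigcup_K\partial K$ let $g^z_{h,i}$ ($i=1,2$) and $G^z_h$ in $V_h\cap H_0^1(\Omega)$ be the discrete Green's functions defined by $A'(u;g^z_{h,i},\phi)=\frac{\partial\phi}{\partial x_i}(z)$ and $A'(u;G^z_h,\phi)=\phi(z)$ for all $\phi\in V_h\cap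 H_0^1(\Omega)$. For $h$ sufficiently small there are positive constants $C_1,C_2,C_3$, independent of $h$ and $z$, with $\|u-P_hu\|_{W^{1,\infty}}\le C_1h^k$, $|A'(u;I_hG-G,G^z_h)|\le C_2h^k|\ln h|$ and $|A'(u;I_hG-G,g^z_{h,i})|\le C_3h^k|\ln h|$; fix such constants and let $C_4=\max\{C_1,C_2,C_3\}$. Then $$B_h=\{v\in V_h:\ v=g_h\text{ on }\partial\Omega,\ \|v-u\|_{W^{1,\infty}(\Omega)}\le 3C_4h^k|\ln h|\}.$$ *)

(* Defs.v *)
From HB Require Import structures.
From mathcomp Require Import all_boot all_order all_algebra.
From mathcomp Require Import all_classical all_reals all_analysis.

Set Implicit Arguments.
Unset Strict Implicit.
Unset Printing Implicit Defensive.

Import Order.TTheory GRing.Theory Num.Theory.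
Import numFieldNormedType.Exports.

Local Open Scope classical_set_scope.
Local Open Scope ring_scope.

(* The plane is [R * R]: its library norm is the sup norm (same topology), so
   Euclidean quantities go through [vec]. *)

Definition vec (R : realType) (x : R * R) : 'cV[R]_2 :=
  \col_(i < 2) (if i == ord0 then x.1 else x.2).

Definition dot (R : realType) (a b : 'cV[R]_2) : R := (a^T *m b) ord0 ord0.

Definition eucl_dist (R : realType) (x y : R * R) : R :=
  Num.sqrt (dot (vec (y - x)) (vec (y - x))).

Definition basis2 (R : realType) (i : 'I_2) : R * R :=
  ((i == ord0)%:R, (i == ord_max)%:R).

Definition area (R : realType) :=
  (@lebesgue_measure R \x @lebesgue_measure R)%E.
Arguments area R : clear implicits.

Definition bdry (R : realType) (D : set (R * R)) : set (R * R) :=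
  closure D `\` D°.

Definition hull (R : realType) (s : seq (R * R)) : set (R * R) :=
  [set x | exists c : 'I_(size s) -> R,
     [/\ forall i, 0 <= c i, \sum_i c i = 1 & x = \sum_i c i *: tnth (in_tuple s) i]].

Definition diam (R : realType) (D : set (R * R)) : R :=
  sup [set d | exists x y, [/\ D x, D y & d = eucl_dist x y]].

Definition inball_diam (R : realType) (D : set (R * R)) : R :=
  sup [set d | exists (c : R * R) (r : R),
    [/\ 0 <= r, [set x | eucl_dist c x <= r] `<=` D & d = r *+ 2]].

Definition convex_polygonal_domain (R : realType) (Om : set (R * R)) : Prop :=
  Om !=set0 /\ exists s : seq (R * R), Om = (hull s)°.

Definition strictly_convex_on (R : realType) (D : set (R * R)) (w : R * R -> R) : Prop :=
  forall x y (t : R), D x -> D y -> x <> y -> 0 < t -> t < 1 ->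
    w (t *: x + (1 - t) *: y) < t * w x + (1 - t) * w y.

(* [dpart [:: i; j] w] is the iterated classical derivative d_i (d_j w). *)
Definition dpart (R : realType) (s : seq 'I_2) (w : R * R -> R) : R * R -> R :=
  foldr (fun i (v : R * R -> R) => fun x : R * R => 'D_(basis2 R i) v x) w s.

Definition grad (R : realType) (w : R * R -> R) (x : R * R) : 'cV[R]_2 :=
  \col_i dpart [:: i] w x.

Definition hess (R : realType) (w : R * R -> R) (x : R * R) : 'M[R]_2 :=
  \matrix_(i, j) dpart [:: i; j] w x.

Definition cof (R : realType) (M : 'M[R]_2) : 'M[R]_2 :=
  \matrix_(i, j) cofactor M i j.

(* Value at a point [x] of the closure of the open set [D] of a function known
   inside [D]: the limit at [x] from within [D]. *)
Definition trace_from (R : realType) (D : set (R * R)) (F : R * R -> R) (x : R * R) : R :=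
  lim (F y @[y --> within D (nbhs x)]).

Definition grad_from (R : realType) (D : set (R * R)) (w : R * R -> R) (x : R * R) : 'cV[R]_2 :=
  \col_i trace_from D (dpart [:: i] w) x.

Definition hess_from (R : realType) (D : set (R * R)) (w : R * R -> R) (x : R * R) : 'M[R]_2 :=
  \matrix_(i, j) trace_from D (dpart [:: i; j] w) x.

(* C^m of the closure of the open set [D]: all derivatives of order <= m exist
   in [D] and extend continuously to the closure. *)
Definition Cm_closure (R : realType) (D : set (R * R)) (m : nat) (w : R * R -> R) : Prop :=
  {within closure D, continuous w} /\
  forall s : seq 'I_2, (size s <= m)%N ->
    ((size s < m)%N -> forall (i : 'I_2) (x : R * R), D x ->
        derivable (dpart s w) x (basis2 R i)) /\
    exists2 v : R * R -> R, {within closure D, continuous v} &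
      forall x, D x -> v x = dpart s w x.

(* C_c^oo(D) *)
Definition test_function (R : realType) (D : set (R * R)) (phi : R * R -> R) : Prop :=
  [/\ forall s : seq 'I_2, continuous (dpart s phi),
      forall (s : seq 'I_2) (i : 'I_2) (x : R * R), derivable (dpart s phi) x (basis2 R i) &
      exists2 A : set (R * R), compact A /\ A `<=` D & forall x, ~ A x -> phi x = 0].

Definition Linfty_norm (R : realType) (D : set (R * R)) (w : R * R -> R) : \bar R :=
  ('N[area R]_+oo[EFin \o (w \_ D)])%E.

Definition Linfty (R : realType) (D : set (R * R)) (w : R * R -> R) : Prop :=
  measurable_fun D w /\ (Linfty_norm D w < +oo)%E.

(* W^{m,oo}(D), with distributional derivatives *)
Definition Wminfty (R : realType) (D : set (R * R)) (m : nat) (w : R * R -> R) : Prop :=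
  Linfty D w /\
  forall s : seq 'I_2, (size s <= m)%N ->
    exists2 d : R * R -> R, Linfty D d &
      forall phi, test_function D phi ->
        \int[area R]_(x in D) (w x * dpart s phi x) =
        (- 1) ^+ size s * \int[area R]_(x in D) (d x * phi x).

(* A triangle is given by its vertices, a mesh by the list of its triangles. *)
Definition triangle (R : realType) := (3.-tuple (R * R))%type.
Definition mesh (R : realType) := seq (triangle R).

Definition nth_tri (R : realType) (T : mesh R) (i : 'I_(size T)) : triangle R :=
  tnth (in_tuple T) i.

Definition meshsize (R : realType) (T : mesh R) : R :=
  \big[Num.max/0]_(K <- T) diam (hull K).

Definition conforming_triangulation (R : realType) (Om : set (R * R)) (T : mesh R) : Prop :=
  [/\ forall K, K \in T -> (hull K)° !=set0,
      \bigcup_(K in [set` T]) hull K = closure Om &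
      forall i j : 'I_(size T), i != j ->
        let K := nth_tri i in let K' := nth_tri j in
        [\/ hull K `&` hull K' = set0,
            exists p, [/\ p \in K, p \in K' & hull K `&` hull K' = [set p]] |
            exists p q, [/\ p != q, p \in K /\ q \in K, p \in K' /\ q \in K' &
                            hull K `&` hull K' = hull [:: p; q]]]].

Definition shape_regular (R : realType) (F : set (mesh R)) : Prop :=
  exists2 sigma : R, 0 < sigma &
    forall T, F T -> forall K, K \in T -> diam (hull K) <= sigma * inball_diam (hull K).

Definition quasi_uniform (R : realType) (F : set (mesh R)) : Prop :=
  exists2 tau : R, 0 < tau &
    forall T, F T -> forall K, K \in T -> meshsize T <= tau * diam (hull K).

(* Domain minus the (null) union of the element boundaries: the set on which
   element-by-element derivatives are classical derivatives. *)
Definition broken (R : realType) (Om : set (R * R)) (T : mesh R) : set (R * R) :=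
  Om `\` \bigcup_(K in [set` T]) bdry (hull K).

(* Broken Sobolev norms; on conforming functions they are the Sobolev norms. *)
Definition H1_norm (R : realType) (Om : set (R * R)) (T : mesh R) (w : R * R -> R) : \bar R :=
  sqrte (\int[area R]_(x in broken Om T)
           ((w x) ^+ 2 + dot (grad w x) (grad w x))%:E)%E.

Definition W1infty_norm (R : realType) (Om : set (R * R)) (T : mesh R) (w : R * R -> R) : \bar R :=
  maxe (Linfty_norm (broken Om T) w)
    (maxe (Linfty_norm (broken Om T) (dpart [:: ord0] w))
          (Linfty_norm (broken Om T) (dpart [:: ord_max] w))).

(* Values outside the closure of [Om] are irrelevant and unconstrained. *)
Definition Vh (R : realType) (Om : set (R * R)) (T : mesh R) (k : nat) : set (R * R -> R) :=
  [set v | {within closure Om, continuous v} /\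
     forall K, K \in T -> exists c : nat -> nat -> R, forall x, hull K x ->
       v x = \sum_(i < k.+1) \sum_(j < k.+1 | (i + j <= k)%N) c i j * x.1 ^+ i * x.2 ^+ j].

(* V_h intersected with H^1_0: for functions of V_h, which are continuous up to
   the boundary, the trace is the restriction to the boundary. *)
Definition Vh0 (R : realType) (Om : set (R * R)) (T : mesh R) (k : nat) : set (R * R -> R) :=
  [set v | Vh Om T k v /\ forall x, bdry Om x -> v x = 0].

(* Lagrange node of [K] with barycentric coordinates [a i / k]. *)
Definition lagrange_node (R : realType) (K : triangle R) (k : nat) (a : 'I_3 -> nat) : R * R :=
  \sum_(i < 3) ((a i)%:R / k%:R : R) *: tnth K i.

(* [xget] picks the element of V_h characterized by the given property; it is
   unique as a function on the closure of [Om]. *)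
Definition interp (R : realType) (Om : set (R * R)) (T : mesh R) (k : nat)
    (w : R * R -> R) : R * R -> R :=
  xget (fun=> 0) [set v | Vh Om T k v /\
    forall K, K \in T -> forall a : 'I_3 -> nat, (\sum_(i < 3) a i)%N = k ->
      v (lagrange_node K k a) = w (lagrange_node K k a)].

Definition Aprime (R : realType) (Om : set (R * R)) (T : mesh R)
    (u v phi : R * R -> R) : R :=
  \int[area R]_(x in broken Om T) dot (cof (hess u x) *m grad v x) (grad phi x).

Definition Phat (R : realType) (Om : set (R * R)) (T : mesh R) (k : nat)
    (u w : R * R -> R) : R * R -> R :=
  xget (fun=> 0) [set v | Vh0 Om T k v /\
    forall phi, Vh0 Om T k phi -> Aprime Om T u (v \- w) phi = 0].

Definition Ph (R : realType) (Om : set (R * R)) (T : mesh R) (k : nat)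
    (u G : R * R -> R) : R * R -> R :=
  Phat Om T k u (u \- G) \+ interp Om T k G.

Definition green (R : realType) (Om : set (R * R)) (T : mesh R) (k : nat)
    (u : R * R -> R) (z : R * R) : R * R -> R :=
  xget (fun=> 0) [set v | Vh0 Om T k v /\
    forall phi, Vh0 Om T k phi -> Aprime Om T u v phi = phi z].

Definition dgreen (R : realType) (Om : set (R * R)) (T : mesh R) (k : nat)
    (u : R * R -> R) (i : 'I_2) (z : R * R) : R * R -> R :=
  xget (fun=> 0) [set v | Vh0 Om T k v /\
    forall phi, Vh0 Om T k phi -> Aprime Om T u v phi = dpart [:: i] phi z].

Definition shared_vertices (R : realType) (K K' : triangle R) : seq (R * R) :=
  [seq p <- K | p \in K'].

Definition centroid (R : realType) (K : triangle R) : R * R :=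
  (3%:R^-1 : R) *: \sum_(i < 3) tnth K i.

(* Unit normal to the edge [p, q] of [K], with negative scalar product with
   the direction from the edge to the centroid of [K]. *)
Definition outward_normal (R : realType) (K : triangle R) (p q : R * R) : 'cV[R]_2 :=
  let nu := vec (q.2 - p.2, p.1 - q.1) in
  (- Num.sg (dot nu (vec (centroid K - p))) / eucl_dist p q) *: nu.

(* Integral over the segment [p, q] with respect to arc length. *)
Definition edge_integral (R : realType) (p q : R * R) (F : R * R -> R) : R :=
  eucl_dist p q * \int[@lebesgue_measure R]_(t in `[0, 1]) F (p + (t : R) *: (q - p)).

(* [[ {{cof D^2 v}} Dv ]] at a point of the edge [p, q] common to [K] and [K']. *)
Definition jump_cof (R : realType) (K K' : triangle R) (p q : R * R)
    (v : R * R -> R) (x : R * R) : R :=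
  let E := 2%:R^-1 *: (cof (hess_from (hull K)° v x) + cof (hess_from (hull K')° v x)) in
  dot (E *m grad_from (hull K)° v x) (outward_normal K p q) +
  dot (E *m grad_from (hull K')° v x) (outward_normal K' p q).

(* In a conforming triangulation the interior edges correspond to the unordered
   pairs of elements (here i < j) with exactly two common vertices.  Elements
   are integrated over their interiors, where the elementwise derivatives of v
   are classical. *)
Definition Aform (R : realType) (f : R * R -> R) (T : mesh R) (v phi : R * R -> R) : R :=
  \sum_(K <- T) \int[area R]_(x in (hull K)°) ((f x - \det (hess v x)) * phi x) +
  \sum_(i < size T) \sum_(j < size T |
      (i < j)%N && (size (shared_vertices (nth_tri i) (nth_tri j)) == 2%N))
    let s := shared_vertices (nth_tri i) (nth_tri j) in
    let p := nth 0 s 0 in let q := nth 0 s 1 in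
    edge_integral p q (fun x => jump_cof (nth_tri i) (nth_tri j) p q v x * phi x).

Definition Bh (R : realType) (Om : set (R * R)) (T : mesh R) (k : nat)
    (u gh : R * R -> R) (C4 : R) : set (R * R -> R) :=
  [set v | [/\ Vh Om T k v, forall x, bdry Om x -> v x = gh x &
     (W1infty_norm Om T (v \- u)%R <= (3 * C4 * meshsize T ^+ k * `|ln (meshsize T)|)%:E)%E]].

Definition discrete_solution (R : realType) (Om : set (R * R)) (f : R * R -> R)
    (T : mesh R) (k : nat) (gh uh : R * R -> R) : Prop :=
  [/\ Vh Om T k uh, forall x, bdry Om x -> uh x = gh x &
      forall phi, Vh0 Om T k phi -> Aform f T uh phi = 0].

(* Main.v *)
(** Write e = v - Du for the broken gradient error of v in V_h. Since det D^2 is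
    quadratic, integration by parts on each triangle gives the exact identity
    A(v, phi) = a(e, phi) + q(e, phi): a is the bilinear form of A'(u; ., .), and
    q is quadratic in e and local, so that inverse estimates bound it by
    h^-1 |e|_oo |e|_2 |phi|_2. The discrete problem becomes a fixed point equation for
    a correction y of v0 = P_h u - (the discrete response to I_h G - G), with
    right-hand side -q: small in the L^2 dual norm because k >= 3, and contracting
    in the energy norm. The inverse estimate alone just fails to bound Dy in the
    maximum norm by h^k |ln h|; a Hardy inequality with a logarithmic weight centred
    at the element in question, tested through the energy form, gains the missing
    factor (ln |ln h|)^(1/2). The bounds on the Green's functions control the maximum
    norm of the response to I_h G - G, and uniqueness in B_h is the contraction
    estimate with |e|_oo of order h^k |ln h|. *)
Require Import Defs.
From HB Require Import structures.
From mathcomp Require Import all_boot all_order all_algebra.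
From mathcomp Require Import all_classical all_reals all_analysis.
From mathcomp Require Import measurable_realfun ess_sup_inf.
From mathcomp Require Import zify ring lra.

Set Implicit Arguments.
Unset Strict Implicit.
Unset Printing Implicit Defensive.

Import Order.TTheory GRing.Theory Num.Theory.
Import numFieldNormedType.Exports.

Local Open Scope classical_set_scope.
Local Open Scope ring_scope.

Local Notation conforming := conforming_triangulation.
Local Notation mplane R := (measurableTypeR R * measurableTypeR R)%type.

(** * Triangles in barycentric coordinates *)

Section Geo.
Variable R : realType.
Implicit Types (a b c x y z p q : R * R).

(** The count of powers at k = 3 shapes the proof. The error e is small but its derivatives are not,
    so q has to be expressed through the values of e alone; the derivatives moved to phi cost h^-1.
    With |e|_oo of order h^k |ln h|, and e of order h^k in mean over about h^-2 elements, q has L^2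
    dual norm of order h^(2k-2) |ln h|, and the inverse estimate turns this into |Dy|_oo of order
    h^(2k-3) |ln h|: for k = 3 this is exactly the size of the ball, with a constant that nothing
    makes small. The radius leaves no room for it: of 3 C_4, one share goes to u - P_h u, one to the
    response to I_h G - G, one to y. Any factor tending to zero is therefore enough, and a double
    logarithm provides one. For the same reason a second |ln h| in q must be avoided: the response
    to I_h G - G carries a logarithm in the maximum norm but none in energy, hence the sums of
    squares of elementwise maxima. Integrals are reduced to functions continuous on closed
    triangles, and discrete functions to their polynomial pieces, extended to the whole plane. *)

Definition jac a b c : R :=
  (b.1 - a.1) * (c.2 - a.2) - (b.2 - a.2) * (c.1 - a.1).
Definition bary a b c x : R := jac x b c / jac a b c.

Lemma pairE x y : x.1 = y.1 -> x.2 = y.2 -> x = y.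
Proof. by case: x y => [? ?] [? ?] /= -> ->. Qed.

Lemma scaleRE (t s : R) : t *: (s : R^o) = t * s. Proof. by []. Qed.

Lemma hull3P a b c x : hull [:: a; b; c] x <->
  exists s t u : R, [/\ [/\ 0 <= s, 0 <= t & 0 <= u], s + t + u = 1 &
    x = s *: a + t *: b + u *: c].
Proof.
split=> [[d [d0 d1 ->]]|[s [t [u [[s0 t0 u0] stu ->]]]]].
- move: d d0 d1; rewrite /= => d d0 d1.
  exists (d ord0), (d (lift ord0 ord0)), (d (lift ord0 (lift ord0 ord0))).
  split; first by split; apply: d0.
    by rewrite -d1 !big_ord_recl big_ord0 /= addr0 addrA.
  by rewrite !big_ord_recl big_ord0 /= addr0 addrA !(tnth_nth 0).
- exists (fun i : 'I_3 => nth 0 [:: s; t; u] i); split.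
  + by case=> [[|[|[|//]]] i3] /=.
  + by rewrite !big_ord_recl big_ord0 /= addr0 addrA.
  + by rewrite !big_ord_recl big_ord0 /= addr0 addrA !(tnth_nth 0).
Qed.

Lemma hull2P a b x : hull [:: a; b] x <->
  exists s t : R, [/\ 0 <= s /\ 0 <= t, s + t = 1 & x = s *: a + t *: b].
Proof.
split=> [[d [d0 d1 ->]]|[s [t [[s0 t0] stu ->]]]].
- move: d d0 d1; rewrite /= => d d0 d1.
  exists (d ord0), (d (lift ord0 ord0)).
  split; first by split; apply: d0.
    by rewrite -d1 !big_ord_recl big_ord0 /= addr0.
  by rewrite !big_ord_recl big_ord0 /= addr0 !(tnth_nth 0).
- exists (fun i : 'I_2 => nth 0 [:: s; t] i); split.
  + by case=> [[|[|//]] i3] /=.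
  + by rewrite !big_ord_recl big_ord0 /= addr0.
  + by rewrite !big_ord_recl big_ord0 /= addr0 !(tnth_nth 0).
Qed.

Lemma jac_cyc a b c : jac b c a = jac a b c.
Proof. by rewrite /jac; ring. Qed.

Lemma jac_swap a b c : jac b a c = - jac a b c.
Proof. by rewrite /jac; ring. Qed.

Lemma baryE a b c x : jac a b c != 0 ->
  x = bary a b c x *: a + bary b c a x *: b + bary c a b x *: c.
Proof.
move=> J; rewrite /bary (jac_cyc a b c) -(jac_cyc c a b).
apply: pairE; rewrite /= !scaleRE; move: J; rewrite /jac => J; by field.
Qed.

Lemma bary_sum a b c x : jac a b c != 0 ->
  bary a b c x + bary b c a x + bary c a b x = 1.
Proof.
move=> J; rewrite /bary (jac_cyc a b c) -(jac_cyc c a b).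
move: J; rewrite /jac => J; by field.
Qed.

Lemma bary_comb a b c (s t u : R) : jac a b c != 0 -> s + t + u = 1 ->
  bary a b c (s *: a + t *: b + u *: c) = s.
Proof.
move=> J stu; rewrite /bary; apply: (canLR (mulfK J)).
have -> : s = 1 - t - u by rewrite -stu; ring.
by rewrite /jac /= !scaleRE; ring.
Qed.

Lemma hull_baryP a b c x : jac a b c != 0 -> hull [:: a; b; c] x <->
  [/\ 0 <= bary a b c x, 0 <= bary b c a x & 0 <= bary c a b x].
Proof.
move=> J; split=> [/hull3P[s [t [u [[s0 t0 u0] stu ->]]]]|[h1 h2 h3]].
- have J1 : jac b c a != 0 by rewrite jac_cyc.
  have J2 : jac c a b != 0 by rewrite jac_cyc.
  rewrite bary_comb//; split => //.
    rewrite -addrA addrC bary_comb//; last by rewrite -stu; ring.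
  rewrite addrC addrA bary_comb//; last by rewrite -stu; ring.
- apply/hull3P; exists (bary a b c x), (bary b c a x), (bary c a b x).
  by split; [split|exact: bary_sum|exact: baryE].
Qed.

End Geo.

(** * Affine changes of variables in the plane and integrability of continuous functions *)

Section Cov.
Variable R : realType.
Local Notation mu := (@lebesgue_measure R).
Local Notation area := (area R).
Local Open Scope ereal_scope.

(** Uniqueness of Lebesgue measure: the pushforward, scaled by [|al|], has the right value on
    half-open intervals. A negative [al] exchanges the open and the closed end, hence the two
    cases. *)
Lemma lebesgue_affine (al be : R) (A : set (measurableTypeR R)) : al != 0%R ->
  measurable A ->
  mu A = `|al|%:E * mu ((fun x : R => (al * x + be)%R : measurableTypeR R) @^-1` A).
Proof.
move=> al0 mA.
pose phi : R -> measurableTypeR R := fun x => (al * x + be)%R.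
have mphi : measurable_fun setT phi.
  by apply: measurable_funD => //; exact: measurable_funM.
have k0 : (0 <= `|al|)%R by [].
have E : mu A = mscale (NngNum k0) (pushforward mu phi) A; last by rewrite (E mphi).
move=> m0; apply: lebesgue_measure_unique => // _ [[a b]] _ <-.
rewrite -[RHS]/(`|al|%:E * mu (phi @^-1` `]a, b]%classic)).
have [an|ap|] := ltgtP al 0%R; last by move/eqP; rewrite (negPf al0).
  rewrite (_ : phi @^-1` _ = `[((b - be) / al)%R, ((a - be) / al)%R[%classic).
    rewrite !lebesgue_measure_itv/= !lte_fin ltr_nM2r ?invr_lt0// ltrD2r.
    case: ifPn => _; last by rewrite mule0.
    rewrite -!EFinD -EFinM ltr0_norm//; congr EFin; field.
    exact: ltr0_neq0.
  apply/seteqP; split=> x; rewrite /phi /= !in_itv/= => /andP[h1 h2].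
    rewrite ler_ndivrMr// ltr_ndivlMr//; lra.
  move: h1 h2; rewrite ler_ndivrMr// ltr_ndivlMr// => h1 h2; lra.
rewrite (_ : phi @^-1` _ = `]((a - be) / al)%R, ((b - be) / al)%R]%classic).
  rewrite !lebesgue_measure_itv/= !lte_fin ltr_pM2r ?invr_gt0// ltrD2r.
  case: ifPn => _; last by rewrite mule0.
  rewrite -!EFinD -EFinM gtr0_norm//; congr EFin; field.
  exact: lt0r_neq0.
apply/seteqP; split=> x; rewrite /phi /= !in_itv/= => /andP[h1 h2].
  rewrite ltr_pdivrMr// ler_pdivlMr//; lra.
move: h1 h2; rewrite ltr_pdivrMr// ler_pdivlMr// => h1 h2; lra.
Qed.

Lemma ge0_integral_affine (al be : R) (f : measurableTypeR R -> \bar R) : al != 0%R ->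
  measurable_fun setT f -> (forall x, 0 <= f x) ->
  \int[mu]_y f y = `|al|%:E * \int[mu]_x f (al * (x : R) + be)%R.
Proof.
move=> al0 mf f0.
pose phi : R -> measurableTypeR R := fun x => (al * x + be)%R.
have mphi : measurable_fun setT phi.
  by apply: measurable_funD => //; exact: measurable_funM.
have k0 : (0 <= `|al|)%R by [].
rewrite (eq_measure_integral (mscale (NngNum k0) (pushforward mu phi))); last first.
  by move=> A mA _; exact: lebesgue_affine.
rewrite ge0_integral_mscale//= ge0_integral_pushforward//.
Qed.

(** Fubini with the one-dimensional change of variables in each fibre; for fixed first coordinate
    the shear is only a translation. *)
Lemma ge0_area_fiber (al ga de : R) (f : mplane R -> \bar R) :
  al != 0%R -> measurable_fun setT f -> (forall x, 0 <= f x) ->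
  \int[area]_z f z =
  `|al|%:E * \int[area]_z f (z.1, (al * z.2 + (ga * z.1 + de))%R).
Proof.
move=> al0 mf f0.
have mphi : measurable_fun setT
   (fun z : mplane R =>
     (z.1, (al * z.2 + (ga * z.1 + de))%R : measurableTypeR R)).
  apply: measurable_fun_pair => //; apply: measurable_funD.
    exact: measurable_funM.
  apply: measurable_funD => //; exact: measurable_funM.
rewrite !fubini_tonelli1//; last by apply: measurableT_comp => //.
rewrite -ge0_integralZl//.
- apply: eq_integral => x _; rewrite /fubini_F/=.
  rewrite (@ge0_integral_affine al (ga * x + de))//.
  by apply: measurableT_comp => //; exact: measurable_fun_pair.
- by apply: measurable_fun_fubini_tonelli_F => //; apply: measurableT_comp.
- by move=> x _; apply: integral_ge0.
Qed.

Lemma ge0_area_swap (f : mplane R -> \bar R) :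
  measurable_fun setT f -> (forall x, 0 <= f x) ->
  \int[area]_z f z = \int[area]_z f (z.2, z.1).
Proof.
move=> mf f0.
have mphi : measurable_fun setT
   (fun z : mplane R => (z.2, z.1)).
  exact: measurable_fun_pair.
rewrite fubini_tonelli1// fubini_tonelli2//.
by apply: measurableT_comp.
Qed.

(** When [q] is nonzero, the affine map factors into two fibrewise maps with swaps of the
    coordinates; a first swap reduces the case [q = 0] to this one. *)
Lemma ge0_area_affine (p q r w a1 a2 : R) (f : mplane R -> \bar R) :
  (p * w - q * r)%R != 0%R -> measurable_fun setT f -> (forall x, 0 <= f x) ->
  \int[area]_z f z = `|(p * w - q * r)%R|%:E *
   \int[area]_z f ((p * z.1 + q * z.2 + a1)%R, (r * z.1 + w * z.2 + a2)%R).
Proof.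
wlog q0 : p q r w / q != 0%R => [hw J mf f0|J mf f0].
  have [q0|q0] := eqVneq q 0%R; last exact: hw.
  have p0 : p != 0%R by apply: contra_neq J => ->; rewrite q0; ring.
  rewrite (hw q p w r)//; last first.
    by apply: contra_neq J => h; rewrite -oppr0 -[in RHS]h; ring.
  rewrite distrC ge0_area_swap//.
    congr (_ * _); apply: eq_integral => z _ /=; congr (f (_, _)); ring.
  apply: measurableT_comp => //; apply: measurable_fun_pair; apply: measurable_funD => //;
    by apply: measurable_funD => //; apply: measurable_funM.
have g1 : ((w / q) * q)%R = w by field.
have al1 : (r - w * p / q)%R != 0%R.
  apply: contra_neq J => h; have -> : (p * w - q * r)%R = (- q * (r - w * p / q))%R by field.
  by rewrite h; ring.
rewrite (@ge0_area_fiber (r - w * p / q)%R (w / q) (a2 - (w / q) * a1)%R)//.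
rewrite ge0_area_swap//=; last first.
  apply: measurableT_comp => //; apply: measurable_fun_pair => //.
  apply: measurable_funD; first exact: measurable_funM.
  by apply: measurable_funD => //; exact: measurable_funM.
rewrite (@ge0_area_fiber q p a1)//=; last first.
  apply: measurableT_comp => //; apply: measurable_fun_pair => //.
  apply: measurable_funD; first exact: measurable_funM.
  by apply: measurable_funD => //; exact: measurable_funM.
rewrite muleA -EFinM -normrM; congr (_ * _).
  congr EFin; rewrite -normrN; congr `|_|%R; by field.
by apply: eq_integral => z _ /=; congr (f (_, _)); field.
Qed.

Local Notation R2 := (mplane R).

Lemma area_affine (p q r w a1 a2 : R) (f : R2 -> R) :
  (p * w - q * r)%R != 0%R -> area.-integrable setT (EFin \o f) ->
  (\int[area]_z f z = `|p * w - q * r| *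
   \int[area]_z f (p * z.1 + q * z.2 + a1, r * z.1 + w * z.2 + a2))%R /\
  area.-integrable setT (fun z => (f (p * z.1 + q * z.2 + a1, r * z.1 + w * z.2 + a2)%R)%:E).
Proof.
move=> J /integrableP[mf fi].
pose phi (z : R2) : R2 := ((p * z.1 + q * z.2 + a1)%R, (r * z.1 + w * z.2 + a2)%R).
have mphi : measurable_fun setT phi.
  by apply: measurable_fun_pair; apply: measurable_funD => //;
     apply: measurable_funD => //; apply: measurable_funM.
have mfp : measurable_fun setT (EFin \o f \o phi) by exact: measurableT_comp.
have fpi : area.-integrable setT (EFin \o f \o phi).
  apply/integrableP; split => //.
  move: fi; rewrite (@ge0_area_affine p q r w a1 a2)//; last exact: measurableT_comp.
  set X := (X in _ * X < _) => h.
  have : 0 <= X by apply: integral_ge0.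
  rewrite -[X in X < _]/X; case: X h => [s| |] //.
    by move=> _ _; rewrite ltry.
  by rewrite mulry gtr0_sg ?mul1e ?normr_gt0.
split => //.
rewrite /Rintegral -[X in (_ = X * _)%R]/(fine (`|p * w - q * r|%R%:E)).
rewrite -fineM//; last by apply: integrable_fin_num.
congr fine.
pose P := \int[area]_z ((EFin \o f \o phi)^\+ z).
pose N := \int[area]_z ((EFin \o f \o phi)^\- z).
have EP : \int[area]_z ((EFin \o f)^\+ z) = `|(p * w - q * r)%R|%:E * P.
  rewrite (@ge0_area_affine p q r w a1 a2)//; last exact: measurable_funepos.
  by rewrite /P; congr (mule _ _); apply: eq_integral => z _; rewrite unlock.
have EN : \int[area]_z ((EFin \o f)^\- z) = `|(p * w - q * r)%R|%:E * N.
  rewrite (@ge0_area_affine p q r w a1 a2)//; last exact: measurable_funeneg.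
  by rewrite /N; congr (mule _ _); apply: eq_integral => z _; rewrite unlock.
have Pfin : P \is a fin_num.
  by have := integrable_funepos measurableT fpi; exact: integrable_fin_num.
transitivity (`|(p * w - q * r)%R|%:E * P - `|(p * w - q * r)%R|%:E * N).
  by rewrite -EP -EN -integralE.
rewrite -muleBr; [|by []|exact: fin_num_adde_defr].
by congr (_ * _); rewrite /P /N -integralE.
Qed.

(** Measurability refers to the product sigma-algebra, so an open set is written as a countable
    union of open boxes with rational corners. *)
Lemma open_measurable2 (A : set (R * R)) : open A -> measurable (A : set R2).
Proof.
move=> oA.
pose box (t : (rat * rat) * (rat * rat)) : set R2 :=
  `](ratr t.1.1), (ratr t.1.2)[%classic `*` `](ratr t.2.1), (ratr t.2.2)[%classic.
pose F t := if `[< box t `<=` A >] then box t else set0.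
have -> : (A : set R2) = \bigcup_t F t.
  apply/seteqP; split=> [x Ax|x [t _]]; last first.
    by rewrite /F; case: asboolP => // h /h.
  have [e /= e0 he] : exists2 e : R, (0 < e)%R & ball x e `<=` A.
    by have := oA x Ax; rewrite -nbhs_ballE => -[e e0 h]; exists e.
  have h1 (y : R) : exists t : rat * rat, [/\ (y - e < ratr t.1)%R, (ratr t.1 < y)%R, (y < ratr t.2)%R & (ratr t.2 < y + e)%R].
    have [a] := @rat_in_itvoo R (y - e) y ltac:(lra); rewrite in_itv/= => /andP[a1 a2].
    have [b] := @rat_in_itvoo R y (y + e) ltac:(lra); rewrite in_itv/= => /andP[b1 b2].
    by exists (a, b).
  have [t1 [p1 p2 p3 p4]] := h1 x.1.
  have [t2 [q1 q2 q3 q4]] := h1 x.2.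
  exists (t1, t2) => //; rewrite /F asboolT.
    by split; rewrite /= in_itv/=; apply/andP; split.
  move=> y [/=]; rewrite !in_itv/= => /andP[r1 r2] /andP[s1 s2].
  apply: he; split; rewrite /ball/= ltr_norml; apply/andP; split; lra.
apply: countable_bigcupT_measurable => [|t]; first exact: countableP.
by rewrite /F; case: asboolP => // _; apply: measurableX; exact: measurable_itv.
Qed.

Definition cont (D : set (R * R)) (F : R * R -> R) := {within D, continuous F}.

Lemma cont_at D F x : open D -> cont D F -> D x -> {for x, continuous F}.
Proof.
move=> oD /subspace_continuousP cF Dx.
have := cF x Dx; rewrite /prop_for /continuous_at.
by rewrite within_interior//; move: oD; rewrite openE => /(_ x Dx).
Qed.

Lemma contW D E F : D `<=` E -> cont E F -> cont D F.
Proof. by move=> DE; apply: continuous_subspaceW. Qed.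

Lemma measurable_cont D F : open D -> cont D F -> measurable_fun (D : set R2) (F : R2 -> R).
Proof.
move=> oD cF; apply: (measurability _ (RGenOpens.measurableE R)).
move=> _ [_ [a [b ->] <-]]; apply: open_measurable2.
rewrite openE => x [Dx Fx]; apply: filterI; first exact: open_nbhs_nbhs.
apply: (cont_at oD cF Dx); apply: open_nbhs_nbhs; split => //; exact: interval_open.
Qed.

Lemma compact_box (C : set (R * R)) : compact C -> exists2 M : R, (0 < M)%R &
  forall x, C x -> (`|x.1| <= M)%R /\ (`|x.2| <= M)%R.
Proof.
move=> /compact_bounded[M [_ HM]]; exists (`|M| + 1)%R; first by rewrite ltr_wpDl.
move=> x Cx; have M1 : (M < `|M| + 1)%R by rewrite (le_lt_trans (ler_norm _))// ltrDl.
by have /= := HM (`|M| + 1)%R M1 x Cx; rewrite prod_normE ge_max => /andP.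
Qed.

Lemma cont_bounded C F : compact C -> cont C F -> exists2 M : R, (0 < M)%R &
  forall x, C x -> (`|F x| <= M)%R.
Proof.
move=> cC cF; have /compact_bounded[M [_ HM]] := continuous_compact cF cC.
exists (`|M| + 1)%R; first by rewrite ltr_wpDl.
move=> x Cx; apply: (HM (`|M| + 1)%R); last by exists x.
by rewrite (le_lt_trans (ler_norm _))// ltrDl.
Qed.

Lemma area_bounded_fin (D : set (R * R)) (M : R) : open D ->
  (forall x, D x -> (`|x.1| <= M)%R /\ (`|x.2| <= M)%R) -> area D < +oo.
Proof.
move=> oD DM.
have [M0|M0] := leP 0%R M; last first.
  suff -> : D = set0 by rewrite /Defs.area measure0.
  rewrite -subset0 => x /DM[h _].
  by have := le_lt_trans h M0; rewrite ltNge normr_ge0.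
pose box : set R2 := `[(- M)%R, M]%classic `*` `[(- M)%R, M]%classic.
have h : area D <= area box.
  apply: le_measure; rewrite ?inE.
  - exact: open_measurable2.
  - by apply: measurableX; exact: measurable_itv.
  - by move=> x /DM[]; rewrite !ler_norml => ? ?; split; rewrite /= in_itv.
apply: (le_lt_trans h).
rewrite /Defs.area product_measure1E; [|exact: measurable_itv|exact: measurable_itv].
have L : (mu `[(- M)%R, M]%classic < +oo).
  by rewrite lebesgue_measure_itv/=; case: ifPn => _; rewrite ?ltry.
apply: lte_mul_pinfty; [exact: measure_ge0|by rewrite ge0_fin_numE|exact: L].
Qed.

Lemma integrable_cont D C F : open D -> D `<=` C -> compact C -> cont C F ->
  area.-integrable (D : set R2) (EFin \o (F : R2 -> R)).
Proof.
move=> oD DC cC cF.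
have mD := open_measurable2 oD.
have mF : measurable_fun (D : set R2) (F : R2 -> R) by apply: measurable_cont => //; exact: contW cF.
have [M M0 HM] := cont_bounded cC cF.
have [N N0 HN] := compact_box cC.
apply/integrableP; split; first exact/measurable_EFinP.
apply: (@le_lt_trans _ _ (\int[area]_(x in D) M%:E)).
  apply: ge0_le_integral => //.
  - by apply: measurableT_comp => //; exact/measurable_EFinP.
  - by move=> x Dx; rewrite /= lee_fin; apply: HM; exact: DC.
rewrite integral_cst//; apply: lte_mul_pinfty => //; first by rewrite lee_fin ltW.
by apply: (@area_bounded_fin _ N) => // x /DC /HN.
Qed.

End Cov.

(** * Functions of class C^1 on a convex set *)

Section C1.
Variable R : realType.
Local Notation mu := (@lebesgue_measure R).
Local Notation pt := (R * R)%type.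
Implicit Types (D : set pt) (F G : pt -> R) (x y v : pt).

Definition cvx D := forall x y (t : R), D x -> D y -> 0 <= t -> t <= 1 ->
  D (x + t *: (y - x)).

(** Class C^1 up to the boundary without one-sided derivatives: [F1] and [F2] are continuous on all
    of [D], while differentiability is asked along segments and at inner parameters only. This is
    what the fundamental theorem of calculus uses on each segment of a closed triangle, and it is
    stable under sums and products. *)
Definition C1on D F F1 F2 := [/\ cont D F, cont D F1, cont D F2 &
  forall x v (l : R), 0 < l -> D x -> D (x + l *: v) -> forall t, 0 < t -> t < l ->
   is_derive t (1 : R) (fun t : R => F (x + t *: v))
     (F1 (x + t *: v) * v.1 + F2 (x + t *: v) * v.2)].

Lemma contP D F : cont D F <-> forall x, D x -> F y @[y --> within D (nbhs x)] --> F x.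
Proof. exact: subspace_continuousP. Qed.

Lemma cont_cst D (k : R) : cont D (fun=> k).
Proof. by apply/contP => x _; exact: cvg_cst. Qed.
Lemma contD D F G : cont D F -> cont D G -> cont D (fun x => F x + G x).
Proof. by move=> /contP f /contP g; apply/contP => x Dx; apply: cvgD; [exact: f|exact: g]. Qed.
Lemma contM D F G : cont D F -> cont D G -> cont D (fun x => F x * G x).
Proof. by move=> /contP f /contP g; apply/contP => x Dx; apply: cvgM; [exact: f|exact: g]. Qed.
Lemma contN D F : cont D F -> cont D (fun x => - F x).
Proof. by move=> /contP f; apply/contP => x Dx; apply: cvgN; exact: f. Qed.
Lemma contB D F G : cont D F -> cont D G -> cont D (fun x => F x - G x).
Proof. by move=> f /contN; exact: contD. Qed.
Lemma contX D F n : cont D F -> cont D (fun x => F x ^+ n).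
Proof.
move=> f; elim: n => [|n IH]; first exact: cont_cst.
rewrite (_ : (fun x => _) = (fun x => F x * F x ^+ n)); first exact: contM.
by apply/funext => x; rewrite exprS.
Qed.
Lemma cont_norm D F : cont D F -> cont D (fun x => `|F x|).
Proof. by move=> /contP f; apply/contP => x Dx; apply: cvg_norm; exact: f. Qed.
Lemma cont1 D : cont D (fun x => x.1).
Proof. by apply: continuous_subspaceT => x; exact: cvg_fst. Qed.
Lemma cont2 D : cont D (fun x => x.2).
Proof. by apply: continuous_subspaceT => x; exact: cvg_snd. Qed.
Lemma cont_eq D F G : (forall x, D x -> F x = G x) -> cont D F -> cont D G.
Proof.
move=> FG cF; apply: (subspace_eq_continuous _ cF) => x; rewrite inE => Dx.
exact: FG.
Qed.

Lemma cont_path D F x v (l : R) : cvx D -> 0 < l -> D x -> D (x + l *: v) -> cont D F ->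
  {within `[0, l], continuous (fun t : R => F (x + t *: v))}.
Proof.
move=> cD l0 Dx Dy /contP cF; apply/subspace_continuousP => t /=.
rewrite in_itv/= => /andP[t0 tl].
have Dt s : s \in `[0, l] -> D (x + s *: v).
  rewrite in_itv/= => /andP[s0 sl].
  have -> : x + s *: v = x + (s / l) *: (x + l *: v - x).
    by rewrite addrAC subrr add0r scalerA divfK ?gt_eqF.
  by apply: cD => //; rewrite ?divr_ge0 ?ler_pdivrMr ?mul1r // ltW.
have tI : t \in `[0, l] by rewrite in_itv/= t0.
have h : (x + s *: v) @[s --> t] --> (x + t *: v).
  apply: cvgD; first exact: cvg_cst.
  have ht : (s : R) @[s --> t] --> t by exact: cvg_id.
  exact: (cvgZr_tmp ht).
move=> A /(cF _ (Dt _ tI)) hA.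
have hB : nbhs t (fun s : R => D (x + s *: v) -> A (F (x + s *: v))) := h _ hA.
change (nbhs t (fun s : R => `[0, l]%classic s -> A (F (x + s *: v)))).
by apply: filterS hB => s As s0l; apply: As; exact: Dt.
Qed.

Lemma FTC_path D F F1 F2 x v (l : R) : cvx D -> C1on D F F1 F2 -> 0 < l ->
  D x -> D (x + l *: v) ->
  \int[mu]_(t in `[0, l]) (F1 (x + t *: v) * v.1 + F2 (x + t *: v) * v.2)
  = F (x + l *: v) - F x.
Proof.
move=> cD [cF c1 c2 dF] l0 Dx Dy; rewrite /Rintegral.
rewrite (@continuous_FTC2 _ _ (fun t => F (x + t *: v)))//.
- by rewrite /= scale0r addr0.
- apply/subspace_continuousP => t /=; rewrite in_itv/= => /andP[t0 tl].
  have p1 := cont_path cD l0 Dx Dy c1; have p2 := cont_path cD l0 Dx Dy c2.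
  have ti : `[0, l]%classic t by rewrite /= in_itv/= t0.
  move/subspace_continuousP : p1 => /(_ t ti) p1.
  move/subspace_continuousP : p2 => /(_ t ti) p2.
  by apply: cvgD; (apply: cvgM; last exact: cvg_cst).
- have := cont_path cD l0 Dx Dy cF; rewrite continuous_within_itvP// => -[p1 p2 p3].
  split => // t; rewrite in_itv/= => /andP[t0 tl].
  by have [] := dF x v l l0 Dx Dy t t0 tl.
- move=> t; rewrite in_itv/= => /andP[t0 tl].
  by rewrite derive1E; have [_] := dF x v l l0 Dx Dy t t0 tl.
Qed.

Lemma C1on_cst D (k : R) : C1on D (fun=> k) (fun=> 0) (fun=> 0).
Proof.
split; [exact: cont_cst..|].
by move=> *; rewrite !mul0r addr0; exact: is_derive_cst.
Qed.

Lemma C1onD D F F1 F2 G G1 G2 : C1on D F F1 F2 -> C1on D G G1 G2 ->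
  C1on D (fun x => F x + G x) (fun x => F1 x + G1 x) (fun x => F2 x + G2 x).
Proof.
move=> [f f1 f2 df] [g g1 g2 dg]; split; [exact: contD..|].
move=> x v l l0 Dx Dy t t0 tl.
apply: (is_derive_eq (is_deriveD (df x v l l0 Dx Dy t t0 tl) (dg x v l l0 Dx Dy t t0 tl))).
by ring.
Qed.

Lemma C1onM D F F1 F2 G G1 G2 : C1on D F F1 F2 -> C1on D G G1 G2 ->
  C1on D (fun x => F x * G x) (fun x => F1 x * G x + F x * G1 x)
     (fun x => F2 x * G x + F x * G2 x).
Proof.
move=> [f f1 f2 df] [g g1 g2 dg]; split; [exact: contM|by apply: contD; exact: contM..|].
move=> x v l l0 Dx Dy t t0 tl.
apply: (is_derive_eq (is_deriveM (df x v l l0 Dx Dy t t0 tl) (dg x v l l0 Dx Dy t t0 tl))).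
by rewrite !scaleRE; ring.
Qed.

Lemma C1on_eq D F F1 F2 G G1 G2 : C1on D F F1 F2 -> cvx D ->
  (forall x, D x -> F x = G x) -> (forall x, D x -> F1 x = G1 x) ->
  (forall x, D x -> F2 x = G2 x) -> C1on D G G1 G2.
Proof.
move=> [f f1 f2 df] cD e e1 e2; split; [exact: cont_eq f|exact: cont_eq f1|exact: cont_eq f2|].
move=> x v l l0 Dx Dy t t0 tl.
have Dt s : 0 < s -> s < l -> D (x + s *: v).
  move=> s0 sl.
  have -> : x + s *: v = x + (s / l) *: (x + l *: v - x).
    by rewrite addrAC subrr add0r scalerA divfK ?gt_eqF.
  by apply: cD => //; rewrite ?divr_ge0 ?ler_pdivrMr ?mul1r // ltW.
rewrite -e1; last exact: Dt.
rewrite -e2; last exact: Dt.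
apply: (near_eq_is_derive _ (df x v l l0 Dx Dy t t0 tl)).
have : t \in `]0, l[ by rewrite in_itv/= t0.
move=> /near_in_itvoo; apply: filterS => s; rewrite in_itv/= => /andP[s0 sl].
by apply: e; exact: Dt.
Qed.

End C1.

Ltac contt := repeat lazymatch goal with
  | |- cont _ (fun x => @?f x + @?g x) => apply: contD
  | |- cont _ (fun x => @?f x * @?g x) => apply: contM
  | |- cont _ (fun x => - @?f x) => apply: contN
  | |- cont _ (fun x => @?f x ^+ _) => apply: contX
  | |- cont _ fst => exact: cont1
  | |- cont _ snd => exact: cont2
  | |- cont _ (fun x => x.1) => exact: cont1
  | |- cont _ (fun x => x.2) => exact: cont2
  | |- cont _ (fun x => ?k) => exact: cont_cst
  | |- cont _ _ => assumption
  end.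

(** * Integrals over triangles and Green's formulas *)

Section Tri.
Variable R : realType.
Local Notation mu := (@lebesgue_measure R).
Local Notation pt := (R * R)%type.
Implicit Types (D : set pt) (F G : pt -> R) (a b c x y v : pt).

Lemma interior2P D x : D° x <-> exists2 e : R, 0 < e &
  forall y, `|y.1 - x.1| < e -> `|y.2 - x.2| < e -> D y.
Proof.
split.
  rewrite /interior/= -nbhs_ballE => -[e /= e0 h]; exists e => // y y1 y2.
  by apply: h; split; rewrite /ball/= distrC.
move=> [e e0 h]; rewrite /interior/= -nbhs_ballE; exists e => //= y [].
by rewrite /ball/= => y1 y2; apply: h; rewrite distrC.
Qed.

Lemma hull3_perm a b c : hull [:: b; c; a] = hull [:: a; b; c].
Proof.
apply/seteqP; split=> x /hull3P[s [t [u [[s0 t0 u0] stu ->]]]]; apply/hull3P.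
  exists u, s, t; split; [by split|by rewrite -stu; ring|].
  by apply: pairE => /=; ring.
exists t, u, s; split; [by split|by rewrite -stu; ring|].
by apply: pairE => /=; ring.
Qed.

Lemma hull3_swap a b c : hull [:: b; a; c] = hull [:: a; b; c].
Proof.
apply/seteqP; split=> x /hull3P[s [t [u [[s0 t0 u0] stu ->]]]]; apply/hull3P;
  exists t, s, u; split => //; rewrite -?stu; try ring; by rewrite (addrC (t *: _)).
Qed.

Lemma hull3_swap23 a b c : hull [:: a; c; b] = hull [:: a; b; c].
Proof. by rewrite (hull3_perm b a c) hull3_swap. Qed.

Lemma jac_swap23 a b c : jac a c b = - jac a b c.
Proof. by rewrite /jac; ring. Qed.

Lemma cvx_hull (s : seq pt) : cvx (hull s).
Proof.
move=> x y t [cx [x0 x1 ->]] [cy [y0 y1 ->]] t0 t1.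
exists (fun i => (1 - t) * cx i + t * cy i); split.
- by move=> i; rewrite addr_ge0// mulr_ge0// subr_ge0.
- by rewrite big_split/= -!mulr_sumr x1 y1; ring.
- rewrite -sumrB scaler_sumr -big_split/=; apply: eq_bigr => i _.
  by apply: pairE => /=; rewrite !scaleRE; ring.
Qed.

Lemma contT_continuous F : cont setT F -> continuous F.
Proof. by move=> cF x; exact: (cont_at openT cF). Qed.

Lemma cont_bary D a b c : cont D (bary a b c).
Proof.
apply: contM; last exact: cont_cst.
by rewrite /jac; contt.
Qed.

Lemma bary_line a b c x v (t : R) : bary a b c (x + t *: v) =
  bary a b c x + t * (bary a b c (x + v) - bary a b c x).
Proof. by rewrite /bary -!mulrBl mulrA -mulrDl; congr (_ / _); rewrite /jac /= !scaleRE; ring. Qed.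

Lemma bary_vertex a b c : jac a b c != 0 ->
  [/\ bary a b c a = 1, bary a b c b = 0 & bary a b c c = 0].
Proof. by move=> J; rewrite /bary divff//; split=> //; rewrite (_ : jac _ _ _ = 0) ?mul0r// /jac; ring. Qed.

(** If the coordinate vanished, a small step from [x] away from the vertex [a] would make it
    negative without leaving the triangle. *)
Lemma hull_int1 a b c x : jac a b c != 0 -> (hull [:: a; b; c])° x -> 0 < bary a b c x.
Proof.
move=> J hx; have := hx => /interior_subset/(hull_baryP x J)[h1 h2 h3].
rewrite lt_neqAle h1 andbT; apply/eqP => h0.
have /interior2P[e e0 he] := hx.
pose m := 1 + `|x.1 - a.1| + `|x.2 - a.2|.
have m1 : 1 <= m by rewrite /m -addrA lerDl addr_ge0.
have m0 : 0 < m by lra.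
pose t := e / 2 / m.
have t0 : 0 < t by rewrite /t divr_gt0// divr_gt0.
have tm : t * m = e / 2 by rewrite /t divfK ?gt_eqF.
have /(hull_baryP _ J)[] : hull [:: a; b; c] (x + t *: (x - a)).
  have A (u : R) : 0 <= u -> `|u| <= m -> `|t * u| < e.
    move=> u0 um; rewrite normrM gtr0_norm// (@le_lt_trans _ _ (e / 2))//; last by lra.
    by rewrite -tm ler_pM2l.
  apply: he; rewrite /= !scaleRE addrAC subrr add0r normrM -(normr_id (_ - _)) -normrM; apply: A => //; rewrite normr_id /m.
    by rewrite addrAC lerDr addr_ge0.
  by rewrite lerDr addr_ge0.
rewrite bary_line -h0 add0r subr0.
have -> : bary a b c (x + (x - a)) = - 1.
  have := bary_line a b c x (a - x) (- 1); rewrite scaleN1r opprB => ->.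
  by rewrite -h0 addrCA subrr addr0; have [-> _ _] := bary_vertex J; ring.
by rewrite mulrN1 oppr_ge0 leNgt t0.
Qed.

Lemma hull_intP a b c x : jac a b c != 0 -> (hull [:: a; b; c])° x <->
  [/\ 0 < bary a b c x, 0 < bary b c a x & 0 < bary c a b x].
Proof.
move=> J; have J1 : jac b c a != 0 by rewrite jac_cyc.
have J2 : jac c a b != 0 by rewrite jac_cyc.
split=> [hx|[h1 h2 h3]].
  split; first exact: hull_int1.
    by apply: hull_int1 => //; rewrite hull3_perm.
  by apply: hull_int1 => //; rewrite -hull3_perm.
pose U := [set y | 0 < bary a b c y] `&` [set y | 0 < bary b c a y] `&` [set y | 0 < bary c a b y].
have oU1 p q r : open [set y : pt | 0 < bary p q r y].
  have /contT_continuous/continuousP h := @cont_bary setT p q r.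
  have -> : [set y : pt | 0 < bary p q r y] = bary p q r @^-1` [set z | 0 < z] by [].
  by apply: h; exact: open_gt.
have oU : open U by apply: openI => //; apply: openI.
rewrite /interior/=; apply: (@filterS _ _ _ U); last by apply: open_nbhs_nbhs; split.
by move=> y [[/= y1 y2] y3]; apply/(hull_baryP y J); split; exact: ltW.
Qed.

(** Three points of the hull span a multiple of [jac a b c], whereas a neighbourhood of an interior
    point contains a right triangle of nonzero area. *)
Lemma hull_int_jac a b c : (hull [:: a; b; c])° !=set0 -> jac a b c != 0.
Proof.
move=> [x hx]; apply/eqP => J.
have /interior2P[e e0 he] := hx.
have J3 y1 y2 y3 : hull [:: a; b; c] y1 -> hull [:: a; b; c] y2 ->
    hull [:: a; b; c] y3 -> jac y1 y2 y3 = 0.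
  move=> /hull3P[s [t [u [_ E ->]]]] /hull3P[s' [t' [u' [_ E' ->]]]]
    /hull3P[s'' [t'' [u'' [_ E'' ->]]]].
  have -> : s = 1 - t - u by rewrite -E; ring.
  have -> : s' = 1 - t' - u' by rewrite -E'; ring.
  have -> : s'' = 1 - t'' - u'' by rewrite -E''; ring.
  transitivity (((t' - t) * (u'' - u) - (u' - u) * (t'' - t)) * jac a b c); last by rewrite J mulr0.
  by rewrite /jac /= !scaleRE; ring.
have := J3 x (x + (e / 2, 0)) (x + (0, e / 2)); rewrite /jac/= => h.
have : (x.1 + e / 2 - x.1) * (x.2 + e / 2 - x.2) - (x.2 + 0 - x.2) * (x.1 + 0 - x.1) = 0.
  apply: h; first exact: interior_subset.
    apply: he => /=; first by rewrite addrAC subrr add0r gtr0_norm; lra.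
    by rewrite addr0 subrr normr0.
  apply: he => /=; first by rewrite addr0 subrr normr0.
  by rewrite addrAC subrr add0r gtr0_norm; lra.
by apply/eqP; rewrite gt_eqF//; nra.
Qed.

Lemma continuous_sum (T : topologicalType) (V : normedModType R) (I : Type) (r : seq I)
    (f : I -> T -> V) : (forall i, continuous (f i)) ->
  continuous (fun x : T => \sum_(i <- r) f i x).
Proof.
move=> cf; elim: r => [|i r IH] x0.
  under eq_fun do rewrite big_nil; exact: cvg_cst.
under eq_fun do rewrite big_cons; apply: cvgD; [exact: cf|exact: IH].
Qed.

(** The hull is the image of the compact simplex of weights under a continuous map. *)
Lemma compact_hull (s : seq pt) : compact (hull s).
Proof.
set n := size s.
pose A := [set v : 'rV[R]_n | forall i, `[(0 : R), 1]%classic (v ord0 i)].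
have cA : compact A.
  by apply: (@rV_compact R n (fun=> `[(0 : R), 1]%classic)) => i; exact: segment_compact.
pose B := [set v : 'rV[R]_n | \sum_i v ord0 i = 1].
have cB : closed B.
  have -> : B = (fun v : 'rV[R]_n => \sum_i v ord0 i) @^-1` [set 1] by [].
  apply: closed_comp; last exact: closed_eq.
  by move=> v _; apply: continuous_sum => i; exact: coord_continuous.
have -> : hull s = (fun v : 'rV[R]_n => \sum_i v ord0 i *: tnth (in_tuple s) i) @` (A `&` B).
  apply/seteqP; split=> [x [c [c0 c1 ->]]|x [v [Av Bv] <-]].
    exists (\row_i c i); last by apply: eq_bigr => i _; rewrite mxE.
    split; last by rewrite /B /= -[RHS]c1; apply: eq_bigr => i _; rewrite mxE.
    move=> i; rewrite mxE /= in_itv/= c0/= -c1 (bigD1 i)//= lerDl.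
    by apply: sumr_ge0.
  exists (fun i => v ord0 i); split => // i.
  by have := Av i; rewrite /= in_itv/= => /andP[].
apply: continuous_compact; last exact: compact_closedI.
apply: continuous_subspaceT; apply: continuous_sum => i v; apply: (@cvgZr_tmp _ _ _ (nbhs v)).
exact: coord_continuous.
Qed.

Lemma closed_hull (s : seq pt) : closed (hull s).
Proof. by apply: compact_closed; [exact: norm_hausdorff|exact: compact_hull]. Qed.

(** The parameter is normalized, not arc length; the missing length of the edge is carried by the
    scaled normals [enu]. *)
Definition seg a b F : R := \int[mu]_(t in `[0, 1]) F (a + t *: (b - a)).
Definition IK a b c F : R := \int[area R]_(x in (hull [:: a; b; c])°) F x.

Lemma hull_mem3 a b c (s t : R) : 0 <= s -> 0 <= t -> s + t <= 1 ->
  hull [:: a; b; c] (a + s *: (b - a) + t *: (c - a)).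
Proof.
move=> s0 t0 st; apply/hull3P; exists (1 - s - t), s, t; split.
- by split => //; lra.
- by ring.
- by apply: pairE => /=; rewrite !scaleRE; ring.
Qed.

Lemma bary_aff a b c (s t : R) : jac a b c != 0 ->
  let x := a + s *: (b - a) + t *: (c - a) in
  [/\ bary a b c x = 1 - s - t, bary b c a x = s & bary c a b x = t].
Proof.
move=> J /=; rewrite /bary (jac_cyc a b c) -(jac_cyc c a b).
by split; apply: (canLR (mulfK J)); rewrite /jac /= !scaleRE; ring.
Qed.

Lemma IK_area a b c F : jac a b c != 0 -> cont (hull [:: a; b; c]) F ->
  let G z := (F \_ (hull [:: a; b; c])°) ((b - a).1 * z.1 + (c - a).1 * z.2 + a.1,
    (b - a).2 * z.1 + (c - a).2 * z.2 + a.2) in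
  IK a b c F = `|jac a b c| * \int[area R]_z G z /\
  (area R).-integrable setT (EFin \o G).
Proof.
move=> J cF /=; set H := hull [:: a; b; c].
have iF : (area R).-integrable setT (EFin \o (F \_ H°)).
  have mH : measurable (H° : set (mplane R)).
    by apply: open_measurable2; exact: open_interior.
  rewrite -restrict_EFin; apply/(integrable_mkcond _ mH).
  apply: (@integrable_cont _ _ H) => //; [exact: open_interior|exact: interior_subset|exact: compact_hull].
rewrite /IK Rintegral_mkcond.
have J' : (b - a).1 * (c - a).2 - (c - a).1 * (b - a).2 != 0.
  by move: J; rewrite /jac /= (mulrC (c.1 - a.1)).
have [-> iG] := @area_affine R (b - a).1 (c - a).1 (b - a).2 (c - a).2 a.1 a.2 _ J' iF.
by split => //; congr (_ * _); rewrite /jac /= (mulrC (c.1 - a.1)).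
Qed.

Lemma ref_int a b c (s t : R) : jac a b c != 0 ->
  let x := (((b - a).1 * s + (c - a).1 * t + a.1), ((b - a).2 * s + (c - a).2 * t + a.2)) in
   x = a + s *: (b - a) + t *: (c - a) /\
   ((hull [:: a; b; c])° x <-> [/\ 0 < s, 0 < t & s + t < 1]).
Proof.
move=> J x; have xE : x = a + s *: (b - a) + t *: (c - a).
  by apply: pairE; rewrite /x/= !scaleRE; ring.
have [E1 E2 E3] := bary_aff s t J.
split => //; split=> [/(hull_intP _ J)|[s0 t0 st]]; last apply/(hull_intP _ J).
  by rewrite xE E1 E2 E3 => -[h1 h2 h3]; split => //; lra.
by rewrite xE E1 E2 E3; split => //; lra.
Qed.

(** Pull-back to the reference triangle and Fubini. The outer interval is open so that the inner
    segment, of length [1 - s], is never degenerate. *)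
Lemma IKE a b c F : jac a b c != 0 -> cont (hull [:: a; b; c]) F ->
  IK a b c F = `|jac a b c| * \int[mu]_(s in `]0, 1[)
     (\int[mu]_(t in `[0, 1 - s]) F (a + s *: (b - a) + t *: (c - a))).
Proof.
move=> J cF; set H := hull [:: a; b; c].
have [-> iG] := IK_area J cF; congr (_ * _).
have bE s t := ref_int s t J.
rewrite /Rintegral -integral12_prod_meas1//.
rewrite [in RHS]integral_mkcond; congr fine; apply: eq_integral => s' _.
pose s : R := s'; rewrite -/s /fubini_F /patch.
case: ifPn => [|sn]; last first.
  apply: integral0_eq => t _; have [/= _ h] := bE s t; case: ifPn => //; rewrite inE => /h[s0 t0 st].
  by move: sn; rewrite notin_setE /= in_itv/= => /negP; rewrite s0/= -leNgt => ?; exfalso; lra.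
rewrite inE/= in_itv/= => /andP[s0 s1].
set g := (fun t : R => F (a + s *: (b - a) + t *: (c - a))).
have cg : {within `[0, 1 - s], continuous g}.
  apply: (@cont_path _ H) => //; first exact: cvx_hull.
  - by lra.
  - rewrite -[X in H X]addr0 -(scale0r (c - a)); apply: hull_mem3; lra.
  - by apply: hull_mem3; lra.
have ig : mu.-integrable `[0, 1 - s] (EFin \o g).
  by apply: continuous_compact_integrable => //; exact: segment_compact.
rewrite fineK; last by apply: integrable_fin_num ig; exact: measurable_itv.
have mg A : measurable A -> A `<=` `[0, 1 - s] -> measurable_fun A (EFin \o g).
  by move=> mA As; apply: measurable_funS (measurable_int _ ig).
rewrite -[RHS]integral_itv_obnd_cbnd; last by apply: mg => //; apply: subset_itv_oc_cc.
rewrite -[RHS]integral_itv_bndo_bndc; last by apply: mg => //; apply: subset_itv_oo_cc.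
rewrite [RHS]integral_mkcond; apply: eq_integral => t _; rewrite /patch.
have [/= xE h] := bE s t; case: ifPn => [|hn]; first rewrite inE => /h[_ t0 st].
  by rewrite xE ifT// inE/= in_itv/= t0/=; lra.
case: ifPn => //; rewrite inE/= in_itv/= => /andP[t0 t1].
by exfalso; move/negP : hn; apply; rewrite inE; apply/h; split => //; lra.
Qed.

Lemma seg_cont a b F D : cvx D -> D a -> D b -> cont D F ->
  {within `[0, 1], continuous (fun t : R => F (a + t *: (b - a)))}.
Proof.
move=> cD Da Db cF; apply: (@cont_path _ D) => //.
by rewrite scale1r addrC subrK.
Qed.

Lemma seg_integrable a b F D : cvx D -> D a -> D b -> cont D F ->
  mu.-integrable `[0, 1] (EFin \o (fun t : R => F (a + t *: (b - a)))).
Proof.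
move=> cD Da Db cF; apply: continuous_compact_integrable; first exact: segment_compact.
exact: (seg_cont cD Da Db cF).
Qed.

Lemma seg_sym a b F D : cvx D -> D a -> D b -> cont D F -> seg b a F = seg a b F.
Proof.
move=> cD Da Db cF.
rewrite /seg (@Rintegration_by_substitution_onem _ (fun t : R => F (a + t *: (b - a))) 1)//.
  rewrite /unstable.onem subrr; apply: eq_Rintegral => t _; congr F; apply: pairE; rewrite /= !scaleRE; ring.
- by rewrite ler01 lexx.
- exact: (seg_cont cD Da Db cF).
Qed.

Lemma Rintegral_oo_cc (f : R -> R) : mu.-integrable `[0, 1] (EFin \o f) ->
  \int[mu]_(t in `]0, 1[) f t = \int[mu]_(t in `[0, 1]) f t.
Proof.
move=> fi; rewrite -Rintegral_itv_obnd_cbnd; last by apply: integrableS fi => //; apply: subset_itv_oc_cc.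
by rewrite -Rintegral_itv_bndo_bndc//; apply: integrableS fi => //; apply: subset_itv_oo_cc.
Qed.

Lemma hull3_v1 a b c : hull [:: a; b; c] a.
Proof. by have := @hull_mem3 a b c 0 0; rewrite !scale0r !addr0; apply; lra. Qed.
Lemma hull3_v2 a b c : hull [:: a; b; c] b.
Proof. by rewrite -hull3_perm; exact: hull3_v1. Qed.
Lemma hull3_v3 a b c : hull [:: a; b; c] c.
Proof. by rewrite hull3_perm; exact: hull3_v1. Qed.

(** The inner integral of [IKE] runs parallel to [c - a], so the fundamental theorem of calculus
    leaves the values on the two other sides. *)
Lemma IK_dir a b c P P1 P2 : jac a b c != 0 -> C1on (hull [:: a; b; c]) P P1 P2 ->
  IK a b c (fun x => P1 x * (c - a).1 + P2 x * (c - a).2) =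
  `|jac a b c| * (seg b c P - seg a b P).
Proof.
move=> J cP; have [p p1 p2 _] := cP; set H := hull [:: a; b; c].
have cH : cvx H by exact: cvx_hull.
have [Ha Hb Hc] : [/\ H a, H b & H c] by split; [exact: hull3_v1|exact: hull3_v2|exact: hull3_v3].
rewrite IKE//; last by contt.
congr (_ * _).
transitivity (\int[mu]_(s in `]0, 1[) (P (c + s *: (b - c)) - P (a + s *: (b - a)))).
  apply: eq_Rintegral => s si; have /andP[s0 s1] : 0 < (s : R) < 1 by move: si; rewrite inE/= in_itv.
  rewrite (@FTC_path _ H P)//.
  - by congr (P _ - P _); apply: pairE; rewrite /= !scaleRE; ring.
  - by lra.
  - rewrite -[X in H X]addr0 -(scale0r (c - a)); apply: hull_mem3; lra.
  - by apply: hull_mem3; lra.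
have i1 := seg_integrable cH Hc Hb p.
have i2 := seg_integrable cH Ha Hb p.
rewrite RintegralB//; last 2 first.
- by apply: integrableS i1 => //; apply: subset_itv_oo_cc.
- by apply: integrableS i2 => //; apply: subset_itv_oo_cc.
by rewrite !Rintegral_oo_cc// -[in RHS](seg_sym cH Hb Hc p).
Qed.

Lemma IK_swap a b c F : IK a c b F = IK a b c F.
Proof. by rewrite /IK hull3_swap23. Qed.

Lemma IK_integrable a b c F : cont (hull [:: a; b; c]) F ->
  (area R).-integrable (hull [:: a; b; c])° (EFin \o F).
Proof.
move=> cF; apply: (@integrable_cont _ _ (hull [:: a; b; c])) => //.
- exact: open_interior.
- exact: interior_subset.
- exact: compact_hull.
Qed.

Lemma IK_meas a b c : measurable ((hull [:: a; b; c])° : set (mplane R)).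
Proof. by apply: open_measurable2; exact: open_interior. Qed.

Lemma IKD a b c F G : cont (hull [:: a; b; c]) F -> cont (hull [:: a; b; c]) G ->
  IK a b c (fun x => F x + G x) = IK a b c F + IK a b c G.
Proof. by move=> cF cG; apply: RintegralD; [exact: IK_meas|exact: IK_integrable..]. Qed.

Lemma IKB a b c F G : cont (hull [:: a; b; c]) F -> cont (hull [:: a; b; c]) G ->
  IK a b c (fun x => F x - G x) = IK a b c F - IK a b c G.
Proof. by move=> cF cG; apply: RintegralB; [exact: IK_meas|exact: IK_integrable..]. Qed.

Lemma IKZ a b c F (k : R) : cont (hull [:: a; b; c]) F ->
  IK a b c (fun x => k * F x) = k * IK a b c F.
Proof. by move=> cF; apply: RintegralZl; [exact: IK_meas|exact: IK_integrable]. Qed.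

Lemma IK_le a b c F G : cont (hull [:: a; b; c]) F -> cont (hull [:: a; b; c]) G ->
  (forall x, hull [:: a; b; c] x -> F x <= G x) -> IK a b c F <= IK a b c G.
Proof.
move=> cF cG FG; apply: le_Rintegral; [exact: IK_meas|exact: IK_integrable..|].
by move=> x /interior_subset; exact: FG.
Qed.

Lemma IK_eq a b c F G : (forall x, (hull [:: a; b; c])° x -> F x = G x) ->
  IK a b c F = IK a b c G.
Proof. by move=> FG; apply: eq_Rintegral => x; rewrite inE; exact: FG. Qed.

Lemma IK_ge0 a b c F : (forall x, (hull [:: a; b; c])° x -> 0 <= F x) -> 0 <= IK a b c F.
Proof. by move=> F0; apply: Rintegral_ge0. Qed.

(** [IK_dir] in the directions [b - a] and [c - a] gives two linear equations for the integrals of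
    [P1] and [P2], with determinant [jac a b c]; they are solved by Cramer's rule. The orientation
    of the triangle survives as a sign. *)
Lemma IK_Green1 a b c P P1 P2 : jac a b c != 0 -> C1on (hull [:: a; b; c]) P P1 P2 ->
  IK a b c P1 = Num.sg (jac a b c) *
   ((b - a).2 * seg a b P + (c - b).2 * seg b c P + (a - c).2 * seg c a P).
Proof.
move=> J cP; have [p p1 p2 _] := cP.
have cH : cvx (hull [:: a; b; c]) by exact: cvx_hull.
have J' : jac a c b != 0 by rewrite jac_swap23 oppr_eq0.
have H1 := IK_dir J cP.
have := @IK_dir a c b P P1 P2 J'; rewrite IK_swap.
rewrite hull3_swap23.
move=> /(_ cP) H2.
have E : jac a b c * IK a b c P1 = (c - a).2 * IK a b c (fun x => P1 x * (b - a).1 + P2 x * (b - a).2)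
   - (b - a).2 * IK a b c (fun x => P1 x * (c - a).1 + P2 x * (c - a).2).
  rewrite -!IKZ -?IKB; try by contt.
  by apply: IK_eq => x _; rewrite /jac /=; ring.
have sJ : `|jac a c b| = `|jac a b c| by rewrite -normrN; congr `|_|; rewrite /jac; ring.
apply: (mulfI J); rewrite E H1 H2 sJ.
rewrite (seg_sym cH (hull3_v2 a b c) (hull3_v3 a b c) p).
rewrite (seg_sym cH (hull3_v1 a b c) (hull3_v3 a b c) p).
by rewrite normrEsg /=; ring.
Qed.

Lemma IK_Green2 a b c P P1 P2 : jac a b c != 0 -> C1on (hull [:: a; b; c]) P P1 P2 ->
  IK a b c P2 = - Num.sg (jac a b c) *
   ((b - a).1 * seg a b P + (c - b).1 * seg b c P + (a - c).1 * seg c a P).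
Proof.
move=> J cP; have [p p1 p2 _] := cP.
have cH : cvx (hull [:: a; b; c]) by exact: cvx_hull.
have J' : jac a c b != 0 by rewrite jac_swap23 oppr_eq0.
have H1 := IK_dir J cP.
have := @IK_dir a c b P P1 P2 J'; rewrite IK_swap.
rewrite hull3_swap23.
move=> /(_ cP) H2.
have E : jac a b c * IK a b c P2 = (b - a).1 * IK a b c (fun x => P1 x * (c - a).1 + P2 x * (c - a).2)
   - (c - a).1 * IK a b c (fun x => P1 x * (b - a).1 + P2 x * (b - a).2).
  rewrite -!IKZ -?IKB; try by contt.
  by apply: IK_eq => x _; rewrite /jac /=; ring.
have sJ : `|jac a c b| = `|jac a b c| by rewrite -normrN; congr `|_|; rewrite /jac; ring.
apply: (mulfI J); rewrite E H1 H2 sJ.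
rewrite (seg_sym cH (hull3_v2 a b c) (hull3_v3 a b c) p).
rewrite (seg_sym cH (hull3_v1 a b c) (hull3_v3 a b c) p).
by rewrite normrEsg /=; ring.
Qed.

End Tri.

(** * Solvability of symmetric linear systems *)

Section Riesz.
Variable R : realType.

(** Fredholm alternative: [L] lies in the row space as soon as it vanishes on the kernel. Stated
    with this kernel condition, it applies to the nodal functions of a mesh without a proof of their
    linear independence. *)
Lemma riesz_fin n (A : 'I_n -> 'I_n -> R) (L : 'I_n -> R) :
  (forall i j, A i j = A j i) ->
  (forall x : 'I_n -> R, (forall j, \sum_i x i * A i j = 0) -> \sum_i x i * L i = 0) ->
  exists y : 'I_n -> R, forall j, \sum_i y i * A i j = L j.
Proof.
move=> As AL.
pose M : 'M[R]_n := \matrix_(i, j) A i j.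
pose l : 'rV[R]_n := \row_i L i.
have lM : (l <= M)%MS.
  rewrite submxE; apply/eqP/matrixP => i j; rewrite (ord1 i) !mxE.
  have /AL h : forall k, \sum_i0 (cokermx M i0 j) * A i0 k = 0.
    move=> k; have : (M *m cokermx M) k j = 0 by rewrite mulmx_coker mxE.
    by rewrite mxE => h0; rewrite -[RHS]h0; apply: eq_bigr => i0 _; rewrite [in RHS]mxE As mulrC.
  by rewrite -[RHS]h; apply: eq_bigr => i0 _; rewrite mxE mulrC.
have /submxP[D lD] := lM.
exists (fun i => D ord0 i) => j.
by have := congr1 (fun v : 'rV[R]_n => v ord0 j) lD; rewrite !mxE => ->; apply: eq_bigr => i _; rewrite mxE.
Qed.

Lemma quad_disc (a b c : R) : 0 <= a ->
  (forall t, 0 <= c + 2 * t * b + t ^+ 2 * a) -> b ^+ 2 <= c * a.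
Proof.
move=> a0 q; have [az|anz] := eqVneq a 0.
  (* At this [t] the affine function [c + 2 t b] takes the value -1, unless [b = 0]. *)
  rewrite az mulr0; have := q (- (c + 1) * b^-1 / 2); rewrite az mulr0 addr0.
  have [->|b0] := eqVneq b 0; first by rewrite expr0n.
  rewrite (_ : 2 * (- (c + 1) * b^-1 / 2) * b = - (c + 1)); last by field.
  by move=> h; exfalso; lra.
have ap : 0 < a by rewrite lt_neqAle eq_sym anz.
have := q (- (b / a)).
rewrite (_ : c + _ + _ = (c * a - b ^+ 2) / a); last by field.
by rewrite pmulr_lge0 ?invr_gt0//; lra.
Qed.

End Riesz.

(** * Polynomial functions of two variables and their derivatives *)

Section Pol.
Variable R : realType.
Local Notation mu := (@lebesgue_measure R).
Local Notation pt := (R * R)%type.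
Implicit Types (D : set pt) (F G : pt -> R) (a b c x y v : pt) (p q : pt -> R).

(** A predicate on functions, generated by constants, sums and multiplication by a coordinate:
    products, affine substitutions and derivatives follow by induction, and [polcP] recovers
    coefficients where they are wanted. *)
Inductive pol : nat -> (pt -> R) -> Prop :=
| pol_cst n k : pol n (fun=> k)
| polD n p q : pol n p -> pol n q -> pol n (fun x => p x + q x)
| polX n p : pol n p -> pol n.+1 (fun x => x.1 * p x)
| polY n p : pol n p -> pol n.+1 (fun x => x.2 * p x).

Lemma polS n p : pol n p -> pol n.+1 p.
Proof. by elim=> *; [exact: pol_cst|exact: polD|exact: polX|exact: polY]. Qed.

Lemma pol_le n m p : (n <= m)%N -> pol n p -> pol m p.
Proof. by move=> /subnKC <-; elim: (m - n)%N => [|k IH]; rewrite ?addn0 ?addnS// => /IH/polS. Qed.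

Lemma polZ n (k : R) p : pol n p -> pol n (fun x => k * p x).
Proof.
elim=> {n p} [n k'|n p q _ IHp _ IHq|n p _ IH|n p _ IH]; first exact: pol_cst.
- rewrite (_ : (fun x => _) = fun x => k * p x + k * q x); first exact: polD.
  by apply/funext => x; rewrite mulrDr.
- rewrite (_ : (fun x => _) = fun x => x.1 * (k * p x)); first exact: polX.
  by apply/funext => x; rewrite mulrCA.
- rewrite (_ : (fun x => _) = fun x => x.2 * (k * p x)); first exact: polY.
  by apply/funext => x; rewrite mulrCA.
Qed.

Lemma polM n m p q : pol n p -> pol m q -> pol (n + m) (fun x => p x * q x).
Proof.
move=> + hq; elim=> {n p} [n k'|n p q' _ IHp _ IHq|n p _ IH|n p _ IH].
- by apply: pol_le (polZ k' hq); exact: leq_addl.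
- rewrite (_ : (fun x => _) = fun x => p x * q x + q' x * q x); first exact: polD.
  by apply/funext => x; rewrite mulrDl.
- rewrite (_ : (fun x => _) = fun x => x.1 * (p x * q x)); first exact: polX.
  by apply/funext => x; rewrite mulrA.
- rewrite (_ : (fun x => _) = fun x => x.2 * (p x * q x)); first exact: polY.
  by apply/funext => x; rewrite mulrA.
Qed.

Lemma pol_aff (k1 k2 k3 : R) : pol 1 (fun x => k1 * x.1 + k2 * x.2 + k3).
Proof.
apply: polD; last exact: pol_cst.
apply: polD; [rewrite (_ : (fun x => _) = fun x => x.1 * k1)|rewrite (_ : (fun x => _) = fun x => x.2 * k2)];
  try (by apply/funext => x; rewrite mulrC).
  by apply: polX; exact: pol_cst.
by apply: polY; exact: pol_cst.
Qed.

Lemma pol_comp n p (k1 k2 k3 l1 l2 l3 : R) : pol n p ->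
  pol n (fun x => p (k1 * x.1 + k2 * x.2 + k3, l1 * x.1 + l2 * x.2 + l3)).
Proof.
elim=> {n p} [n k'|n p q' _ IHp _ IHq|n p _ IH|n p _ IH]; [exact: pol_cst|exact: polD|..];
  rewrite -add1n /=; apply: polM => //; exact: pol_aff.
Qed.

Lemma pol_sum n (I : Type) (r : seq I) (P : pred I) (f : I -> pt -> R) :
  (forall i, P i -> pol n (f i)) -> pol n (fun x => \sum_(i <- r | P i) f i x).
Proof.
move=> h; elim: r => [|i r IH].
  rewrite (_ : (fun x => _) = fun=> 0); first exact: pol_cst.
  by apply/funext => x; rewrite big_nil.
case Pi: (P i).
  rewrite (_ : (fun x => _) = fun x => f i x + \sum_(i <- r | P i) f i x).
    by apply: polD => //; exact: h.
  by apply/funext => x; rewrite big_cons Pi.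
rewrite (_ : (fun x => _) = fun x => \sum_(i <- r | P i) f i x)//.
by apply/funext => x; rewrite big_cons Pi.
Qed.

Lemma pol_monom (i j : nat) : pol (i + j) (fun x => x.1 ^+ i * x.2 ^+ j).
Proof.
elim: i => [|i IH].
  elim: j => [|j IH].
    by rewrite (_ : (fun x => _) = fun=> 1); [exact: pol_cst|apply/funext => x; rewrite !expr0 mulr1].
  rewrite addnS (_ : (fun x => _) = fun x => x.2 * (x.1 ^+ 0 * x.2 ^+ j)); first exact: polY.
  by apply/funext => x; rewrite exprS mulrCA.
rewrite addSn (_ : (fun x => _) = fun x => x.1 * (x.1 ^+ i * x.2 ^+ j)); first exact: polX.
by apply/funext => x; rewrite exprS mulrA.
Qed.

Definition polc n (c : nat -> nat -> R) x :=
  \sum_(i < n.+1) \sum_(j < n.+1 | (i + j <= n)%N) c i j * x.1 ^+ i * x.2 ^+ j.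

Lemma pol_polc n (c : nat -> nat -> R) : pol n (polc n c).
Proof.
apply: pol_sum => i _; apply: pol_sum => j ij.
rewrite (_ : (fun x => _) = fun x => c i j * (x.1 ^+ i * x.2 ^+ j)).
  by apply: polZ; apply: pol_le ij _; exact: pol_monom.
by apply/funext => x; rewrite mulrA.
Qed.

Lemma polcP n p : pol n p -> exists c : nat -> nat -> R, p = polc n c.
Proof.
elim=> {n p} [n k'|n p q _ [cp ->] _ [cq ->]|n p _ [cp ->]|n p _ [cp ->]].
- exists (fun i j => if (i == 0%N) && (j == 0%N) then k' else 0); apply/funext => x.
  rewrite /polc (bigD1 ord0)//= (bigD1 ord0)//= expr0 !mulr1 !big1 ?addr0//.
    move=> i /negPf i0; rewrite big1// => j _; rewrite -[X in X && _]/(i == ord0) i0 /=; ring.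
  by move=> j /andP[_ /negPf j0]; rewrite -[X in if X then _ else _]/(j == ord0) j0; ring.
- exists (fun i j => cp i j + cq i j); apply/funext => x.
  rewrite /polc -big_split; apply: eq_bigr => i _; rewrite -big_split; apply: eq_bigr => j _ /=; ring.
- exists (fun i j => if i is i'.+1 then cp i' j else 0); apply/funext => x.
  rewrite /polc [RHS]big_ord_recl /= [X in _ = X + _]big1 ?add0r; last by move=> *; ring.
  rewrite mulr_sumr; apply: eq_bigr => i _.
  rewrite [RHS]big_mkcond big_ord_recr /= -[X in _ = _ + X]/(if (i.+1 + n.+1 <= n.+1)%N then _ else _).
  rewrite (_ : (_ <= _)%N = false) ?addr0; last first.
    by apply/negbTE; rewrite -ltnNge addSn ltnS leq_addl.
  rewrite -big_mkcond mulr_sumr.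
  by apply: eq_big => [j|j _]; rewrite /bump /= ?add1n ?addSn ?ltnS// exprS; ring.
- exists (fun i j => if j is j'.+1 then cp i j' else 0); apply/funext => x.
  rewrite /polc [RHS]big_ord_recr /= [X in _ = _ + X]big1 ?addr0; last first.
    by move=> [[|j] hj] /=; [move=> *; ring|rewrite addnS ltnNge leq_addr].
  rewrite mulr_sumr; apply: eq_bigr => i _.
  rewrite [RHS]big_mkcond big_ord_recl /= [X in _ = X + _](_ : _ = 0); last by case: ifP => _; ring.
  rewrite add0r -big_mkcond mulr_sumr.
  by apply: eq_big => [j|j _]; rewrite /bump /= ?add1n ?addnS ?ltnS// exprS; ring.
Qed.

Lemma path_is_derive F x v (t : R) (d : R) : is_derive (x + t *: v) v F d ->
  is_derive t (1 : R) (fun t : R => F (x + t *: v)) d.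
Proof.
move=> [dF dE].
have E : (fun h : R => h^-1 *: ((F \o shift (x + t *: v)) (h *: v) - F (x + t *: v))) =
   (fun h : R => h^-1 *: (((fun t : R => F (x + t *: v)) \o shift t) (h *: 1) - F (x + t *: v))).
  apply/funext => h; congr (_ *: (F _ - _)).
  by apply: pairE; rewrite /= !scaleRE; ring.
have d1 : derivable (fun t : R => F (x + t *: v)) t 1 by move: dF; rewrite /derivable E.
by split => //; rewrite -dE /derive E.
Qed.

Lemma pol_cont D n p : pol n p -> cont D p.
Proof. by elim=> *; contt. Qed.

Lemma is_derive_fst x v : is_derive x v (fun x : pt => x.1) v.1.
Proof.
have E : (fun h : R => h^-1 *: (((fun x : pt => x.1) \o shift x) (h *: v) - x.1)) @ 0^' --> v.1.
  apply: (@cvg_trans _ ((fun=> v.1) @ (0 : R)^')); last exact: cvg_cst.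
  apply: near_eq_cvg; near=> h.
  rewrite /= !scaleRE addrK mulrA mulVf ?mul1r//; near: h; exact: nbhs_dnbhs_neq.
by split; [apply/cvg_ex; exists v.1|apply: cvg_lim].
Unshelve. all: by end_near. Qed.

Lemma is_derive_snd x v : is_derive x v (fun x : pt => x.2) v.2.
Proof.
have E : (fun h : R => h^-1 *: (((fun x : pt => x.2) \o shift x) (h *: v) - x.2)) @ 0^' --> v.2.
  apply: (@cvg_trans _ ((fun=> v.2) @ (0 : R)^')); last exact: cvg_cst.
  apply: near_eq_cvg; near=> h.
  rewrite /= !scaleRE addrK mulrA mulVf ?mul1r//; near: h; exact: nbhs_dnbhs_neq.
by split; [apply/cvg_ex; exists v.2|apply: cvg_lim].
Unshelve. all: by end_near. Qed.

(** Degree bound for a derivative. In degree 0 the derivative is zero and not just of degree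
    [0.-1 = 0]; otherwise multiplying it by a coordinate would overshoot the bound. *)
Definition dpol n p := if n is m.+1 then pol m p else p = fun=> 0.

Lemma dpol_D n p q : dpol n p -> dpol n q -> dpol n (fun x => p x + q x).
Proof. by case: n => [-> ->|n]; [apply/funext => x; rewrite addr0|exact: polD]. Qed.

Lemma dpol_X n p : dpol n p -> pol n (fun x => x.1 * p x).
Proof.
case: n => [->|n]; last exact: polX.
by rewrite (_ : (fun x => _) = fun=> 0); [exact: pol_cst|apply/funext => x; rewrite mulr0].
Qed.

Lemma dpol_Y n p : dpol n p -> pol n (fun x => x.2 * p x).
Proof.
case: n => [->|n]; last exact: polY.
by rewrite (_ : (fun x => _) = fun=> 0); [exact: pol_cst|apply/funext => x; rewrite mulr0].
Qed.

Lemma pol_deriv n p : pol n p -> exists p1 p2, [/\ dpol n p1, dpol n p2 &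
  forall x v, is_derive x v p (p1 x * v.1 + p2 x * v.2)].
Proof.
elim=> {n p} [n k'|n p q hp [p1 [p2 [P1 P2 dp]]] hq [q1 [q2 [Q1 Q2 dq]]]|
   n p hp [p1 [p2 [P1 P2 dp]]]|n p hp [p1 [p2 [P1 P2 dp]]]].
- exists (fun=> 0), (fun=> 0); split; [by case: n => // n; exact: pol_cst..|].
  by move=> x v; rewrite !mul0r addr0; exact: is_derive_cst.
- exists (fun x => p1 x + q1 x), (fun x => p2 x + q2 x); split; [exact: dpol_D..|].
  by move=> x v; apply: (is_derive_eq (is_deriveD (dp x v) (dq x v))); ring.
- exists (fun x => p x + x.1 * p1 x), (fun x => x.1 * p2 x); split.
  + by apply: polD => //; exact: dpol_X.
  + exact: dpol_X.
  + move=> x v; apply: (is_derive_eq (is_deriveM (is_derive_fst x v) (dp x v))).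
    by rewrite !scaleRE; ring.
- exists (fun x => x.2 * p1 x), (fun x => p x + x.2 * p2 x); split.
  + exact: dpol_Y.
  + by apply: polD => //; exact: dpol_Y.
  + move=> x v; apply: (is_derive_eq (is_deriveM (is_derive_snd x v) (dp x v))).
    by rewrite !scaleRE; ring.
Qed.

Definition o0 : 'I_2 := ord0.
Definition o1 : 'I_2 := ord_max.

Lemma dpart_of F (F1 F2 : pt -> R) : (forall x v, is_derive x v F (F1 x * v.1 + F2 x * v.2)) ->
  dpart [:: o0] F = F1 /\ dpart [:: o1] F = F2.
Proof.
move=> dF; split; apply/funext => x; rewrite /dpart /=.
  by have [_ ->] := dF x (basis2 R o0); rewrite /= mulr1 mulr0 addr0.
by have [_ ->] := dF x (basis2 R o1); rewrite /= mulr1 mulr0 add0r.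
Qed.

Lemma dpol_pol n p : dpol n p -> pol n.-1 p.
Proof. by case: n => // ->; exact: pol_cst. Qed.

Lemma pol_dpart n p i : pol n p -> pol n.-1 (dpart [:: i] p).
Proof.
move=> /pol_deriv[p1 [p2 [P1 P2 /dpart_of[E1 E2]]]].
have [->|->] : i = o0 \/ i = o1 by case: i => [[|[|//]]] hi; [left|right]; exact: val_inj.
  by rewrite E1; exact: dpol_pol.
by rewrite E2; exact: dpol_pol.
Qed.

Lemma pol_is_derive n p : pol n p -> forall x v,
  is_derive x v p (dpart [:: o0] p x * v.1 + dpart [:: o1] p x * v.2).
Proof. by move=> /pol_deriv[p1 [p2 [_ _ dp]]]; have [-> ->] := dpart_of dp. Qed.

Lemma pol_C1on D n p : pol n p -> C1on D p (dpart [:: o0] p) (dpart [:: o1] p).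
Proof.
move=> hp; split; [exact: pol_cont hp|exact: pol_cont (pol_dpart _ hp)..|].
by move=> x v l _ _ _ t _ _; apply: path_is_derive; exact: pol_is_derive hp _ _.
Qed.

End Pol.

(** * Polynomial coefficients against the L^2 norm, in one variable, on the interval from 0 to
    1/2 *)

Section Inverse.
Variable R : realType.
Local Notation mu := (@lebesgue_measure R).

Local Notation J := (`](0 : R), (2^-1 : R)[%classic).
Local Notation pint F := (\int[mu]_(s in J) F s).

Lemma half_integrable (F : R -> R) : continuous F -> mu.-integrable J (EFin \o F).
Proof.
move=> cF; have iF : mu.-integrable `[(0 : R), (2^-1 : R)]%classic (EFin \o F).
  apply: continuous_compact_integrable; first exact: segment_compact.
  exact: continuous_subspaceT.
by apply: integrableS iF => //; exact: subset_itv_oo_cc.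
Qed.

Definition psum n (c : nat -> R) (s : R) : R := \sum_(i < n) c i * s ^+ i.

Lemma psum_continuous n c : continuous (psum n c).
Proof.
rewrite /psum; apply: continuous_sum => i; move=> s; apply: cvgM; first exact: cvg_cst.
exact: exprn_continuous.
Qed.

Lemma Rintegral_sum d (T : measurableType d) (m : {measure set T -> \bar R}) (D : set T)
   (I : Type) (r : seq I) (F : I -> T -> R) : measurable D ->
  (forall i, m.-integrable D (EFin \o F i)) ->
  m.-integrable D (EFin \o (fun x => \sum_(i <- r) F i x)) /\
  \int[m]_(x in D) (\sum_(i <- r) F i x) = \sum_(i <- r) \int[m]_(x in D) F i x.
Proof.
move=> mD iF; elim: r => [|i r [IH1 IH2]].
  rewrite big_nil (_ : (fun x => _) = cst 0); last by apply/funext => x; rewrite big_nil.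
  by split; [exact: integrable0|rewrite Rintegral_cst// mul0r].
rewrite big_cons (_ : (fun x => _) = fun x => F i x + \sum_(i <- r) F i x).
  split; last by rewrite RintegralD// IH2.
  by rewrite (_ : EFin \o _ = (EFin \o F i) \+ (EFin \o (fun x => \sum_(i <- r) F i x)))//; apply: integrableD.
by apply/funext => x; rewrite big_cons.
Qed.

Lemma half_psum_mul n (x y : nat -> R) :
  pint (fun s => psum n x s * psum n y s) =
  \sum_(i < n) \sum_(j < n) x i * y j * pint (fun s : R => s ^+ i * s ^+ j).
Proof.
have mJ : measurable (J : set (measurableTypeR R)) by exact: measurable_itv.
have ci i j : continuous (fun s : R => s ^+ i * s ^+ j).
  by move=> s; apply: cvgM; exact: exprn_continuous.
have cij i j (k : R) : continuous (fun s : R => k * (s ^+ i * s ^+ j)).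
  by move=> s; apply: cvgM; [exact: cvg_cst|exact: ci].
have csum i : continuous (fun s : R => \sum_(j < n) x i * y j * (s ^+ i * s ^+ j)).
  by apply: continuous_sum => j; exact: cij.
transitivity (pint (fun s : R => \sum_(i < n) \sum_(j < n) x i * y j * (s ^+ i * s ^+ j))).
  apply: eq_Rintegral => s _; rewrite /psum mulr_suml; apply: eq_bigr => i _.
  by rewrite mulr_sumr; apply: eq_bigr => j _; ring.
have [_ ->] := @Rintegral_sum _ _ mu J _ (index_enum 'I_n)
  (fun i s => \sum_(j < n) x i * y j * (s ^+ i * s ^+ j)) mJ (fun i => half_integrable (csum i)).
apply: eq_bigr => i _.
have [_ ->] := @Rintegral_sum _ _ mu J _ (index_enum 'I_n)
  (fun j s => x i * y j * (s ^+ i * s ^+ j)) mJ (fun j => half_integrable (cij _ _ _)).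
apply: eq_bigr => j _; rewrite RintegralZl//; exact: half_integrable (ci _ _).
Qed.

(** A polynomial whose square has integral zero vanishes almost everywhere, so it has a root outside
    any given finite list: roots can be collected until there are more than the degree permits. *)
Lemma half_poly0 n (c : nat -> R) : pint (fun s => psum n c s * psum n c s) = 0 ->
  forall i : 'I_n, c i = 0.
Proof.
move=> c0.
have mJ : measurable (J : set (measurableTypeR R)) by exact: measurable_itv.
have cq : continuous (fun s => psum n c s * psum n c s).
  by move=> s; apply: cvgM; exact: psum_continuous.
have iq := half_integrable cq.
have : ae_eq mu J (EFin \o (fun s => psum n c s * psum n c s)) (cst 0%E).
  apply/ae_eq_integral_abs => //; first exact: measurable_int iq.
  have E s : `|psum n c s * psum n c s| = psum n c s * psum n c s.
    by rewrite ger0_norm// -expr2 sqr_ge0.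
  under eq_integral do rewrite /= E.
  rewrite -[LHS]fineK; last exact: (integrable_fin_num mJ iq).
  by congr (_%:E).
move=> [N [mN N0 sN]].
have pick (rs : seq R) : exists2 x, x \notin rs & psum n c x = 0.
  apply/not_exists2P => H.
  have crs : countable ([set` rs] : set (measurableTypeR R)).
    by apply: finite_set_countable; exact: finite_seq.
  have mrs : measurable ([set` rs] : set (measurableTypeR R)).
    exact: countable_measurable crs.
  have sub : J `<=` N `|` [set` rs].
    move=> s Js; have [Ns|nNs] := pselect (N s); [by left|right].
    apply: contra_notP nNs => /negP srs; case: (H s) => [//|nz].
    apply: sN => /= /(_ Js) [h]; apply: nz; apply/eqP; rewrite -sqrf_eq0 expr2; exact/eqP.
  have : (mu J <= mu (N `|` [set` rs]))%E.
    by apply: le_measure; rewrite ?inE//; apply: measurableU.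
  have -> : mu (N `|` [set` rs]) = 0%E.
    apply/eqP; rewrite eq_le measure_ge0 andbT.
    apply: (le_trans (measureU2 _ _ _)) => //.
    by rewrite [X in (X + _ <= _)%E]N0 [X in (_ + X <= _)%E](countable_lebesgue_measure0 crs) adde0.
  by rewrite lebesgue_measure_itv/= lte_fin invr_gt0 ltr0n -EFinB subr0 lee_fin leNgt invr_gt0 ltr0n.
pose P := \poly_(i < n) c i.
have PE x : P.[x] = psum n c x by rewrite horner_poly.
have [P0|P0] := eqVneq P 0.
  by move=> i; have := congr1 (fun p : {poly R} => p`_i) P0; rewrite coef_poly ltn_ord coef0.
have [rs [urs rrs srs]] : exists rs : seq R, [/\ uniq rs, all (root P) rs & size rs = n].
  elim: {1}n => [|m [rs [urs rrs srs]]]; first by exists [::].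
  have [x xrs x0] := pick rs; exists (x :: rs); rewrite /= xrs urs srs rrs; split => //.
  by rewrite /root PE x0 eqxx.
have := max_poly_roots P0 rrs urs; rewrite srs ltnNge.
by rewrite /P (leq_trans (size_poly _ _)).
Qed.

(** Taking the coefficient of index [i] is a linear functional, represented by some [y] for the L^2
    product; Cauchy-Schwarz bounds it by the L^2 norm. The kernel condition of [riesz_fin] is
    [half_poly0]. *)
Lemma half_coef_bound n : exists2 k : R, 0 < k & forall (c : nat -> R) (i : 'I_n),
  k * c i ^+ 2 <= pint (fun s => psum n c s * psum n c s).
Proof.
have mJ : measurable (J : set (measurableTypeR R)) by exact: measurable_itv.
have c2 x y : continuous (fun s => psum n x s * psum n y s).
  by move=> s; apply: cvgM; exact: psum_continuous.
have b (i : 'I_n) : exists2 M : R, 0 <= M &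
    forall c : nat -> R, c i ^+ 2 <= M * pint (fun s => psum n c s * psum n c s).
  have [||y yE] := @riesz_fin R n (fun k j => pint (fun s : R => s ^+ k * s ^+ j)) (fun j => (j == i)%:R).
  - by move=> k j; apply: eq_Rintegral => s _; rewrite mulrC.
  - move=> x x0.
    pose x' m := if insub m is Some k then x k else 0 : R.
    have x'E (k : 'I_n) : x' k = x k by rewrite /x' valK.
    have z : forall k : 'I_n, x k = 0.
      move=> k; rewrite -x'E; apply: half_poly0; rewrite half_psum_mul.
      rewrite exchange_big big1// => j _.
      under eq_bigr do rewrite !x'E mulrAC; rewrite -mulr_suml x0 mul0r//.
    by rewrite big1// => k _; rewrite z mul0r.
  pose y' m := if insub m is Some k then y k else 0 : R.
  have y'E (k : 'I_n) : y' k = y k by rewrite /y' valK.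
  have sq0 x : 0 <= pint (fun s => psum n x s * psum n x s).
    by apply: Rintegral_ge0 => s _; rewrite -expr2 sqr_ge0.
  exists (pint (fun s => psum n y' s * psum n y' s)) => // c.
  have -> : c i = pint (fun s => psum n y' s * psum n c s).
    rewrite half_psum_mul exchange_big /= (bigD1 i)//= [X in _ + X]big1 => [|j ji].
      by under eq_bigr do rewrite y'E mulrAC; rewrite -mulr_suml yE eqxx mul1r addr0.
    by under eq_bigr do rewrite y'E mulrAC; rewrite -mulr_suml yE (negPf ji) mul0r.
  rewrite mulrC; apply: quad_disc => // t.
  pose z m := c m + t * y' m.
  have zE s : psum n z s = psum n c s + t * psum n y' s.
    by rewrite /psum mulr_sumr -big_split/=; apply: eq_bigr => k _; rewrite /z; ring.
  have ck (k : R) x w : continuous (fun s => k * (psum n x s * psum n w s)).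
    by move=> s; apply: cvgM; [exact: cvg_cst|exact: c2].
  have -> : pint (fun s => psum n c s * psum n c s) + 2 * t * pint (fun s => psum n y' s * psum n c s) +
      t ^+ 2 * pint (fun s => psum n y' s * psum n y' s) = pint (fun s => psum n z s * psum n z s).
    have i3 (k : R) x w := half_integrable (ck k x w).
    have i2 x w := half_integrable (c2 x w).
    have i4 : mu.-integrable J (EFin \o (fun s => psum n c s * psum n c s + 2 * t * (psum n y' s * psum n c s))).
      by apply: half_integrable => s; apply: cvgD; [exact: c2|exact: ck].
    rewrite -!RintegralZl// -RintegralD// -RintegralD//.
    by apply: eq_Rintegral => s _; rewrite !zE; ring.
  exact: sq0.
pose M i := sval (cid2 (b i)).
have M0 i : 0 <= M i by rewrite /M; case: cid2.
have Mb (i : 'I_n) (c : nat -> R) : c i ^+ 2 <= M i * pint (fun s => psum n c s * psum n c s).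
  by rewrite /M; case: cid2.
pose S := 1 + \sum_i M i.
have S0 : 0 < S by rewrite ltr_wpDr// sumr_ge0.
exists S^-1; first by rewrite invr_gt0.
move=> c i; rewrite mulrC ler_pdivrMr// (le_trans (Mb i c))// mulrC ler_wpM2l//.
  by apply: Rintegral_ge0 => s _; rewrite -expr2 sqr_ge0.
by rewrite /S (bigD1 i)//= addrCA lerDl addr_ge0// sumr_ge0.
Qed.

End Inverse.

(** * Inverse estimates on a triangle *)

Section Inv2.
Variable R : realType.
Local Notation mu := (@lebesgue_measure R).
Local Notation pt := (R * R)%type.
Implicit Types (F G : pt -> R) (a b c x y v : pt) (p q : pt -> R).
Local Notation J := (`](0 : R), (2^-1 : R)[%classic).

Lemma sqr_absE (x : R) : `|x| ^+ 2 = x ^+ 2.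
Proof. by rewrite real_normK ?num_real. Qed.

(** A full tensor sum instead of the triangular one of [polc], so that the one-variable bound can be
    applied in each coordinate in turn. *)
Definition dsum n (d : nat -> nat -> R) (z : pt) : R :=
  \sum_(i < n) \sum_(j < n) d i j * z.1 ^+ i * z.2 ^+ j.

Lemma dsum_polc n d z : polc n d z = dsum n.+1 (fun i j => if (i + j <= n)%N then d i j else 0) z.
Proof.
apply: eq_bigr => i _; rewrite big_mkcond; apply: eq_bigr => j _.
by case: ifP => _; ring.
Qed.

Lemma dsum_pol n d : pol (n + n) (dsum n d).
Proof.
apply: pol_sum => i _; apply: pol_sum => j _.
rewrite (_ : (fun x => _) = fun x => d i j * (x.1 ^+ i * x.2 ^+ j)).
  by apply: polZ; apply: (@pol_le _ (i + j)); [apply: leq_add; exact: ltnW|exact: pol_monom].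
by apply/funext => x; rewrite mulrA.
Qed.

(** Fubini and [half_coef_bound] twice: in the second variable the coefficients are polynomials of
    the first, to which the bound applies again. *)
Lemma square_coef n : exists2 k : R, 0 < k & forall (d : nat -> nat -> R) (i j : 'I_n),
  ((k * d i j ^+ 2)%:E <= \int[area R]_(z in J `*` J) (dsum n d z ^+ 2)%:E)%E.
Proof.
have [k k0 hk] := half_coef_bound R n.
exists (k * k); first exact: mulr_gt0.
move=> d i j.
have mJ : measurable (J : set (measurableTypeR R)) by exact: measurable_itv.
have mJJ : measurable (J `*` J : set (mplane R)) by exact: measurableX.
have cJ : cont setT (fun z => dsum n d z ^+ 2).
  by apply: contX; exact: pol_cont (dsum_pol n d).
have mf : measurable_fun setT ((fun z : mplane R => (dsum n d z ^+ 2)%:E) \_ (J `*` J)).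
  apply/(measurable_restrictT _ mJJ).
  apply/measurable_EFinP; apply: (@measurable_funS _ _ _ _ setT) => //.
  exact: (measurable_cont openT cJ).
rewrite integral_mkcond fubini_tonelli1//; last first.
  by move=> z; rewrite patchE; case: ifP => _ //; rewrite lee_fin sqr_ge0.
pose e (s : R) : R := psum n (fun i => d i j) s.
have inner (s : measurableTypeR R) : J s ->
  (fubini_F mu ((fun z : mplane R => (dsum n d z ^+ 2)%:E) \_ (J `*` J)) s
    >= (k * (e s * e s))%:E)%E.
  move=> Js; rewrite /fubini_F.
  pose f (t : R) := psum n (fun j => psum n (fun i => d i j) s) t.
  have fE t : dsum n d (s, t) = f t.
    rewrite /dsum exchange_big /f /psum /=; apply: eq_bigr => j' _.
    by rewrite mulr_suml; apply: eq_bigr.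
  have -> : (\int[mu]_y ((fun z : mplane R => (dsum n d z ^+ 2)%:E) \_ (J `*` J)) (s, y)
     = \int[mu]_(y in J) (f y * f y)%:E)%E.
    rewrite [RHS]integral_mkcond; apply: eq_integral => t _; rewrite !patchE.
    have [tJ|tJ] := boolP (t \in J).
      by rewrite ifT ?fE ?expr2// inE; split => //; rewrite inE in tJ.
    by rewrite ifF//; apply/negbTE; apply: contraNN tJ; rewrite !inE => -[].
  have cf : continuous (fun t : R => f t * f t).
    by move=> t; apply: cvgM; exact: psum_continuous.
  rewrite -[leRHS]fineK; last exact: (integrable_fin_num mJ (half_integrable cf)).
  rewrite lee_fin -expr2; exact: (hk (fun j => psum n (fun i => d i j) s) j).
apply: (@le_trans _ _ (\int[mu]_(s in J) (k * (e s * e s))%:E)%E).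
  have ce : continuous (fun s : R => e s * e s).
    by move=> t; apply: cvgM; exact: psum_continuous.
  have cke : continuous (fun s : R => k * (e s * e s)).
    by move=> t; apply: cvgM; [exact: cvg_cst|exact: ce].
  rewrite -[leRHS]fineK; last exact: (integrable_fin_num mJ (half_integrable cke)).
  rewrite lee_fin -/(Rintegral mu J (fun s => k * (e s * e s))) RintegralZl//; last exact: half_integrable.
  by rewrite -mulrA ler_pM2l//; exact: (hk (fun i => d i j) i).
rewrite integral_mkcond; apply: ge0_le_integral => //.
- by move=> s _; rewrite patchE; case: ifP => // _; rewrite lee_fin; apply: mulr_ge0; [exact: ltW|rewrite -expr2; exact: sqr_ge0].
- apply/(measurable_restrictT _ mJ)/measurable_EFinP.
  apply: measurable_funS measurableT _ _ => //; apply: continuous_measurable_fun.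
  by move=> t; apply: cvgM; [exact: cvg_cst|apply: cvgM; exact: psum_continuous].
- by apply: measurable_fun_fubini_tonelli_F => // z; rewrite patchE; case: ifP => _ //; rewrite lee_fin sqr_ge0.
- move=> s _; rewrite patchE; case: ifPn => [|_]; first by rewrite inE; exact: inner.
  by apply: integral_ge0 => t _; rewrite patchE; case: ifP => _ //; rewrite lee_fin sqr_ge0.
Qed.

(* [cc] are the coefficients of [p] in the coordinates of the reference triangle. *)
Lemma IK_coef n : exists2 k : R, 0 < k & forall a b c p, jac a b c != 0 -> pol n p ->
  exists cc : nat -> nat -> R,
   (forall x, p x = polc n cc (bary b c a x, bary c a b x)) /\
   (forall i j, (i + j <= n)%N -> k * `|jac a b c| * cc i j ^+ 2 <= IK a b c (fun x => p x ^+ 2)).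
Proof.
have [k k0 hk] := square_coef n.+1; exists k => // a b c p J0 hp.
pose phi (z : pt) := ((b - a).1 * z.1 + (c - a).1 * z.2 + a.1, (b - a).2 * z.1 + (c - a).2 * z.2 + a.2).
have [cc ccE] := polcP (pol_comp (b - a).1 (c - a).1 a.1 (b - a).2 (c - a).2 a.2 hp).
exists cc; split => [x|i j ij].
  have /= <- := congr1 (fun f : pt -> R => f (bary b c a x, bary c a b x)) ccE.
  congr p; rewrite {1}(baryE x J0).
  have -> : bary a b c x = 1 - bary b c a x - bary c a b x by rewrite -(bary_sum x J0); ring.
  by apply: pairE; rewrite /= !scaleRE; ring.
have cF : cont (hull [:: a; b; c]) (fun x => p x ^+ 2) by apply: contX; exact: pol_cont hp.
have [-> iG] := IK_area J0 cF.
rewrite mulrAC mulrC ler_pM2l ?normr_gt0//.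
rewrite -lee_fin fineK; last exact: (integrable_fin_num measurableT iG).
have [i1 j1] : (i < n.+1)%N /\ (j < n.+1)%N.
  by split; rewrite ltnS (leq_trans _ ij)// ?leq_addr ?leq_addl.
have := hk (fun i j => if (i + j <= n)%N then cc i j else 0) (Ordinal i1) (Ordinal j1).
rewrite /= ij => /le_trans; apply.
(* Coordinates below 1/2 add up to less than 1: the square of side 1/2 lies in the open reference
   triangle, and the integrand is nonnegative. *)
rewrite integral_mkcond; apply: ge0_le_integral => //.
- by move=> z _; rewrite patchE; case: ifP => // _; rewrite lee_fin sqr_ge0.
- have mJ : measurable (J : set (measurableTypeR R)) by exact: measurable_itv.
  have mJJ : measurable (J `*` J : set (mplane R)) by exact: measurableX.
  apply/(measurable_restrictT _ mJJ)/measurable_EFinP; apply: (@measurable_funS _ _ _ _ setT) => //.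
  apply: (measurable_cont openT); apply: contX; exact: pol_cont (dsum_pol _ _).
- exact: measurable_int iG.
- move=> z _; rewrite !patchE; case: ifPn => [|_]; last by case: ifP => _ //; rewrite lee_fin sqr_ge0.
  rewrite inE => -[/=]; rewrite !in_itv/= => /andP[s0 s1] /andP[t0 t1].
  rewrite ifT ?lee_fin; last first.
    by rewrite inE; apply/(ref_int z.1 z.2 J0).2; split => //; lra.
  by rewrite -dsum_polc -ccE.
Qed.

Lemma bary_affine a b c x : jac a b c != 0 -> bary a b c x =
  (b.2 - c.2) / jac a b c * x.1 + (c.1 - b.1) / jac a b c * x.2 + (b.1 * c.2 - b.2 * c.1) / jac a b c.
Proof.
move=> J0; rewrite /bary ![_ / _ * _]mulrAC -!mulrDl; congr (_ / _); rewrite /jac; ring.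
Qed.

(** A directional derivative only sees the values along a line; this serves as the chain rule for
    affine changes of variables. *)
Lemma is_derive_ext F x v y w (G : pt -> R) (d : R) : (forall h : R, F (x + h *: v) = G (y + h *: w)) ->
  is_derive y w G d -> is_derive x v F d.
Proof.
move=> FG dG.
have := path_is_derive (x := y) (v := w) (t := 0) (F := G) (d := d); rewrite scale0r addr0 => /(_ dG).
rewrite (_ : (fun t => G _) = (fun t => F (x + t *: v))); last by apply/funext => t; rewrite FG.
move=> [dF dE].
have E : (fun h : R => h^-1 *: ((F \o shift x) (h *: v) - F x)) =
   (fun h : R => h^-1 *: (((fun t : R => F (x + t *: v)) \o shift 0) (h *: 1) - F (x + 0 *: v))).
  apply/funext => h; congr (_ *: (F _ - F _)); apply: pairE; rewrite /= !scaleRE; ring.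
by split; [rewrite /derivable E|rewrite -dE /derive E].
Qed.

Lemma pol_dpart_sum n (I : finType) (k : I -> R) (f : I -> pt -> R) i :
  (forall j, pol n (f j)) ->
  dpart [:: i] (fun x => \sum_j k j * f j x) = fun x => \sum_j k j * dpart [:: i] (f j) x.
Proof.
move=> hf.
have H x v : is_derive x v (fun x => \sum_j k j * f j x)
    ((\sum_j k j * dpart [:: o0] (f j) x) * v.1 + (\sum_j k j * dpart [:: o1] (f j) x) * v.2).
  rewrite !mulr_suml -big_split/=.
  elim: (index_enum I) => [|j r IH].
    rewrite big_nil (_ : (fun x => _) = cst 0); first exact: is_derive_cst.
    by apply/funext => y; rewrite big_nil.
  rewrite big_cons (_ : (fun x => _) = fun x => k j * f j x + \sum_(j <- r) k j * f j x); last first.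
    by apply/funext => y; rewrite big_cons.
  apply: (is_derive_eq (is_deriveD (is_deriveM (is_derive_cst (k j) x v) (pol_is_derive (hf j) x v)) IH)).
  by rewrite /dpart /= !scaleRE; ring.
have [E1 E2] := dpart_of H.
have [->|->] : i = o0 \/ i = o1 by case: i => [[|[|//]]] hi; [left|right]; exact: val_inj.
  exact: E1.
exact: E2.
Qed.

Lemma ref_bary a b c x : jac a b c != 0 -> hull [:: a; b; c] x ->
  0 <= bary b c a x <= 1 /\ 0 <= bary c a b x <= 1.
Proof.
move=> J0 /(hull_baryP _ J0)[h1 h2 h3]; have := bary_sum x J0 => h.
by rewrite h2 h3 /=; split; lra.
Qed.

(* A reference coefficient estimate turned into estimates of values and first
   derivatives: the gradients of the barycentric coordinates are at most [h / |J|]. *)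
Lemma inverse_estimate n : exists2 C : R, 0 < C & forall a b c p (h : R), jac a b c != 0 ->
  [/\ `|(b - a).1| <= h, `|(b - a).2| <= h, `|(c - a).1| <= h & `|(c - a).2| <= h] ->
  pol n p -> forall x, hull [:: a; b; c] x ->
  `|jac a b c| * p x ^+ 2 <= C * IK a b c (fun x => p x ^+ 2) /\
  forall i, `|jac a b c| * (dpart [:: i] p x * (jac a b c / h)) ^+ 2 <= C * IK a b c (fun x => p x ^+ 2).
Proof.
have [k k0 hk] := IK_coef n.
pose m (i j : 'I_n.+1) (z : pt) := z.1 ^+ i * z.2 ^+ j.
have hm i j : pol (n + n) (m i j).
  by apply: (@pol_le _ (i + j)); [apply: leq_add; rewrite -ltnS|exact: pol_monom].
have csq : compact (`[(0 : R), 1]%classic `*` `[(0 : R), 1]%classic).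
  by apply: compact_setX; exact: segment_compact.
have bM i j l : exists M : R, 0 < M /\ forall z : pt, `[(0 : R), 1]%classic z.1 -> `[(0 : R), 1]%classic z.2 ->
    `|dpart [:: l] (m i j) z| <= M.
  have [M M0 hM] := cont_bounded csq (pol_cont (pol_dpart l (hm i j))).
  by exists M; split => // z z1 z2; apply: hM.
pose M i j l := sval (cid (bM i j l)).
have M0 i j l : 0 < M i j l by rewrite /M; case: cid => ? [].
have hM i j l z : `[(0 : R), 1]%classic z.1 -> `[(0 : R), 1]%classic z.2 -> `|dpart [:: l] (m i j) z| <= M i j l.
  by rewrite /M; case: cid => x0 [_ hx] /= z1 z2; exact: hx.
pose S := 1 + \sum_i \sum_j (M i j o0 + M i j o1).
have S1 : 1 <= S by rewrite /S lerDl sumr_ge0// => i _; rewrite sumr_ge0// => j _; rewrite addr_ge0// ltW.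
pose N := (n.+1 * n.+1)%:R : R.
have N0 : 0 < N by rewrite /N ltr0n.
exists ((N ^+ 2 + 4 * S ^+ 2) / k).
  by apply: divr_gt0 => //; have := mulr_gt0 N0 N0; nra.
move=> a b c p h J0 [hb1 hb2 hc1 hc2] hp x Hx.
have [cc [pE ccB]] := hk a b c p J0 hp.
set E := IK a b c _.
have aJ : 0 < `|jac a b c| by rewrite normr_gt0.
pose d i j := if (i + j <= n)%N then cc i j else 0.
(* [W] is the common bound of the reference coefficients, normalized so that [E] is exactly a
   multiple of its square; everything below is measured in [W]. *)
have [W [W0 WE hW]] : exists W : R, [/\ 0 <= W, k * `|jac a b c| * W ^+ 2 = E & forall i j, `|d i j| <= W].
  have E0 : 0 <= E by apply: IK_ge0 => y _; exact: sqr_ge0.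
  exists (Num.sqrt (E / (k * `|jac a b c|))).
  have kJ : 0 < k * `|jac a b c| by rewrite mulr_gt0.
  have Eq0 : 0 <= E / (k * `|jac a b c|) by apply: divr_ge0 => //; exact: ltW.
  split; [exact: sqrtr_ge0|by rewrite sqr_sqrtr// mulrC divfK// gt_eqF|].
  move=> i j; rewrite /d; case: ifP => [ij|_]; last by rewrite normr0 sqrtr_ge0.
  by rewrite -sqrtr_sqr ler_wsqrtr// ler_pdivlMr// mulrC ccB.
have [/andP[s0 s1] /andP[t0 t1]] := ref_bary J0 Hx.
set s := bary b c a x in s0 s1 *; set t := bary c a b x in t0 t1 *.
have pE2 z : polc n cc z = \sum_(i < n.+1) \sum_(j < n.+1) d i j * m i j z.
  by rewrite dsum_polc; apply: eq_bigr => i _; apply: eq_bigr => j _; rewrite /m /d mulrA.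
split.
  have pW : `|p x| <= N * W.
    rewrite pE pE2 (le_trans (ler_norm_sum _ _ _))//.
    apply: (@le_trans _ _ (\sum_(i < n.+1) \sum_(j < n.+1) W)).
      apply: ler_sum => i _; rewrite (le_trans (ler_norm_sum _ _ _))//.
      apply: ler_sum => j _; rewrite normrM -[leRHS]mulr1 ler_pM//.
      by rewrite /m /= normrM !normrX !ger0_norm// mulr_ile1 ?exprn_ge0 ?exprn_ile1.
    by rewrite !sumr_const !card_ord -mulrnA /N mulr_natl.
  rewrite -WE -(sqr_absE (p x)).
  apply: (@le_trans _ _ (`|jac a b c| * (N * W) ^+ 2)).
    by rewrite ler_pM2l// ler_pXn2r// ?nnegrE ?mulr_ge0// ltW.
  have -> : (N ^+ 2 + 4 * S ^+ 2) / k * (k * `|jac a b c| * W ^+ 2) =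
     `|jac a b c| * (N * W) ^+ 2 + 4 * S ^+ 2 * `|jac a b c| * W ^+ 2 by field; exact: lt0r_neq0.
  by rewrite lerDl -mulrA; apply: mulr_ge0; apply: mulr_ge0 => //; exact: sqr_ge0.
move=> l.
have DW l' : `|dpart [:: l'] (polc n cc) (s, t)| <= S * W.
  have -> : polc n cc = fun z => \sum_(ij : 'I_n.+1 * 'I_n.+1) d ij.1 ij.2 * m ij.1 ij.2 z.
    by apply/funext => z; rewrite pE2 pair_big.
  rewrite (@pol_dpart_sum (n + n)%N ('I_n.+1 * 'I_n.+1)%type (fun ij : 'I_n.+1 * 'I_n.+1 => d ij.1 ij.2) (fun ij : 'I_n.+1 * 'I_n.+1 => m ij.1 ij.2) l'); last by move=> ij; exact: hm.
  rewrite (le_trans (ler_norm_sum _ _ _))//.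
  apply: (@le_trans _ _ (\sum_(ij : 'I_n.+1 * 'I_n.+1) (M ij.1 ij.2 o0 + M ij.1 ij.2 o1) * W)).
    apply: ler_sum => ij _; rewrite normrM mulrC ler_pM//.
    have [->|->] : l' = o0 \/ l' = o1 by case: l' => [[|[|//]]] hi; [left|right]; exact: val_inj.
      by rewrite (le_trans (hM _ _ _ _ _ _))//= ?in_itv/= ?s0 ?t0// lerDl ltW.
    by rewrite (le_trans (hM _ _ _ _ _ _))//= ?in_itv/= ?s0 ?t0// lerDr ltW.
  rewrite -mulr_suml ler_wpM2r// /S -(pair_big xpredT xpredT (fun i j => M i j o0 + M i j o1)) /=.
  by rewrite lerDr.
(* The derivative, in the direction [v], of the two barycentric coordinates that serve as reference
   coordinates. *)
pose lin (v : pt) : pt := (((c - a).2 * v.1 - (c - a).1 * v.2) / jac a b c, ((b - a).1 * v.2 - (b - a).2 * v.1) / jac a b c).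
have dp v : is_derive x v p (dpart [:: o0] (polc n cc) (s, t) * (lin v).1 + dpart [:: o1] (polc n cc) (s, t) * (lin v).2).
  apply: (@is_derive_ext p x v (s, t) (lin v) (polc n cc)); last exact: pol_is_derive (pol_polc n cc) _ _.
  move=> r; rewrite pE; congr polc; rewrite /s /t /bary (jac_cyc a b c) -(jac_cyc c a b).
  by apply: pairE; rewrite /lin /= !scaleRE mulrA -mulrDl; congr (_ / _); rewrite /jac /= !scaleRE; ring.
move: (dpart [:: o0] (polc n cc) (s, t)) (dpart [:: o1] (polc n cc) (s, t)) (DW o0) (DW o1) dp.
move=> D1 D2 DW1 DW2 dp.
have dl : `|dpart [:: l] p x * jac a b c| <= 2 * S * W * h.
  have B (q r : R) : `|q| <= h -> `|r| <= h -> `|D1 * q + D2 * r| <= 2 * S * W * h.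
    move=> hq hr; rewrite (le_trans (ler_normD _ _))// !normrM.
    have -> : 2 * S * W * h = S * W * h + S * W * h by ring.
    by apply: lerD; apply: ler_pM.
  have [->|->] : l = o0 \/ l = o1 by case: l => [[|[|//]]] hi; [left|right]; exact: val_inj.
    have -> : dpart [:: o0] p x = D1 * (lin (basis2 R o0)).1 + D2 * (lin (basis2 R o0)).2.
      by have [_] := dp (basis2 R o0).
    have -> : (D1 * (lin (basis2 R o0)).1 + D2 * (lin (basis2 R o0)).2) * jac a b c =
      D1 * (c - a).2 + D2 * (- (b - a).2) by rewrite /lin /=; field.
    by apply: B; rewrite ?normrN.
  have -> : dpart [:: o1] p x = D1 * (lin (basis2 R o1)).1 + D2 * (lin (basis2 R o1)).2.
    by have [_] := dp (basis2 R o1).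
  have -> : (D1 * (lin (basis2 R o1)).1 + D2 * (lin (basis2 R o1)).2) * jac a b c =
    D1 * (- (c - a).1) + D2 * (b - a).1 by rewrite /lin /=; field.
  by apply: B; rewrite ?normrN.
have h0 : 0 < h.
  rewrite lt_neqAle (le_trans (normr_ge0 _) hb1) andbT; apply/eqP => h0.
  move: J0; rewrite /jac; move: hb1 hb2 => /=; rewrite -h0 !normr_le0 => /eqP -> /eqP ->.
  by rewrite !mul0r subrr eqxx.
rewrite [dpart _ _ _ * _]mulrA -[(_ / h) ^+ 2]sqr_absE normrM normfV (gtr0_norm h0).
have dl2 : `|dpart [:: l] p x * jac a b c| / h <= 2 * S * W by rewrite ler_pdivrMr.
rewrite -WE.
apply: (@le_trans _ _ (`|jac a b c| * (2 * S * W) ^+ 2)).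
  by rewrite ler_pM2l// ler_pXn2r// ?nnegrE ?divr_ge0 ?mulr_ge0//; lra.
have -> : (N ^+ 2 + 4 * S ^+ 2) / k * (k * `|jac a b c| * W ^+ 2) =
   `|jac a b c| * (2 * S * W) ^+ 2 + N ^+ 2 * `|jac a b c| * W ^+ 2 by field; exact: lt0r_neq0.
by rewrite lerDl -mulrA; apply: mulr_ge0; apply: mulr_ge0 => //; exact: sqr_ge0.
Qed.

End Inv2.

(** * Edges of a conforming triangulation *)

Section Mesh.
Variable R : realType.
Local Notation pt := (R * R)%type.
Implicit Types (a b c p q r x y z : pt) (K : triangle R).

Definition va K : pt := nth 0 K 0.
Definition vb K : pt := nth 0 K 1.
Definition vc K : pt := nth 0 K 2.

Lemma triE K : K = [:: va K; vb K; vc K] :> seq pt.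
Proof. by case: K => [[|a [|b [|c [|]]]] //= ?]. Qed.

Lemma hull_triE K : hull K = hull [:: va K; vb K; vc K].
Proof. by rewrite -triE. Qed.

Lemma jac_neq a b c : jac a b c != 0 -> [/\ a != b, b != c & a != c].
Proof.
by move=> J; split; apply: contra_neq J => ->; rewrite /jac; ring.
Qed.

(* Near the midpoint of [p q], the two triangles overlap when their third
   vertices lie on the same side. *)
Lemma same_side_meet p q r r' : 0 < jac p q r * jac p q r' ->
  (hull [:: p; q; r])° `&` (hull [:: p; q; r'])° !=set0.
Proof.
move=> JJ.
have J : jac p q r != 0 by apply: contraTneq JJ => ->; rewrite mul0r ltxx.
have J' : jac p q r' != 0 by apply: contraTneq JJ => ->; rewrite mulr0 ltxx.
pose m : pt := 2^-1 *: p + 2^-1 *: q.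
pose M := 1 + `|jac m q r'| / `|jac p q r'| + `|bary p q r' r| + `|bary q r' p r|.
(* At the midpoint [m] the coordinates belonging to [p] and [q] are 1/2; a move by [e] towards [r]
   is short enough to keep both positive. *)
pose e := (4 * M)^-1.
have M1 : 1 <= M by rewrite /M -!addrA lerDl !addr_ge0// divr_ge0.
have e0 : 0 < e by rewrite invr_gt0; lra.
have e1 : e <= 4^-1 by rewrite lef_pV2 ?posrE; lra.
have eM : e * M = 4^-1 by rewrite /e; field; apply: lt0r_neq0; lra.
exists ((1 - e) *: m + e *: r).
have xE : (1 - e) *: m + e *: r = ((1 - e) / 2) *: p + ((1 - e) / 2) *: q + e *: r.
  by apply: pairE; rewrite /m /= !scaleRE; ring.
have xE2 : (1 - e) *: m + e *: r = m + e *: (r - m).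
  by apply: pairE; rewrite /= !scaleRE; ring.
split.
  apply/(hull_intP _ J); rewrite xE.
  have [h1 h2 h3] := bary_aff ((1 - e) / 2) e J.
  have -> : ((1 - e) / 2) *: p + ((1 - e) / 2) *: q + e *: r = p + ((1 - e) / 2) *: (q - p) + e *: (r - p).
    by apply: pairE; rewrite /= !scaleRE; field.
  by rewrite h1 h2 h3; split; lra.
apply/(hull_intP _ J'); rewrite xE2 (bary_line p q r' m) (bary_line q r' p m) (bary_line r' p q m).
have [h1 h2 h3] := bary_aff 2^-1 0 J'.
have mE : m = p + 2^-1 *: (q - p) + 0 *: (r' - p).
  by apply: pairE; rewrite /m /= !scaleRE; field.
have -> : m + (r - m) = r by rewrite addrC subrK.
rewrite mE h1 h2 h3.
have b3 : bary r' p q r = jac p q r / jac p q r'.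
  by rewrite /bary; congr (_ / _); rewrite /jac; ring.
have b30 : 0 < bary r' p q r.
  rewrite b3; have -> : jac p q r / jac p q r' = jac p q r * jac p q r' * (jac p q r')^-1 ^+ 2 by field.
  by rewrite mulr_gt0// lt_neqAle sqr_ge0 andbT eq_sym expf_neq0// invr_neq0.
have n1 := ler_norm (- bary p q r' r); have n2 := ler_norm (- bary q r' p r).
rewrite !normrN in n1 n2.
have n3 : 0 <= `|jac m q r'| / `|jac p q r'| by rewrite divr_ge0.
have n4 := normr_ge0 (bary p q r' r); have n5 := normr_ge0 (bary q r' p r).
have k1 : e * `|bary p q r' r| <= 4^-1 by rewrite -eM ler_pM2l// /M; lra.
have k2 : e * `|bary q r' p r| <= 4^-1 by rewrite -eM ler_pM2l// /M; lra.
split.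
- have : - bary p q r' r * e <= 4^-1 by rewrite (le_trans _ k1)// mulrC ler_pM2l.
  by move=> k3; nra.
- have : - bary q r' p r * e <= 4^-1 by rewrite (le_trans _ k2)// mulrC ler_pM2l.
  by move=> k3; nra.
- by rewrite add0r subr0 mulr_gt0.
Qed.

Variables (Om : set pt) (s : seq pt) (T : mesh R).
Hypothesis OmE : Om = (hull s)°.
Hypothesis Om0 : Om !=set0.
Hypothesis conf : conforming Om T.

Lemma open_Om : open Om.
Proof. by rewrite OmE; exact: open_interior. Qed.

Lemma closure_Om_hull : closure Om `<=` hull s.
Proof.
rewrite OmE => x /(closure_subset (@interior_subset _ (hull s))).
by rewrite -(closure_id (hull s)).1//; exact: closed_hull.
Qed.

Lemma tri_neq0 K : K \in T -> jac (va K) (vb K) (vc K) != 0.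
Proof. by move=> KT; have [h _ _] := conf; apply: hull_int_jac; rewrite -hull_triE; exact: h. Qed.

Lemma tri_sub K : K \in T -> hull K `<=` closure Om.
Proof. by move=> KT; have [_ <- _] := conf => x Kx; exists K. Qed.

Lemma tri_int_sub K : K \in T -> (hull K)° `<=` Om.
Proof.
move=> KT x; rewrite OmE; apply: interiorS => y /(tri_sub KT); exact: closure_Om_hull.
Qed.

Lemma nth_triT (i : 'I_(size T)) : nth_tri i \in T.
Proof. exact: mem_tnth. Qed.

Lemma seg_not_int p q r x : jac p q r != 0 -> hull [:: p; q] x -> ~ (hull [:: p; q; r])° x.
Proof.
move=> J /hull2P[u [v [[u0 v0] uv ->]]] /(hull_intP _ J)[_ _].
have [_ _] := bary_aff v 0 J.
have -> : p + v *: (q - p) + 0 *: (r - p) = u *: p + v *: q.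
  by rewrite -(addrK v u) uv; apply: pairE; rewrite /= !scaleRE; ring.
by move=> ->; rewrite ltxx.
Qed.

Lemma vtx_cases K x : x \in (K : seq pt) -> [\/ x = va K, x = vb K | x = vc K].
Proof. by rewrite triE !inE => /or3P[] /eqP; [constructor 1|constructor 2|constructor 3]. Qed.

(** By conformity the intersection is empty, a vertex or an edge, and neither a vertex nor an edge
    contains interior points of the triangle. *)
Lemma tri_int_disj (i j : 'I_(size T)) : i != j -> (hull (nth_tri i))° `&` hull (nth_tri j) = set0.
Proof.
move=> ij; rewrite -subset0 => x [xi xj].
have Ji := tri_neq0 (nth_triT i).
have [_ _ /(_ i j ij)] := conf.
have xx : (hull (nth_tri i) `&` hull (nth_tri j)) x by split => //; exact: interior_subset.
rewrite (hull_triE (nth_tri i)) in xi *.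
set a := va _ in Ji xi *; set b := vb _ in Ji xi *; set c := vc _ in Ji xi *.
have Jb : jac b c a != 0 by rewrite jac_cyc.
have Jc : jac c a b != 0 by rewrite jac_cyc.
have nab y : hull [:: a; b] y -> ~ (hull [:: a; b; c])° y by exact: seg_not_int.
have nbc y : hull [:: b; c] y -> ~ (hull [:: a; b; c])° y by rewrite -hull3_perm; exact: seg_not_int.
have nca y : hull [:: c; a] y -> ~ (hull [:: a; b; c])° y.
  by rewrite -hull3_perm -hull3_perm; exact: seg_not_int.
have h2 p q y : hull [:: q; p] y -> hull [:: p; q] y.
  by move=> /hull2P[u [v [[u0 v0] uv ->]]]; apply/hull2P; exists v, u; split => //; rewrite addrC.
have h1 p q : hull [:: p; q] p.
  by apply/hull2P; exists 1, 0; split; [split|rewrite addr0|rewrite scale1r scale0r addr0].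
case.
- move=> h; move: xx; rewrite h; exact.
- move=> [p [pK _ h]]; move: xx; rewrite h /= => xp.
  by case: (vtx_cases pK) => pE; have xi' := xi; rewrite xp pE in xi';
    [exact: (nab _ (h1 a b) xi')|exact: (nbc _ (h1 b c) xi')|exact: (nca _ (h1 c a) xi')].
- move=> [p [q [pq [pK qK] _ h]]]; move: xx; rewrite h => xpq.
  case: (vtx_cases pK) (vtx_cases qK) => pE [] qE; move: pq xpq; rewrite ?pE ?qE ?eqxx// => _ xpq;
   first [exact: (nab _ xpq xi)|exact: (nbc _ xpq xi)|exact: (nca _ xpq xi)|
       exact: (nab _ (h2 _ _ _ xpq) xi)|exact: (nbc _ (h2 _ _ _ xpq) xi)|exact: (nca _ (h2 _ _ _ xpq) xi)].
Qed.

Lemma mem_nth_tri K : K \in T -> exists i : 'I_(size T), K = nth_tri i.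
Proof. by move=> KT; have /(tnthP (in_tuple T))[i ->] := KT; exists i. Qed.

Lemma brokenE : broken Om T = \bigcup_(i : 'I_(size T)) (hull (nth_tri i))°.
Proof.
apply/seteqP; split => [x [Ox nb]|x [i _ xi]].
  have [_ hc _] := conf.
  have : closure Om x by exact: subset_closure.
  rewrite -hc => -[K KT Kx]; have [i KE] := mem_nth_tri KT.
  exists i => //; apply: contrapT => ni; apply: nb; exists K => //; split; first exact: subset_closure.
  by rewrite KE.
split; first exact: tri_int_sub (nth_triT i) _ xi.
move=> [K KT [cK nK]]; have [j KE] := mem_nth_tri KT.
have [ij|ij] := eqVneq i j; first by apply: nK; rewrite KE -ij.
have := tri_int_disj ij; rewrite -subset0; apply; split; first exact: xi.
by rewrite -KE (closure_id (hull K)).1//; exact: closed_hull.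
Qed.

Local Notation tri i := (nth_tri i : seq pt).

(** Names the vertices of element [i] in an arbitrary order, so that any edge can be taken as the
    first two of them. *)
Definition vtx (i : 'I_(size T)) p q r :=
  [/\ hull (nth_tri i) = hull [:: p; q; r], jac p q r != 0 &
      forall x, (x \in tri i) = (x \in [:: p; q; r])].

Lemma vtx0 i : vtx i (va (nth_tri i)) (vb (nth_tri i)) (vc (nth_tri i)).
Proof. by split; [exact: hull_triE|exact: tri_neq0 (nth_triT i)|move=> x; rewrite -triE]. Qed.

Lemma vtx_rot i p q r : vtx i p q r -> vtx i q r p.
Proof.
move=> [h J m]; split; [by rewrite hull3_perm|by rewrite jac_cyc|].
by move=> x; rewrite m !inE; case: (x == p); case: (x == q); case: (x == r).
Qed.

Lemma vtx_swap i p q r : vtx i p q r -> vtx i q p r.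
Proof.
move=> [h J m]; split; [by rewrite hull3_swap|by rewrite jac_swap oppr_eq0|].
by move=> x; rewrite m !inE; case: (x == p); case: (x == q); case: (x == r).
Qed.

Lemma vtx_of i p q : p \in tri i -> q \in tri i -> p != q -> exists r, vtx i p q r.
Proof.
have v0 := vtx0 i; have v1 := vtx_rot v0; have v2 := vtx_rot v1.
have w0 := vtx_swap v0; have w1 := vtx_swap v1; have w2 := vtx_swap v2.
move=> /vtx_cases[] -> /vtx_cases[] ->; rewrite ?eqxx// => _; eexists;
  first [exact: v0|exact: v1|exact: v2|exact: w0|exact: w1|exact: w2].
Qed.

Lemma opposite_sides i j p q r r' : vtx i p q r -> vtx j p q r' -> i != j ->
  jac p q r * jac p q r' < 0.
Proof.
move=> [hi Ji _] [hj Jj _] ij; rewrite lt_neqAle mulf_neq0//= leNgt; apply/negP.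
move=> /same_side_meet[x [xi xj]]; have := tri_int_disj ij; rewrite -subset0; apply.
by split; [rewrite hi; exact: xi|rewrite hj; exact: interior_subset].
Qed.

(** Sliding [x] a little towards the midpoint of the edge gives a point [y] of [Om] that is not a
    vertex. If no other element contained [y], a neighbourhood of [y] would lie in element [i],
    which is impossible for a point of an edge. An element that does contain [y] shares, by
    conformity, the whole edge with element [i]. *)
Lemma edge_neighbour i p q r x : vtx i p q r -> hull [:: p; q] x -> ~ bdry Om x ->
  exists j, [/\ j != i, p \in tri j & q \in tri j].
Proof.
move=> vi hx nb; have [hi Ji mi] := vi.
have cx : closure Om x.
  apply: (tri_sub (nth_triT i)); rewrite hi.
  have /hull2P[u [v [[u0 v0] uv ->]]] := hx; apply/hull3P; exists u, v, 0.
  by split => //; rewrite ?addr0// scale0r addr0.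
have Ox : Om x by apply: contrapT => nO; apply: nb; split => //; apply: contra_not nO; exact: interior_subset.
have [e e0 he] : exists2 e : R, 0 < e & forall y, `|y.1 - x.1| < e -> `|y.2 - x.2| < e -> Om y.
  by apply/interior2P; have := open_Om; rewrite openE; apply.
have /hull2P[u [v [[u0 v0] uv xE]]] := hx.
pose m : pt := 2^-1 *: p + 2^-1 *: q.
pose M := 1 + `|m.1 - x.1| + `|m.2 - x.2|.
have M1 : 1 <= M by rewrite /M -addrA lerDl addr_ge0.
pose t := Num.min 2^-1 (e / 2 / M).
have t0 : 0 < t by rewrite lt_min invr_gt0 ltr0n !divr_gt0//; lra.
have t1 : t <= 2^-1 by rewrite ge_min lexx.
have t2 : t * M <= e / 2 by rewrite -ler_pdivlMr ?ge_min ?lexx ?orbT//; lra.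
pose y := x + t *: (m - x).
have n1 := normr_ge0 (m.1 - x.1); have n2 := normr_ge0 (m.2 - x.2).
have Oy : Om y.
  apply: he; rewrite /y /= !scaleRE addrAC subrr add0r normrM gtr0_norm//;
   (apply: (le_lt_trans (y := t * M)); [rewrite ler_pM2l// /M; lra|lra]).
have yE : y = p + ((1 - t) * v + t / 2) *: (q - p) + 0 *: (r - p).
  have uE : u = 1 - v by rewrite -uv addrK.
  by rewrite /y xE uE /m; apply: pairE; rewrite /= !scaleRE; field.
have [b1 b2 b3] := bary_aff ((1 - t) * v + t / 2) 0 Ji; rewrite -yE in b1 b2 b3.
have v1 : v <= 1 by rewrite -uv lerDr.
have bp : 0 < bary p q r y by rewrite b1; nra.
have bq : 0 < bary q r p y by rewrite b2; nra.
have Jq : jac q r p != 0 by rewrite jac_cyc.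
have Jr : jac r p q != 0 by rewrite jac_cyc.
have onv z : z \in tri i -> y = z -> False.
  have [_ bq1 br1] := bary_vertex Ji; have [_ bq2 br2] := bary_vertex Jq.
  rewrite mi !inE => /or3P[] /eqP zE yz; move: bp bq; rewrite yz zE.
  - by rewrite br2 ltxx.
  - by rewrite bq1 ltxx.
  - by rewrite br1 ltxx.
have key j : j != i -> hull (nth_tri j) y -> p \in tri j /\ q \in tri j.
  move=> ji hj; have [_ _ /(_ i j)] := conf; rewrite eq_sym => /(_ ji).
  have hy : (hull (nth_tri i) `&` hull (nth_tri j)) y.
    by split => //; rewrite hi; apply/(hull_baryP y Ji); rewrite b3; split => //; exact: ltW.
  case.
  - by move=> h; move: hy; rewrite h.
  - by move=> [z [zi _ h]]; move: hy; rewrite h /= => /(onv z zi).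
  - move=> [z [w [zw [zi wi] [zj wj] h]]]; move: hy; rewrite h => /hull2P[u' [v' [[u'0 v'0] uv' yE']]].
    have bz (A B C : pt) : jac A B C != 0 -> bary A B C y = u' * bary A B C z + v' * bary A B C w.
      move=> J; rewrite yE' (_ : _ + _ = z + v' *: (w - z)); last first.
        by rewrite -(addrK v' u') uv'; apply: pairE; rewrite /= !scaleRE; ring.
      rewrite bary_line (_ : z + (w - z) = w); last by rewrite addrC subrK.
      by rewrite -(addrK v' u') uv'; ring.
    have ep := bz p q r Ji; have eq := bz q r p Jq;
    have [p1 p2 p3] := bary_vertex Ji; have [q1 q2 q3] := bary_vertex Jq.
    move: zi wi zj wj; rewrite !mi !inE => /or3P[] /eqP zE /or3P[] /eqP wE; move: zw bp bq; rewrite ep eq;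
      rewrite zE wE ?eqxx// ?p1 ?p2 ?p3 ?q1 ?q2 ?q3 => _ B1 B2 zj' wj'; (try by split);
      exfalso; clear -u'0 v'0 uv' B1 B2; lra.
have [[j [ji hj]]|nj] := pselect (exists j, j != i /\ hull (nth_tri j) y).
  by exists j; have [] := key j ji hj.
exfalso; have : (hull (nth_tri i))° y.
  have N0 (j : 'I_(size T)) : \forall z \near y, (j != i -> ~ hull (nth_tri j) z).
    have [->|ji] := eqVneq j i; first exact: filterE.
    have oc : open (~` hull (nth_tri j)) by apply: closed_openC; exact: closed_hull.
    have : (~` hull (nth_tri j)) y by move=> hj; apply: nj; exists j.
    by move=> ny; apply: filterS (open_nbhs_nbhs (conj oc ny)) => z nz _.
  have N1 : \forall z \near y, forall j, j != i -> ~ hull (nth_tri j) z.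
    exact: (filter_forall (f := fun (j : 'I_(size T)) z => j != i -> ~ hull (nth_tri j) z) _ N0).
  have N2 : \forall z \near y, Om z by apply: open_nbhs_nbhs; split => //; exact: open_Om.
  rewrite /interior/=; apply: filterS2 N1 N2 => z nz Oz.
  have [_ hc _] := conf; have : closure Om z by exact: subset_closure.
  rewrite -hc => -[K KT Kz]; have [j KE] := mem_nth_tri KT.
  have [ji|ji] := eqVneq j i; first by rewrite -ji -KE.
  by exfalso; apply: (nz j ji); rewrite -KE.
rewrite hi; apply: seg_not_int => //.
apply/hull2P; exists (1 - ((1 - t) * v + t / 2)), ((1 - t) * v + t / 2); split.
- by split; nra.
- by rewrite subrK.
- by rewrite yE; apply: pairE; rewrite /= !scaleRE; ring.
Qed.

(** Otherwise the neighbour would have [r] as its own third vertex, on the same side of the edge. *)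
Lemma edge_third i j p q r : vtx i p q r -> j != i -> p \in tri j -> q \in tri j -> r \notin tri j.
Proof.
move=> vi ji pj qj; apply/negP => rj; have [_ Ji _] := vi.
have [pq qr pr] := jac_neq Ji.
have [r' vj] := vtx_of pj qj pq; have [_ _ mj] := vj.
have := opposite_sides vi vj; rewrite eq_sym => /(_ ji).
move: rj; rewrite mj !inE eq_sym (negPf pr) eq_sym (negPf qr) /= => /eqP <-.
by rewrite ltNge -expr2 sqr_ge0.
Qed.

(** Of three elements on one edge, two would have their third vertices on the same side. *)
Lemma edge_unique i j j' p q r : vtx i p q r -> j != i -> j' != i ->
  p \in tri j -> q \in tri j -> p \in tri j' -> q \in tri j' -> j = j'.
Proof.
move=> vi ji ji' pj qj pj' qj'; apply/eqP/negPn/negP => jj.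
have [_ Ji _] := vi; have [pq _ _] := jac_neq Ji.
have [r1 v1] := vtx_of pj qj pq; have [r2 v2] := vtx_of pj' qj' pq.
have := opposite_sides v1 v2 jj; have := opposite_sides v1 vi ji; have := opposite_sides v2 vi ji'.
by nra.
Qed.

Section EdgeSum.
Variable X : 'I_(size T) -> pt -> pt -> R.
Hypothesis Xsym : forall i p q, X i p q = X i q p.
Hypothesis Xbdry : forall i p q r, vtx i p q r -> (forall x, hull [:: p; q] x -> bdry Om x) ->
  X i p q = 0.

Let sh (i j : 'I_(size T)) := shared_vertices (nth_tri i) (nth_tri j).
Let P i j := size (sh i j) == 2.
Let Y i j := X i (nth 0 (sh i j) 0) (nth 0 (sh i j) 1).

Lemma one_edge_sum i p q r : vtx i p q r ->
  \sum_(j | j != i) (if (p \in tri j) && (q \in tri j) then X i p q else 0) = X i p q.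
Proof.
move=> vi.
have [[j [ji pj qj]]|nj] := pselect (exists j, [/\ j != i, p \in tri j & q \in tri j]).
  rewrite (bigD1 j)//= pj qj /= big1 ?addr0// => j' /andP[ji' jj].
  case: ifP => // /andP[pj' qj'].
  by move: jj; rewrite (edge_unique vi ji' ji pj' qj' pj qj) eqxx.
rewrite big1 => [|j ji]; last first.
  by case: ifP => // /andP[pj qj]; exfalso; apply: nj; exists j.
rewrite (Xbdry vi)// => x hx; apply: contrapT => nb; apply: nj.
by have [j [ji pj qj]] := edge_neighbour vi hx nb; exists j.
Qed.

Lemma shared_sum i : \sum_(j | (j != i) && P i j) Y i j =
  X i (va (nth_tri i)) (vb (nth_tri i)) + X i (vb (nth_tri i)) (vc (nth_tri i)) +
  X i (vc (nth_tri i)) (va (nth_tri i)).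
Proof.
have v0 := vtx0 i; have v1 := vtx_rot v0; have v2 := vtx_rot v1.
rewrite -(one_edge_sum v0) -(one_edge_sum v1) -(one_edge_sum v2) -!big_split /= big_mkcondr.
apply: eq_bigr => j ji; rewrite /P /Y /sh /shared_vertices.
have := edge_third v0 ji; rewrite [X in [seq _ <- X | _]]triE /=.
case: (va _ \in _); case: (vb _ \in _); case: (vc _ \in _) => //=; rewrite ?addr0 ?add0r//.
  by move=> /(_ isT isT).
Qed.

Lemma P_sym i j : P i j = P j i.
Proof.
rewrite /P; have u (k : 'I_(size T)) : uniq (tri k).
  have [_ J _] := vtx0 k; have [h1 h2 h3] := jac_neq J.
  by rewrite triE /= !inE h2 negb_or h1 h3.
congr (_ == _); rewrite /sh /shared_vertices; apply: perm_size; apply: uniq_perm; rewrite ?filter_uniq//.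
by move=> x; rewrite !mem_filter andbC.
Qed.

Lemma Y_swap i j : P i j -> X j (nth 0 (sh i j) 0) (nth 0 (sh i j) 1) = Y j i.
Proof.
have u (k : 'I_(size T)) : uniq (tri k).
  have [_ J _] := vtx0 k; have [h1 h2 h3] := jac_neq J.
  by rewrite triE /= !inE h2 negb_or h1 h3.
move=> Pij; have Pji : P j i by rewrite -P_sym.
have upq : uniq (sh i j) by rewrite filter_uniq.
have h : sh i j =i sh j i by move=> x; rewrite !mem_filter andbC.
move: Pij Pji upq h; rewrite /P /Y; move: (sh i j) (sh j i) => [|p [|q []]]//= [|p' [|q' []]]//= _ _.
rewrite inE andbT => pq h; have := h p; have := h q; rewrite !inE !eqxx orbT /=.
have [<-|pp] := eqVneq p p'.
  by rewrite eq_sym (negPf pq) /= => /esym/eqP ->.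
move=> + /esym/eqP pq'; rewrite -pq' (eq_sym q p) (negPf pq) orbF => /esym/eqP ->; exact: Xsym.
Qed.

(** A pair [i < j] with two common vertices is an interior edge, met from both of its sides; an edge
    without neighbour lies on the boundary, where [X] vanishes. The symmetry of [X] takes care of
    the two orders in which the lists of shared vertices may come. *)
Lemma edge_sum : \sum_(i < size T) \sum_(j < size T | (i < j)%N && P i j)
    (X i (nth 0 (sh i j) 0) (nth 0 (sh i j) 1) + X j (nth 0 (sh i j) 0) (nth 0 (sh i j) 1)) =
  \sum_(i < size T) (X i (va (nth_tri i)) (vb (nth_tri i)) + X i (vb (nth_tri i)) (vc (nth_tri i)) +
    X i (vc (nth_tri i)) (va (nth_tri i))).
Proof.
under [RHS]eq_bigr do rewrite -shared_sum.
under [LHS]eq_bigr => i _ do rewrite big_split /=.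
rewrite big_split /= [X in _ + X](exchange_big_dep xpredT) //=.
rewrite -big_split; apply: eq_bigr => i _ /=.
rewrite [RHS](bigID (fun j : 'I_(size T) => (i < j)%N)) /=; congr (_ + _).
  by apply: eq_bigl => j; rewrite -val_eqE /=; case: (ltngtP i j); case: (P i j).
apply: eq_big => j; first by rewrite P_sym -val_eqE /=; case: (ltngtP i j); case: (P i j).
by move=> /andP[_ Pji]; exact: Y_swap.
Qed.

End EdgeSum.
End Mesh.

(** * Lagrange interpolation on a triangle *)

Section Lagrange.
Variable R : realType.
Variable k : nat.
Hypothesis k0 : (0 < k)%N.
Local Notation pt := (R * R)%type.
Implicit Types (a b c p q r x y z : pt) (w : pt -> R).

(** Silvester polynomial: degree [m], value 1 at [m / k], zeros at the smaller multiples of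
    [1 / k]. *)
Definition sil (m : nat) (l : R) : R := \prod_(r < m) ((k%:R * l - r%:R) / r.+1%:R).

Definition nd a b c (i j : nat) : pt :=
  ((k - i - j)%:R / k%:R) *: a + (i%:R / k%:R) *: b + (j%:R / k%:R) *: c.

Definition lagr a b c (i j : nat) x : R :=
  sil (k - i - j) (bary a b c x) * sil i (bary b c a x) * sil j (bary c a b x).

Definition adm : seq ('I_k.+1 * 'I_k.+1) :=
  seq.filter (fun t : 'I_k.+1 * 'I_k.+1 => (t.1 + t.2 <= k)%N) (index_enum ('I_k.+1 * 'I_k.+1)%type).

Lemma adm_sum (F : nat -> nat -> R) : \sum_(t <- adm) F t.1 t.2 =
  \sum_(i < k.+1) \sum_(j < k.+1 | (i + j <= k)%N) F i j.
Proof. by rewrite /adm big_filter pair_big_dep. Qed.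

Lemma mem_adm (i j : nat) : (i + j <= k)%N -> exists2 t, t \in adm & (t.1 = i :> nat) /\ (t.2 = j :> nat).
Proof.
move=> ij; have i1 : (i < k.+1)%N by rewrite ltnS (leq_trans (leq_addr _ _) ij).
have j1 : (j < k.+1)%N by rewrite ltnS (leq_trans (leq_addl _ _) ij).
by exists (Ordinal i1, Ordinal j1) => //; rewrite mem_filter /= ij mem_index_enum.
Qed.

Lemma kR0 : k%:R != 0 :> R. Proof. by rewrite pnatr_eq0 -lt0n. Qed.

Lemma sil_node m n : sil m (n%:R / k%:R) = if (n < m)%N then 0 else \prod_(r < m) ((n%:R - r%:R) / r.+1%:R).
Proof.
rewrite /sil; have E : k%:R * (n%:R / k%:R) = n%:R :> R by rewrite mulrC divfK// kR0.
case: ifP => nm; last by under eq_bigr do rewrite E.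
by rewrite (bigD1 (Ordinal nm))//= E subrr !mul0r.
Qed.

Lemma sil_diag m : sil m (m%:R / k%:R) = 1.
Proof.
rewrite sil_node ltnn (eq_bigr (fun r : 'I_m => (m - r)%:R / r.+1%:R)); last first.
  by move=> r _; rewrite natrB// ltnW.
rewrite prodf_div; apply: (canLR (mulfK _)).
  by apply/prodf_neq0 => i _; rewrite pnatr_eq0.
rewrite mul1r (reindex_inj rev_ord_inj) /=; apply: eq_bigr => i _.
by congr _%:R; rewrite subKn.
Qed.

Lemma sil0 m : sil m 0 = (m == 0%N)%:R.
Proof.
case: m => [|m]; first by rewrite /sil big_ord0.
by rewrite /sil big_ord_recl /= mulr0 subrr !mul0r.
Qed.

Lemma sil_pol a b c m : jac a b c != 0 -> pol m (fun x => sil m (bary a b c x)).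
Proof.
move=> J; elim: m => [|m IH].
  by rewrite (_ : (fun x => _) = fun=> 1); [exact: pol_cst|apply/funext => x; rewrite /sil big_ord0].
rewrite (_ : (fun x => _) = fun x => sil m (bary a b c x) * ((k%:R * bary a b c x - m%:R) / m.+1%:R)); last first.
  by apply/funext => x; rewrite /sil big_ord_recr.
rewrite -[X in pol X]addn1; apply: polM => //.
rewrite (_ : (fun x => _) = fun x => m.+1%:R^-1 * (k%:R * bary a b c x + - m%:R)); last first.
  by apply/funext => x; rewrite mulrC.
apply: polZ; apply: polD; last exact: pol_cst.
apply: polZ; rewrite (funext (fun x => bary_affine x J)).
exact: pol_aff.
Qed.

Lemma lagr_pol a b c i j : jac a b c != 0 -> (i + j <= k)%N -> pol k (lagr a b c i j).
Proof.
move=> J ij; have J1 : jac b c a != 0 by rewrite jac_cyc.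
have J2 : jac c a b != 0 by rewrite jac_cyc.
rewrite -[X in pol X](subnK ij) addnA subnDA; apply: polM; last exact: sil_pol.
by apply: polM; exact: sil_pol.
Qed.

Lemma bary_nd a b c i j : jac a b c != 0 -> (i + j <= k)%N ->
  [/\ bary a b c (nd a b c i j) = (k - i - j)%:R / k%:R, bary b c a (nd a b c i j) = i%:R / k%:R &
      bary c a b (nd a b c i j) = j%:R / k%:R].
Proof.
move=> J ij.
have E : (k - i - j)%:R / k%:R = 1 - i%:R / k%:R - j%:R / k%:R :> R.
  by rewrite -subnDA natrB// natrD; field; exact: kR0.
rewrite /nd E; have [h1 h2 h3] := bary_aff (i%:R / k%:R) (j%:R / k%:R) J.
have -> : (1 - i%:R / k%:R - j%:R / k%:R) *: a + (i%:R / k%:R) *: b + (j%:R / k%:R) *: c =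
  a + (i%:R / k%:R) *: (b - a) + (j%:R / k%:R) *: (c - a) by apply: pairE; rewrite /= !scaleRE; ring.
by [].
Qed.

Lemma nd_hull a b c i j : jac a b c != 0 -> (i + j <= k)%N -> hull [:: a; b; c] (nd a b c i j).
Proof.
move=> J ij; apply/(hull_baryP _ J); have [-> -> ->] := bary_nd J ij.
by split; rewrite divr_ge0.
Qed.

(** The three indices of a node add up to [k]. Two different nodes hence differ in some index that
    is smaller for the second one, and there the Silvester factor vanishes. *)
Lemma lagr_nd a b c i j i' j' : jac a b c != 0 -> (i + j <= k)%N -> (i' + j' <= k)%N ->
  lagr a b c i j (nd a b c i' j') = ((i == i') && (j == j'))%:R.
Proof.
move=> J ij ij'; rewrite /lagr; have [-> -> ->] := bary_nd J ij'.
have [/andP[/eqP <- /eqP <-]|ne] := boolP ((i == i') && (j == j')); first by rewrite !sil_diag !mulr1.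
have [h|h] := ltnP i' i; first by rewrite (sil_node i) h mulr0 mul0r.
have [h'|h'] := ltnP j' j; first by rewrite (sil_node j) h' mulr0.
have h2 : (k - i' - j' < k - i - j)%N.
  rewrite -!subnDA ltn_sub2l//.
    rewrite (leq_trans _ ij')// ltn_neqAle leq_add// andbT; apply: contraNneq ne => e.
    have ei : i = i'.
      apply/eqP; rewrite eqn_leq h /= -(leq_add2r j') -e leq_add2l.
      by rewrite h'.
    by rewrite ei eqxx /= -(eqn_add2l i) e ei.
  rewrite ltn_neqAle leq_add// andbT; apply: contraNneq ne => e.
  have ei : i = i'.
    apply/eqP; rewrite eqn_leq h /= -(leq_add2r j') -e leq_add2l.
    by rewrite h'.
  by rewrite ei eqxx /= -(eqn_add2l i) e ei.
by rewrite sil_node h2 !mul0r.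
Qed.

(* A left inverse of a square matrix is a right inverse: the evaluation matrix
   of the monomials at the nodes inverts the coefficient matrix of the basis. *)
Lemma lagrange_repr a b c (p : pt -> R) : jac a b c != 0 -> pol k p ->
  forall x, p x = \sum_(t <- adm) p (nd a b c t.1 t.2) * lagr a b c t.1 t.2 x.
Proof.
move=> J; pose n := size adm; pose tt (u : 'I_n) := tnth (in_tuple adm) u.
have tta u : ((tt u).1 + (tt u).2 <= k)%N.
  by have := mem_tnth u (in_tuple adm); rewrite mem_filter => /andP[].
have /choice[cf cfE] : forall u : 'I_n, exists d : nat -> nat -> R,
    lagr a b c (tt u).1 (tt u).2 = polc k d.
  by move=> u; apply: polcP; exact: lagr_pol.
have sumE (d : nat -> nat -> R) x : polc k d x = \sum_(v < n) d (tt v).1 (tt v).2 * (x.1 ^+ (tt v).1 * x.2 ^+ (tt v).2).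
  rewrite /polc -(adm_sum (fun i j => d i j * x.1 ^+ i * x.2 ^+ j)) big_tnth.
  by apply: eq_bigr => v _; rewrite mulrA.
pose C : 'M[R]_n := \matrix_(u, v) cf u (tt v).1 (tt v).2.
pose M : 'M[R]_n := \matrix_(v, u) (let z := nd a b c (tt u).1 (tt u).2 in z.1 ^+ (tt v).1 * z.2 ^+ (tt v).2).
have utt : injective tt.
  have ua : uniq adm by rewrite filter_uniq// index_enum_uniq.
  move=> u v; rewrite /tt !(tnth_nth (ord0, ord0)) => e; apply: val_inj => /=; apply/eqP.
  by rewrite -(nth_uniq (ord0, ord0) _ _ ua)// e.
have CM : C *m M = 1%:M.
  apply/matrixP => u v; rewrite !mxE.
  transitivity (lagr a b c (tt u).1 (tt u).2 (nd a b c (tt v).1 (tt v).2)).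
    by rewrite cfE sumE; apply: eq_bigr => l _; rewrite !mxE.
  rewrite lagr_nd//; congr (_%:R).
  by rewrite -(inj_eq utt) -pair_eqE /pair_eq -!val_eqE.
have MC := mulmx1C CM.
move=> /polcP[d ->] x; rewrite big_tnth sumE.
pose mo (v : 'I_n) z : R := z.1 ^+ (tt v).1 * z.2 ^+ (tt v).2.
have moE v z : mo v z = \sum_(u < n) mo v (nd a b c (tt u).1 (tt u).2) * lagr a b c (tt u).1 (tt u).2 z.
  transitivity (\sum_(l < n) (M *m C) v l * mo l z).
    by rewrite MC (bigD1 v)//= big1 ?addr0 => [|l lv]; rewrite mxE ?eqxx ?mul1r// eq_sym (negPf lv) mul0r.
  under eq_bigr do rewrite mxE mulr_suml.
  rewrite exchange_big; apply: eq_bigr => u _; rewrite cfE sumE mulr_sumr.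
  by apply: eq_bigr => l _; rewrite !mxE mulrA.
under eq_bigr do rewrite -/(mo _ _) moE mulr_sumr.
rewrite exchange_big; apply: eq_bigr => u _; rewrite sumE mulr_suml.
by apply: eq_bigr => v _; rewrite mulrA.
Qed.

Definition LI a b c w x := \sum_(t <- adm) w (nd a b c t.1 t.2) * lagr a b c t.1 t.2 x.

Lemma LI_pol a b c w : jac a b c != 0 -> pol k (LI a b c w).
Proof.
move=> J; rewrite (_ : LI a b c w = fun x => \sum_(i < k.+1) \sum_(j < k.+1 | (i + j <= k)%N) w (nd a b c i j) * lagr a b c i j x).
  by apply: pol_sum => i _; apply: pol_sum => j ij; apply: polZ; exact: lagr_pol.
by apply/funext => x; rewrite /LI (adm_sum (fun i j => w (nd a b c i j) * lagr a b c i j x)).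
Qed.

Lemma LI_nd a b c w i j : jac a b c != 0 -> (i + j <= k)%N -> LI a b c w (nd a b c i j) = w (nd a b c i j).
Proof.
move=> J ij; have [t ta [<- <-]] := mem_adm ij.
have ua : uniq adm by rewrite filter_uniq// index_enum_uniq.
rewrite /LI (bigD1_seq t)//= lagr_nd ?eqxx; last 3 first.
- by [].
- by move: ta; rewrite mem_filter => /andP[].
- by move: ta; rewrite mem_filter => /andP[].
rewrite mulr1 big_seq_cond big1 ?addr0// => t' /andP[ta' tt'].
rewrite lagr_nd; last 3 first.
- by [].
- by move: ta'; rewrite mem_filter => /andP[].
- by move: ta; rewrite mem_filter => /andP[].
rewrite (_ : _ && _ = (t' == t)); last by case: (t') (t) => [? ?] [? ?].
by rewrite (negPf tt') mulr0.
Qed.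

Lemma LI_id a b c (p : pt -> R) : jac a b c != 0 -> pol k p -> LI a b c p = p.
Proof. by move=> J hp; apply/funext => x; rewrite [RHS](lagrange_repr J hp). Qed.

Lemma LI_eq a b c w w' : jac a b c != 0 ->
  (forall i j, (i + j <= k)%N -> w (nd a b c i j) = w' (nd a b c i j)) -> LI a b c w = LI a b c w'.
Proof.
move=> J h; apply/funext => x; rewrite /LI big_seq [RHS]big_seq; apply: eq_bigr => t.
by rewrite mem_filter => /andP[ta _]; rewrite h.
Qed.

Lemma nd_rot a b c i j : (i + j <= k)%N -> nd a b c i j = nd b c a j (k - i - j).
Proof.
move=> ij; rewrite /nd.
have -> : (k - j - (k - i - j))%N = i by lia.
by rewrite -addrA addrC.
Qed.

Lemma nd_swap a b c i j : (i + j <= k)%N -> nd a b c i j = nd b a c (k - i - j) j.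
Proof.
move=> ij; rewrite /nd; have -> : (k - (k - i - j) - j)%N = i by lia.
by rewrite (addrC (_ *: a)).
Qed.

(** Interpolation reproduces polynomials, so two interpolants that agree at the nodes coincide;
    renumbering the vertices only permutes the nodes. *)
Lemma LI_rot a b c w : jac a b c != 0 -> LI b c a w = LI a b c w.
Proof.
move=> J; have J1 : jac b c a != 0 by rewrite jac_cyc.
rewrite -[LHS](LI_id J); last exact: LI_pol.
apply: LI_eq => // i j ij; rewrite nd_rot// LI_nd//; lia.
Qed.

Lemma LI_swap a b c w : jac a b c != 0 -> LI b a c w = LI a b c w.
Proof.
move=> J; have J1 : jac b a c != 0 by rewrite jac_swap oppr_eq0.
rewrite -[LHS](LI_id J); last exact: LI_pol.
apply: LI_eq => // i j ij; rewrite nd_swap// LI_nd//; lia.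
Qed.

(** The right-hand side does not involve [c]: shape functions of nodes off the edge vanish on it.
    This is why interpolants on neighbouring elements fit together. *)
Lemma LI_edge a b c w (t : R) : jac a b c != 0 -> LI a b c w (a + t *: (b - a)) =
  \sum_(i < k.+1) w (nd a b b i 0) * (sil (k - i) (1 - t) * sil i t).
Proof.
move=> J; rewrite /LI (adm_sum (fun i j => w (nd a b c i j) * lagr a b c i j (a + t *: (b - a)))).
apply: eq_bigr => i _.
have [h1 h2 h3] := bary_aff t 0 J; rewrite scale0r addr0 in h1 h2 h3.
rewrite (bigD1 ord0)/=; last by rewrite addn0 -ltnS.
rewrite big1 ?addr0 => [|j /andP[_ j0]]; last first.
  have /negPf jN : (j : nat) != 0%N by move: j0; rewrite -val_eqE.
  by rewrite /lagr h3 sil0 jN !mulr0.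
by rewrite /lagr h1 h2 h3 sil0 mulr1 subr0 subn0 /nd mul0r !scale0r.
Qed.

Lemma sil_bound m : exists2 C : R, 0 < C & forall l, 0 <= l <= 1 -> `|sil m l| <= C.
Proof.
elim: m => [|m [C C0 hC]]; first by exists 1 => // l _; rewrite /sil big_ord0 normr1.
exists (C * (k%:R + m%:R + 1)); first by rewrite mulr_gt0// ltr_wpDl// addr_ge0.
move=> l hl; have /andP[l0 l1] := hl; rewrite /sil big_ord_recr /= normrM; apply: ler_pM => //; first exact: hC.
rewrite normrM normfV [X in _ / X]ger0_norm ?ler0n// ler_pdivrMr ?ltr0n//.
have m1 : 1 <= m.+1%:R :> R by rewrite ler1n.
have km : 0 <= k%:R + m%:R + 1 :> R by rewrite !addr_ge0.
apply: (@le_trans _ _ (k%:R + m%:R)).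
  rewrite (le_trans (ler_normB _ _))// normrM !ger0_norm//.
  by rewrite lerD2r ler_piMr.
by nra.
Qed.

Lemma lagr_bound : exists2 C : R, 0 < C & forall a b c i j x, jac a b c != 0 -> (i + j <= k)%N ->
  hull [:: a; b; c] x -> `|lagr a b c i j x| <= C.
Proof.
have /choice[C hC] : forall m, exists C : R, 0 < C /\ forall l, 0 <= l <= 1 -> `|sil m l| <= C.
  by move=> m; have [C] := sil_bound m; exists C.
pose S := 1 + \sum_(m < k.+1) C m.
have CS m : (m <= k)%N -> C m <= S.
  move=> mk; rewrite /S (bigD1 (inord m))//= inordK// addrCA lerDl addr_ge0// sumr_ge0// => i _.
  by have [/ltW] := hC i.
have S1 : 1 <= S by rewrite lerDl sumr_ge0// => i _; have [/ltW] := hC i.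
exists (S * S * S); first by rewrite !mulr_gt0; lra.
move=> a b c i j x J ij /(hull_baryP _ J)[h1 h2 h3]; have h := bary_sum x J.
have B m l : (m <= k)%N -> 0 <= l <= 1 -> `|sil m l| <= S.
  by move=> mk hl; have [_ /(_ l hl) hm] := hC m; exact: le_trans hm (CS _ mk).
rewrite /lagr !normrM; do 2?(apply: ler_pM; rewrite ?mulr_ge0//); apply: B; try lia; apply/andP; split; lra.
Qed.

End Lagrange.

(** * The finite element space: pieces, interpolation, nodal functions, functionals *)

Lemma filter_ord (T : Type) (F : set_system T) (n : nat) (P : 'I_n -> T -> Prop) : Filter F ->
  (forall i, F (P i)) -> F (fun x => forall i, P i x).
Proof. by move=> FF h; apply: filter_forall. Qed.

Section FE.
Variable R : realType.
Variable k : nat.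
Hypothesis k0 : (0 < k)%N.
Local Notation pt := (R * R)%type.
Implicit Types (a b c p q r x y z : pt) (w v phi : pt -> R).
Variables (Om : set pt) (s : seq pt) (T : mesh R).
Hypothesis OmE : Om = (hull s)°.
Hypothesis Om0 : Om !=set0.
Hypothesis conf : conforming Om T.

Definition HT (i : 'I_(size T)) : set pt := hull [:: va (nth_tri i); vb (nth_tri i); vc (nth_tri i)].

(** A polynomial on the whole plane, not a restriction to the element. For a discrete function it
    extends its piece on element [i], so that derivatives and edge traces of the piece are
    classical. *)
Definition loc w (i : 'I_(size T)) : pt -> R := LI k (va (nth_tri i)) (vb (nth_tri i)) (vc (nth_tri i)) w.

Lemma HTE i : hull (nth_tri i) = HT i. Proof. by rewrite hull_triE. Qed.

Lemma jacT (i : 'I_(size T)) : jac (va (nth_tri i)) (vb (nth_tri i)) (vc (nth_tri i)) != 0.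
Proof. apply: (tri_neq0 conf); exact: nth_triT. Qed.

Lemma loc_pol w i : pol k (loc w i).
Proof. exact/LI_pol/jacT. Qed.

Lemma HT_sub i : HT i `<=` closure Om.
Proof. by rewrite -HTE; apply: (tri_sub conf); exact: nth_triT. Qed.

Lemma mesh_closureE x : closure Om x <-> exists i, HT i x.
Proof.
split=> [|[i /HT_sub//]].
have [_ <- _] := conf; move=> [K /= KT hx]; have [i e] := mem_nth_tri KT.
by exists i; rewrite -HTE -e.
Qed.

Lemma VhP v : Vh Om T k v <-> cont (closure Om) v /\
  forall i, exists2 p, pol k p & forall x, HT i x -> v x = p x.
Proof.
split=> [[cv h]|[cv h]].
  split=> // i; have [d hd] := h _ (nth_triT i).
  exists (polc k d); first exact: pol_polc.
  by move=> x hx; rewrite hd ?HTE.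
split=> // K /mem_nth_tri[i ->]; have [p /polcP[d ->] hp] := h i.
by exists d => x; rewrite HTE; exact: hp.
Qed.

Lemma loc_eq w w' i : (forall x, HT i x -> w x = w' x) -> loc w i = loc w' i.
Proof. by move=> h; apply: LI_eq; [exact: jacT|move=> i' j' ij; apply/h/nd_hull => //; exact: jacT]. Qed.

Lemma loc_id (p : pt -> R) i : pol k p -> loc p i = p.
Proof. by move=> hp; apply: LI_id => //; exact: jacT. Qed.

Lemma vh_loc v i x : Vh Om T k v -> HT i x -> v x = loc v i x.
Proof. by move=> /VhP[_ /(_ i)[p hp e]] hx; rewrite (loc_eq e) loc_id// e. Qed.

Lemma Vh_lin (l : R) v w : Vh Om T k v -> Vh Om T k w -> Vh Om T k (fun x => l * v x + w x).
Proof.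
move=> /VhP[cv hv] /VhP[cw hw]; apply/VhP; split.
  by apply: contD => //; apply: contM => //; exact: cont_cst.
move=> i; have [p Pp hp] := hv i; have [q Pq hq] := hw i.
exists (fun x => l * p x + q x); first by apply: polD => //; exact: polZ.
by move=> x hx; rewrite hp// hq.
Qed.

Lemma Vh_cst0 : Vh Om T k (fun=> 0).
Proof.
apply/VhP; split=> [|i]; first exact: cont_cst.
by exists (fun=> 0) => //; exact: pol_cst.
Qed.

Lemma Vh0_lin (l : R) v w : Vh0 Om T k v -> Vh0 Om T k w -> Vh0 Om T k (fun x => l * v x + w x).
Proof. by move=> [v1 v2] [w1 w2]; split=> [|x hx]; [exact: Vh_lin|rewrite v2// w2// mulr0 addr0]. Qed.

Lemma Vh0_cst0 : Vh0 Om T k (fun=> 0).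
Proof. by split=> //; exact: Vh_cst0. Qed.

Lemma loc_vtx w i p q r : vtx i p q r -> loc w i = LI k p q r w.
Proof.
move=> [_ J m]; have J0 := jacT i.
have mp : p \in (nth_tri i : seq pt) by rewrite m !inE eqxx.
have mq : q \in (nth_tri i : seq pt) by rewrite m !inE eqxx orbT.
have mr : r \in (nth_tri i : seq pt) by rewrite m !inE eqxx !orbT.
rewrite /loc; move: J J0 (vtx_cases mp) (vtx_cases mq) (vtx_cases mr).
set A := va _; set B := vb _; set C := vc _ => J J0.

have Z : forall x y, [/\ jac x x y = 0, jac x y x = 0 & jac y x x = 0].
  by move=> x y; rewrite /jac; split; ring.
move=> [] Ep [] Eq [] Er; subst p q r => //;
  try (by have [z1 z2 z3] := Z A B; have [z4 z5 z6] := Z B C; have [z7 z8 z9] := Z C A;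
    have [y1 y2 y3] := Z B A; have [y4 y5 y6] := Z C B; have [y7 y8 y9] := Z A C;
    have [x1 _ _] := Z A A; have [x2 _ _] := Z B B; have [x3 _ _] := Z C C;
    rewrite ?(z1, z2, z3, z4, z5, z6, z7, z8, z9, y1, y2, y3, y4, y5, y6, y7, y8, y9, x1, x2, x3) eqxx in J).
- rewrite -[LHS](LI_swap k0 w J0); apply/esym/(@LI_rot _ _ k0 B A C); by rewrite jac_swap oppr_eq0.
- by apply/esym/(@LI_swap _ _ k0 A B C).
- by apply/esym/(@LI_rot _ _ k0 A B C).
- by apply: (@LI_rot _ _ k0 C A B); rewrite -jac_cyc.
- by rewrite -[LHS](LI_rot k0 w J0); apply/esym/(@LI_swap _ _ k0 B C A); rewrite jac_cyc.
Qed.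

Lemma vtx_at (i : 'I_(size T)) p : p \in (nth_tri i : seq pt) -> exists q r, vtx i p q r.
Proof.
move=> /vtx_cases[] ->.
- by exists (vb (nth_tri i)), (vc (nth_tri i)); exact: (vtx0 conf).
- exists (vc (nth_tri i)), (va (nth_tri i)); apply: vtx_rot; exact: (vtx0 conf).
- exists (va (nth_tri i)), (vb (nth_tri i)); apply/vtx_rot/vtx_rot; exact: (vtx0 conf).
Qed.

Lemma loc_at_vertex w i p : p \in (nth_tri i : seq pt) -> loc w i p = w p.
Proof.
move=> /vtx_at[q [r v]]; rewrite (loc_vtx w v); have [_ J _] := v.
have e : nd k p q r 0 0 = p by rewrite /nd !subn0 divff ?kR0// scale1r mul0r !scale0r !addr0.
by have := LI_nd k0 w J (leq0n k : (0 + 0 <= k)%N); rewrite e.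
Qed.

Lemma hull2_line p q x : hull [:: p; q] x -> exists2 t : R, 0 <= t <= 1 & x = p + t *: (q - p).
Proof.
move=> /hull2P[u [t [[u0 t0] ut ->]]]; exists t; first by rewrite t0/=; lra.
by have -> : u = 1 - t; [lra|apply: pairE; rewrite /= !scaleRE; ring].
Qed.

Lemma loc_agree w i j x : HT i x -> HT j x -> loc w i x = loc w j x.
Proof.
have [->//|ij] := eqVneq i j; have [_ _ /(_ i j ij)] := conf; rewrite -!HTE => h xi xj.
case: h => [e|[p [pi pj e]]|[p [q [pq [pi qi] [pj qj] e]]]].
- by have : (hull (nth_tri i) `&` hull (nth_tri j)) x by []; rewrite e.
- have : (hull (nth_tri i) `&` hull (nth_tri j)) x by []; rewrite e => ->.
  by rewrite !loc_at_vertex.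
have : (hull (nth_tri i) `&` hull (nth_tri j)) x by []; rewrite e => /hull2_line[t _ ->].
have [r vi] := vtx_of conf pi qi pq; have [r' vj] := vtx_of conf pj qj pq.
rewrite (loc_vtx w vi) (loc_vtx w vj); have [_ Ji _] := vi; have [_ Jj _] := vj.
by rewrite !LI_edge.
Qed.

(** The element containing [x] is picked arbitrarily; by [loc_agree] the choice does not affect the
    value. *)
Definition gI w x : R := if [pick i : 'I_(size T) | `[< HT i x >]] is Some i then loc w i x else 0.

Lemma gI_loc w i x : HT i x -> gI w x = loc w i x.
Proof.
move=> hx; rewrite /gI; case: pickP => [j /asboolP hj|/(_ i)]; first exact: loc_agree.
by move/asboolP.
Qed.

Lemma closed_HT i : closed (HT i). Proof. exact: closed_hull. Qed.

Lemma cont_closure v : (forall i, exists2 p, cont setT p & forall x, HT i x -> v x = p x) -> cont (closure Om) v.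
Proof.
move=> h; apply/contP => x cx; apply/cvgrPdist_lt => e e0.
have H : \forall y \near x, forall i, HT i y -> `|v x - v y| < e.
  apply: filter_ord => i; have [p cp hp] := h i.
  have [hx|nx] := pselect (HT i x); last first.
    have : nbhs x (~` HT i) by apply: open_nbhs_nbhs; split => //; exact/closed_openC/closed_HT.
    by apply: filterS => y ny /ny.
  have /cvgrPdist_lt/(_ e e0) := contT_continuous cp (x := x).
  by apply: filterS => y hy hiy; rewrite !hp.
change (nbhs x (fun y => closure Om y -> `|v x - v y| < e)).
by apply: filterS H => y hy /mesh_closureE[i hi]; exact: hy hi.
Qed.

Lemma gI_Vh w : Vh Om T k (gI w).
Proof.
apply/VhP; split=> [|i].
  apply: cont_closure => i; exists (loc w i); first exact: pol_cont (loc_pol w i).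
  by move=> x; exact: gI_loc.
by exists (loc w i); [exact: loc_pol|move=> x; exact: gI_loc].
Qed.

Lemma lagrange_node_nd (i : 'I_(size T)) (a : 'I_3 -> nat) : (\sum_(j < 3) a j)%N = k ->
  exists i' j', (i' + j' <= k)%N /\ lagrange_node (nth_tri i) k a =
    nd k (va (nth_tri i)) (vb (nth_tri i)) (vc (nth_tri i)) i' j'.
Proof.
rewrite !big_ord_recl big_ord0 addn0 => e.
set a1 := a (lift ord0 ord0) in e; set a2 := a (lift ord0 (lift ord0 ord0)) in e.
exists a1, a2; split; first by rewrite -e leq_addl.
rewrite /lagrange_node !big_ord_recl big_ord0 addr0 /nd -/a1 -/a2 addrA !(tnth_nth 0) /=.
by congr (_%:R / _ *: _ + _ + _); lia.
Qed.

Lemma nd_lagrange_node (i : 'I_(size T)) i' j' : (i' + j' <= k)%N -> exists a : 'I_3 -> nat,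
  (\sum_(j < 3) a j)%N = k /\ lagrange_node (nth_tri i) k a =
    nd k (va (nth_tri i)) (vb (nth_tri i)) (vc (nth_tri i)) i' j'.
Proof.
move=> ij; exists (fun j => nth 0%N [:: (k - i' - j')%N; i'; j'] j).
rewrite /lagrange_node !big_ord_recl !big_ord0 /= !(tnth_nth 0) /= !addr0 addrA; split=> //.
by rewrite addn0; lia.
Qed.

(** [interp] is a choice by [xget]; [gI w] shows that there is something to choose, and the nodal
    values then determine every piece. *)
Lemma interpP w : Vh Om T k (interp Om T k w) /\ forall i x, HT i x -> interp Om T k w x = loc w i x.
Proof.
rewrite /interp; set P := [set v | _]; have [V1 V2] : P (xget (fun=> 0) P).
  apply: xgetPex; exists (gI w); split; first exact: gI_Vh.
  move=> K /mem_nth_tri[i ->] a /(lagrange_node_nd i)[i' [j' [ij ->]]].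
  have J := jacT i; rewrite (@gI_loc _ i) ?LI_nd//; first exact: LI_nd.
  exact: nd_hull.
split=> // i x hx; rewrite (vh_loc V1 hx); congr (_ x); apply: LI_eq; first exact: jacT.
move=> i' j' ij; have [a [a1 <-]] := nd_lagrange_node i ij.
by rewrite V2//; exact: nth_triT.
Qed.

(* A point of a polygon lying strictly between an interior point and another
   point of the polygon is interior. *)
Lemma interior_segment x y (t : R) : Om x -> hull s y -> 0 <= t < 1 -> Om (x + t *: (y - x)).
Proof.
move=> Ox hy /andP[t0 t1]; rewrite OmE; move: Ox; rewrite OmE => /interior2P[e e0 he].
apply/interior2P; exists ((1 - t) * e); first by rewrite mulr_gt0// subr_gt0.
have u0 : 0 < 1 - t by rewrite subr_gt0.
move=> z z1 z2; have -> : z = (x + (1 - t)^-1 *: (z - (x + t *: (y - x)))) +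
    t *: (y - (x + (1 - t)^-1 *: (z - (x + t *: (y - x))))).
  by apply: pairE; rewrite /= !scaleRE; field; rewrite gt_eqF.
apply: cvx_hull => //; last exact: ltW.
apply: he; rewrite /= scaleRE addrAC subrr add0r normrM normfV (gtr0_norm u0) mulrC ltr_pdivrMr// mulrC.
  exact: z1.
exact: z2.
Qed.

Lemma bary_shift p q r x y (e : R) : bary p q r (x + e *: (x - y)) =
  bary p q r x + e * (bary p q r x - bary p q r y).
Proof. by rewrite /bary /jac /= !scaleRE; ring. Qed.

(** If the shape function of a node [z] does not vanish at [x], every barycentric coordinate that is
    zero at [x] is zero at [z] too, so the segment from [z] to [x] can be prolonged beyond [x]
    inside the element. Were [z] in [Om], then [x] would be strictly between an interior point and a
    point of the closure, hence in [Om]. Boundary values of an interpolant therefore depend on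
    boundary values only. *)
Lemma node_bdry i x i' j' : (i' + j' <= k)%N -> HT i x -> bdry Om x ->
  lagr k (va (nth_tri i)) (vb (nth_tri i)) (vc (nth_tri i)) i' j' x != 0 ->
  bdry Om (nd k (va (nth_tri i)) (vb (nth_tri i)) (vc (nth_tri i)) i' j').
Proof.
have J := jacT i; rewrite /HT; set A := va _; set B := vb _; set C := vc _ => ij hx [cx nx].
set z := nd _ _ _ _ _ _ => L.
have hz : HT i z by exact: nd_hull.
split; first exact: HT_sub hz.
move=> /interior_subset Oz; apply: nx; rewrite (interior_id _).1; last exact: (open_Om OmE).
have [h1 h2 h3] := (hull_baryP _ J).1 hx.
have [e1 e2 e3] := bary_nd k0 J ij; rewrite -/z in e1 e2 e3.
have [g1 g2 g3] := (hull_baryP _ J).1 hz.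
have sz := bary_sum z J.
(* If [l = 0], the nonvanishing Silvester factor forces the index [n], and with it the node
   coordinate [m], to be zero; if [l > 0], a step of size [l] is harmless because [m <= 1]. *)
have H (l m : R) (n : nat) : 0 <= l -> 0 <= m -> m <= 1 -> m = n%:R / k%:R -> sil k n l != 0 ->
    exists2 e : R, 0 < e & forall e', 0 <= e' <= e -> 0 <= l + e' * (l - m).
  move=> l0 m0 m1 mE sn; have [lz|lp] := leP l 0.
    have lz' : l = 0 by apply/eqP; rewrite eq_le lz l0.
    move: sn; rewrite lz' sil0; case: (n =P 0%N) mE => [->|]; last by rewrite eqxx.
    by rewrite mul0r => -> _; exists 1 => // e' _; rewrite subrr mulr0 addr0.
  exists l => // e' /andP[e0 el]; nra.
move: L; rewrite /lagr !mulf_eq0 !negb_or => /andP[/andP[n1 n2] n3].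
have [d1 d10 hd1] := H _ _ _ h1 g1 ltac:(lra) e1 n1.
have [d2 d20 hd2] := H _ _ _ h2 g2 ltac:(lra) e2 n2.
have [d3 d30 hd3] := H _ _ _ h3 g3 ltac:(lra) e3 n3.
pose d := Num.min d1 (Num.min d2 d3).
have d0 : 0 < d by rewrite !lt_min d10 d20.
have [l1 l2 l3] : [/\ d <= d1, d <= d2 & d <= d3] by split; rewrite !ge_min lexx ?orbT.
have hy : HT i (x + d *: (x - z)).
  by apply/(hull_baryP _ J); rewrite !bary_shift; split; [apply: hd1|apply: hd2|apply: hd3]; apply/andP; split=> //; exact: ltW.
have -> : x = z + (1 + d)^-1 *: ((x + d *: (x - z)) - z).
  have dn : (1 + d)^-1 * (1 + d) = 1 by rewrite mulVf//; apply/eqP; lra.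
  have E (X Z : R) : X = Z + (1 + d)^-1 * (X + d * (X - Z) - Z).
    transitivity (Z + ((1 + d)^-1 * (1 + d)) * (X - Z)); [rewrite dn|]; ring.
  by apply: pairE; rewrite /= !scaleRE; exact: E.
apply: interior_segment => //; first exact: closure_Om_hull OmE _ (HT_sub hy).
by rewrite invr_ge0 invf_lt1 ?ltrDl ?d0 ?andbT ?addr_ge0 ?ltW// addr_gt0.
Qed.

Lemma loc_bdry w w' i x : (forall x, bdry Om x -> w x = w' x) -> bdry Om x -> HT i x ->
  loc w i x = loc w' i x.
Proof.
move=> h bx hx; rewrite /loc /LI big_seq [RHS]big_seq; apply: eq_bigr => t.
rewrite mem_filter => /andP[ta _].
set l := lagr _ _ _ _ _ _ _; have [->|l0] := eqVneq l 0; first by rewrite !mulr0.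
by rewrite h//; exact: node_bdry hx bx l0.
Qed.

Lemma bdry_HT x : bdry Om x -> exists i, HT i x.
Proof. by move=> [/mesh_closureE]. Qed.

Lemma interp_bdry w w' x : (forall x, bdry Om x -> w x = w' x) -> bdry Om x ->
  interp Om T k w x = interp Om T k w' x.
Proof.
move=> h bx; have [i hx] := bdry_HT bx.
rewrite ((interpP w).2 i)// ((interpP w').2 i)//; exact: loc_bdry.
Qed.

Lemma gI_Vh0 w : (forall x, bdry Om x -> w x = 0) -> Vh0 Om T k (gI w).
Proof.
move=> h; split=> [|x bx]; first exact: gI_Vh.
have [i hx] := bdry_HT bx; rewrite (gI_loc w hx) (loc_bdry h bx hx) loc_id//; exact: pol_cst.
Qed.

Definition nodes : seq pt := undup (seq.filter (fun z => `[< Om z >])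
  [seq nd k (va (nth_tri i)) (vb (nth_tri i)) (vc (nth_tri i)) t.1 t.2 | i : 'I_(size T) <- enum 'I_(size T), t : 'I_k.+1 * 'I_k.+1 <- adm k]).

Definition node (j : 'I_(size nodes)) : pt := nth 0 nodes j.

Definition nodal (j : 'I_(size nodes)) : pt -> R := gI (fun x => (x == node j)%:R).

Lemma node_Om j : Om (node j).
Proof.
have : node j \in nodes by exact: mem_nth.
by rewrite mem_undup mem_filter => /andP[/asboolP].
Qed.

Lemma nodal_Vh0 j : Vh0 Om T k (nodal j).
Proof.
apply: gI_Vh0 => x [_ nx]; case: eqP => // e; case: nx; rewrite e (interior_id _).1; first exact: node_Om.
exact: (open_Om OmE).
Qed.

Lemma loc_sum (I : Type) (r : seq I) (l : I -> R) (w : I -> pt -> R) i x :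
  loc (fun x => \sum_(j <- r) l j * w j x) i x = \sum_(j <- r) l j * loc (w j) i x.
Proof.
rewrite /loc /LI; under eq_bigr do rewrite mulr_suml.
rewrite exchange_big; apply: eq_bigr => j _; rewrite mulr_sumr.
by apply: eq_bigr => t _; rewrite mulrA.
Qed.

Lemma nodal_span v x : Vh0 Om T k v -> closure Om x -> v x = \sum_j v (node j) * nodal j x.
Proof.
move=> [Vv v0] /mesh_closureE[i hx]; rewrite (vh_loc Vv hx) (eq_bigr (fun j => v (node j) * loc (fun x => (x == node j)%:R) i x)).
  rewrite -loc_sum; congr (_ x); apply: LI_eq; first exact: jacT.
  move=> i' j' ij; set z := nd _ _ _ _ _ _.
  have cz : closure Om z by apply/HT_sub/nd_hull => //; exact: jacT.
  have [Oz|nOz] := pselect (Om z).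
    have zn : z \in nodes.
      rewrite mem_undup mem_filter; apply/andP; split; first exact/asboolP.
      have [t ta [t1 t2]] := mem_adm ij; rewrite /z -t1 -t2.
      by apply/allpairsP; exists (i, t); split=> //; rewrite mem_enum.
    have iz : (index z nodes < size nodes)%N by rewrite index_mem.
    have nz : node (Ordinal iz) = z by rewrite /node /= nth_index.
    rewrite (bigD1 (Ordinal iz))//= nz eqxx mulr1 big1 ?addr0// => j jz.
    case: eqP => [e|_]; last by rewrite mulr0.
    case/eqP: jz; apply: val_inj => /=; by rewrite e index_uniq//; exact: undup_uniq.
  rewrite v0; last by split=> //; rewrite (interior_id _).1//; exact: (open_Om OmE).
  rewrite big1// => j _; case: eqP => [e|_]; last by rewrite mulr0.
  by case: nOz; rewrite e; exact: node_Om.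
by move=> j _; rewrite /nodal (gI_loc _ hx).
Qed.

(** Discrete functions are unconstrained outside the closure, so besides being linear a functional
    must not see their values there. *)
Definition lin0 (L : (pt -> R) -> R) :=
  (forall (l : R) v w, Vh0 Om T k v -> Vh0 Om T k w -> L (fun x => l * v x + w x) = l * L v + L w) /\
  (forall v, Vh0 Om T k v -> (forall x, closure Om x -> v x = 0) -> L v = 0).

Lemma lin0_eq L v w : lin0 L -> Vh0 Om T k v -> Vh0 Om T k w ->
  (forall x, closure Om x -> v x = w x) -> L v = L w.
Proof.
move=> [L1 L2] Vv Vw e; have := L1 (- 1) w v Vw Vv.
rewrite L2; first by move=> h; lra.
  exact: Vh0_lin.
by move=> x cx; rewrite e// mulN1r addNr.
Qed.

Lemma Vh0_sum (I : Type) (r : seq I) (l : I -> R) (w : I -> pt -> R) : (forall i, Vh0 Om T k (w i)) ->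
  Vh0 Om T k (fun x => \sum_(j <- r) l j * w j x).
Proof.
move=> h; elim: r => [|i r IH].
  by rewrite (_ : (fun x => _) = fun=> 0); [exact: Vh0_cst0|apply/funext => x; rewrite big_nil].
by rewrite (_ : (fun x => _) = fun x => l i * w i x + \sum_(j <- r) l j * w j x);
  [exact: Vh0_lin|apply/funext => x; rewrite big_cons].
Qed.

Lemma lin0_sum L (I : Type) (r : seq I) (l : I -> R) (w : I -> pt -> R) : lin0 L -> (forall i, Vh0 Om T k (w i)) ->
  L (fun x => \sum_(j <- r) l j * w j x) = \sum_(j <- r) l j * L (w j).
Proof.
move=> LL h; have [L1 L2] := LL; elim: r => [|i r IH].
  rewrite big_nil L2//; first exact: Vh0_sum.
  by move=> x _; rewrite big_nil.
rewrite (_ : (fun x => _) = fun x => l i * w i x + \sum_(j <- r) l j * w j x); last first.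
  by apply/funext => x; rewrite big_cons.
by rewrite L1 ?IH ?big_cons//; exact: Vh0_sum.
Qed.

(** [riesz_fin] for the Gram matrix of the nodal functions: coefficients in its kernel give a
    function that vanishes on the closure by definiteness, and [L] vanishes on it. *)
Lemma riesz_vh (B : (pt -> R) -> (pt -> R) -> R) (L : (pt -> R) -> R) :
  (forall v w, Vh0 Om T k v -> Vh0 Om T k w -> B v w = B w v) ->
  (forall v, Vh0 Om T k v -> lin0 (B v)) ->
  (forall v, Vh0 Om T k v -> B v v = 0 -> forall x, closure Om x -> v x = 0) ->
  lin0 L -> exists2 v, Vh0 Om T k v & forall phi, Vh0 Om T k phi -> B v phi = L phi.
Proof.
move=> Bsym Blin Bdef LL.
have BS (l : 'I_(size nodes) -> R) w : Vh0 Om T k w ->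
    B (fun x => \sum_j l j * nodal j x) w = \sum_j l j * B (nodal j) w.
  move=> Vw; rewrite Bsym//; last exact/Vh0_sum/nodal_Vh0.
  rewrite lin0_sum; [|exact: Blin|exact: nodal_Vh0].
  by apply: eq_bigr => j _; rewrite Bsym//; exact: nodal_Vh0.
have [|l H|y hy] := @riesz_fin R _ (fun i j => B (nodal i) (nodal j)) (fun i => L (nodal i)).
- by move=> i j; apply: Bsym; exact: nodal_Vh0.
- pose v x := \sum_j l j * nodal j x; have Vv : Vh0 Om T k v by exact/Vh0_sum/nodal_Vh0.
  have v0 : forall x, closure Om x -> v x = 0.
    apply: Bdef => //; rewrite {2}/v lin0_sum; [|exact: Blin|exact: nodal_Vh0].
    by rewrite big1// => j _; rewrite BS ?H ?mulr0//; exact: nodal_Vh0.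
  by rewrite -lin0_sum//; [exact: LL.2|exact: nodal_Vh0].
exists (fun x => \sum_j y j * nodal j x); first exact/Vh0_sum/nodal_Vh0.
move=> phi Vp; set v := (fun x => _); have Vv : Vh0 Om T k v by exact/Vh0_sum/nodal_Vh0.
have Vs : Vh0 Om T k (fun x => \sum_j phi (node j) * nodal j x) by exact/Vh0_sum/nodal_Vh0.
have E x : closure Om x -> phi x = \sum_j phi (node j) * nodal j x by exact: nodal_span.
rewrite (lin0_eq (Blin _ Vv) Vp Vs E) (lin0_eq LL Vp Vs E) !lin0_sum//; try exact: nodal_Vh0; last exact: Blin.
by apply: eq_bigr => j _; rewrite BS ?hy//; exact: nodal_Vh0.
Qed.

End FE.

(** * From partial derivatives in the open domain to class C^1 on its closure *)

Section Reg.
Variable R : realType.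
Local Notation pt := (R * R)%type.
Implicit Types (a b c p q r x y z v : pt) (w F G : pt -> R) (D : set pt).

Lemma near2P x (P : pt -> Prop) : (\forall y \near x, P y) <-> exists2 e : R, 0 < e &
  forall y, `|y.1 - x.1| < e -> `|y.2 - x.2| < e -> P y.
Proof. exact: (interior2P P x). Qed.

Lemma MVT_unord (f df : R -> R) (a b : R) :
  (forall t, Num.min a b <= t <= Num.max a b -> is_derive t (1 : R) f (df t)) ->
  exists2 t, Num.min a b <= t <= Num.max a b & f b - f a = df t * (b - a).
Proof.
wlog ab : a b / a <= b => [H h|].
  case: (boolP (a <= b)) => [ab|]; first exact: (H a b ab h).
  rewrite -ltNge => /ltW ba; have [|t ht e] := H b a ba; first by rewrite minC maxC.
  by exists t; [rewrite minC maxC|lra].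
rewrite (min_idPl ab) (max_idPr ab) => h.
have [|t|t] := @MVT_segment R f df a b ab.
- by move=> t; rewrite in_itv /= => /andP[/ltW ? /ltW ?]; apply/h/andP.
- by apply: derivable_within_continuous => u; rewrite in_itv/= => /h[].
- by rewrite in_itv/=; exists t.
Qed.

Lemma is_derive_est (V : normedModType R) (x v : V) (F : V -> R) (d : R) :
  (forall e : R, 0 < e -> exists2 dl : R, 0 < dl & forall h : R, `|h| < dl -> `|F (h *: v + x) - F x - h * d| <= e * `|h|) ->
  is_derive x v F d.
Proof.
move=> H; have E : (fun h : R => h^-1 *: ((F \o shift x) (h *: v) - F x)) @ 0^' --> d.
  apply/cvgrPdist_le => e e0; have [dl dl0 hd] := H e e0; near=> h.
  have h0 : h != 0 by near: h; exact: nbhs_dnbhs_neq.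
  have -> : d - h^-1 *: ((F \o shift x) (h *: v) - F x) = - (h^-1 * (F (h *: v + x) - F x - h * d)).
    by rewrite /= scaleRE; field.
  rewrite normrN normrM normfV mulrC ler_pdivrMr ?normr_gt0//.
  by apply: hd; near: h; apply: dnbhs0_lt.
by split; [apply/cvg_ex; exists d|apply: cvg_lim].
Unshelve. all: by end_near. Qed.

(** From [x] to [y] along two axis-parallel legs, with the mean value theorem on each: only the two
    partial derivatives are involved. *)
Lemma C1_box_estimate x F F1 F2 (e d : R) :
  (forall y, `|y.1 - x.1| < d -> `|y.2 - x.2| < d ->
     [/\ is_derive y (basis2 R o0) F (F1 y), is_derive y (basis2 R o1) F (F2 y),
        `|F1 y - F1 x| <= e & `|F2 y - F2 x| <= e]) ->
  forall y, `|y.1 - x.1| < d -> `|y.2 - x.2| < d ->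
  `|F y - F x - (F1 x * (y.1 - x.1) + F2 x * (y.2 - x.2))| <= e * (`|y.1 - x.1| + `|y.2 - x.2|).
Proof.
move=> H y y1 y2.
have d0 : 0 < d by exact: le_lt_trans y1.
have btw (u w t : R) : `|w - u| < d -> Num.min u w <= t <= Num.max u w -> `|t - u| < d.
  rewrite ge_min le_max !ltr_norml => /andP[h1 h2] /andP[/orP[h3|h3] /orP[h4|h4]]; lra.
have e1 (t : R) (z : pt) : (t, z.2) = (0, z.2) + t *: basis2 R o0 :> pt.
  by apply: pairE; rewrite /= !scaleRE /=; ring.
have e2 (t : R) (z : pt) : (z.1, t) = (z.1, 0) + t *: basis2 R o1 :> pt.
  by apply: pairE; rewrite /= !scaleRE /=; ring.
have [t /(btw _ _ _ y1) ht E1] : exists2 t, Num.min x.1 y.1 <= t <= Num.max x.1 y.1 &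
    F (y.1, x.2) - F (x.1, x.2) = F1 (t, x.2) * (y.1 - x.1).
  apply: (@MVT_unord (fun t => F (t, x.2)) (fun t => F1 (t, x.2))) => t /(btw _ _ _ y1) ht.
  rewrite (_ : (fun t => _) = fun t => F ((0, x.2) + t *: basis2 R o0)); last by apply/funext => u; rewrite -e1.
  apply: path_is_derive; rewrite -e1.
  by have [] := H (t, x.2) ht; rewrite ?subrr ?normr0.
have [u /(btw _ _ _ y2) hu E2] : exists2 t, Num.min x.2 y.2 <= t <= Num.max x.2 y.2 &
    F (y.1, y.2) - F (y.1, x.2) = F2 (y.1, t) * (y.2 - x.2).
  apply: (@MVT_unord (fun t => F (y.1, t)) (fun t => F2 (y.1, t))) => t' /(btw _ _ _ y2) ht'.
  rewrite (_ : (fun t => _) = fun t => F ((y.1, 0) + t *: basis2 R o1)); last by apply/funext => u; rewrite -e2.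
  apply: path_is_derive; rewrite -e2.
  by have [] := H (y.1, t') y1 ht'.
have [|_ _ b1 _] := H (t, x.2) ht; first by rewrite subrr normr0.
have [_ _ _ b2] := H (y.1, u) y1 hu.
move: E1 E2; rewrite -!surjective_pairing => E1 E2.
have -> : F y - F x - (F1 x * (y.1 - x.1) + F2 x * (y.2 - x.2)) =
  (F1 (t, x.2) - F1 x) * (y.1 - x.1) + (F2 (y.1, u) - F2 x) * (y.2 - x.2) by lra.
rewrite (le_trans (ler_normD _ _))// !normrM mulrDr lerD//; exact: ler_wpM2r.
Qed.

Lemma cont_box D F x (e : R) : cont D F -> D x -> 0 < e -> exists2 d : R, 0 < d &
  forall y, D y -> `|y.1 - x.1| < d -> `|y.2 - x.2| < d -> `|F y - F x| < e.
Proof.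
move=> /contP/[apply] /cvgrPdist_lt/[apply] H.
have /near2P[d d0 hd] : \forall y \near x, D y -> `|F x - F y| < e by exact: H.
by exists d => // y Dy y1 y2; rewrite distrC; exact: hd.
Qed.

Lemma partials_is_derive D F F1 F2 x v : open D -> cont D F1 -> cont D F2 ->
  (forall y, D y -> is_derive y (basis2 R o0) F (F1 y) /\ is_derive y (basis2 R o1) F (F2 y)) ->
  D x -> is_derive x v F (F1 x * v.1 + F2 x * v.2).
Proof.
move=> oD c1 c2 dF Dx; apply: is_derive_est => e e0.
pose N := `|v.1| + `|v.2| + 1; have N0 : 0 < N by rewrite ltr_wpDl// addr_ge0.
have eN : 0 < e / N by rewrite divr_gt0.
have [d1 d10 h1] := cont_box c1 Dx eN; have [d2 d20 h2] := cont_box c2 Dx eN.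
have [d3 d30 h3] : exists2 d : R, 0 < d & forall y, `|y.1 - x.1| < d -> `|y.2 - x.2| < d -> D y.
  by apply/interior2P; rewrite (interior_id _).1.
pose d := Num.min d1 (Num.min d2 d3).
have d0 : 0 < d by rewrite !lt_min d10 d20.
have H := @C1_box_estimate x F F1 F2 (e / N) d.
exists (d / N); first by rewrite divr_gt0.
move=> h; rewrite ltr_pdivlMr// => hd.
have hv1 : `|(h *: v + x).1 - x.1| = `|h| * `|v.1| by rewrite /= scaleRE addrK normrM.
have hv2 : `|(h *: v + x).2 - x.2| = `|h| * `|v.2| by rewrite /= scaleRE addrK normrM.
have l1 : `|h| * `|v.1| < d.
  by apply: le_lt_trans hd; rewrite ler_wpM2l// /N; have := normr_ge0 v.1; have := normr_ge0 v.2; lra.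
have l2 : `|h| * `|v.2| < d.
  by apply: le_lt_trans hd; rewrite ler_wpM2l// /N; have := normr_ge0 v.1; have := normr_ge0 v.2; lra.
have -> : h * (F1 x * v.1 + F2 x * v.2) = F1 x * ((h *: v + x).1 - x.1) + F2 x * ((h *: v + x).2 - x.2).
  by rewrite /= !scaleRE; ring.
apply: le_trans (H _ (h *: v + x) _ _) _.
- move=> y; rewrite !lt_min => /and3P[? ? ?] /and3P[? ? ?].
  have Dy : D y by exact: h3.
  have [q1 q2] := dF y Dy; split=> //; apply/ltW; [exact: h1|exact: h2].
- by rewrite hv1.
- by rewrite hv2.
rewrite hv1 hv2 -mulrDr (_ : e / N * _ = e * `|h| * ((`|v.1| + `|v.2|) / N)); last by ring.
by apply: ler_piMr; [apply: mulr_ge0 => //; exact: ltW|rewrite ler_pdivrMr// mul1r /N; lra].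
Qed.

Lemma segL D a b F G (l m : R) : cvx D -> D a -> D b -> cont D F -> cont D G ->
  seg a b (fun x => l * F x + m * G x) = l * seg a b F + m * seg a b G.
Proof.
move=> cD Da Db cF cG; rewrite /seg.
have cl H (t : R) : cont D H -> cont D (fun x => t * H x) by move=> cH; contt.
rewrite RintegralD //; last 2 first.
- exact: (seg_integrable cD Da Db (cl F l cF)).
- exact: (seg_integrable cD Da Db (cl G m cG)).
rewrite !RintegralZl//; [exact: (seg_integrable cD Da Db cG)|exact: (seg_integrable cD Da Db cF)].
Qed.

Lemma seg_eq a b F G : (forall t : R, 0 <= t <= 1 -> F (a + t *: (b - a)) = G (a + t *: (b - a))) ->
  seg a b F = seg a b G.
Proof.
move=> h; apply: eq_Rintegral => t; rewrite inE/= in_itv/=; exact: h.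
Qed.

Lemma seg_FTC D a b F F1 F2 : cvx D -> D a -> D b -> C1on D F F1 F2 ->
  seg a b (fun x => F1 x * (b - a).1 + F2 x * (b - a).2) = F b - F a.
Proof.
move=> cD Da Db cF; have e : a + 1 *: (b - a) = b by rewrite scale1r addrC subrK.
rewrite /seg (FTC_path cD cF) ?e//.
Qed.

End Reg.

(** A first-order Taylor estimate survives a small displacement of both points: [y'], [z'] are the
    values and [a1], [a2] the increments at displaced points, and [g] measures the displacement. *)
Lemma perturbation (R : realType) (e g f1 f2 y z y' z' a1 a2 b1 b2 : R) : 0 <= e ->
  `|z' - y' - (f1 * a1 + f2 * a2)| <= e * (`|a1| + `|a2|) -> `|y' - y| <= g -> `|z' - z| <= g ->
  `|b1 - a1| <= 2 * g -> `|b2 - a2| <= 2 * g ->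
  `|z - y - (f1 * b1 + f2 * b2)| <= e * (`|b1| + `|b2|) + (2 + 2 * `|f1| + 2 * `|f2| + 4 * e) * g.
Proof.
move=> e0 I Y Z A1 A2.
have B1 : `|a1| <= `|b1| + 2 * g.
  by rewrite -(subKr b1 a1) (le_trans (ler_normB _ _))// lerD2l.
have B2 : `|a2| <= `|b2| + 2 * g.
  by rewrite -(subKr b2 a2) (le_trans (ler_normB _ _))// lerD2l.
have E : e * (`|a1| + `|a2|) <= e * (`|b1| + `|b2| + 4 * g) by apply: ler_wpM2l; lra.
have C1 : `|f1 * (b1 - a1)| <= `|f1| * (2 * g) by rewrite normrM ler_wpM2l.
have C2 : `|f2 * (b2 - a2)| <= `|f2| * (2 * g) by rewrite normrM ler_wpM2l.
have -> : z - y - (f1 * b1 + f2 * b2) = z' - y' - (f1 * a1 + f2 * a2) + (y' - y) - (z' - z) -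
   f1 * (b1 - a1) - f2 * (b2 - a2) by ring.
have D0 := ler_normB (z' - y' - (f1 * a1 + f2 * a2) + (y' - y) - (z' - z) - f1 * (b1 - a1)) (f2 * (b2 - a2)).
have D1 := ler_normB (z' - y' - (f1 * a1 + f2 * a2) + (y' - y) - (z' - z)) (f1 * (b1 - a1)).
have D2 := ler_normB (z' - y' - (f1 * a1 + f2 * a2) + (y' - y)) (z' - z).
have D3 := ler_normD (z' - y' - (f1 * a1 + f2 * a2)) (y' - y).
have -> : e * (`|b1| + `|b2|) + (2 + 2 * `|f1| + 2 * `|f2| + 4 * e) * g =
  e * (`|b1| + `|b2| + 4 * g) + 2 * g + `|f1| * (2 * g) + `|f2| * (2 * g) by ring.
lra.
Qed.

Section Closure.
Variable R : realType.
Local Notation pt := (R * R)%type.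
Implicit Types (a b c p q r x y z v : pt) (w F G : pt -> R).
Variables (Om : set pt) (s : seq pt).
Hypothesis OmE : Om = (hull s)°.
Hypothesis Om0 : Om !=set0.

(** A point of the hull is approached along the segment from an interior point, which stays in [Om]
    by [interior_segment]. *)
Lemma closure_hull : closure Om = hull s.
Proof.
apply/seteqP; split; first exact: closure_Om_hull OmE.
move=> y hy B /near2P[d d0 hB]; have [c Oc] := Om0.
pose N := `|c.1 - y.1| + `|c.2 - y.2|; pose u := d / (N + 1 + d).
have N0 : 0 <= N by exact: addr_ge0.
have S0 : 0 < N + 1 + d by lra.
have u0 : 0 < u by rewrite divr_gt0.
have u1 : u <= 1 by rewrite ler_pdivrMr// mul1r; lra.
have uN : u * N < d by rewrite /u mulrAC ltr_pdivrMr//; nra.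
exists (c + (1 - u) *: (y - c)); split.
  by apply: (interior_segment OmE) => //; lra.
have e1 (C Y : R) : C + (1 - u) * (Y - C) - Y = u * (C - Y) by ring.
have n1 := normr_ge0 (c.1 - y.1); have n2 := normr_ge0 (c.2 - y.2).
apply: hB; rewrite /= scaleRE e1 normrM (gtr0_norm u0); apply: le_lt_trans uN; (apply: ler_wpM2l; [exact: ltW|rewrite /N; lra]).
Qed.

Lemma cvx_closure : cvx (closure Om).
Proof. by rewrite closure_hull; exact: cvx_hull. Qed.

Lemma compact_closure : compact (closure Om).
Proof. by rewrite closure_hull; exact: compact_hull. Qed.

Lemma cvx_Om : cvx Om.
Proof.
move=> x y t Ox Oy t0; rewrite le_eqVlt => /orP[/eqP->|t1]; first by rewrite scale1r addrC subrK.
apply: (interior_segment OmE) => //; last by rewrite t0.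
by rewrite -closure_hull; exact: subset_closure.
Qed.

Lemma closure_approx y (d : R) : closure Om y -> 0 < d -> exists2 y', Om y' & `|y'.1 - y.1| < d /\ `|y'.2 - y.2| < d.
Proof.
move=> cy d0; have [|y' [Oy hy]] := cy [set z | `|z.1 - y.1| < d /\ `|z.2 - y.2| < d].
  by apply/near2P; exists d.
by exists y'.
Qed.

Section Extension.
Variables F F1 F2 : pt -> R.
Hypotheses (cF : cont (closure Om) F) (cF1 : cont (closure Om) F1) (cF2 : cont (closure Om) F2).
Hypothesis dF : forall y, Om y -> is_derive y (basis2 R o0) F (F1 y) /\ is_derive y (basis2 R o1) F (F2 y).

(** Strict differentiability at a point of the closure. Near [x] the gradient is within [e] of its
    value there, so the mean value theorem on segments gives the estimate for points of the convex
    set [Om]; density and [perturbation] carry it over to the closure. *)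
Lemma C1_strict x (e : R) : closure Om x -> 0 < e -> exists2 d : R, 0 < d & forall y z,
  closure Om y -> closure Om z -> `|y.1 - x.1| < d -> `|y.2 - x.2| < d ->
  `|z.1 - x.1| < d -> `|z.2 - x.2| < d ->
  `|F z - F y - (F1 x * (z.1 - y.1) + F2 x * (z.2 - y.2))| <= e * (`|z.1 - y.1| + `|z.2 - y.2|).
Proof.
move=> cx e0.
have [d1 d10 h1] := cont_box cF1 cx e0; have [d2 d20 h2] := cont_box cF2 cx e0.
pose d := Num.min d1 d2; have d0 : 0 < d by rewrite lt_min d10.
have OC := @subset_closure _ Om.
have In y z : Om y -> Om z -> `|y.1 - x.1| < d -> `|y.2 - x.2| < d ->
  `|z.1 - x.1| < d -> `|z.2 - x.2| < d ->
  `|F z - F y - (F1 x * (z.1 - y.1) + F2 x * (z.2 - y.2))| <= e * (`|z.1 - y.1| + `|z.2 - y.2|).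
  move=> Oy Oz y1 y2 z1 z2.
  have [|t ht E] := @MVT_unord R (fun t => F (y + t *: (z - y)))
     (fun t => F1 (y + t *: (z - y)) * (z - y).1 + F2 (y + t *: (z - y)) * (z - y).2) 0 1.
    move=> t; rewrite (min_idPl ler01) (max_idPr ler01) => /andP[t0 t1].
    apply: path_is_derive; apply: (@partials_is_derive _ Om) => //.
    - exact: open_Om OmE.
    - exact: contW OC cF1.
    - exact: contW OC cF2.
    - exact: cvx_Om.
  move: ht; rewrite (min_idPl ler01) (max_idPr ler01) => ht; have /andP[t0 t1] := ht.
  move: E; rewrite scale0r scale1r addr0 subr0 mulr1 (addrC y) subrK => ->.
  set xi := y + _; have Oxi : Om xi by exact: cvx_Om.
  have btw (X Y Z : R) : `|Y - X| < d -> `|Z - X| < d -> `|Y + t * (Z - Y) - X| < d.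
    rewrite !ltr_norml => /andP[A1 A2] /andP[B1 B2].
    have [->|tn] := eqVneq t 0; first by rewrite mul0r addr0 A1.
    have tp : 0 < t by rewrite lt_neqAle eq_sym tn.
    have p1 : 0 <= (1 - t) * (d - (Y - X)) by apply: mulr_ge0; lra.
    have p2 : 0 <= (1 - t) * (d + (Y - X)) by apply: mulr_ge0; lra.
    have p3 : 0 < t * (d - (Z - X)) by apply: mulr_gt0; lra.
    have p4 : 0 < t * (d + (Z - X)) by apply: mulr_gt0; lra.
    by apply/andP; split; nra.
  have [k1 k2] : `|xi.1 - x.1| < d /\ `|xi.2 - x.2| < d by split; rewrite /xi /= scaleRE; exact: btw.
  move: (k1) (k2); rewrite !lt_min => /andP[k11 k12] /andP[k21 k22].
  have b1 := h1 _ (OC _ Oxi) k11 k21; have b2 := h2 _ (OC _ Oxi) k12 k22.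
  have -> : F1 xi * (z - y).1 + F2 xi * (z - y).2 - (F1 x * (z.1 - y.1) + F2 x * (z.2 - y.2)) =
    (F1 xi - F1 x) * (z.1 - y.1) + (F2 xi - F2 x) * (z.2 - y.2) by rewrite /=; ring.
  by rewrite (le_trans (ler_normD _ _))// !normrM mulrDr lerD// ler_wpM2r// ltW.
exists d => // y z cy cz y1 y2 z1 z2; rewrite leNgt; apply/negP => H.
set l := `|F z - _ - _| in H; set r := e * _ in H.
pose K := 2 + 2 * `|F1 x| + 2 * `|F2 x| + 4 * e.
have n1 := normr_ge0 (F1 x); have n2 := normr_ge0 (F2 x).
have K0 : 0 < K by rewrite /K; lra.
(* With this [g] the error of [perturbation] is half of the supposed excess [l - r], a
   contradiction. *)
pose g := (l - r) / (2 * K).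
have g0 : 0 < g by rewrite divr_gt0 ?subr_gt0// mulr_gt0.
have gK : K * g = (l - r) / 2 by rewrite /g; field; rewrite gt_eqF.
have [dy dy0 hy] := cont_box cF cy g0; have [dz dz0 hz] := cont_box cF cz g0.
pose m := [:: g; dy; dz; d - `|y.1 - x.1|; d - `|y.2 - x.2|; d - `|z.1 - x.1|; d - `|z.2 - x.2|].
have [q q0 qm] : exists2 q : R, 0 < q & forall t, t \in m -> q <= t.
  have : forall t, t \in m -> 0 < t.
    by move=> t; rewrite !inE => /or4P[/eqP->|/eqP->|/eqP->|/or4P[/eqP->|/eqP->|/eqP->|/eqP->]] //; rewrite subr_gt0.
  elim: (m) => [|t m' IH] h; first by exists 1.
  have [|q q0 hq] := IH; first by move=> t' ht; apply: h; rewrite inE ht orbT.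
  exists (Num.min t q); first by rewrite lt_min q0 h// mem_head.
  move=> t'; rewrite inE ge_min => /orP[/eqP->|/hq ->]; by rewrite ?lexx ?orbT.
have [y' Oy [ya yb]] := closure_approx cy q0; have [z' Oz [za zb]] := closure_approx cz q0.
have q1 : q <= g by apply: qm; rewrite !inE eqxx ?orbT.
have q2 : q <= dy by apply: qm; rewrite !inE eqxx ?orbT.
have q3 : q <= dz by apply: qm; rewrite !inE eqxx ?orbT.
have q4 : q <= d - `|y.1 - x.1| by apply: qm; rewrite !inE eqxx ?orbT.
have q5 : q <= d - `|y.2 - x.2| by apply: qm; rewrite !inE eqxx ?orbT.
have q6 : q <= d - `|z.1 - x.1| by apply: qm; rewrite !inE eqxx ?orbT.
have q7 : q <= d - `|z.2 - x.2| by apply: qm; rewrite !inE eqxx ?orbT.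
have tri (X Y Z : R) : `|X - Y| < q -> q <= d - `|Y - Z| -> `|X - Z| < d.
  by move=> h1' h2'; apply: le_lt_trans (ler_distD Y X Z) _; lra.
have I := In y' z' Oy Oz (tri _ _ _ ya q4) (tri _ _ _ yb q5) (tri _ _ _ za q6) (tri _ _ _ zb q7).
have Fy := hy y' (OC _ Oy) (lt_le_trans ya q2) (lt_le_trans yb q2).
have Fz := hz z' (OC _ Oz) (lt_le_trans za q3) (lt_le_trans zb q3).
have A (X Y X' Y' : R) : `|X' - X| < q -> `|Y' - Y| < q -> `|X - Y - (X' - Y')| <= 2 * g.
  move=> h1' h2'; rewrite (_ : _ - _ = - (X' - X) + (Y' - Y)); last by ring.
  by rewrite (le_trans (ler_normD _ _))// normrN; lra.
have P := perturbation (ltW e0) I (ltW Fy) (ltW Fz) (A _ _ _ _ za ya) (A _ _ _ _ zb yb).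
have : l <= r + K * g by [].
by rewrite gK; clear - H; lra.
Qed.

Lemma C1_closure : C1on (closure Om) F F1 F2.
Proof.
split=> // x v l l0 cx cy t t0 tl; set x0 := x + t *: v.
have cvC (h : R) : 0 <= t + h <= l -> closure Om (x + (t + h) *: v).
  move=> /andP[h0 h1]; have := cvx_closure cx cy (t := (t + h) / l).
  rewrite (_ : x + ((t + h) / l) *: (x + l *: v - x) = x + (t + h) *: v).
    by apply; rewrite ?divr_ge0 ?ler_pdivrMr ?mul1r// ltW.
  by apply: pairE; rewrite /= !scaleRE; field; rewrite gt_eqF.
have cx0 : closure Om x0 by have := cvC 0; rewrite addr0; apply; lra.
apply: is_derive_est => e e0.
pose N := `|v.1| + `|v.2| + 1; have N0 : 0 < N by rewrite ltr_wpDl// addr_ge0.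
have n1 := normr_ge0 v.1; have n2 := normr_ge0 v.2.
have [|d d0 hd] := @C1_strict x0 (e / N) cx0; first by rewrite divr_gt0.
exists (Num.min (d / N) (Num.min t (l - t))); first by rewrite !lt_min divr_gt0// t0 subr_gt0.
move=> h; rewrite !lt_min ltr_pdivlMr// => /and3P[h1 h2 h3].
rewrite scaleRE mulr1 (addrC h t); set z := x + _.
have cz : closure Om z by apply: cvC; move: h2 h3; rewrite !ltr_norml => /andP[? ?] /andP[? ?]; lra.
have Z1 : z.1 - x0.1 = h * v.1 by rewrite /= !scaleRE; ring.
have Z2 : z.2 - x0.2 = h * v.2 by rewrite /= !scaleRE; ring.
have l1 : `|h| * `|v.1| < d by apply: le_lt_trans h1; rewrite ler_wpM2l// /N; lra.
have l2 : `|h| * `|v.2| < d by apply: le_lt_trans h1; rewrite ler_wpM2l// /N; lra.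
have := hd x0 z cx0 cz; rewrite !subrr !normr0 Z1 Z2 !normrM => /(_ d0 d0 l1 l2).
rewrite (_ : F1 x0 * (h * v.1) + F2 x0 * (h * v.2) = h * (F1 x0 * v.1 + F2 x0 * v.2)); last by ring.
move=> /le_trans; apply; rewrite -mulrDr (_ : e / N * _ = e * `|h| * ((`|v.1| + `|v.2|) / N)); last by ring.
by apply: ler_piMr; [apply: mulr_ge0 => //; exact: ltW|rewrite ler_pdivrMr// mul1r /N; lra].
Qed.

End Extension.

Lemma IK_cst_gt0 a b c (l : R) : jac a b c != 0 -> 0 < l -> 0 < IK a b c (fun=> l).
Proof.
move=> J l0; have [C C0 hC] := inverse_estimate R 0.
pose h := `|(b - a).1| + `|(b - a).2| + `|(c - a).1| + `|(c - a).2|.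
have [||H _] := hC a b c (fun=> 1) h J _ _ a (hull3_v1 a b c).
- have n1 := normr_ge0 (b - a).1; have n2 := normr_ge0 (b - a).2.
  by have n3 := normr_ge0 (c - a).1; have n4 := normr_ge0 (c - a).2; split; rewrite /h; lra.
- exact: pol_cst.
have P : 0 < IK a b c (fun=> 1 ^+ 2).
  by rewrite -(pmulr_rgt0 _ C0); apply: lt_le_trans H; rewrite expr1n mulr1 normr_gt0.
have -> : IK a b c (fun=> l) = l * IK a b c (fun=> 1 ^+ 2).
  rewrite -IKZ; last exact: cont_cst.
  by apply: IK_eq => x _; rewrite expr1n mulr1.
exact: mulr_gt0.
Qed.

(** Around a point where [F] is positive there is a small triangle on which [F] exceeds half of that
    value, and the integral over it is positive. *)
Lemma IK0_le0 F : cont Om F -> (forall a b c, jac a b c != 0 -> hull [:: a; b; c] `<=` Om -> IK a b c F = 0) ->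
  forall x, Om x -> F x <= 0.
Proof.
move=> cF H x Ox; rewrite leNgt; apply/negP => Fx.
have Fx2 : 0 < F x / 2 by rewrite divr_gt0.
have [d d0 hd] := cont_box cF Ox Fx2.
have [d' d'0 hd'] : exists2 d : R, 0 < d & forall y, `|y.1 - x.1| < d -> `|y.2 - x.2| < d -> Om y.
  by apply/interior2P; rewrite (interior_id _).1//; exact: open_Om OmE.
pose g := Num.min d d' / 2; have g0 : 0 < g by rewrite divr_gt0// lt_min d0.
have gd : g < d /\ g < d' by rewrite /g minEle; case: ifP => ?; lra.
pose b := (x.1 + g, x.2); pose c := (x.1, x.2 + g).
have J : jac x b c != 0.
  by rewrite (_ : jac x b c = g ^+ 2) ?expf_eq0 ?gt_eqF//= /jac /=; ring.
have hin y : hull [:: x; b; c] y -> `|y.1 - x.1| <= g /\ `|y.2 - x.2| <= g.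
  move=> /hull3P[s1 [s2 [s3 [[a1 a2 a3] e ->]]]] /=; rewrite !scaleRE.
  have -> : s1 * x.1 + s2 * (x.1 + g) + s3 * x.1 - x.1 = s2 * g by rewrite (_ : s1 = 1 - s2 - s3); [ring|lra].
  have -> : s1 * x.2 + s2 * x.2 + s3 * (x.2 + g) - x.2 = s3 * g by rewrite (_ : s1 = 1 - s2 - s3); [ring|lra].
  have ab (S : R) : 0 <= S -> S <= 1 -> `|S * g| <= g.
    by move=> S0 S1; rewrite normrM (ger0_norm S0) gtr0_norm// ler_piMl// ltW.
  by split; apply: ab => //; lra.
have sub : hull [:: x; b; c] `<=` Om.
  by move=> y /hin[y1 y2]; apply: hd'; [exact: le_lt_trans y1 gd.2|exact: le_lt_trans y2 gd.2].
have := IK_cst_gt0 J Fx2.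
rewrite ltNge => /negP; apply; rewrite -(H x b c J sub); apply: IK_le.
- exact: cont_cst.
- exact: contW sub cF.
move=> y hy; have [y1 y2] := hin y hy; have := hd y (sub _ hy) (le_lt_trans y1 gd.1) (le_lt_trans y2 gd.1).
by rewrite ltr_norml => /andP[? ?]; lra.
Qed.

(** By Green's formulas the integral of [F21 - F12] over a triangle inside [Om] is, up to sign, the
    circulation of the gradient of [F] around it, which telescopes to zero. Continuity gives
    equality pointwise, first in [Om], then on the closure. *)
Lemma Schwarz F F1 F2 F11 F12 F21 F22 : let C := closure Om in
  C1on C F F1 F2 -> C1on C F1 F11 F12 -> C1on C F2 F21 F22 -> forall x, C x -> F12 x = F21 x.
Proof.
move=> C cF cF1 cF2.
have OC := @subset_closure _ Om.
have [_ f1 f2 _] := cF; have [_ _ f12 _] := cF1; have [_ f21 _ _] := cF2.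
have C1W D D' G G1 G2 : D `<=` D' -> C1on D' G G1 G2 -> C1on D G G1 G2.
  move=> DD [g g1 g2 dg]; split; [exact: contW g|exact: contW g1|exact: contW g2|].
  by move=> x v l l0 Dx Dy; apply: dg => //; exact: DD.
have E a b c : jac a b c != 0 -> hull [:: a; b; c] `<=` Om -> IK a b c F21 = IK a b c F12.
  move=> J sub; set H := hull _ in sub.
  have HC : H `<=` C by move=> x /sub/OC.
  have [ha hb hc] : [/\ H a, H b & H c] by split; [exact: hull3_v1|exact: hull3_v2|exact: hull3_v3].
  rewrite (IK_Green1 J (C1W _ _ _ _ _ HC cF2)) (IK_Green2 J (C1W _ _ _ _ _ HC cF1)).
  have cH := cvx_hull (s := [:: a; b; c]); rewrite -/H in cH.
  have c1 := contW HC f1; have c2 := contW HC f2.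
  have K p q : H p -> H q -> (q - p).1 * seg p q F1 + (q - p).2 * seg p q F2 = F q - F p.
    move=> hp hq; rewrite -(seg_FTC cH hp hq (C1W _ _ _ _ _ HC cF)) -(segL _ _ cH hp hq c1 c2).
    by apply: seg_eq => t _; ring.
  have k1 := K a b ha hb; have k2 := K b c hb hc; have k3 := K c a hc ha.
  apply/eqP; rewrite -subr_eq0; apply/eqP.
  set sg := Num.sg _; transitivity (sg * ((b - a).1 * seg a b F1 + (b - a).2 * seg a b F2 + ((c - b).1 * seg b c F1 + (c - b).2 * seg b c F2) + ((a - c).1 * seg c a F1 + (a - c).2 * seg c a F2))); first by ring.
  by rewrite k1 k2 k3; ring.
have cD : cont C (fun x => F21 x - F12 x) by exact: contB.
have cD' : cont C (fun x => F12 x - F21 x) by exact: contB.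
have Z x : Om x -> F12 x = F21 x.
  move=> Ox; apply/eqP; rewrite eq_le -subr_le0 -[X in _ && X]subr_le0; apply/andP; split.
    apply: (@IK0_le0 (fun x => F12 x - F21 x)) => //; first exact: contW cD'.
    by move=> a b c J sub; have HC : hull [:: a; b; c] `<=` C by [move=> y /sub/OC]; rewrite IKB ?E ?subrr//; exact: contW HC _.
  apply: (@IK0_le0 (fun x => F21 x - F12 x)) => //; first exact: contW cD.
  by move=> a b c J sub; have HC : hull [:: a; b; c] `<=` C by [move=> y /sub/OC]; rewrite IKB ?E ?subrr//; exact: contW HC _.
move=> x cx; apply/eqP; rewrite -subr_eq0 -normr_eq0 eq_le normr_ge0 andbT leNgt; apply/negP => h.
have [d d0 hd] := cont_box cD' cx h; have [y Oy [y1 y2]] := closure_approx cx d0.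
by have := hd y (OC _ Oy) y1 y2; rewrite (Z y Oy) subrr sub0r normrN ltxx.
Qed.

Lemma trace_fromE F G x : cont (closure Om) G -> (forall y, Om y -> G y = F y) -> closure Om x ->
  trace_from Om F x = G x.
Proof.
move=> /contP cG e cx; have PF : ProperFilter (within Om (nbhs x)).
  exact: within_nbhs_proper.
apply: cvg_lim => //; apply: (@cvg_trans _ (G y @[y --> within Om (nbhs x)])).
  by apply: near_eq_cvg; near=> y; apply/e; near: y; exact: withinT.
apply: cvg_trans (cG x cx); apply: cvg_app; apply: within_subset; exact: subset_closure.
Unshelve. all: by end_near. Qed.

End Closure.

(** * Continuous extensions of derivatives *)

Section Jets.
Variable R : realType.
Local Notation pt := (R * R)%type.
Implicit Types (a b c p q r x y z v : pt) (w F G : pt -> R) (D : set pt).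

Lemma dpart_local D F G (s : seq 'I_2) : open D -> (forall y, D y -> F y = G y) ->
  forall x, D x -> dpart s F x = dpart s G x.
Proof.
move=> oD; elim: s => [//|i s IH] e x Dx /=; apply: near_eq_derive.
by apply: filterS (open_nbhs_nbhs (conj oD Dx)) => y Dy; exact: IH.
Qed.

Variables (Om : set pt) (s : seq pt).
Hypothesis OmE : Om = (hull s)°.
Hypothesis Om0 : Om !=set0.
Local Notation C := (closure Om).

Lemma cont_eq_closure F G : cont C F -> cont C G -> (forall x, Om x -> F x = G x) -> forall x, C x -> F x = G x.
Proof.
move=> cF cG e x cx; apply/eqP; rewrite -subr_eq0 -normr_eq0 eq_le normr_ge0 andbT leNgt; apply/negP => h.
have [d d0 hd] := cont_box (contB cF cG) cx h; have [y Oy [y1 y2]] := closure_approx cx d0.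
by have := hd y (subset_closure Oy) y1 y2; rewrite (e y Oy) subrr sub0r normrN ltxx.
Qed.

(** One continuous extension [W l] is fixed for each iterated derivative, which moves all later
    statements to the closure. The last clause exchanges the two inner derivatives below an outer
    one; it follows by differentiating the second-order symmetry in the open domain. *)
Lemma jets m w : Cm_closure Om m w -> exists W : seq 'I_2 -> pt -> R,
  [/\ W [::] = w,
      forall l, (size l <= m)%N -> cont C (W l) /\ forall x, Om x -> dpart l w x = W l x,
      forall l, (size l < m)%N -> C1on C (W l) (W (o0 :: l)) (W (o1 :: l)),
      forall l x, ((size l).+2 <= m)%N -> C x -> W [:: o0, o1 & l] x = W [:: o1, o0 & l] x &
      forall i x, (3 <= m)%N -> C x -> W [:: i; o0; o1] x = W [:: i; o1; o0] x].
Proof.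
move=> [cw h].
have /choice[W0 hW0] : forall l, exists v : pt -> R, (size l <= m)%N -> cont C v /\ forall x, Om x -> v x = dpart l w x.
  (* Beyond order [m] the extension is arbitrary; [w] is a default value. *)
  by move=> l; case: (leqP (size l) m) => [/h[_ [v v1 v2]]|_]; [exists v|exists w].
pose W l := if l is [::] then w else W0 l.
have hW l : (size l <= m)%N -> cont C (W l) /\ forall x, Om x -> dpart l w x = W l x.
  case: l => [//|i l] hl; have [c e] := hW0 _ hl; split=> // x Ox; by rewrite /W e.
have Wnil : W [::] = w by [].
clearbody W => {hW0 W0}.
have oO := open_Om OmE.
have c1 l : (size l < m)%N -> C1on C (W l) (W (o0 :: l)) (W (o1 :: l)).
  move=> hl; have [cl el] := hW l (ltnW hl).
  have D i y : Om y -> is_derive y (basis2 R i) (W l) (W (i :: l) y).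
    move=> Oy; rewrite -(hW (i :: l) hl).2//.
    have dl : is_derive y (basis2 R i) (dpart l w) (dpart (i :: l) w y).
      by apply: DeriveDef => //; exact: (h l (ltnW hl)).1.
    apply: near_eq_is_derive dl.
        by apply: filterS (open_nbhs_nbhs (conj oO Oy)) => z Oz; rewrite (hW l (ltnW hl)).2.
  apply: (C1_closure OmE Om0) => //; [exact: (hW (o0 :: l) hl).1|exact: (hW (o1 :: l) hl).1|].
  by move=> y Oy; split; exact: D.
have sw l x : ((size l).+2 <= m)%N -> C x -> W [:: o0, o1 & l] x = W [:: o1, o0 & l] x.
  move=> hl cx; have hl1 : (size (o0 :: l) < m)%N by [].
  have hl2 : (size (o1 :: l) < m)%N by [].
  have C0 := c1 l (ltnW hl); have C1 := c1 _ hl1; have C2 := c1 _ hl2.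
  apply/esym; move: C0 C1 C2; generalize (W l) (W (o0 :: l)) (W (o1 :: l)) (W [:: o0, o0 & l]) (W [:: o1, o1 & l]) (W [:: o0, o1 & l]) (W [:: o1, o0 & l]).
  by move=> F F1 F2 F11 F22 F21 F12 C0 C1 C2; have H := @Schwarz _ _ _ OmE _ _ _ _ _ _ _ C0 C1 C2 x cx; rewrite H.
exists W; split=> //.
move=> i x m3; apply: cont_eq_closure; [exact: (hW [:: i; o0; o1] m3).1|exact: (hW [:: i; o1; o0] m3).1|].
move=> y Oy; rewrite -((hW [:: i; o0; o1] m3).2 y Oy) -((hW [:: i; o1; o0] m3).2 y Oy).
apply: (@dpart_local Om (dpart [:: o0; o1] w) (dpart [:: o1; o0] w) [:: i] oO _ y Oy) => z Oz.
have m2 : (2 <= m)%N by exact: ltnW.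
rewrite ((hW [:: o0; o1] m2).2 z Oz) ((hW [:: o1; o0] m2).2 z Oz); apply: sw => //; exact: subset_closure.
Qed.

End Jets.

(** * Very weak form of the determinant on one triangle *)

Section LocalForm.
Variable R : realType.
Local Notation pt := (R * R)%type.
Implicit Types (a b c p q x y z nu : pt) (F G P Q : pt -> R).

Lemma C1onZ D (l : R) F F1 F2 : C1on D F F1 F2 -> C1on D (fun x => l * F x) (fun x => l * F1 x) (fun x => l * F2 x).
Proof.
move=> cF; have [f f1 f2 d] := C1onM (C1on_cst D l) cF; split.
- exact: f.
- by have [_ f1' _ _] := cF; contt.
- by have [_ _ f2' _] := cF; contt.
- move=> x v m m0 Dx Dy t t0 tm; have := d x v m m0 Dx Dy t t0 tm.
  by rewrite !mul0r !add0r.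
Qed.

Lemma C1onB D F F1 F2 G G1 G2 : C1on D F F1 F2 -> C1on D G G1 G2 ->
  C1on D (fun x => F x - G x) (fun x => F1 x - G1 x) (fun x => F2 x - G2 x).
Proof.
move=> cF cG; have := C1onD cF (C1onZ (- 1) cG).
have e (A B : pt -> R) : (fun x => A x + -1 * B x) = (fun x => A x - B x) by apply/funext => x; rewrite mulN1r.
by rewrite !e.
Qed.

(** The edge vector turned by a right angle, pointing outwards when [s] is the orientation of the
    triangle. Its length is that of the edge, which makes up for the normalized parameter of
    [seg]. *)
Definition enu (s : R) p q : pt := (s * (q - p).2, - s * (q - p).1).

Definition edge3 (s : R) (E : pt -> pt -> pt -> R) a b c :=
  E a b (enu s a b) + E b c (enu s b c) + E c a (enu s c a).

Lemma div_tri a b c P P1 P2 Q Q1 Q2 : jac a b c != 0 ->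
  C1on (hull [:: a; b; c]) P P1 P2 -> C1on (hull [:: a; b; c]) Q Q1 Q2 ->
  IK a b c (fun x => P1 x + Q2 x) =
  edge3 (Num.sg (jac a b c)) (fun p q nu => seg p q (fun x => nu.1 * P x + nu.2 * Q x)) a b c.
Proof.
move=> J cP cQ; have [p p1 p2 _] := cP; have [q q1 q2 _] := cQ.
have cH := cvx_hull (s := [:: a; b; c]).
have [ha hb hc] : [/\ hull [:: a; b; c] a, hull [:: a; b; c] b & hull [:: a; b; c] c].
  by split; [exact: hull3_v1|exact: hull3_v2|exact: hull3_v3].
rewrite IKD// (IK_Green1 J cP) (IK_Green2 J cQ) /edge3.
have S p' q' l m : hull [:: a; b; c] p' -> hull [:: a; b; c] q' ->
  seg p' q' (fun x => l * P x + m * Q x) = l * seg p' q' P + m * seg p' q' Q by move=> hp hq; apply: segL cH hp hq p q.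
by rewrite (S a b)// (S b c)// (S c a)// /enu /=; ring.
Qed.

Definition Mf (t nu : pt) (X Y Z : R) := t.1 * nu.1 * X + (t.1 * nu.2 + t.2 * nu.1) * Y + t.2 * nu.2 * Z.

Definition nrm2 p : R := p.1 ^+ 2 + p.2 ^+ 2.

(* The part on an edge of [ell] below; [X], [Y], [Z] stand for the products of
   first derivatives [w1 y1], [(w1 y2 + w2 y1) / 2], [w2 y2], and [Mf] for
   the product of a tangential and a normal derivative. *)
Definition eform X Y Z (ph ph1 ph2 : pt -> R) p q nu :=
  seg p q (fun x => (Y x * nu.2 - Z x * nu.1) * ph1 x + (Y x * nu.1 - X x * nu.2) * ph2 x) +
  (nrm2 (q - p))^-1 * (Mf (q - p) nu (X q) (Y q) (Z q) * ph q - Mf (q - p) nu (X p) (Y p) (Z p) * ph p -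
    seg p q (fun x => Mf (q - p) nu (X x) (Y x) (Z x) * (ph1 x * (q - p).1 + ph2 x * (q - p).2))).

(** The determinant of [D^2 w] is half of a double curl of the products of first derivatives. Two
    integrations by parts put both remaining derivatives on the test function, so [w] enters through
    [X], [Y], [Z] only; for a pair of functions this is the polarized form. *)
Definition ell a b c X Y Z (ph ph1 ph2 ph11 ph12 ph22 : pt -> R) :=
  2^-1 * (- IK a b c (fun x => 2 * Y x * ph12 x - Z x * ph11 x - X x * ph22 x) +
    edge3 (Num.sg (jac a b c)) (eform X Y Z ph ph1 ph2) a b c).

Definition jet2 D (w w1 w2 w11 w12 w22 : pt -> R) :=
  [/\ C1on D w w1 w2, C1on D w1 w11 w12 & C1on D w2 w12 w22].

Definition jet3 D (w w1 w2 w11 w12 w22 : pt -> R) := jet2 D w w1 w2 w11 w12 w22 /\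
  exists A B E F, [/\ C1on D w11 A B, C1on D w12 B E & C1on D w22 E F].

Lemma seg_ext p q F G : (forall x, F x = G x) -> seg p q F = seg p q G.
Proof. by move=> h; apply: seg_eq. Qed.

Definition pX (w1 y1 : pt -> R) x := w1 x * y1 x.
Definition pY (w1 w2 y1 y2 : pt -> R) x := 2^-1 * (w1 x * y2 x + w2 x * y1 x).
Definition pZ (w2 y2 : pt -> R) x := w2 x * y2 x.
Definition ttf p q (v11 v12 v22 : pt -> R) x := (q - p).1 ^+ 2 * v11 x + 2 * (q - p).1 * (q - p).2 * v12 x + (q - p).2 ^+ 2 * v22 x.
Definition nnf nu (v1 v2 : pt -> R) x := nu.1 * v1 x + nu.2 * v2 x.

Section Identity.
Variables (a b c : pt).
Hypothesis J : jac a b c != 0.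
Local Notation H := (hull [:: a; b; c]).
Variables (w w1 w2 w11 w12 w22 y y1 y2 y11 y12 y22 ph ph1 ph2 ph11 ph12 ph22 : pt -> R).
Hypothesis jw : jet3 H w w1 w2 w11 w12 w22.
Hypothesis jy : jet3 H y y1 y2 y11 y12 y22.
Hypothesis jp : jet2 H ph ph1 ph2 ph11 ph12 ph22.

Let X := pX w1 y1.
Let Y := pY w1 w2 y1 y2.
Let Z := pZ w2 y2.
Let sg := Num.sg (jac a b c).

(** [E1] and [E2] are the two integrations by parts. Their boundary terms contain mixed
    tangential-normal second derivatives; [T] integrates along the edge the tangential derivative of
    the product in [Mf], at the price of end point values and a tangential derivative of the test
    function, and so removes them. What remains on an edge is normal first times tangential second
    derivative, which is the flux of the scheme. *)
Lemma ell_identity : 2 * ell a b c (pX w1 y1) (pY w1 w2 y1 y2) (pZ w2 y2) ph ph1 ph2 ph11 ph12 ph22 =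
  - IK a b c (fun x => (w11 x * y22 x + w22 x * y11 x - 2 * w12 x * y12 x) * ph x) +
  edge3 (Num.sg (jac a b c)) (fun p q nu => seg p q (fun x => (nrm2 (q - p))^-1 *
    (nnf nu w1 w2 x * ttf p q y11 y12 y22 x + nnf nu y1 y2 x * ttf p q w11 w12 w22 x) * ph x)) a b c.
Proof.
have [[cw cw1 cw2] [A [B [E [F [cA cB cE]]]]]] := jw.
have [[cy cy1 cy2] [A' [B' [E' [F' [cA' cB' cE']]]]]] := jy.
have [cp cp1 cp2] := jp.
have [k1 k2 k3 _] := cw; have [k4 k5 k6 _] := cw1; have [_ _ k7 _] := cw2.
have [l1 l2 l3 _] := cy; have [l4 l5 l6 _] := cy1; have [_ _ l7 _] := cy2.
have [m1 m2 m3 _] := cp; have [m4 m5 m6 _] := cp1; have [_ _ m7 _] := cp2.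
have [_ n1 n2 _] := cA; have [_ _ n3 _] := cB; have [_ _ n4 _] := cE.
have [_ n1' n2' _] := cA'; have [_ _ n3' _] := cB'; have [_ _ n4' _] := cE'.
have cX := C1onM cw1 cy1; have cZ := C1onM cw2 cy2.
have cY := C1onZ 2^-1 (C1onD (C1onM cw1 cy2) (C1onM cw2 cy1)).
have [hX _ _ _] := cX; have [hY _ _ _] := cY; have [hZ _ _ _] := cZ.
have kX : cont H X by []. have kY : cont H Y by []. have kZ : cont H Z by [].
pose V1 x := w1 x * y22 x + w22 x * y1 x - (w12 x * y2 x + w2 x * y12 x).
pose V2 x := w11 x * y2 x + w2 x * y11 x - (w12 x * y1 x + w1 x * y12 x).
have cV1 := C1onB (C1onD (C1onM cw1 cE') (C1onM cE cy1)) (C1onD (C1onM cB cy2) (C1onM cw2 cB')).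
have cV2 := C1onB (C1onD (C1onM cA cy2) (C1onM cw2 cA')) (C1onD (C1onM cB cy1) (C1onM cw1 cB')).
have [kV1 _ _ _] := cV1; have [kV2 _ _ _] := cV2.
have fV1 : cont H V1 by []. have fV2 : cont H V2 by [].
have cH := cvx_hull (s := [:: a; b; c]).
have [ha hb hc] : [/\ H a, H b & H c] by split; [exact: hull3_v1|exact: hull3_v2|exact: hull3_v3].
have I1 := div_tri J (C1onB (C1onM cY cp2) (C1onM cZ cp1)) (C1onB (C1onM cY cp1) (C1onM cX cp2)).
have I2 := div_tri J (C1onM cV1 cp) (C1onM cV2 cp).
have E1 : IK a b c (fun x => 2 * Y x * ph12 x - Z x * ph11 x - X x * ph22 x) +
    2^-1 * IK a b c (fun x => V1 x * ph1 x + V2 x * ph2 x) =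
    edge3 sg (fun p q nu => seg p q (fun x => (Y x * nu.2 - Z x * nu.1) * ph1 x + (Y x * nu.1 - X x * nu.2) * ph2 x)) a b c.
  rewrite -IKZ; last by contt.
  rewrite -IKD; [|by contt..].
  transitivity (edge3 sg (fun p q nu => seg p q (fun x => nu.1 * (Y x * ph2 x - Z x * ph1 x) + nu.2 * (Y x * ph1 x - X x * ph2 x))) a b c).
    by rewrite -I1; apply: IK_eq => x _; rewrite /V1 /V2 /X /Y /Z /pX /pY /pZ; field.
  by rewrite /edge3; congr (_ + _ + _); apply: seg_ext => x; ring.
have E2 : IK a b c (fun x => V1 x * ph1 x + V2 x * ph2 x) =
   - 2 * IK a b c (fun x => (w11 x * y22 x + w22 x * y11 x - 2 * w12 x * y12 x) * ph x) +
   edge3 sg (fun p q nu => seg p q (fun x => nu.1 * (V1 x * ph x) + nu.2 * (V2 x * ph x))) a b c.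
  rewrite -I2 -IKZ; last by contt.
  rewrite -IKD; [|by contt|].
    by apply: IK_eq => x _; rewrite /V1 /V2; ring.
  have [_ v11 _ _] := cV1; have [_ _ v22 _] := cV2.
  by contt.
have segD p q P Q : H p -> H q -> cont H P -> cont H Q -> seg p q (fun x => P x + Q x) = seg p q P + seg p q Q.
  move=> hp hq cP cQ; have := segL 1 1 cH hp hq cP cQ; rewrite !mul1r => <-.
  by apply: seg_ext => x; rewrite !mul1r.
have segZ p q l P : H p -> H q -> cont H P -> seg p q (fun x => l * P x) = l * seg p q P.
  move=> hp hq cP; have := segL l 0 cH hp hq cP cP; rewrite mul0r addr0 => <-.
  by apply: seg_ext => x; rewrite mul0r addr0.
pose Mt (t nu : pt) x := 2^-1 * (nnf nu w1 w2 x * (t.1 ^+ 2 * y11 x + 2 * t.1 * t.2 * y12 x + t.2 ^+ 2 * y22 x)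
      + nnf nu y1 y2 x * (t.1 ^+ 2 * w11 x + 2 * t.1 * t.2 * w12 x + t.2 ^+ 2 * w22 x)
      + (t.1 * w1 x + t.2 * w2 x) * (nu.1 * (t.1 * y11 x + t.2 * y12 x) + nu.2 * (t.1 * y12 x + t.2 * y22 x))
      + (t.1 * y1 x + t.2 * y2 x) * (nu.1 * (t.1 * w11 x + t.2 * w12 x) + nu.2 * (t.1 * w12 x + t.2 * w22 x))).
have cMt t nu : cont H (Mt t nu) by rewrite /Mt /nnf; contt.
have T p q nu : H p -> H q -> Mf (q - p) nu (X q) (Y q) (Z q) * ph q - Mf (q - p) nu (X p) (Y p) (Z p) * ph p -
    seg p q (fun x => Mf (q - p) nu (X x) (Y x) (Z x) * (ph1 x * (q - p).1 + ph2 x * (q - p).2)) =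
    seg p q (fun x => Mt (q - p) nu x * ph x).
  move=> hp hq; set t := q - p.
  have cM := C1onD (C1onD (C1onZ (t.1 * nu.1) cX) (C1onZ (t.1 * nu.2 + t.2 * nu.1) cY)) (C1onZ (t.2 * nu.2) cZ).
  have S := seg_FTC cH hp hq (C1onM cM cp).
  have -> : Mf t nu (X q) (Y q) (Z q) * ph q - Mf t nu (X p) (Y p) (Z p) * ph p =
    seg p q (fun x => Mt t nu x * ph x + Mf t nu (X x) (Y x) (Z x) * (ph1 x * t.1 + ph2 x * t.2)).
    transitivity ((fun x => (t.1 * nu.1 * (w1 x * y1 x) + (t.1 * nu.2 + t.2 * nu.1) * (2^-1 * (w1 x * y2 x + w2 x * y1 x)) + t.2 * nu.2 * (w2 x * y2 x)) * ph x) q -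
     (fun x => (t.1 * nu.1 * (w1 x * y1 x) + (t.1 * nu.2 + t.2 * nu.1) * (2^-1 * (w1 x * y2 x + w2 x * y1 x)) + t.2 * nu.2 * (w2 x * y2 x)) * ph x) p); first by [].
    by rewrite -S; apply: seg_ext => x; rewrite /Mt /Mf /nnf /X /Y /Z /pX /pY /pZ -/t; field.
  rewrite segD ?addrK//; first by have := cMt t nu; move=> ?; contt.
  by rewrite /Mf; contt.
have EN p q : p != q -> H p -> H q -> eform X Y Z ph ph1 ph2 p q (enu sg p q) =
   seg p q (fun x => (Y x * (enu sg p q).2 - Z x * (enu sg p q).1) * ph1 x + (Y x * (enu sg p q).1 - X x * (enu sg p q).2) * ph2 x)
   - 2^-1 * seg p q (fun x => (enu sg p q).1 * (V1 x * ph x) + (enu sg p q).2 * (V2 x * ph x))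
   + seg p q (fun x => (nrm2 (q - p))^-1 *
    (nnf (enu sg p q) w1 w2 x * ttf p q y11 y12 y22 x + nnf (enu sg p q) y1 y2 x * ttf p q w11 w12 w22 x) * ph x).
  move=> pq hp hq; rewrite /eform T// -addrA; congr (_ + _).
  have cm : cont H (fun x => Mt (q - p) (enu sg p q) x * ph x) by have := cMt (q - p) (enu sg p q) => ?; contt.
  have cv : cont H (fun x => (enu sg p q).1 * (V1 x * ph x) + (enu sg p q).2 * (V2 x * ph x)) by contt.
  rewrite -segZ// [RHS]addrC; apply/eqP; rewrite -subr_eq opprK -segZ// -segD//; [|by contt..].
  apply/eqP/seg_ext => x; rewrite /Mt /V1 /V2 /nnf /ttf /enu /nrm2 /=; field.
  rewrite -/(nrm2 (q - p)); apply: contra pq; rewrite /nrm2 paddr_eq0 ?sqr_ge0// !sqrf_eq0 !subr_eq0 => /andP[/eqP e1 /eqP e2].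
  by apply/eqP/pairE.
have [ab bc ca] : [/\ a != b, b != c & c != a] by have [? ? ?] := jac_neq J; split=> //; rewrite eq_sym.
rewrite /ell mulrA divff// mul1r; move: E1 E2; rewrite /edge3 !EN//.
set s1 := seg a b (fun x => (_ - _) * _ + _); set s2 := seg b c (fun x => (_ - _) * _ + _).
set s3 := seg c a (fun x => (_ - _) * _ + _) => E1 E2.
lra.
Qed.

(** One integration by parts, after which third derivatives of [w] cancel because the cofactor
    matrix of a Hessian is divergence free; [EN] splits the flux into tangential and normal
    components. *)
Lemma IK_cof : IK a b c (fun x => (w22 x * y1 x - w12 x * y2 x) * ph1 x + (w11 x * y2 x - w12 x * y1 x) * ph2 x) =
  - IK a b c (fun x => (w11 x * y22 x + w22 x * y11 x - 2 * w12 x * y12 x) * ph x) +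
  edge3 (Num.sg (jac a b c)) (fun p q nu => seg p q (fun x => (nrm2 (q - p))^-1 *
    (nnf nu y1 y2 x * ttf p q w11 w12 w22 x -
     ((q - p).1 * y1 x + (q - p).2 * y2 x) * (nu.1 * ((q - p).1 * w11 x + (q - p).2 * w12 x) + nu.2 * ((q - p).1 * w12 x + (q - p).2 * w22 x))) * ph x)) a b c.
Proof.
have [[cw cw1 cw2] [A [B [E [F [cA cB cE]]]]]] := jw.
have [[cy cy1 cy2] _] := jy.
have [cp cp1 cp2] := jp.
have [k1 k2 k3 _] := cw; have [k4 k5 k6 _] := cw1; have [_ _ k7 _] := cw2.
have [l1 l2 l3 _] := cy; have [l4 l5 l6 _] := cy1; have [_ _ l7 _] := cy2.
have [m1 m2 m3 _] := cp; have [m4 m5 m6 _] := cp1; have [_ _ m7 _] := cp2.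
have I1 := div_tri J (C1onM (C1onB (C1onM cE cy1) (C1onM cB cy2)) cp) (C1onM (C1onB (C1onM cA cy2) (C1onM cB cy1)) cp).
apply/eqP; rewrite addrC -subr_eq opprK -IKD; [|by contt..].
apply/eqP; transitivity (edge3 sg (fun p q nu => seg p q (fun x => nu.1 * ((w22 x * y1 x - w12 x * y2 x) * ph x) + nu.2 * ((w11 x * y2 x - w12 x * y1 x) * ph x))) a b c).
  by rewrite -I1; apply: IK_eq => x _; ring.
have EN p q : p != q -> seg p q (fun x => (enu sg p q).1 * ((w22 x * y1 x - w12 x * y2 x) * ph x) + (enu sg p q).2 * ((w11 x * y2 x - w12 x * y1 x) * ph x)) =
  seg p q (fun x => (nrm2 (q - p))^-1 *
    (nnf (enu sg p q) y1 y2 x * ttf p q w11 w12 w22 x -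
     ((q - p).1 * y1 x + (q - p).2 * y2 x) * ((enu sg p q).1 * ((q - p).1 * w11 x + (q - p).2 * w12 x) + (enu sg p q).2 * ((q - p).1 * w12 x + (q - p).2 * w22 x))) * ph x).
  move=> pq; apply: seg_ext => x; rewrite /nnf /ttf /enu /nrm2 /=; field.
  rewrite -/(nrm2 (q - p)); apply: contra pq; rewrite /nrm2 paddr_eq0 ?sqr_ge0// !sqrf_eq0 !subr_eq0 => /andP[/eqP e1 /eqP e2].
  by apply/eqP/pairE.
have [ab bc ca] : [/\ a != b, b != c & c != a] by have [? ? ?] := jac_neq J; split=> //; rewrite eq_sym.
by rewrite /edge3 !EN.
Qed.
End Identity.
End LocalForm.

(** * Scaled inverse estimates and the bound for the quadratic form *)

Section Bounds.
Variable R : realType.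
Local Notation pt := (R * R)%type.
Local Notation mu := (@lebesgue_measure R).
Implicit Types (a b c p q x y z nu : pt) (F G P Q : pt -> R) (f : pt -> R).

Lemma IK1_le a b c : jac a b c != 0 -> IK a b c (fun=> 1) <= `|jac a b c|.
Proof.
move=> J; rewrite (IKE J); last exact: cont_cst.
rewrite ler_piMr//.
have E (s : R) : 0 < s < 1 -> \int[mu]_(t in `[0, 1 - s]) (1 : R) = 1 - s.
  move=> /andP[s0 s1]; rewrite Rintegral_cst// /mu /= lebesgue_measure_itv /= lte_fin subr_gt0 s1.
  by rewrite mul1r /= subr0.
rewrite (@eq_Rintegral _ _ _ mu _ (fun s => 1 - s)); last first.
  by move=> s; rewrite inE/= in_itv/=; exact: E.
apply: (@le_trans _ _ (\int[mu]_(s in `]0, 1[) (1 : R))).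
  have I01 (g : R -> R) : continuous g -> mu.-integrable `]0, 1[ (EFin \o g).
    move=> cg; have ig : mu.-integrable `[0, 1] (EFin \o g).
      apply: continuous_compact_integrable; first exact: segment_compact.
      exact: continuous_subspaceT.
    by apply: integrableS ig => //; exact: subset_itv_oo_cc.
  apply: le_Rintegral => //.
  - by apply: I01 => s; apply: cvgB; [exact: cvg_cst|exact: cvg_id].
  - by apply: I01 => s; exact: cvg_cst.
  - by move=> s; rewrite /= in_itv/= => /andP[s0 _]; lra.
by rewrite Rintegral_cst// /mu /= lebesgue_measure_itv /= lte_fin ltr01 oppr0 adde0 mul1r.
Qed.

Lemma IK_bound a b c F (M : R) : jac a b c != 0 -> cont (hull [:: a; b; c]) F ->
  (forall x, hull [:: a; b; c] x -> `|F x| <= M) -> `|IK a b c F| <= M * `|jac a b c|.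
Proof.
move=> J cF h; have M0 : 0 <= M by apply: le_trans (h a (hull3_v1 a b c)).
have cM l : cont (hull [:: a; b; c]) (fun=> l : R) by exact: cont_cst.
have E l : IK a b c (fun=> l) = l * IK a b c (fun=> 1).
  by rewrite -IKZ//; apply: IK_eq => x _; rewrite mulr1.
have U : IK a b c F <= M * IK a b c (fun=> 1).
  by rewrite -E; apply: IK_le => // x /h; rewrite ler_norml => /andP[].
have L : - (M * IK a b c (fun=> 1)) <= IK a b c F.
  by rewrite -mulNr -E; apply: IK_le => // x /h; rewrite ler_norml => /andP[].
apply: (@le_trans _ _ (M * IK a b c (fun=> 1))); first by rewrite ler_norml L U.
by rewrite ler_wpM2l// IK1_le.
Qed.

Lemma seg_bound D a b F (M : R) : cvx D -> D a -> D b -> cont D F ->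
  (forall x, D x -> `|F x| <= M) -> `|seg a b F| <= M.
Proof.
move=> cD Da Db cF h.
have iF := seg_integrable cD Da Db cF.
have ic (l : R) : mu.-integrable `[0, 1] (EFin \o (fun=> l)).
  apply: continuous_compact_integrable; first exact: segment_compact.
  by apply: continuous_subspaceT => s; exact: cvg_cst.
have C (l : R) : \int[mu]_(t in `[0, 1]) l = l.
  by rewrite Rintegral_cst// /mu /= lebesgue_measure_itv /= lte_fin ltr01 oppr0 adde0 mulr1.
have B (t : R) : `[0, 1]%classic t -> `|F (a + t *: (b - a))| <= M.
  by rewrite /= in_itv/= => /andP[t0 t1]; exact/h/cD.
rewrite ler_norml -{1}(C (- M)) -{2}(C M); apply/andP; split; apply: le_Rintegral => // t /B;
  by rewrite ler_norml => /andP[].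
Qed.

(** [Schwarz] on a unit right triangle with vertex [x]. *)
Lemma pol_schwarz n f : pol n f -> dpart [:: o1; o0] f = dpart [:: o0; o1] f.
Proof.
move=> hf; apply/funext => x; pose b := (x.1 + 1, x.2); pose c := (x.1, x.2 + 1).
have J : jac x b c != 0 by rewrite (_ : jac _ _ _ = 1) ?oner_eq0// /jac /=; ring.
have C1 i : C1on (closure (hull [:: x; b; c])°) (dpart [:: i] f) (dpart [:: o0; i] f) (dpart [:: o1; i] f).
  exact: (pol_C1on _ (pol_dpart i hf)).
apply: (@Schwarz R (hull [:: x; b; c])° [:: x; b; c] erefl f (dpart [:: o0] f) (dpart [:: o1] f) (dpart [:: o0; o0] f) (dpart [:: o1; o0] f) (dpart [:: o0; o1] f) (dpart [:: o1; o1] f)) => //.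
- exact: (pol_C1on _ hf).
rewrite (@closure_hull _ _ [:: x; b; c])//; first exact: hull3_v1.
exists (x + 3^-1 *: (b - x) + 3^-1 *: (c - x)).
by apply/(hull_intP _ J); have [-> -> ->] := bary_aff 3^-1 3^-1 J; split; lra.
Qed.

Lemma pol_dpart2 n f i j : pol n f -> pol n.-2 (dpart [:: i; j] f).
Proof. by move=> hf; exact: (pol_dpart i (pol_dpart j hf)). Qed.

Lemma pol_jet2 D n f : pol n f -> jet2 D f (dpart [:: o0] f) (dpart [:: o1] f)
  (dpart [:: o0; o0] f) (dpart [:: o0; o1] f) (dpart [:: o1; o1] f).
Proof.
move=> hf; split; [exact: pol_C1on hf| |exact: (pol_C1on _ (pol_dpart o1 hf))].
by rewrite -(pol_schwarz hf); exact: (pol_C1on _ (pol_dpart o0 hf)).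
Qed.

Lemma pol_jet3 D n f : pol n f -> jet3 D f (dpart [:: o0] f) (dpart [:: o1] f)
  (dpart [:: o0; o0] f) (dpart [:: o0; o1] f) (dpart [:: o1; o1] f).
Proof.
move=> hf; split; first exact: pol_jet2 hf.
have h0 := pol_dpart o0 hf; have h1 := pol_dpart o1 hf.
exists (dpart [:: o0; o0; o0] f), (dpart [:: o0; o0; o1] f), (dpart [:: o0; o1; o1] f), (dpart [:: o1; o1; o1] f); split.
- have <- : dpart [:: o1; o0; o0] f = dpart [:: o0; o0; o1] f.
    transitivity (dpart [:: o0; o1; o0] f); first exact: (pol_schwarz h0).
    transitivity (dpart [:: o0] (dpart [:: o1; o0] f)); first by [].
    by rewrite (pol_schwarz hf).
  exact: (pol_C1on _ (pol_dpart o0 h0)).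
- have <- : dpart [:: o1; o0; o1] f = dpart [:: o0; o1; o1] f by exact: (pol_schwarz h1).
  exact: (pol_C1on _ (pol_dpart o0 h1)).
- exact: (pol_C1on _ (pol_dpart o1 h1)).
Qed.

Definition L2 a b c F := Num.sqrt (IK a b c (fun x => F x ^+ 2)).

(** Shape regularity in the form used from here on. By quasi-uniformity the same [h], the mesh size,
    serves for all elements. *)
Definition reg (kap h : R) a b c := [/\ 0 < kap, 0 < h,
  [/\ `|(b - a).1| <= h, `|(b - a).2| <= h, `|(c - a).1| <= h & `|(c - a).2| <= h] &
  kap * h ^+ 2 <= `|jac a b c|].

Lemma reg_jac kap h a b c : reg kap h a b c -> jac a b c != 0.
Proof. by move=> [k0 h0 _ J]; rewrite -normr_gt0; apply: lt_le_trans J; rewrite mulr_gt0// exprn_gt0. Qed.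

Lemma sqr_le_norm (u v : R) : 0 <= v -> u ^+ 2 <= v ^+ 2 -> `|u| <= v.
Proof. by move=> v0 h; rewrite -(@ler_pXn2r _ 2)// ?nnegrE// -normrX ger0_norm ?sqr_ge0. Qed.

Lemma inverse_bounds n kap : exists2 C : R, 0 < C & forall h a b c f, reg kap h a b c -> pol n f ->
  forall x, hull [:: a; b; c] x ->
  [/\ `|f x| <= C / h * L2 a b c f, forall i, `|dpart [:: i] f x| <= C / h ^+ 2 * L2 a b c f &
   forall i, L2 a b c (dpart [:: i] f) <= C / h * L2 a b c f].
Proof.
have [k0|k0] := ltP 0 kap; last first.
  by exists 1 => // h a b c f [kk]; move: (lt_le_trans kk k0); rewrite ltxx.
have [C C0 hC] := inverse_estimate R n.
pose K := 1 + C / kap + C / kap ^+ 3 + C / kap ^+ 2.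
have [P1 P2 P3] : [/\ 0 < C / kap, 0 < C / kap ^+ 3 & 0 < C / kap ^+ 2] by split; rewrite divr_gt0// exprn_gt0.
have K0 : 0 < K by rewrite /K; lra.
have [K1 K2 K3] : [/\ C / kap <= K ^+ 2, C / kap ^+ 3 <= K ^+ 2 & C / kap ^+ 2 <= K ^+ 2].
  have : K <= K ^+ 2 by rewrite expr2 ler_peMl ?ltW// /K; lra.
  by rewrite /K => ?; split; lra.
exists K => // h a b c f rg pf x hx; have J := reg_jac rg; have [_ h0 hh Jk] := rg.
set I := IK a b c (fun x => f x ^+ 2).
have I0 : 0 <= I by apply: IK_ge0 => y _; exact: sqr_ge0.
have sI : L2 a b c f ^+ 2 = I by rewrite sqr_sqrtr.
have s0 : 0 <= L2 a b c f by exact: sqrtr_ge0.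
have J0 : 0 < `|jac a b c| by rewrite normr_gt0.
have JJ : jac a b c ^+ 2 = `|jac a b c| ^+ 2 by rewrite sqr_absE.
set j : R := `|jac a b c| in J0 Jk JJ.
have D i y : hull [:: a; b; c] y -> dpart [:: i] f y ^+ 2 <= C * h ^+ 2 * I / j ^+ 3.
  move=> hy; have [_ /(_ i)] := hC a b c f h J hh pf y hy; rewrite -/j -/I exprMn exprMn JJ => H.
  rewrite ler_pdivlMr ?exprn_gt0//; have h2 : 0 < h ^+ 2 by rewrite exprn_gt0.
  have -> : dpart [:: i] f y ^+ 2 * j ^+ 3 = (j * (dpart [:: i] f y ^+ 2 * (j ^+ 2 * h^-1 ^+ 2))) * h ^+ 2.
    by field; rewrite gt_eqF.
  by rewrite (_ : C * h ^+ 2 * I = C * I * h ^+ 2); [rewrite ler_wpM2r// ltW|ring].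
have kh : 0 < kap * h ^+ 2 by rewrite mulr_gt0// exprn_gt0.
have CI : 0 <= C * h ^+ 2 * I by apply: mulr_ge0 => //; apply: mulr_ge0; rewrite ?sqr_ge0// ltW.
have jn n' : j ^- n' <= (kap * h ^+ 2) ^- n'.
  by rewrite lef_pV2 ?posrE ?exprn_gt0//; apply: lerXn2r => //; rewrite nnegrE; exact: ltW.
split.
- have [H _] := hC a b c f h J hh pf x hx; apply: sqr_le_norm; first by rewrite mulr_ge0// divr_ge0// ltW.
  rewrite exprMn exprMn sI; apply: (@le_trans _ _ (C * I / j)).
    by rewrite ler_pdivlMr// mulrC.
  apply: (@le_trans _ _ (C / kap * (h^-1 ^+ 2 * I))).
    rewrite (_ : C / kap * _ = C * I * (kap * h ^+ 2)^-1); last by field; rewrite !gt_eqF.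
    by rewrite ler_wpM2l ?mulr_ge0 ?(ltW C0)//; have := jn 1%N; rewrite !expr1.
  by rewrite -[leRHS]mulrA ler_wpM2r// mulr_ge0// sqr_ge0.
- move=> i; apply: sqr_le_norm; first by rewrite mulr_ge0// divr_ge0 ?sqr_ge0// ltW.
  rewrite exprMn exprMn sI; apply: le_trans (D i x hx) _.
  apply: (@le_trans _ _ (C / kap ^+ 3 * ((h ^+ 2)^-1 ^+ 2 * I))).
    rewrite (_ : C / kap ^+ 3 * _ = C * h ^+ 2 * I * (kap * h ^+ 2) ^- 3); last by field; rewrite !gt_eqF.
    by rewrite ler_wpM2l.
  by rewrite -[leRHS]mulrA ler_wpM2r// mulr_ge0// sqr_ge0.
- move=> i; have KL : 0 <= K / h * L2 a b c f by rewrite mulr_ge0// divr_ge0// ltW.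
  rewrite -(ger0_norm KL) -sqrtr_sqr ler_wsqrtr//.
  rewrite exprMn exprMn sI.
  have cf : cont (hull [:: a; b; c]) (fun x => dpart [:: i] f x ^+ 2).
    by have := pol_cont (D := hull [:: a; b; c]) (pol_dpart i pf) => ?; contt.
  have B : `|IK a b c (fun x => dpart [:: i] f x ^+ 2)| <= C * h ^+ 2 * I / j ^+ 3 * j.
    by apply: IK_bound => // y hy; rewrite ger0_norm ?sqr_ge0//; exact: D.
  apply: le_trans (ler_norm _) (le_trans B _).
  apply: (@le_trans _ _ (C / kap ^+ 2 * (h^-1 ^+ 2 * I))).
    rewrite (_ : _ / j ^+ 3 * j = C * h ^+ 2 * I * j ^- 2); last by field; rewrite gt_eqF.
    rewrite (_ : C / kap ^+ 2 * _ = C * h ^+ 2 * I * (kap * h ^+ 2) ^- 2); last by field; rewrite !gt_eqF.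
    by rewrite ler_wpM2l.
  by rewrite -[leRHS]mulrA ler_wpM2r// mulr_ge0// sqr_ge0.
Qed.

Lemma norm_sub3 (x y z u v w : R) : `|x| <= u -> `|y| <= v -> `|z| <= w -> `|x - y - z| <= u + v + w.
Proof.
move=> hx hy hz; rewrite (le_trans (ler_normB _ _))// lerD// (le_trans (ler_normB _ _))//; exact: lerD.
Qed.

(** Tangent and normal both have the length of the edge, so their product has the order of its
    square, which cancels the factor [(nrm2 (q - p))^-1] of [eform]: short edges do no harm. *)
Lemma Mf_bound (s S X Y Z : R) p q : `|s| <= 1 -> `|X| <= S -> `|Y| <= S -> `|Z| <= S ->
  `|Mf (q - p) (enu s p q) X Y Z| <= nrm2 (q - p) * (2 * S).
Proof.
move=> s1 hX hY hZ; set t := q - p.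
have -> : Mf t (enu s p q) X Y Z = s * (t.1 * t.2 * (X - Z) + (t.2 ^+ 2 - t.1 ^+ 2) * Y).
  by rewrite /Mf /enu -/t /=; ring.
rewrite normrM -[leRHS]mul1r ler_pM//.
have a1 : `|t.1 * t.2| <= nrm2 t / 2.
  have am (u v : R) : `|u * v| <= (u ^+ 2 + v ^+ 2) / 2.
    by rewrite ler_norml; have := sqr_ge0 (u - v); have := sqr_ge0 (u + v); move=> ? ?; apply/andP; split; nra.
  exact: am.
have a2 : `|t.2 ^+ 2 - t.1 ^+ 2| <= nrm2 t.
  have am (u v : R) : `|u ^+ 2 - v ^+ 2| <= v ^+ 2 + u ^+ 2.
    by rewrite ler_norml; have := sqr_ge0 u; have := sqr_ge0 v; move=> ? ?; apply/andP; split; lra.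
  exact: am.
rewrite (le_trans (ler_normD _ _))// !normrM.
have a3 : `|X - Z| <= 2 * S by rewrite (le_trans (ler_normB _ _))//; lra.
have n0 := normr_ge0 t.1; have n1 := normr_ge0 t.2.
rewrite normrM in a1.
have b1 : `|t.1| * `|t.2| * `|X - Z| <= nrm2 t / 2 * (2 * S) by rewrite ler_pM// mulr_ge0.
have b2 : `|t.2 ^+ 2 - t.1 ^+ 2| * `|Y| <= nrm2 t * S by rewrite ler_pM.
by lra.
Qed.

Lemma eform_bound D (s h S M0 M1 : R) X Y Z (ph ph1 ph2 : pt -> R) p q : cvx D -> D p -> D q ->
  `|s| <= 1 -> p != q -> `|(q - p).1| <= h -> `|(q - p).2| <= h ->
  cont D X -> cont D Y -> cont D Z -> cont D ph1 -> cont D ph2 ->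
  (forall x, D x -> [/\ `|X x| <= S, `|Y x| <= S & `|Z x| <= S]) ->
  (forall x, D x -> [/\ `|ph x| <= M0, `|ph1 x| <= M1 & `|ph2 x| <= M1]) ->
  `|eform X Y Z ph ph1 ph2 p q (enu s p q)| <= S * (4 * M0 + 8 * h * M1).
Proof.
move=> cD Dp Dq s1 pq h1 h2 cX cY cZ c1 c2 hS hM.
have S0 : 0 <= S by have [+ _ _] := hS p Dp; apply: le_trans.
have M00 : 0 <= M0 by have [+ _ _] := hM p Dp; apply: le_trans.
have M10 : 0 <= M1 by have [_ + _] := hM p Dp; apply: le_trans.
have hp : 0 <= h by apply: le_trans h1.
have N0 : 0 < nrm2 (q - p).
  rewrite lt_neqAle addr_ge0 ?sqr_ge0// andbT eq_sym; apply: contra pq.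
  rewrite paddr_eq0 ?sqr_ge0// !sqrf_eq0 !subr_eq0 => /andP[/eqP e1 /eqP e2].
  by apply/eqP/pairE.
have Q4 (A B C' D' u v w z : R) : `|A| <= u -> `|B| <= v -> `|C'| <= w -> `|D'| <= z -> `|A * B + C' * D'| <= u * v + w * z.
  by move=> *; rewrite (le_trans (ler_normD _ _))// !normrM lerD// ler_pM.
have n1 : `|(enu s p q).1| <= h by rewrite /enu /= normrM -[leRHS]mul1r ler_pM.
have n2 : `|(enu s p q).2| <= h by rewrite /enu /= normrM normrN -[leRHS]mul1r ler_pM.
have A x : D x -> `|(Y x * (enu s p q).2 - Z x * (enu s p q).1) * ph1 x + (Y x * (enu s p q).1 - X x * (enu s p q).2) * ph2 x| <= 4 * S * h * M1.
  move=> Dx; have [hX hY hZ] := hS x Dx; have [_ k1 k2] := hM x Dx.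
  have -> : 4 * S * h * M1 = (S * h + S * h) * M1 + (S * h + S * h) * M1 by ring.
  by apply/Q4 => //; rewrite -mulrN; apply/Q4; rewrite ?normrN.
have B x : D x -> `|Mf (q - p) (enu s p q) (X x) (Y x) (Z x) * (ph1 x * (q - p).1 + ph2 x * (q - p).2)| <=
   nrm2 (q - p) * (2 * S) * (M1 * h + M1 * h).
  move=> Dx; have [hX hY hZ] := hS x Dx; have [_ k1 k2] := hM x Dx.
  by rewrite normrM ler_pM//; [exact: Mf_bound|exact/Q4].
rewrite /eform (le_trans (ler_normD _ _))//.
have -> : S * (4 * M0 + 8 * h * M1) = 4 * S * h * M1 + (4 * S * M0 + 4 * S * h * M1) by ring.
apply: lerD; first by apply: (seg_bound cD Dp Dq) A; contt.
rewrite normrM gtr0_norm ?invr_gt0// ler_pdivrMl//.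
have [e1 e2] : `|Mf (q - p) (enu s p q) (X q) (Y q) (Z q) * ph q| <= nrm2 (q - p) * (2 * S) * M0 /\
   `|Mf (q - p) (enu s p q) (X p) (Y p) (Z p) * ph p| <= nrm2 (q - p) * (2 * S) * M0.
  by split; rewrite normrM ler_pM//; [by have [? ? ?] := hS q Dq; exact: Mf_bound|by have [] := hM q Dq|
     by have [? ? ?] := hS p Dp; exact: Mf_bound|by have [] := hM p Dp].
have e3 : `|seg p q (fun x => Mf (q - p) (enu s p q) (X x) (Y x) (Z x) * (ph1 x * (q - p).1 + ph2 x * (q - p).2))| <= nrm2 (q - p) * (2 * S) * (M1 * h + M1 * h).
  by apply: (seg_bound cD Dp Dq) B; rewrite /Mf; contt.
rewrite (le_trans (ler_normB _ _))//.
apply: (@le_trans _ _ (nrm2 (q - p) * (2 * S) * M0 + nrm2 (q - p) * (2 * S) * M0 + nrm2 (q - p) * (2 * S) * (M1 * h + M1 * h))).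
  by rewrite lerD// (le_trans (ler_normB _ _))// lerD.
by rewrite (_ : nrm2 (q - p) * (4 * S * M0 + 4 * S * h * M1) = nrm2 (q - p) * (2 * S) * M0 + nrm2 (q - p) * (2 * S) * M0 + nrm2 (q - p) * (2 * S) * (M1 * h + M1 * h)); [|ring].
Qed.

Lemma ell_abs (h S M0 M1 M2 : R) a b c X Y Z (f f1 f2 f11 f12 f22 : pt -> R) : let H := hull [:: a; b; c] in
  jac a b c != 0 ->
  [/\ `|(b - a).1| <= h, `|(b - a).2| <= h, `|(c - a).1| <= h & `|(c - a).2| <= h] ->
  cont H X -> cont H Y -> cont H Z -> cont H f1 -> cont H f2 -> cont H f11 -> cont H f12 -> cont H f22 ->
  (forall x, H x -> [/\ `|X x| <= S, `|Y x| <= S & `|Z x| <= S]) ->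
  (forall x, H x -> [/\ `|f x| <= M0, `|f1 x| <= M1 & `|f2 x| <= M1]) ->
  (forall x, H x -> [/\ `|f11 x| <= M2, `|f12 x| <= M2 & `|f22 x| <= M2]) ->
  `|ell a b c X Y Z f f1 f2 f11 f12 f22| <= S * (4 * h ^+ 2 * M2 + 6 * M0 + 24 * h * M1).
Proof.
move=> H J [q1 q2 q3 q4] cX cY cZ c1 c2 c11 c12 c22 hS B B2.
have S0 : 0 <= S by have [+ _ _] := hS a (hull3_v1 a b c); apply: le_trans.
have M20 : 0 <= M2 by have [+ _ _] := B2 a (hull3_v1 a b c); apply: le_trans.
have Jh : `|jac a b c| <= 2 * h ^+ 2.
  rewrite /jac (le_trans (ler_normB _ _))// !normrM.
  have Q : `|b.1 - a.1| * `|c.2 - a.2| <= h * h by rewrite ler_pM.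
  have Q' : `|b.2 - a.2| * `|c.1 - a.1| <= h * h by rewrite ler_pM.
  by rewrite expr2; lra.
have IB : `|IK a b c (fun x => 2 * Y x * f12 x - Z x * f11 x - X x * f22 x)| <= 4 * S * M2 * (2 * h ^+ 2).
  apply: (@le_trans _ _ (4 * S * M2 * `|jac a b c|)); last by apply: ler_wpM2l => //; apply: mulr_ge0 => //; exact: mulr_ge0.
  apply: IK_bound => //; first by contt.
  move=> x hx; have [k1 k2 k3] := hS x hx; have [l1 l2 l3] := B2 x hx.
  have -> : 4 * S * M2 = 2 * S * M2 + S * M2 + S * M2 by ring.
  apply: norm_sub3; rewrite !normrM ?(ger0_norm (ler0n _ 2)) ler_pM ?mulr_ge0// ler_wpM2l//.
have sg1 : `|Num.sg (jac a b c)| <= 1 by rewrite normr_sg J.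
have [ab bc ac] := jac_neq J; have ca : c != a by rewrite eq_sym.
have [ha hb hc] : [/\ H a, H b & H c] by split; [exact: hull3_v1|exact: hull3_v2|exact: hull3_v3].
have EB p q : H p -> H q -> p != q -> `|(q - p).1| <= 2 * h -> `|(q - p).2| <= 2 * h ->
    `|eform X Y Z f f1 f2 p q (enu (Num.sg (jac a b c)) p q)| <= S * (4 * M0 + 8 * (2 * h) * M1).
  by move=> hp hq pq e1 e2; apply: (@eform_bound H); rewrite ?cvx_hull//; exact: cvx_hull.
have t1 : `|(c - b).1| <= 2 * h.
  by rewrite (_ : (c - b).1 = (c - a).1 - (b - a).1) ?(le_trans (ler_normB _ _))//=; [lra|ring].
have t2 : `|(c - b).2| <= 2 * h.
  by rewrite (_ : (c - b).2 = (c - a).2 - (b - a).2) ?(le_trans (ler_normB _ _))//=; [lra|ring].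
have [u1 u2] : `|(b - a).1| <= 2 * h /\ `|(b - a).2| <= 2 * h.
  by have := normr_ge0 (b - a).1; have := normr_ge0 (b - a).2; split; lra.
have [v1 v2] : `|(a - c).1| <= 2 * h /\ `|(a - c).2| <= 2 * h.
  have e1 : `|(a - c).1| = `|(c - a).1| by rewrite /= distrC.
  have e2 : `|(a - c).2| = `|(c - a).2| by rewrite /= distrC.
  by rewrite e1 e2; have := normr_ge0 (c - a).1; have := normr_ge0 (c - a).2; split; lra.
have := EB a b ha hb ab u1 u2; have := EB b c hb hc bc t1 t2; have := EB c a hc ha ca v1 v2.
rewrite /ell /edge3; move: IB; move: (eform _ _ _ _ _ _ c a _) (eform _ _ _ _ _ _ b c _) (eform _ _ _ _ _ _ a b _) (IK _ _ _ _) => e1 e2 e3 I IB E1 E2 E3.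
rewrite normrM ger0_norm ?invr_ge0//.
have m1 := ler_normD (- I) (e3 + e2 + e1); have m2 := ler_normD (e3 + e2) e1; have m3 := ler_normD e3 e2.
rewrite normrN in m1.
have -> : S * (4 * h ^+ 2 * M2 + 6 * M0 + 24 * h * M1) = 2^-1 * (4 * S * M2 * (2 * h ^+ 2) + 3 * (S * (4 * M0 + 8 * (2 * h) * M1))).
  by field.
rewrite ler_wpM2l ?invr_ge0//; clear - E1 E2 E3 IB m1 m2 m3; lra.
Qed.

Definition ellp a b c X Y Z f := ell a b c X Y Z f (dpart [:: o0] f) (dpart [:: o1] f)
  (dpart [:: o0; o0] f) (dpart [:: o0; o1] f) (dpart [:: o1; o1] f).

(** The powers of [h] balance: second derivatives of the test function cost h^-3 against the area
    h^2, first derivatives h^-2 against the edge length h, values h^-1. *)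
Lemma ell_bound n kap : exists2 C : R, 0 < C & forall (h S : R) a b c X Y Z f, reg kap h a b c -> pol n f ->
  cont (hull [:: a; b; c]) X -> cont (hull [:: a; b; c]) Y -> cont (hull [:: a; b; c]) Z ->
  (forall x, hull [:: a; b; c] x -> [/\ `|X x| <= S, `|Y x| <= S & `|Z x| <= S]) ->
  `|ellp a b c X Y Z f| <= C * S / h * L2 a b c f.
Proof.
have [C C0 hC] := inverse_bounds n kap; have [C' C'0 hC'] := inverse_bounds n.-1 kap.
exists (4 * C' * C + 30 * C); first by have := mulr_gt0 C'0 C0; lra.
move=> h S a b c X Y Z f rg pf cX cY cZ hS; have J := reg_jac rg; have [k0 h0 hh Jk] := rg.
set H := hull [:: a; b; c]; set L : R := L2 a b c f.
have B2 x (i j : 'I_2) : H x -> `|dpart [:: i; j] f x| <= C' * C / h ^+ 3 * L.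
  move=> hx; have [_ /(_ i) k1 _] := hC' h a b c _ rg (pol_dpart j pf) x hx.
  have [_ _ /(_ j) k2] := hC h a b c f rg pf x hx.
  apply: le_trans k1 _; rewrite (_ : C' * C / h ^+ 3 * L = C' / h ^+ 2 * (C / h * L)); last by field; rewrite gt_eqF.
  by rewrite ler_wpM2l// divr_ge0 ?sqr_ge0// ltW.
have cd (i : 'I_2) : cont H (dpart [:: i] f):= pol_cont (D := H) (pol_dpart i pf).
have cd2 (i j : 'I_2) : cont H (dpart [:: i; j] f):= pol_cont (D := H) (pol_dpart2 i j pf).
have B x : H x -> [/\ `|f x| <= C / h * L, `|dpart [:: o0] f x| <= C / h ^+ 2 * L & `|dpart [:: o1] f x| <= C / h ^+ 2 * L].
  by move=> hx; have [k1 k2 _] := hC h a b c f rg pf x hx; split; [exact: k1|exact: k2|exact: k2].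
have B2' x : H x -> [/\ `|dpart [:: o0; o0] f x| <= C' * C / h ^+ 3 * L, `|dpart [:: o0; o1] f x| <= C' * C / h ^+ 3 * L & `|dpart [:: o1; o1] f x| <= C' * C / h ^+ 3 * L].
  by move=> hx; split; exact: B2.
have := ell_abs J hh cX cY cZ (cd o0) (cd o1) (cd2 o0 o0) (cd2 o0 o1) (cd2 o1 o1) hS B B2'.
by move=> /le_trans; apply; rewrite le_eqVlt; apply/orP; left; apply/eqP; field; rewrite gt_eqF.
Qed.

End Bounds.

(** * Derivatives of the exact solution; two-by-two matrices *)

Section Jet3.
Variable R : realType.
Local Notation pt := (R * R)%type.
Variables (Om : set pt) (s : seq pt).
Hypothesis OmE : Om = (hull s)°.
Hypothesis Om0 : Om !=set0.
Local Notation C := (closure Om).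

Lemma o_ord : o0 = ord0 :> 'I_2 /\ o1 = ord_max :> 'I_2. Proof. by []. Qed.

Lemma jets3 w : Cm_closure Om 3 w -> exists W1 W2 W11 W12 W22, [/\ jet3 C w W1 W2 W11 W12 W22,
  (forall x, Om x -> [/\ dpart [:: o0; o0] w x = W11 x, dpart [:: o0; o1] w x = W12 x,
     dpart [:: o1; o0] w x = W12 x & dpart [:: o1; o1] w x = W22 x]) &
  forall x, Om x -> is_derive x (basis2 R o0) w (W1 x) /\ is_derive x (basis2 R o1) w (W2 x)].
Proof.
move=> hw; have [W [W0 cW C1W sW sW3]] := jets OmE Om0 hw; have cv := cvx_closure OmE Om0.
exists (W [:: o0]), (W [:: o1]), (W [:: o0; o0]), (W [:: o0; o1]), (W [:: o1; o1]); split.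
- split; first split.
  + by have := C1W [::] isT; rewrite W0.
  + by apply: (C1on_eq (C1W [:: o0] isT) cv) => // x cx; rewrite (sW [::] x isT cx).
  + exact: (C1W [:: o1] isT).
  exists (W [:: o0; o0; o0]), (W [:: o0; o0; o1]), (W [:: o1; o0; o1]), (W [:: o1; o1; o1]); split.
  + by apply: (C1on_eq (C1W [:: o0; o0] isT) cv) => // x cx; rewrite (sW3 o0 x isT cx) (sW [:: o0] x isT cx).
  + exact: (C1W [:: o0; o1] isT).
  + by apply: (C1on_eq (C1W [:: o1; o1] isT) cv) => // x cx; rewrite (sW [:: o1] x isT cx).
- move=> x ox; have cx := subset_closure ox; have E l (hl : (size l <= 3)%N) := (cW l hl).2 x ox.
  by split; [exact: E [:: o0; o0] isT|exact: E [:: o0; o1] isT|rewrite (sW [::] x isT cx); exact: E [:: o1; o0] isT|exact: E [:: o1; o1] isT].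
- move=> x ox; have [_ /(_ [::] isT)[/(_ isT) d _]] := hw.
  have e0 := (cW [:: o0] isT).2 x ox; have e1 := (cW [:: o1] isT).2 x ox.
  by split; [rewrite -e0; exact: derivableP (d o0 x ox)|rewrite -e1; exact: derivableP (d o1 x ox)].
Qed.

End Jet3.

Opaque dpart o0 o1.

Section Mx2.
Variable R : realType.
Implicit Types (M : 'M[R]_2) (g n : 'cV[R]_2).

Lemma sum_I2 (V : nmodType) (F : 'I_2 -> V) : \sum_i F i = F o0 + F o1.
Proof.
rewrite big_ord_recl big_ord_recl big_ord0 addr0; congr (F _ + F _).
exact: val_inj.
Qed.

Lemma I2P (P : 'I_2 -> Prop) : P o0 -> P o1 -> forall i, P i.
Proof.
move=> h0 h1 i; have [->//|h] : i = o0 \/ i = o1.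
  by case: i => [[|[|]]] //= h; [left|right]; exact: val_inj.
by rewrite h.
Qed.

Lemma cof2 M : [/\ cof M o0 o0 = M o1 o1, cof M o0 o1 = - M o1 o0, cof M o1 o0 = - M o0 o1 & cof M o1 o1 = M o0 o0].
Proof.
have l0 : lift o0 ord0 = o1 :> 'I_2 by exact: val_inj.
have l1 : lift o1 ord0 = o0 :> 'I_2 by exact: val_inj.
by split; rewrite mxE /cofactor det_mx11 !mxE ?l0 ?l1 /= ?addn0 ?add0n ?expr0 ?expr1 ?mul1r ?mulN1r// sqrrN expr1n mul1r.
Qed.

Lemma det2 M : \det M = M o0 o0 * M o1 o1 - M o0 o1 * M o1 o0.
Proof.
have [c1 c2 c3 c4] := cof2 M; rewrite (expand_det_row _ o0) sum_I2.
by move: c1 c2; rewrite !mxE => -> ->; ring.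
Qed.

Lemma dot2 g n : dot g n = g o0 ord0 * n o0 ord0 + g o1 ord0 * n o1 ord0.
Proof. by rewrite /dot mxE sum_I2 !mxE. Qed.

Lemma mulmx2 M g : (M *m g) o0 ord0 = M o0 o0 * g o0 ord0 + M o0 o1 * g o1 ord0 /\
  (M *m g) o1 ord0 = M o1 o0 * g o0 ord0 + M o1 o1 * g o1 ord0.
Proof. by rewrite !mxE !sum_I2. Qed.

End Mx2.

Lemma dpartS (R : realType) i l (f : R * R -> R) : dpart (i :: l) f = dpart [:: i] (dpart l f).
Proof. by []. Qed.

Lemma vecE (R : realType) (x : R * R) : vec x o0 ord0 = x.1 /\ vec x o1 ord0 = x.2.
Proof. by rewrite !mxE. Qed.

(** * Regrouping element boundaries by edges; the jump term *)

Section Regroup.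
Variable R : realType.
Variable k : nat.
Hypothesis k0 : (0 < k)%N.
Local Notation pt := (R * R)%type.
Implicit Types (a b c p q r x y z nu : pt) (w v phi : pt -> R).
Variables (Om : set pt) (s : seq pt) (T : mesh R).
Hypothesis OmE : Om = (hull s)°.
Hypothesis Om0 : Om !=set0.
Hypothesis conf : conforming Om T.
Local Notation A i := (va (nth_tri (T := T) i)).
Local Notation B i := (vb (nth_tri (T := T) i)).
Local Notation C i := (vc (nth_tri (T := T) i)).

(** Orientation of the edge as seen from the element, read off at the centroid exactly as in
    [outward_normal]; it needs neither the third vertex nor the numbering of the element. *)
Definition sgc (i : 'I_(size T)) p q : R := Num.sg (jac p q (centroid (nth_tri i))).

Lemma centroidE (i : 'I_(size T)) : centroid (nth_tri i) = A i + 3^-1 *: (B i - A i) + 3^-1 *: (C i - A i).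
Proof.
rewrite /centroid !big_ord_recl big_ord0 addr0 !(tnth_nth 0) /=.
by apply: pairE; rewrite /= !scaleRE /va /vb /vc; field.
Qed.

Lemma sgc_vtx i p q r : vtx i p q r -> sgc i p q = Num.sg (jac p q r).
Proof.
move=> [h J m]; have Ji := jacT conf i.
have hc : (hull [:: p; q; r])° (centroid (nth_tri i)).
  rewrite -h hull_triE centroidE; apply/(hull_intP _ Ji).
  by have [-> -> ->] := bary_aff 3^-1 3^-1 Ji; split; lra.
have := hc => /(hull_intP _ J)[_ _]; rewrite /bary /sgc => H.
have J1 : jac (centroid (nth_tri i)) p q = jac p q (centroid (nth_tri i)) by rewrite -jac_cyc.
have J2 : jac r p q = jac p q r by rewrite -jac_cyc.
rewrite J1 J2 in H; rewrite -[jac p q (centroid _)](divfK J) sgrM gtr0_sg ?mul1r//.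
Qed.

Lemma sgc_swap i p q : sgc i q p = - sgc i p q.
Proof. by rewrite /sgc jac_swap sgrN. Qed.

Lemma sgc_tri i : [/\ sgc i (A i) (B i) = Num.sg (jac (A i) (B i) (C i)),
   sgc i (B i) (C i) = Num.sg (jac (A i) (B i) (C i)) & sgc i (C i) (A i) = Num.sg (jac (A i) (B i) (C i))].
Proof.
have v0 := vtx0 conf i; have v1 := vtx_rot v0; have v2 := vtx_rot v1.
by rewrite (sgc_vtx v0) (sgc_vtx v1) (sgc_vtx v2) (jac_cyc (B i) (C i) (A i)) (jac_cyc (A i) (B i) (C i)).
Qed.

Lemma sgc_opp i j p q r r' : vtx i p q r -> vtx j p q r' -> i != j -> sgc j p q = - sgc i p q.
Proof.
move=> vi vj ij; rewrite (sgc_vtx vi) (sgc_vtx vj); have := opposite_sides conf vi vj ij; set x := jac p q r; set y := jac p q r' => xy.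
have [x0|x0|x0] := ltgtP x 0; last by rewrite x0 mul0r ltxx in xy.
  have y0 : 0 < y by rewrite nmulr_rlt0 in xy.
  by rewrite (gtr0_sg y0) (ltr0_sg x0) opprK.
have y0 : y < 0 by rewrite pmulr_rlt0 in xy.
by rewrite (ltr0_sg y0) (gtr0_sg x0).
Qed.

Lemma vtx_mem (i : 'I_(size T)) p q r : vtx i p q r -> p \in (nth_tri i : seq pt) /\ q \in (nth_tri i : seq pt).
Proof. by move=> [_ _ m]; rewrite !m !inE !eqxx orbT. Qed.

Lemma tri_HT (i : 'I_(size T)) p : p \in (nth_tri i : seq pt) -> HT i p.
Proof. by move=> /vtx_cases[] ->; [exact: hull3_v1|exact: hull3_v2|exact: hull3_v3]. Qed.

Lemma shared_mem (i j : 'I_(size T)) : size (shared_vertices (nth_tri i) (nth_tri j)) == 2%N ->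
  let s := shared_vertices (nth_tri i) (nth_tri j) in let p := nth 0 s 0 in let q := nth 0 s 1 in
  [/\ p \in (nth_tri i : seq pt), q \in (nth_tri i : seq pt), p \in (nth_tri j : seq pt), q \in (nth_tri j : seq pt) & p != q].
Proof.
move=> /eqP e /=; set l := shared_vertices _ _ in e *.
have u : uniq l.
  apply: filter_uniq; have [h1 h2 h3] := jac_neq (jacT conf i).
  by rewrite triE /= !inE h2 negb_or h1 h3.
have [m0 m1] : nth 0 l 0 \in l /\ nth 0 l 1 \in l by split; apply: mem_nth; rewrite e.
move: (m0) (m1); rewrite !mem_filter => /andP[-> ->] /andP[-> ->]; split=> //.
by rewrite nth_uniq// e.
Qed.

Section Edges.
Variable Psi : 'I_(size T) -> pt -> pt -> pt -> pt -> R.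
Hypothesis Psym : forall i p q nu, Psi i q p nu = Psi i p q nu.
Hypothesis Pbdry : forall i p q r nu x, vtx i p q r -> (forall x, hull [:: p; q] x -> bdry Om x) ->
  hull [:: p; q] x -> Psi i p q nu x = 0.
Hypothesis Pcont : forall i p q nu, cont (HT i) (Psi i p q nu).

Let X i p q := if (p \in (nth_tri i : seq pt)) && (q \in (nth_tri i : seq pt)) then
  seg p q (Psi i p q (enu (sgc i p q) p q)) else 0.

Lemma enu_sym i p q : enu (sgc i q p) q p = enu (sgc i p q) p q.
Proof. by rewrite sgc_swap; apply: pairE; rewrite /enu /=; ring. Qed.

Lemma hull2_seg p q (t : R) : 0 <= t <= 1 -> hull [:: p; q] (p + t *: (q - p)).
Proof.
move=> /andP[t0 t1]; apply/hull2P; exists (1 - t), t; split; [split|ring|]; rewrite ?subr_ge0//.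
by apply: pairE; rewrite /= !scaleRE; ring.
Qed.

(** [edge_sum] applied to fluxes. Reversing the edge changes both the edge vector and the
    orientation sign, so the normal stays the same. The auxiliary [X] is set to 0 when [p] or [q] is
    not a vertex, which makes it symmetric for all pairs of points. *)
Lemma edge_regroup :
  \sum_(i < size T) \sum_(j < size T | (i < j)%N && (size (shared_vertices (nth_tri i) (nth_tri j)) == 2%N))
    (let s := shared_vertices (nth_tri i) (nth_tri j) in let p := nth 0 s 0 in let q := nth 0 s 1 in
     seg p q (Psi i p q (enu (sgc i p q) p q)) + seg p q (Psi j p q (enu (sgc j p q) p q))) =
  \sum_(i < size T) edge3 (Num.sg (jac (A i) (B i) (C i))) (fun p q nu => seg p q (Psi i p q nu)) (A i) (B i) (C i).
Proof.
have Xsym i p q : X i p q = X i q p.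
  rewrite /X andbC; case: ifP => // /andP[qi pi].
  rewrite enu_sym Psym.
  by rewrite (@seg_sym _ q p _ (HT i))//; [exact: cvx_hull|exact: tri_HT..].
have Xb i p q r : vtx i p q r -> (forall x, hull [:: p; q] x -> bdry Om x) -> X i p q = 0.
  move=> vi hb; have [pi qi] := vtx_mem vi; rewrite /X pi qi /=.
  rewrite (seg_eq (G := fun=> 0)); first by rewrite /seg Rintegral_cst// mul0r.
  by move=> t ht; apply: (Pbdry _ vi hb); exact: hull2_seg.
transitivity (\sum_(i < size T) (X i (A i) (B i) + X i (B i) (C i) + X i (C i) (A i))).
  rewrite -(edge_sum OmE conf Xsym Xb); apply: eq_bigr => i _; apply: eq_bigr => j /andP[_ /shared_mem[pi qi pj qj _]].
  by rewrite /X pi qi pj qj.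
apply: eq_bigr => i _; have [s1 s2 s3] := sgc_tri i.
have [m1 m2 m3] : [/\ A i \in (nth_tri i : seq pt), B i \in (nth_tri i : seq pt) & C i \in (nth_tri i : seq pt)].
  by rewrite triE !inE !eqxx !orbT.
by rewrite /X m1 m2 m3 /= s1 s2 s3.
Qed.

(** Neighbours have opposite normals on their common edge: a flux that is single valued there and
    odd in the normal drops out of the sum over all elements. *)
Lemma edge_cancel :
  (forall i j p q r r' nu x, vtx i p q r -> vtx j p q r' -> i != j -> hull [:: p; q] x -> Psi i p q nu x = Psi j p q nu x) ->
  (forall i p q (sg : R) x, Psi i p q (enu (- sg) p q) x = - Psi i p q (enu sg p q) x) ->
  \sum_(i < size T) edge3 (Num.sg (jac (A i) (B i) (C i))) (fun p q nu => seg p q (Psi i p q nu)) (A i) (B i) (C i) = 0.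
Proof.
move=> Pm Po; rewrite -edge_regroup; apply: big1 => i _; apply: big1 => j /andP[ij /shared_mem[]].
set p := nth _ _ 0; set q := nth _ _ 1 => pi qi pj qj pq /=; rewrite -/p -/q.
have ij' : i != j by apply: contraTN ij => /eqP ->; rewrite ltnn.
have [r vi] := vtx_of conf pi qi pq; have [r' vj] := vtx_of conf pj qj pq.
rewrite (sgc_opp vi vj ij').
rewrite [X in _ + X](seg_eq (G := fun x => -1 * Psi i p q (enu (sgc i p q) p q) x)); last first.
  by move=> t ht; rewrite Po mulN1r (Pm i j p q r r')//; exact: hull2_seg.
have cP : cont (HT i) (Psi i p q (enu (sgc i p q) p q)) by exact: Pcont.
have cH : cvx (HT i) by exact: cvx_hull.
have := segL (-1) 0 cH (tri_HT pi) (tri_HT qi) cP cP.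
rewrite mul0r addr0 (@seg_ext _ p q _ (fun x => -1 * Psi i p q (enu (sgc i p q) p q) x)) => [->|x].
  by rewrite mulN1r subrr.
by rewrite mul0r addr0.
Qed.

End Edges.

Lemma pol_dparts n (f : pt -> R) l : pol n f -> exists m, pol m (dpart l f).
Proof.
move=> hf; elim: l => [|i l [m hm]]; first by exists n.
by exists m.-1; rewrite dpartS; exact: (pol_dpart i hm).
Qed.

Lemma open_int i : open (HT (T := T) i)°. Proof. exact: open_interior. Qed.

Lemma int_neq0 i : (HT (T := T) i)° !=set0.
Proof.
exists (centroid (nth_tri i)); rewrite centroidE; apply/(hull_intP _ (jacT conf i)).
by have [-> -> ->] := bary_aff 3^-1 3^-1 (jacT conf i); split; lra.
Qed.

Lemma closure_HT i : closure (HT (T := T) i)° = HT i.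
Proof. by apply: closure_hull => //; exact: int_neq0. Qed.

Lemma dpart_loc v (i : 'I_(size T)) l x : Vh Om T k v -> (HT i)° x -> dpart l v x = dpart l (loc k v i) x.
Proof.
move=> Vv hx; apply: (@dpart_local _ _ v (loc k v i) l (open_int (i:=i)) _ x hx) => y /interior_subset hy.
exact: (vh_loc k0 conf Vv hy).
Qed.

Lemma trace_loc v (i : 'I_(size T)) l x : Vh Om T k v -> HT i x -> trace_from (hull (nth_tri i))° (dpart l v) x = dpart l (loc k v i) x.
Proof.
move=> Vv hx; rewrite HTE; have [m hm] := pol_dparts l (loc_pol k conf v i).
apply: (@trace_fromE _ (HT i)° (dpart l v) (dpart l (loc k v i)) x).
- exact: (pol_cont (D := closure (HT i)°) hm).
- by move=> y hy; rewrite (dpart_loc l Vv hy).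
- by rewrite closure_HT.
Qed.

Lemma tangential n (f f' : pt -> R) p t : pol n f -> pol n f' -> (forall l : R, f (p + l *: t) = f' (p + l *: t)) ->
  forall l : R, let D (f : pt -> R) x := dpart [:: o0] f x * t.1 + dpart [:: o1] f x * t.2 in
   D f (p + l *: t) = D f' (p + l *: t).
Proof.
move=> hf hf' e l D.
have d1 := path_is_derive (pol_is_derive hf (p + l *: t) t).
have d2 := path_is_derive (pol_is_derive hf' (p + l *: t) t).
have E : (fun l : R => f (p + l *: t)) = (fun l : R => f' (p + l *: t)) by apply/funext.
rewrite E in d1; have [_ e1] := d1; have [_ e2] := d2.
by rewrite /D -e1 e2.
Qed.

Lemma dpart_lin (i : 'I_2) (l m : R) n (f g : pt -> R) : pol n f -> pol n g ->
  dpart [:: i] (fun y => l * f y + m * g y) = fun y => l * dpart [:: i] f y + m * dpart [:: i] g y.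
Proof.
move=> hf hg; have h0 := pol_is_derive hf; have h1 := pol_is_derive hg.
have gen (f0 f1 g0 g1 : pt -> R) : (forall x y, is_derive x y f (f0 x * y.1 + f1 x * y.2)) ->
    (forall x y, is_derive x y g (g0 x * y.1 + g1 x * y.2)) ->
    dpart [:: o0] (fun y => l * f y + m * g y) = (fun y => l * f0 y + m * g0 y) /\
    dpart [:: o1] (fun y => l * f y + m * g y) = (fun y => l * f1 y + m * g1 y).
  move=> df dg; apply: dpart_of => x y.
  have dd := is_deriveD (is_deriveZ l (df x y)) (is_deriveZ m (dg x y)).
  by apply: is_derive_eq dd _; rewrite !scaleRE; ring.
by have [e0 e1] := gen _ _ _ _ h0 h1; elim/I2P: i.
Qed.

Lemma tangential2 n (f f' : pt -> R) p q : pol n f -> pol n f' ->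
  (forall l : R, f (p + l *: (q - p)) = f' (p + l *: (q - p))) ->
  forall l : R, let x := p + l *: (q - p) in
   nnf (q - p) (dpart [:: o0] f) (dpart [:: o1] f) x = nnf (q - p) (dpart [:: o0] f') (dpart [:: o1] f') x /\
   ttf p q (dpart [:: o0; o0] f) (dpart [:: o0; o1] f) (dpart [:: o1; o1] f) x =
   ttf p q (dpart [:: o0; o0] f') (dpart [:: o0; o1] f') (dpart [:: o1; o1] f') x.
Proof.
move=> hf hf' e l x; set t := q - p.
have D1 := tangential hf hf' e.
have N (g : pt -> R) y : nnf t (dpart [:: o0] g) (dpart [:: o1] g) y = dpart [:: o0] g y * t.1 + dpart [:: o1] g y * t.2.
  by rewrite /nnf mulrC (mulrC t.2).
split; first by rewrite !N; exact: D1.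
have P (g : pt -> R) : pol n g -> pol n.-1 (fun y => t.1 * dpart [:: o0] g y + t.2 * dpart [:: o1] g y).
  by move=> hg; apply: polD; apply: polZ; exact: pol_dpart.
have Q (g : pt -> R) y : pol n g -> ttf p q (dpart [:: o0; o0] g) (dpart [:: o0; o1] g) (dpart [:: o1; o1] g) y =
   dpart [:: o0] (fun y => t.1 * dpart [:: o0] g y + t.2 * dpart [:: o1] g y) y * t.1 +
   dpart [:: o1] (fun y => t.1 * dpart [:: o0] g y + t.2 * dpart [:: o1] g y) y * t.2.
  move=> hg; rewrite !(dpart_lin _ t.1 t.2 (pol_dpart o0 hg) (pol_dpart o1 hg)).
  have gen (g1 g2 g3 g4 : R) : g2 = g3 ->
    t.1 ^+ 2 * g1 + 2 * t.1 * t.2 * g3 + t.2 ^+ 2 * g4 = (t.1 * g1 + t.2 * g3) * t.1 + (t.1 * g2 + t.2 * g4) * t.2.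
    by move=> ->; ring.
  exact: (gen _ _ _ _ (congr1 (fun f => f y) (pol_schwarz hg))).
have H (l' : R) : t.1 * dpart [:: o0] f (p + l' *: t) + t.2 * dpart [:: o1] f (p + l' *: t) =
    t.1 * dpart [:: o0] f' (p + l' *: t) + t.2 * dpart [:: o1] f' (p + l' *: t).
  by rewrite mulrC (mulrC t.2) (mulrC t.1) (mulrC t.2); exact: (D1 l').
have K := tangential (P f hf) (P f' hf') H l.
exact: (etrans (Q f _ hf) (etrans K (esym (Q f' _ hf')))).
Qed.

(** Normal derivative times tangential second derivative. The factor in front normalizes the
    tangent, which occurs twice; the length left in [nu] is the arc length element. *)
Definition Psi_loc v (phi : pt -> R) (i : 'I_(size T)) p q nu x := (nrm2 (q - p))^-1 *
  (nnf nu (dpart [:: o0] (loc k v i)) (dpart [:: o1] (loc k v i)) x *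
   ttf p q (dpart [:: o0; o0] (loc k v i)) (dpart [:: o0; o1] (loc k v i)) (dpart [:: o1; o1] (loc k v i)) x) * loc k phi i x.

Lemma edge_loc v (i j : 'I_(size T)) p q r r' (t : R) : vtx i p q r -> vtx j p q r' -> i != j ->
  loc k v i (p + t *: (q - p)) = loc k v j (p + t *: (q - p)).
Proof.
move=> vi vj ij; rewrite (loc_vtx k0 conf v vi) (loc_vtx k0 conf v vj).
by have [_ J _] := vi; have [_ J' _] := vj; rewrite !LI_edge.
Qed.

Lemma nrm2_gt0 p q : p != q -> 0 < nrm2 (q - p).
Proof.
move=> pq; rewrite lt_neqAle eq_sym addr_ge0 ?sqr_ge0// andbT; apply: contra pq.
rewrite /nrm2 paddr_eq0 ?sqr_ge0// !sqrf_eq0 !subr_eq0 => /andP[/eqP e1 /eqP e2].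
by apply/eqP/pairE.
Qed.

Lemma outward_dot (l : 'I_(size T)) (g : 'cV[R]_2) p q : dot g (outward_normal (nth_tri l) p q) =
   (sgc l p q / eucl_dist p q) * (g o0 ord0 * (q - p).2 - g o1 ord0 * (q - p).1).
Proof.
have [v1 v2] := vecE (q.2 - p.2, p.1 - q.1); have [v3 v4] := vecE (centroid (nth_tri l) - p).
rewrite dot2 /outward_normal dot2 v1 v2 v3 v4 ![(_ *: _ : 'cV_2) _ _]mxE v1 v2 /=.
have -> : - Num.sg ((q.2 - p.2) * ((centroid (nth_tri l)).1 - p.1) + (p.1 - q.1) * ((centroid (nth_tri l)).2 - p.2)) = sgc l p q.
  by rewrite -sgrN /sgc; congr (Num.sg _); rewrite /jac; ring.
ring.
Qed.

(** The jump of the gradient is orthogonal to the edge, hence a multiple of the turned edge vector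
    ([E1], [E2]). Inserted in the averaged cofactor flux, it selects the tangential second
    derivative, which has the same value from both sides. *)
Lemma jump_algebra (d sg ph g1 g2 k1 k2 a11 a12 a22 b11 b12 b22 : R) p q : d != 0 -> nrm2 (q - p) != 0 ->
  (q - p).1 * g1 + (q - p).2 * g2 = (q - p).1 * k1 + (q - p).2 * k2 ->
  (q - p).1 ^+ 2 * a11 + 2 * (q - p).1 * (q - p).2 * a12 + (q - p).2 ^+ 2 * a22 =
  (q - p).1 ^+ 2 * b11 + 2 * (q - p).1 * (q - p).2 * b12 + (q - p).2 ^+ 2 * b22 ->
  d * ((sg / d * ((2^-1 * (a22 + b22) * g1 + 2^-1 * (- a12 + - b12) * g2) * (q - p).2 -
     (2^-1 * (- a12 + - b12) * g1 + 2^-1 * (a11 + b11) * g2) * (q - p).1) +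
    - sg / d * ((2^-1 * (a22 + b22) * k1 + 2^-1 * (- a12 + - b12) * k2) * (q - p).2 -
     (2^-1 * (- a12 + - b12) * k1 + 2^-1 * (a11 + b11) * k2) * (q - p).1)) * ph) =
  (nrm2 (q - p))^-1 * (((enu sg p q).1 * g1 + (enu sg p q).2 * g2) *
    ((q - p).1 ^+ 2 * a11 + 2 * (q - p).1 * (q - p).2 * a12 + (q - p).2 ^+ 2 * a22)) * ph +
  (nrm2 (q - p))^-1 * (((enu (- sg) p q).1 * k1 + (enu (- sg) p q).2 * k2) *
    ((q - p).1 ^+ 2 * b11 + 2 * (q - p).1 * (q - p).2 * b12 + (q - p).2 ^+ 2 * b22)) * ph.
Proof.
rewrite /enu /nrm2; move: (q - p).1 (q - p).2 => t1 t2 /= d0 N0 T1 T2.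
have W : (g1 - k1) * t1 = - ((g2 - k2) * t2) by lra.
(* The component of the gradient jump along the normal, times the length of the edge. *)
pose w := (g1 - k1) * t2 - (g2 - k2) * t1.
have E1 : (t1 ^+ 2 + t2 ^+ 2) * (g1 - k1) = t2 * w.
  have W1 : (g1 - k1) * t1 * t1 = - ((g2 - k2) * t2) * t1 by rewrite W.
  by rewrite /w; lra.
have E2 : (t1 ^+ 2 + t2 ^+ 2) * (g2 - k2) = - t1 * w.
  have W2 : (g1 - k1) * t1 * t2 = - ((g2 - k2) * t2) * t2 by rewrite W.
  by rewrite /w; lra.
set S := _ + _ + _ in T2 *; rewrite -T2.
have -> : d * ((sg / d * ((2^-1 * (a22 + b22) * g1 + 2^-1 * (- a12 + - b12) * g2) * t2 -
     (2^-1 * (- a12 + - b12) * g1 + 2^-1 * (a11 + b11) * g2) * t1) +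
    - sg / d * ((2^-1 * (a22 + b22) * k1 + 2^-1 * (- a12 + - b12) * k2) * t2 -
     (2^-1 * (- a12 + - b12) * k1 + 2^-1 * (a11 + b11) * k2) * t1)) * ph) =
   sg * ph * ((t1 ^+ 2 + t2 ^+ 2)^-1 * (2^-1 * ((a22 + b22) * ((t1 ^+ 2 + t2 ^+ 2) * (g1 - k1)) * t2 - (a12 + b12) * ((t1 ^+ 2 + t2 ^+ 2) * (g2 - k2)) * t2 +
     (a12 + b12) * ((t1 ^+ 2 + t2 ^+ 2) * (g1 - k1)) * t1 - (a11 + b11) * ((t1 ^+ 2 + t2 ^+ 2) * (g2 - k2)) * t1))).
  by field; rewrite N0 d0.
rewrite E1 E2.
transitivity (sg * ph * ((t1 ^+ 2 + t2 ^+ 2)^-1 * w * (2^-1 * (S + (t1 ^+ 2 * b11 + 2 * t1 * t2 * b12 + t2 ^+ 2 * b22))))).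
  by rewrite /S; field.
by rewrite -T2 /w; field.
Qed.

(* On an interior edge the jump of the gradient is normal, so the averaged
   cofactor matrix only enters through its normal-normal entry, which is the
   tangential second derivative and is single valued. *)
Lemma jump_identity v phi i j p q r r' (t : R) : Vh Om T k v -> Vh Om T k phi ->
  vtx i p q r -> vtx j p q r' -> i != j -> 0 <= t <= 1 -> let x := p + t *: (q - p) in
  eucl_dist p q * (jump_cof (nth_tri i) (nth_tri j) p q v x * phi x) =
  Psi_loc v phi i p q (enu (sgc i p q) p q) x + Psi_loc v phi j p q (enu (sgc j p q) p q) x.
Proof.
move=> Vv Vp vi vj ij ht x.
have [pi qi] := vtx_mem vi; have [pj qj] := vtx_mem vj.
have hx (l : 'I_(size T)) : p \in (nth_tri l : seq pt) -> q \in (nth_tri l : seq pt) -> HT l x.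
  by move=> pl ql; move: ht => /andP[t0 t1]; apply: cvx_hull => //; exact: tri_HT.
have hi := hx i pi qi; have hj := hx j pj qj.
have ephi : phi x = loc k phi i x by exact: (vh_loc k0 conf Vp hi).
have ephj : loc k phi i x = loc k phi j x by exact: (edge_loc phi t vi vj ij).
have pq : p != q by have [_ J _] := vi; have [] := jac_neq J.
have N1 := nrm2_gt0 pq.
have D0 : eucl_dist p q != 0.
  by rewrite /eucl_dist dot2 (vecE _).1 (vecE _).2 gt_eqF// sqrtr_gt0 -!expr2.
have tr l m (z : 'I_(size T)) : HT z x -> hess_from (hull (nth_tri z))° v x l m = dpart [:: l; m] (loc k v z) x.
  by move=> hz; rewrite mxE (trace_loc [:: l; m] Vv hz).
have gr l (z : 'I_(size T)) : HT z x -> grad_from (hull (nth_tri z))° v x l ord0 = dpart [:: l] (loc k v z) x.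
  by move=> hz; rewrite mxE (trace_loc [:: l] Vv hz).
have tri l m := tr l m i hi; have trj l m := tr l m j hj.
have gri l := gr l i hi; have grj l := gr l j hj => {tr gr}.
rewrite /jump_cof !outward_dot; set E := 2^-1 *: _; have [c1 c2 c3 c4] := cof2 (hess_from (hull (nth_tri i))° v x).
have [d1 d2 d3 d4] := cof2 (hess_from (hull (nth_tri j))° v x).
have sE l m : E l m = 2^-1 * (cof (hess_from (hull (nth_tri i))° v x) l m + cof (hess_from (hull (nth_tri j))° v x) l m).
  by rewrite !mxE.
rewrite !(mulmx2 _ _).1 !(mulmx2 _ _).2 !sE c1 c2 c3 c4 d1 d2 d3 d4 !tri !trj !gri !grj.
rewrite (pol_schwarz (loc_pol k conf v i)) (pol_schwarz (loc_pol k conf v j)).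
rewrite (sgc_opp vi vj ij) ephi /Psi_loc -ephj.
have [T1 T2] := tangential2 (loc_pol k conf v i) (loc_pol k conf v j) (fun l => edge_loc v l vi vj ij) t.
have H := jump_algebra (sgc i p q) (loc k phi i x) D0 (lt0r_neq0 N1) T1 T2.
by rewrite /nnf /ttf; exact: H.
Qed.

End Regroup.

Lemma is_derive_basis (R : realType) (f : R * R -> R) x (g0 g1 : R) :
  (forall y, is_derive x y f (g0 * y.1 + g1 * y.2)) ->
  is_derive x (basis2 R o0) f g0 /\ is_derive x (basis2 R o1) f g1.
Proof.
move=> h; split; [apply: is_derive_eq (h (basis2 R o0)) _|apply: is_derive_eq (h (basis2 R o1)) _];
  by rewrite /basis2 /= ?mulr1 ?mulr0 ?addr0 ?add0r.
Qed.

(** * Linearity of the forms; the error identity on one element *)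

Section Linear.
Variable R : realType.
Local Notation pt := (R * R)%type.
Implicit Types (a b c p q x y z nu : pt).

Lemma edge3_lin a b c (sg l m : R) (P Q S : pt -> pt -> pt -> pt -> R) :
  (forall p q nu, cont (hull [:: a; b; c]) (P p q nu)) -> (forall p q nu, cont (hull [:: a; b; c]) (Q p q nu)) ->
  (forall p q nu x, S p q nu x = l * P p q nu x + m * Q p q nu x) ->
  edge3 sg (fun p q nu => seg p q (S p q nu)) a b c =
  l * edge3 sg (fun p q nu => seg p q (P p q nu)) a b c + m * edge3 sg (fun p q nu => seg p q (Q p q nu)) a b c.
Proof.
move=> cP cQ e; set H := hull [:: a; b; c] in cP cQ.
have [ha hb hc] : [/\ H a, H b & H c] by split; [exact: hull3_v1|exact: hull3_v2|exact: hull3_v3].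
have cH : cvx H by exact: cvx_hull.
have E p q nu : H p -> H q -> seg p q (S p q nu) = l * seg p q (P p q nu) + m * seg p q (Q p q nu).
  by move=> hp hq; rewrite -(segL _ _ cH hp hq (cP p q nu) (cQ p q nu)); apply: seg_ext.
by rewrite /edge3 !E//; ring.
Qed.

Lemma ell_lin a b c (l m : R) (X Y Z X' Y' Z' f f1 f2 f11 f12 f22 : pt -> R) : let H := hull [:: a; b; c] in
  cont H X -> cont H Y -> cont H Z -> cont H X' -> cont H Y' -> cont H Z' ->
  cont H f1 -> cont H f2 -> cont H f11 -> cont H f12 -> cont H f22 ->
  ell a b c (fun x => l * X x + m * X' x) (fun x => l * Y x + m * Y' x) (fun x => l * Z x + m * Z' x) f f1 f2 f11 f12 f22 =
  l * ell a b c X Y Z f f1 f2 f11 f12 f22 + m * ell a b c X' Y' Z' f f1 f2 f11 f12 f22.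
Proof.
move=> H cX cY cZ cX' cY' cZ' c1 c2 c11 c12 c22.
have [ha hb hc] : [/\ H a, H b & H c] by split; [exact: hull3_v1|exact: hull3_v2|exact: hull3_v3].
have cH : cvx H by exact: cvx_hull.
have E p q nu : H p -> H q -> eform (fun x => l * X x + m * X' x) (fun x => l * Y x + m * Y' x) (fun x => l * Z x + m * Z' x) f f1 f2 p q nu =
    l * eform X Y Z f f1 f2 p q nu + m * eform X' Y' Z' f f1 f2 p q nu.
  move=> hp hq; rewrite /eform.
  rewrite (@seg_ext _ p q (fun x => ((l * Y x + m * Y' x) * nu.2 - (l * Z x + m * Z' x) * nu.1) * f1 x + ((l * Y x + m * Y' x) * nu.1 - (l * X x + m * X' x) * nu.2) * f2 x)
     (fun x => l * ((Y x * nu.2 - Z x * nu.1) * f1 x + (Y x * nu.1 - X x * nu.2) * f2 x) + m * ((Y' x * nu.2 - Z' x * nu.1) * f1 x + (Y' x * nu.1 - X' x * nu.2) * f2 x))); last by move=> x; ring.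
  rewrite (@seg_ext _ p q (fun x => Mf (q - p) nu (l * X x + m * X' x) (l * Y x + m * Y' x) (l * Z x + m * Z' x) * (f1 x * (q - p).1 + f2 x * (q - p).2))
    (fun x => l * (Mf (q - p) nu (X x) (Y x) (Z x) * (f1 x * (q - p).1 + f2 x * (q - p).2)) + m * (Mf (q - p) nu (X' x) (Y' x) (Z' x) * (f1 x * (q - p).1 + f2 x * (q - p).2)))); last by move=> x; rewrite /Mf; ring.
  rewrite (segL _ _ cH hp hq); [|by contt..].
  rewrite (segL _ _ cH hp hq); [|by rewrite /Mf; contt..].
  rewrite /Mf; ring.
rewrite /ell /edge3 !E//.
rewrite (@IK_eq _ a b c (fun x => 2 * (l * Y x + m * Y' x) * f12 x - (l * Z x + m * Z' x) * f11 x - (l * X x + m * X' x) * f22 x)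
  (fun x => l * (2 * Y x * f12 x - Z x * f11 x - X x * f22 x) + m * (2 * Y' x * f12 x - Z' x * f11 x - X' x * f22 x))); last by move=> x _; ring.
rewrite IKD; [|by contt..].
rewrite IKZ; [|by contt]; rewrite IKZ; [|by contt].
ring.
Qed.

Lemma jet3B D (w w1 w2 w11 w12 w22 y y1 y2 y11 y12 y22 : pt -> R) :
  jet3 D w w1 w2 w11 w12 w22 -> jet3 D y y1 y2 y11 y12 y22 ->
  jet3 D (fun x => w x - y x) (fun x => w1 x - y1 x) (fun x => w2 x - y2 x) (fun x => w11 x - y11 x) (fun x => w12 x - y12 x) (fun x => w22 x - y22 x).
Proof.
move=> [[h1 h2 h3] [X [Y [Z [W [h4 h5 h6]]]]]] [[g1 g2 g3] [X' [Y' [Z' [W' [g4 g5 g6]]]]]].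
split; first by split; exact: C1onB.
by exists (fun x => X x - X' x), (fun x => Y x - Y' x), (fun x => Z x - Z' x), (fun x => W x - W' x); split; exact: C1onB.
Qed.

(* The algebra of [A_identity] on one element: [p] is the discrete function,
   [v] the exact solution and [w = p - v] the error. *)
Lemma local_identity a b c (f p p1 p2 p11 p12 p22 v v1 v2 v11 v12 v22 h h1 h2 h11 h12 h22 : pt -> R) : jac a b c != 0 ->
  let H := hull [:: a; b; c] in let sg := Num.sg (jac a b c) in
  jet3 H p p1 p2 p11 p12 p22 -> jet3 H v v1 v2 v11 v12 v22 -> jet2 H h h1 h2 h11 h12 h22 -> cont H f ->
  (forall x, H° x -> f x = v11 x * v22 x - v12 x ^+ 2) ->
  let w1 x := p1 x - v1 x in let w2 x := p2 x - v2 x in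
  IK a b c (fun x => (f x - (p11 x * p22 x - p12 x * p12 x)) * h x) +
  edge3 sg (fun p q nu => seg p q (fun x => (nrm2 (q - p))^-1 * (nnf nu p1 p2 x * ttf p q p11 p12 p22 x) * h x)) a b c =
  IK a b c (fun x => (v22 x * w1 x - v12 x * w2 x) * h1 x + (v11 x * w2 x - v12 x * w1 x) * h2 x) +
  ell a b c (pX w1 w1) (pY w1 w2 w1 w2) (pZ w2 w2) h h1 h2 h11 h12 h22 +
  edge3 sg (fun p q nu => seg p q (fun x => (nrm2 (q - p))^-1 * (nnf nu v1 v2 x * ttf p q v11 v12 v22 x) * h x)) a b c +
  edge3 sg (fun p q nu => seg p q (fun x => (nrm2 (q - p))^-1 *
   (nnf nu v1 v2 x * ttf p q (fun x => p11 x - v11 x) (fun x => p12 x - v12 x) (fun x => p22 x - v22 x) x +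
    nnf (q - p) w1 w2 x * (nu.1 * ((q - p).1 * v11 x + (q - p).2 * v12 x) + nu.2 * ((q - p).1 * v12 x + (q - p).2 * v22 x))) * h x)) a b c.
Proof.
move=> J H sg jp jv jh cf fE w1 w2.
have jw := jet3B jp jv.
have I1 := ell_identity J jp jp jh; have I2 := ell_identity J jv jv jh; have I3 := ell_identity J jv jw jh.
have I4 := IK_cof J jv jw jh.
have [[[P0 P1 P2 _] [_ P11 P12 _] [_ _ P22 _]] _] := jp.
have [[[V0 V1 V2 _] [_ V11 V12 _] [_ _ V22 _]] _] := jv.
have [[H0 H1 H2 _] [_ H11 H12 _] [_ _ H22 _]] := jh.
rewrite -/sg in I1 I2 I3 I4; rewrite -/w1 -/w2 in I3 I4.
have W1 : cont H w1 by rewrite /w1; contt.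
have W2 : cont H w2 by rewrite /w2; contt.
have L1 := @ell_lin a b c 1 1 (fun x => 1 * pX v1 v1 x + 2 * pX v1 w1 x) (fun x => 1 * pY v1 v2 v1 v2 x + 2 * pY v1 v2 w1 w2 x) (fun x => 1 * pZ v2 v2 x + 2 * pZ v2 w2 x)
  (pX w1 w1) (pY w1 w2 w1 w2) (pZ w2 w2) h h1 h2 h11 h12 h22.
have L2 := @ell_lin a b c 1 2 (pX v1 v1) (pY v1 v2 v1 v2) (pZ v2 v2) (pX v1 w1) (pY v1 v2 w1 w2) (pZ v2 w2) h h1 h2 h11 h12 h22.
(* With [p = v + w] the products split into [vv], [vw] and [ww]. The first part reproduces the
   integral of [f], the cross term becomes the linearized form by [ell_identity] and [IK_cof], and
   the last is the quadratic remainder. *)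
have EX : pX p1 p1 = fun x => 1 * (1 * pX v1 v1 x + 2 * pX v1 w1 x) + 1 * pX w1 w1 x by apply/funext => x; rewrite /pX /w1; ring.
have EY : pY p1 p2 p1 p2 = fun x => 1 * (1 * pY v1 v2 v1 v2 x + 2 * pY v1 v2 w1 w2 x) + 1 * pY w1 w2 w1 w2 x by apply/funext => x; rewrite /pY /w1 /w2; field.
have EZ : pZ p2 p2 = fun x => 1 * (1 * pZ v2 v2 x + 2 * pZ v2 w2 x) + 1 * pZ w2 w2 x by apply/funext => x; rewrite /pZ /w2; ring.
rewrite EX EY EZ L1 in I1; try (by rewrite /pX /pY /pZ; contt).
rewrite L2 in I1; try (by rewrite /pX /pY /pZ; contt).
clear L1 L2 EX EY EZ.
rewrite (@edge3_lin a b c sg 2 0 (fun p q nu x => (nrm2 (q - p))^-1 * (nnf nu p1 p2 x * ttf p q p11 p12 p22 x) * h x) (fun _ _ _ => fun=> 0)) in I1;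
  [|by move=> *; rewrite /nnf /ttf; contt|by move=> *; contt|by move=> *; ring].
rewrite (@edge3_lin a b c sg 2 0 (fun p q nu x => (nrm2 (q - p))^-1 * (nnf nu v1 v2 x * ttf p q v11 v12 v22 x) * h x) (fun _ _ _ => fun=> 0)) in I2;
  [|by move=> *; rewrite /nnf /ttf; contt|by move=> *; contt|by move=> *; ring].
have := @edge3_lin a b c sg 1 (-1) (fun p q nu x => (nrm2 (q - p))^-1 * (nnf nu v1 v2 x * ttf p q (fun x => p11 x - v11 x) (fun x => p12 x - v12 x) (fun x => p22 x - v22 x) x + nnf nu w1 w2 x * ttf p q v11 v12 v22 x) * h x)
  (fun p q nu x => (nrm2 (q - p))^-1 * (nnf nu w1 w2 x * ttf p q v11 v12 v22 x - ((q - p).1 * w1 x + (q - p).2 * w2 x) * (nu.1 * ((q - p).1 * v11 x + (q - p).2 * v12 x) + nu.2 * ((q - p).1 * v12 x + (q - p).2 * v22 x))) * h x)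
  (fun p q nu x => (nrm2 (q - p))^-1 *
   (nnf nu v1 v2 x * ttf p q (fun x => p11 x - v11 x) (fun x => p12 x - v12 x) (fun x => p22 x - v22 x) x +
    nnf (q - p) w1 w2 x * (nu.1 * ((q - p).1 * v11 x + (q - p).2 * v12 x) + nu.2 * ((q - p).1 * v12 x + (q - p).2 * v22 x))) * h x).
move=> -> ; [|by move=> *; rewrite /nnf /ttf; contt|by move=> *; rewrite /nnf /ttf; contt|by move=> *; rewrite /nnf; ring].
have F1 : IK a b c (fun x => (f x - (p11 x * p22 x - p12 x * p12 x)) * h x) =
   IK a b c (fun x => f x * h x) - 2^-1 * IK a b c (fun x => (p11 x * p22 x + p22 x * p11 x - 2 * p12 x * p12 x) * h x).
  rewrite -IKZ; last by contt.
  rewrite -IKB; [|by contt..].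
  by apply: IK_eq => x _; field.
have F2 : IK a b c (fun x => (v11 x * v22 x + v22 x * v11 x - 2 * v12 x * v12 x) * h x) = 2 * IK a b c (fun x => f x * h x).
  rewrite -IKZ; last by contt.
  by apply: IK_eq => x hx; rewrite fE//; ring.
rewrite F1; rewrite F2 in I2; clear F1 F2.
move: I1 I2 I3 I4.
move: (IK a b c _) (IK a b c _) (IK a b c _) (IK a b c _) => i1 i2 i3 i4; lra.
Qed.
End Linear.

(** * Broken gradients and the linearized form as sums over elements *)

Section Pw.
Variable R : realType.
Variable k : nat.
Hypothesis k0 : (0 < k)%N.
Local Notation pt := (R * R)%type.
Local Notation R2 := (mplane R).
Implicit Types (a b c p q r x y z nu : pt) (w v phi : pt -> R).
Variables (Om : set pt) (s : seq pt) (T : mesh R).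
Hypothesis OmE : Om = (hull s)°.
Hypothesis Om0 : Om !=set0.
Hypothesis conf : conforming Om T.
Local Notation A i := (va (nth_tri (T := T) i)).
Local Notation B i := (vb (nth_tri (T := T) i)).
Local Notation C i := (vc (nth_tri (T := T) i)).

Definition IKi (i : 'I_(size T)) (F : pt -> R) := IK (A i) (B i) (C i) F.

Lemma broken_int (F : pt -> R) (G : 'I_(size T) -> pt -> R) :
  (forall i, cont (HT i) (G i)) -> (forall i x, (HT i)° x -> F x = G i x) ->
  (area R).-integrable (broken Om T : set R2) (EFin \o (F : R2 -> R)) /\
  \int[area R]_(x in broken Om T) F x = \sum_i IKi i (G i).
Proof.
move=> cG e.
have mB : measurable (broken Om T : set R2).
  apply: open_measurable2; rewrite (brokenE OmE conf); apply: bigcup_open => i _; exact: open_interior.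
have mI (i : 'I_(size T)) : measurable ((HT i)° : set R2) by exact: IK_meas.
have iG i : (area R).-integrable setT (EFin \o (G i \_ (HT i)° : R2 -> R)).
  by rewrite -restrict_EFin; apply/integrable_restrict => //; rewrite setTI; apply: IK_integrable; exact: cG.
have [I1 I2] := @Rintegral_sum R _ R2 (area R) setT 'I_(size T) (index_enum _) (fun i => (G i \_ (HT i)° : R2 -> R)) measurableT iG.
have E : (fun x : R2 => \sum_i (G i \_ (HT i)°) x) = (F \_ (broken Om T) : R2 -> R).
  apply/funext => x; rewrite patchE; case: ifPn => [|nx].
    rewrite inE (brokenE OmE conf) => -[i _]; rewrite HTE => hx.
    rewrite (bigD1 i)//= patchE mem_set// big1 ?addr0 ?(e i)// => j ji.
    rewrite patchE memNset// => hj; have := tri_int_disj conf ji; rewrite !HTE => /seteqP[+ _] => /(_ x); apply.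
    by split=> //; exact: interior_subset.
  apply: big1 => i _; rewrite patchE memNset// => hi; move/negP: nx; apply; rewrite inE (brokenE OmE conf).
  by exists i => //; rewrite HTE.
split.
  move: I1; rewrite E -restrict_EFin => /integrable_restrict; rewrite setTI; exact.
rewrite Rintegral_mkcond -E I2; apply: eq_bigr => i _.
by rewrite /IKi /IK [RHS]Rintegral_mkcond.
Qed.

(** [W0] and [W1] are the pieces of the broken gradient, continuous up to the closed elements; they
    are tied to classical derivatives in the interiors. *)
Definition pw w (W0 W1 : 'I_(size T) -> pt -> R) := forall i,
  [/\ cont (HT i) (W0 i), cont (HT i) (W1 i) &
  forall x, (HT i)° x -> is_derive x (basis2 R o0) w (W0 i x) /\ is_derive x (basis2 R o1) w (W1 i x)].

Lemma pw_dpart w W0 W1 i x : pw w W0 W1 -> (HT i)° x -> dpart [:: o0] w x = W0 i x /\ dpart [:: o1] w x = W1 i x.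
Proof. by move=> /(_ i)[_ _ h] /h[[_ <-] [_ <-]]. Qed.

Lemma pw_lin (l m : R) w W0 W1 v V0 V1 : pw w W0 W1 -> pw v V0 V1 ->
  pw (fun x => l * w x + m * v x) (fun i x => l * W0 i x + m * V0 i x) (fun i x => l * W1 i x + m * V1 i x).
Proof.
move=> hw hv i; have [cw0 cw1 dw] := hw i; have [cv0 cv1 dv] := hv i.
split; [by contt|by contt|].
move=> x hx; have [d0 d1] := dw x hx; have [e0 e1] := dv x hx; split.
  exact: (is_deriveD (is_deriveZ l d0) (is_deriveZ m e0)).
exact: (is_deriveD (is_deriveZ l d1) (is_deriveZ m e1)).
Qed.

Lemma pw_eq w v W0 W1 : pw w W0 W1 -> (forall x, w x = v x) -> pw v W0 W1.
Proof. by move=> + /funext <-. Qed.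

Definition D0 v (i : 'I_(size T)) := dpart [:: o0] (loc k v i).
Definition D1 v (i : 'I_(size T)) := dpart [:: o1] (loc k v i).

Lemma pw_Vh v : Vh Om T k v -> pw v (D0 v) (D1 v).
Proof.
move=> Vv i; have pl := loc_pol k conf v i.
split; [exact: (pol_cont (D := HT i) (pol_dpart o0 pl))|exact: (pol_cont (D := HT i) (pol_dpart o1 pl))|].
move=> x hx; have nr : \near x, loc k v i x = v x.
  apply: filterS (open_nbhs_nbhs (conj (open_interior (HT i)) hx)) => y /interior_subset hy.
  by rewrite (vh_loc k0 conf Vv hy).
have [d0 d1] := is_derive_basis (pol_is_derive pl x).
by split; [exact: near_eq_is_derive nr d0|exact: near_eq_is_derive nr d1].
Qed.

Variables (u U1 U2 U11 U12 U22 : pt -> R).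
Hypothesis Ujet : jet3 (closure Om) u U1 U2 U11 U12 U22.
Hypothesis Uhess : forall x, Om x -> [/\ dpart [:: o0; o0] u x = U11 x, dpart [:: o0; o1] u x = U12 x,
  dpart [:: o1; o0] u x = U12 x & dpart [:: o1; o1] u x = U22 x].

Definition cof_form (W0 W1 P0 P1 : pt -> R) x :=
  (U22 x * W0 x - U12 x * W1 x) * P0 x + (U11 x * W1 x - U12 x * W0 x) * P1 x.

Definition cof_sum (W0 W1 P0 P1 : 'I_(size T) -> pt -> R) := \sum_i IKi i (cof_form (W0 i) (W1 i) (P0 i) (P1 i)).

Lemma C1onW D D' F F1 F2 : D `<=` D' -> C1on D' F F1 F2 -> C1on (R := R) D F F1 F2.
Proof.
move=> DD [g g1 g2 dg]; split; [exact: contW g|exact: contW g1|exact: contW g2|].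
by move=> x v l l0 Dx Dy; apply: dg => //; exact: DD.
Qed.

Lemma jet3W D D' (F F1 F2 F11 F12 F22 : pt -> R) : D `<=` D' -> jet3 D' F F1 F2 F11 F12 F22 -> jet3 D F F1 F2 F11 F12 F22.
Proof.
move=> DD [[h1 h2 h3] [X [Y [Z [W [h4 h5 h6]]]]]]; split; first by split; exact: C1onW DD _.
by exists X, Y, Z, W; split; exact: C1onW DD _.
Qed.

Lemma Ujet_i i : jet3 (HT (T := T) i) u U1 U2 U11 U12 U22.
Proof. exact: jet3W (HT_sub conf (i := i)) Ujet. Qed.

Lemma Ucont i : [/\ cont (HT (T := T) i) U1, cont (HT (T := T) i) U2, cont (HT (T := T) i) U11, cont (HT (T := T) i) U12 & cont (HT (T := T) i) U22].
Proof. by have [[_ [c1 c2 c3 _] [c4 c5 c6 _]] _] := Ujet_i i. Qed.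

Lemma aint_cont i (W0 W1 P0 P1 : pt -> R) : cont (HT i) W0 -> cont (HT i) W1 -> cont (HT i) P0 -> cont (HT i) P1 ->
  cont (HT (T := T) i) (cof_form W0 W1 P0 P1).
Proof. by move=> *; have [? ? ? ? ?] := Ucont i; rewrite /cof_form; contt. Qed.

Lemma Aprime_sum w W0 W1 phi P0 P1 : pw w W0 W1 -> pw phi P0 P1 -> Aprime Om T u w phi = cof_sum W0 W1 P0 P1.
Proof.
move=> hw hp; have cG i : cont (HT i) (cof_form (W0 i) (W1 i) (P0 i) (P1 i)).
  by have [cw0 cw1 _] := hw i; have [cp0 cp1 _] := hp i; exact: aint_cont.
apply: (broken_int cG _).2.
move=> i x hx; have [w0 w1] := pw_dpart hw hx; have [p0 p1] := pw_dpart hp hx.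
have Ox : Om x by apply: (tri_int_sub OmE conf (nth_triT i)); rewrite HTE.
have [h00 h01 h10 h11] := Uhess Ox.
have [c1 c2 c3 c4] := cof2 (hess u x); have [m1 m2] := mulmx2 (cof (hess u x)) (grad w x).
rewrite dot2 m1 m2 c1 c2 c3 c4 !mxE h00 h01 h10 h11 w0 w1 p0 p1 /cof_form; ring.
Qed.

End Pw.

(** * The error identity for the discrete form *)

Section AId.
Variable R : realType.
Variable k : nat.
Hypothesis k0 : (0 < k)%N.
Local Notation pt := (R * R)%type.
Implicit Types (a b c p q r x y z nu : pt) (w v phi : pt -> R).
Variables (Om : set pt) (s : seq pt) (T : mesh R).
Hypothesis OmE : Om = (hull s)°.
Hypothesis conf : conforming Om T.
Local Notation A i := (va (nth_tri (T := T) i)).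
Local Notation B i := (vb (nth_tri (T := T) i)).
Local Notation C i := (vc (nth_tri (T := T) i)).
Local Notation D0 := (D0 k (T := T)).
Local Notation D1 := (D1 k (T := T)).
Local Notation loc := (@loc R k T).
Variables (u U1 U2 U11 U12 U22 : pt -> R).
Hypothesis Ujet : jet3 (closure Om) u U1 U2 U11 U12 U22.
Local Notation asum := (@cof_sum R T U11 U12 U22).
Local Notation aint := (cof_form U11 U12 U22).
Local Notation Ucont := (Ucont conf Ujet).
Local Notation Psi_loc := (@Psi_loc R k T).

Variable f : pt -> R.
Hypothesis cf : cont (closure Om) f.
Hypothesis fE : forall x, Om x -> f x = U11 x * U22 x - U12 x ^+ 2.

Definition e0 v (i : 'I_(size T)) x := D0 v i x - U1 x.
Definition e1 v (i : 'I_(size T)) x := D1 v i x - U2 x.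

Lemma Psi_loc_cont v phi i p q nu : cont (HT (T := T) i) (Psi_loc v phi i p q nu).
Proof.
have pl := loc_pol k conf v i; have ph := loc_pol k conf phi i.
have gen (g0 g1 g00 g01 g11 h : pt -> R) : cont (HT i) g0 -> cont (HT i) g1 -> cont (HT i) g00 -> cont (HT i) g01 ->
    cont (HT i) g11 -> cont (HT i) h -> cont (HT i) (fun x => (nrm2 (q - p))^-1 * (nnf nu g0 g1 x * ttf p q g00 g01 g11 x) * h x).
  by move=> *; rewrite /nnf /ttf; contt.
apply: gen; rewrite ?(dpartS _ [:: _]);
  [exact: (pol_cont (pol_dpart _ pl))|exact: (pol_cont (pol_dpart _ pl))|
   exact: (pol_cont (pol_dpart _ (pol_dpart _ pl)))|exact: (pol_cont (pol_dpart _ (pol_dpart _ pl)))|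
   exact: (pol_cont (pol_dpart _ (pol_dpart _ pl)))|exact: pol_cont ph].
Qed.

Lemma bdry_phi phi i p q r x : Vh0 Om T k phi -> vtx i p q r -> (forall x, hull [:: p; q] x -> bdry Om x) ->
  hull [:: p; q] x -> loc phi i x = 0.
Proof.
move=> [Vp p0] vi hb hx; rewrite -(p0 x (hb x hx)); apply/esym/(vh_loc k0 conf Vp).
have [t /andP[t0 t1] ->] := hull2_line hx; have [pi qi] := vtx_mem vi.
by apply: cvx_hull => //; exact: tri_HT.
Qed.

Lemma edge_int_sum v phi i j p q r r' : Vh Om T k v -> Vh Om T k phi -> vtx i p q r -> vtx j p q r' -> i != j ->
  edge_integral p q (fun x => jump_cof (nth_tri i) (nth_tri j) p q v x * phi x) =
  seg p q (Psi_loc v phi i p q (enu (sgc i p q) p q)) + seg p q (Psi_loc v phi j p q (enu (sgc j p q) p q)).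
Proof.
move=> Vv Vp vi vj ij.
have pq : p != q by have [_ J _] := vi; have [] := jac_neq J.
have D0' : eucl_dist p q != 0.
  by rewrite /eucl_dist dot2 (vecE _).1 (vecE _).2 gt_eqF// sqrtr_gt0 -!expr2; exact: nrm2_gt0 pq.
have [pi qi] := vtx_mem vi; have [pj qj] := vtx_mem vj.
have cH : cvx (hull [:: p; q]) by exact: cvx_hull.
have hp : hull [:: p; q] p by have := @hull2_seg _ p q 0; rewrite scale0r addr0; apply; rewrite lexx ler01.
have hq : hull [:: p; q] q by have := @hull2_seg _ p q 1; rewrite scale1r (addrC p) subrK; apply; rewrite lexx ler01.
have sub (l : 'I_(size T)) : p \in (nth_tri l : seq pt) -> q \in (nth_tri l : seq pt) -> hull [:: p; q] `<=` HT l.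
  by move=> pl ql x /hull2_line[t /andP[t0 t1] ->]; apply: cvx_hull => //; exact: tri_HT.
have ci := contW (sub i pi qi) (@Psi_loc_cont v phi i p q (enu (sgc i p q) p q)).
have cj := contW (sub j pj qj) (@Psi_loc_cont v phi j p q (enu (sgc j p q) p q)).
rewrite /edge_integral; set I := \int[_]_(_ in _) _; set S := RHS.
suff -> : I = (eucl_dist p q)^-1 * S by rewrite mulrA mulfV// mul1r.
rewrite /I /S.
rewrite mulrDr -(segL _ _ cH hp hq ci cj); apply: eq_Rintegral => t; rewrite inE/= in_itv/= => ht.
rewrite -mulrDr -(jump_identity k0 conf Vv Vp vi vj ij ht) mulrA mulVf// mul1r.
by [].
Qed.

Lemma Aform_sum v phi : Vh Om T k v -> Vh0 Om T k phi -> Aform f T v phi =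
  \sum_i (IKi i (fun x => (f x - (dpart [:: o0; o0] (loc v i) x * dpart [:: o1; o1] (loc v i) x -
     dpart [:: o0; o1] (loc v i) x * dpart [:: o0; o1] (loc v i) x)) * loc phi i x) +
   edge3 (Num.sg (jac (A i) (B i) (C i))) (fun p q nu => seg p q (Psi_loc v phi i p q nu)) (A i) (B i) (C i)).
Proof.
move=> Vv Vp0; have [Vp p0] := Vp0; rewrite /Aform big_split /=; congr (_ + _).
  rewrite big_tnth; apply: eq_bigr => i _; rewrite -/(nth_tri i) HTE /IKi /IK.
  apply: eq_Rintegral => x; rewrite inE => hx; rewrite (vh_loc k0 conf Vp (interior_subset hx)).
  have h (l m : 'I_2) : hess v x l m = dpart [:: l; m] (loc v i) x by rewrite mxE (dpart_loc k0 conf [:: l; m] Vv hx).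
  have hs := congr1 (fun g => g x) (pol_schwarz (loc_pol k conf v i)).
  have gen (F a b c d P : R) : c = d -> (F - (a * b - d * c)) * P = (F - (a * b - d * d)) * P by move=> ->.
  rewrite det2 !h; exact: (gen _ _ _ _ _ _ hs).
rewrite -(edge_regroup OmE conf).
- apply: eq_bigr => i _; apply: eq_bigr => j /andP[ij /(shared_mem conf)[]].
  set p := nth _ _ 0; set q := nth _ _ 1 => pi qi pj qj pq /=; rewrite -/p -/q.
  have ij' : i != j by apply: contraTN ij => /eqP ->; rewrite ltnn.
  have [r vi] := vtx_of conf pi qi pq; have [r' vj] := vtx_of conf pj qj pq.
  exact: edge_int_sum vi vj ij'.
- move=> i p q nu; apply/funext => x; rewrite /Psi_loc /ttf /nrm2.
  have -> : (q - p).1 = - (p - q).1 by rewrite /= opprB.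
  have -> : (q - p).2 = - (p - q).2 by rewrite /= opprB.
  move: (p - q).1 (p - q).2 => t1 t2.
  by rewrite !sqrrN (_ : 2 * - t1 * - t2 = 2 * t1 * t2); [|ring].
- by move=> i p q r nu x vi hb hx; rewrite /Psi_loc (bdry_phi Vp0 vi hb hx) mulr0.
- by move=> i p q nu; exact: Psi_loc_cont.
Qed.

(** [local_identity] summed over the elements. The fluxes [S1] contain derivatives of [u] only; in
    [S2] the error enters through first and second tangential derivatives, which are single valued
    on an edge. Both are odd in the normal, so [edge_cancel] removes them. *)
Theorem A_identity v phi : Vh Om T k v -> Vh0 Om T k phi -> Aform f T v phi =
  asum (e0 v) (e1 v) (D0 phi) (D1 phi) +
  \sum_i ellp (A i) (B i) (C i) (pX (e0 v i) (e0 v i)) (pY (e0 v i) (e1 v i) (e0 v i) (e1 v i)) (pZ (e1 v i) (e1 v i)) (loc phi i).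
Proof.
move=> Vv Vp0; have [Vp p0] := Vp0; rewrite Aform_sum//.
pose S1 i p q nu x := (nrm2 (q - p))^-1 * (nnf nu U1 U2 x * ttf p q U11 U12 U22 x) * loc phi i x.
pose S2 i p q nu x := (nrm2 (q - p))^-1 *
   (nnf nu U1 U2 x * ttf p q (fun x => dpart [:: o0; o0] (loc v i) x - U11 x) (fun x => dpart [:: o0; o1] (loc v i) x - U12 x) (fun x => dpart [:: o1; o1] (loc v i) x - U22 x) x +
    nnf (q - p) (e0 v i) (e1 v i) x * (nu.1 * ((q - p).1 * U11 x + (q - p).2 * U12 x) + nu.2 * ((q - p).1 * U12 x + (q - p).2 * U22 x))) * loc phi i x.
transitivity (\sum_i (IKi i (aint (e0 v i) (e1 v i) (D0 phi i) (D1 phi i)) +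
  ellp (A i) (B i) (C i) (pX (e0 v i) (e0 v i)) (pY (e0 v i) (e1 v i) (e0 v i) (e1 v i)) (pZ (e1 v i) (e1 v i)) (loc phi i) +
  edge3 (Num.sg (jac (A i) (B i) (C i))) (fun p q nu => seg p q (S1 i p q nu)) (A i) (B i) (C i) +
  edge3 (Num.sg (jac (A i) (B i) (C i))) (fun p q nu => seg p q (S2 i p q nu)) (A i) (B i) (C i))).
  apply: eq_bigr => i _; apply: (local_identity (jacT conf i)).
  - exact: pol_jet3 (loc_pol k conf v i).
  - exact: (Ujet_i conf Ujet).
  - exact: pol_jet2 (loc_pol k conf phi i).
  - exact: contW (HT_sub conf (i := i)) cf.
  - by move=> x hx; rewrite fE//; apply: (tri_int_sub OmE conf (nth_triT i)); rewrite HTE.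
have sgn (p q : pt) : (q - p).1 = - (p - q).1 /\ (q - p).2 = - (p - q).2 by rewrite /= !opprB.
have Z1 : \sum_i edge3 (Num.sg (jac (A i) (B i) (C i))) (fun p q nu => seg p q (S1 i p q nu)) (A i) (B i) (C i) = 0.
  apply: (edge_cancel OmE conf).
  - move=> i p q nu; apply/funext => x; rewrite /S1 /ttf /nrm2 (sgn p q).1 (sgn p q).2; move: (p - q).1 (p - q).2 => t1 t2.
    by rewrite !sqrrN (_ : 2 * - t1 * - t2 = 2 * t1 * t2); [|ring].
  - by move=> i p q r nu x vi hb hx; rewrite /S1 (bdry_phi Vp0 vi hb hx) mulr0.
  - move=> i p q nu; have [c1 c2 c3 c4 c5] := Ucont i; have cp := pol_cont (D := HT i) (loc_pol k conf phi i).
    by rewrite /S1 /nnf /ttf; contt.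
  - move=> i j p q r r' nu x vi vj ij /hull2_line[t _ ->]; rewrite /S1; congr (_ * _).
    exact: (edge_loc k0 conf phi t vi vj ij).
  - by move=> i p q sg x; rewrite /S1 /nnf /enu /=; ring.
have Z2 : \sum_i edge3 (Num.sg (jac (A i) (B i) (C i))) (fun p q nu => seg p q (S2 i p q nu)) (A i) (B i) (C i) = 0.
  apply: (edge_cancel OmE conf).
  - move=> i p q nu; apply/funext => x; rewrite /S2 /ttf /nrm2 /nnf (sgn p q).1 (sgn p q).2.
    move: (p - q).1 (p - q).2 (dpart [:: o0; o0] _ x) (dpart [:: o0; o1] _ x) (dpart [:: o1; o1] _ x) => t1 t2 g1 g2 g3.
    by rewrite !sqrrN; ring.
  - by move=> i p q r nu x vi hb hx; rewrite /S2 (bdry_phi Vp0 vi hb hx) mulr0.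
  - move=> i p q nu; have [c1 c2 c3 c4 c5] := Ucont i; have cp := pol_cont (D := HT i) (loc_pol k conf phi i).
    have gen (g0 g1 g00 g01 g11 : pt -> R) : cont (HT i) g0 -> cont (HT i) g1 -> cont (HT i) g00 -> cont (HT i) g01 ->
       cont (HT i) g11 -> cont (HT i) (fun x => (nrm2 (q - p))^-1 *
   (nnf nu U1 U2 x * ttf p q (fun x => g00 x - U11 x) (fun x => g01 x - U12 x) (fun x => g11 x - U22 x) x +
    nnf (q - p) (fun x => g0 x - U1 x) (fun x => g1 x - U2 x) x * (nu.1 * ((q - p).1 * U11 x + (q - p).2 * U12 x) + nu.2 * ((q - p).1 * U12 x + (q - p).2 * U22 x))) * loc phi i x).
      by move=> *; rewrite /nnf /ttf; contt.
    have pl := loc_pol k conf v i.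
    apply: gen; rewrite ?(dpartS _ [:: _]);
    [exact: (pol_cont (pol_dpart _ pl))|exact: (pol_cont (pol_dpart _ pl))|
     exact: (pol_cont (pol_dpart _ (pol_dpart _ pl)))|exact: (pol_cont (pol_dpart _ (pol_dpart _ pl)))|
     exact: (pol_cont (pol_dpart _ (pol_dpart _ pl)))].
  - move=> i j p q r r' nu x vi vj ij /hull2_line[t _ ->].
    have [T1 T2] := tangential2 (loc_pol k conf v i) (loc_pol k conf v j) (fun l => edge_loc k0 conf v l vi vj ij) t.
    have gen (N n1 n2 d1 d2 u1 u2 u11 u12 u22 a1 a2 b1 b2 a11 a12 a22 b11 b12 b22 P : R) :
        d1 * a1 + d2 * a2 = d1 * b1 + d2 * b2 ->
        d1 ^+ 2 * a11 + 2 * d1 * d2 * a12 + d2 ^+ 2 * a22 = d1 ^+ 2 * b11 + 2 * d1 * d2 * b12 + d2 ^+ 2 * b22 ->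
        N * ((n1 * u1 + n2 * u2) * (d1 ^+ 2 * (a11 - u11) + 2 * d1 * d2 * (a12 - u12) + d2 ^+ 2 * (a22 - u22)) +
          (d1 * (a1 - u1) + d2 * (a2 - u2)) * (n1 * (d1 * u11 + d2 * u12) + n2 * (d1 * u12 + d2 * u22))) * P =
        N * ((n1 * u1 + n2 * u2) * (d1 ^+ 2 * (b11 - u11) + 2 * d1 * d2 * (b12 - u12) + d2 ^+ 2 * (b22 - u22)) +
          (d1 * (b1 - u1) + d2 * (b2 - u2)) * (n1 * (d1 * u11 + d2 * u12) + n2 * (d1 * u12 + d2 * u22))) * P.
      move=> E1 E2.
      have -> : d1 ^+ 2 * (a11 - u11) + 2 * d1 * d2 * (a12 - u12) + d2 ^+ 2 * (a22 - u22) =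
        (d1 ^+ 2 * a11 + 2 * d1 * d2 * a12 + d2 ^+ 2 * a22) - (d1 ^+ 2 * u11 + 2 * d1 * d2 * u12 + d2 ^+ 2 * u22) by ring.
      have -> : d1 * (a1 - u1) + d2 * (a2 - u2) = (d1 * a1 + d2 * a2) - (d1 * u1 + d2 * u2) by ring.
      by rewrite E1 E2; ring.
    rewrite /S2 (edge_loc k0 conf phi t vi vj ij).
    exact: (gen _ _ _ _ _ _ _ _ _ _ _ _ _ _ _ _ _ _ _ _ _ T1 T2).
  - move=> i p q sg x; rewrite /S2 /enu /=.
    set A1 := nnf (q - p) _ _ x; set A2 := ttf p q _ _ _ x; rewrite /nnf /=; ring.
have fin (X Y Z W : 'I_(size T) -> R) : \sum_i Z i = 0 -> \sum_i W i = 0 ->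
    \sum_i (X i + Y i + Z i + W i) = \sum_i X i + \sum_i Y i.
  by move=> z0 w0; rewrite !big_split /= z0 w0 !addr0.
exact: (fin _ _ _ _ Z1 Z2).
Qed.

End AId.

(** * Geometric constants of the mesh family *)

Section MeshSize.
Variable R : realType.
Local Notation pt := (R * R)%type.
Implicit Types (a b c p q r x y z : pt).

Lemma eucl_distE x y : eucl_dist x y = Num.sqrt (nrm2 (y - x)).
Proof. by rewrite /eucl_dist dot2 (vecE _).1 (vecE _).2 -!expr2. Qed.

Lemma nrm2_ge0 (x : pt) : 0 <= nrm2 x.
Proof. by rewrite addr_ge0 ?sqr_ge0. Qed.

Lemma abs_le_eucl x y : `|(y - x).1| <= eucl_dist x y /\ `|(y - x).2| <= eucl_dist x y.
Proof.
rewrite eucl_distE; split; rewrite -sqrtr_sqr ler_wsqrtr// /nrm2 ?lerDl ?lerDr sqr_ge0//.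
Qed.

Lemma eucl_le (x y : pt) (M : R) : `|(y - x).1| <= M -> `|(y - x).2| <= M -> eucl_dist x y <= 2 * M.
Proof.
move=> h1 h2; have M0 : 0 <= M by apply: le_trans h1.
have M2 : 0 <= 2 * M by rewrite mulr_ge0.
rewrite eucl_distE -(ger0_norm M2) -sqrtr_sqr ler_wsqrtr// /nrm2.
have e1 : (y - x).1 ^+ 2 <= M ^+ 2 by rewrite -[leLHS]sqr_absE lerXn2r// ?nnegrE.
have e2 : (y - x).2 ^+ 2 <= M ^+ 2 by rewrite -[leLHS]sqr_absE lerXn2r// ?nnegrE.
by rewrite exprMn; have := sqr_ge0 M; lra.
Qed.

Lemma diam_ub (D : set pt) x y : compact D -> D x -> D y -> eucl_dist x y <= diam D.
Proof.
move=> cD Dx Dy; apply: sup_upper_bound; last by exists x, y.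
split; first by exists (eucl_dist x y), x, y.
have [M M0 hM] := compact_box cD; exists (2 * (2 * M)) => _ [x' [y' [Dx' Dy' ->]]].
have [x1 x2] := hM x' Dx'; have [y1 y2] := hM y' Dy'.
by apply: eucl_le; rewrite /= (le_trans (ler_normB _ _))//; lra.
Qed.

Variables (T : mesh R).

Lemma diam_meshsize K : K \in T -> diam (hull K) <= meshsize T.
Proof. by move=> KT; apply: (le_bigmax_seq 0 K xpredT (fun K => diam (hull K))). Qed.

Lemma bary_diff a b c x y : bary a b c x - bary a b c y =
  ((x.1 - y.1) * (b.2 - c.2) - (x.2 - y.2) * (b.1 - c.1)) / jac a b c.
Proof. by rewrite /bary -mulrBl; congr (_ / _); rewrite /jac; ring. Qed.

(* A disc of radius [r] inside a triangle: comparing the barycentric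
   coordinates of opposite points of the disc bounds [jac] below. *)
Lemma inball_jac a b c x (r : R) : jac a b c != 0 -> 0 <= r ->
  [set y | eucl_dist x y <= r] `<=` hull [:: a; b; c] -> 2 * r ^+ 2 <= `|jac a b c|.
Proof.
move=> J r0 sub.
pose e1 := (x.1 + r, x.2); pose e2 := (x.1 - r, x.2); pose e3 := (x.1, x.2 + r); pose e4 := (x.1, x.2 - r).
have mem y : nrm2 (y - x) = r ^+ 2 -> hull [:: a; b; c] y.
  by move=> h; apply: sub; rewrite /= eucl_distE h sqrtr_sqr ger0_norm.
have h1 : hull [:: a; b; c] e1 by apply: mem; rewrite /nrm2 /=; ring.
have h2 : hull [:: a; b; c] e2 by apply: mem; rewrite /nrm2 /=; ring.
have h3 : hull [:: a; b; c] e3 by apply: mem; rewrite /nrm2 /=; ring.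
have h4 : hull [:: a; b; c] e4 by apply: mem; rewrite /nrm2 /=; ring.
have rng y z : hull [:: a; b; c] y -> hull [:: a; b; c] z -> [/\ `|bary a b c y - bary a b c z| <= 1,
    `|bary b c a y - bary b c a z| <= 1 & `|bary c a b y - bary c a b z| <= 1].
  move=> /(hull_baryP _ J)[u1 u2 u3] /(hull_baryP _ J)[v1 v2 v3].
  have su := bary_sum y J; have sv := bary_sum z J.
  by split; rewrite ler_norml; apply/andP; split; lra.
have J0 : 0 < `|jac a b c| by rewrite normr_gt0.
have J1 : jac b c a = jac a b c by exact: jac_cyc.
have J2 : jac c a b = jac a b c by rewrite -jac_cyc.
have [_ k2 k3] := rng e3 e4 h3 h4; have [_ l2 l3] := rng e1 e2 h1 h2.
have B : `|c.1 - a.1| * (2 * r) <= `|jac a b c|.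
  move: k2; rewrite bary_diff J1 normrM normfV ler_pdivrMr// mul1r.
  rewrite (_ : _ - _ = - ((c.1 - a.1) * (2 * r))) ?normrN ?normrM ?(ger0_norm (_ : 0 <= 2)) //=; last by ring.
  by rewrite (ger0_norm r0).
have C : `|a.1 - b.1| * (2 * r) <= `|jac a b c|.
  move: k3; rewrite bary_diff J2 normrM normfV ler_pdivrMr// mul1r.
  rewrite (_ : _ - _ = - ((a.1 - b.1) * (2 * r))) ?normrN ?normrM ?(ger0_norm (_ : 0 <= 2)) //=; last by ring.
  by rewrite (ger0_norm r0).
have E : 2 * r = (bary b c a e1 - bary b c a e2) * (b.1 - a.1) + (bary c a b e1 - bary c a b e2) * (c.1 - a.1).
  have E1 := baryE e1 J; have E2 := baryE e2 J; have s1 := bary_sum e1 J; have s2 := bary_sum e2 J.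
  have : e1.1 - e2.1 = 2 * r by rewrite /=; ring.
  move=> <-; rewrite {1}E1 {1}E2 /= !scaleRE; move: s1 s2.
  move: (bary a b c e1) (bary b c a e1) (bary c a b e1) (bary a b c e2) (bary b c a e2) (bary c a b e2) => u1 u2 u3 v1 v2 v3 su sv.
  have -> : u1 = 1 - u2 - u3 by lra.
  have -> : v1 = 1 - v2 - v3 by lra.
  ring.
have F : 2 * r <= `|b.1 - a.1| + `|c.1 - a.1|.
  rewrite {1}E (le_trans (ler_norm _))// (le_trans (ler_normD _ _))// !normrM lerD// ler_piMl//.
rewrite (distrC a.1) in C.
have : 2 * r * (2 * r) <= (`|b.1 - a.1| + `|c.1 - a.1|) * (2 * r) by rewrite ler_wpM2r// mulr_ge0.
by rewrite expr2; lra.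
Qed.

End MeshSize.

Section MeshConst.
Variable R : realType.
Local Notation pt := (R * R)%type.
Variables (F : set (mesh R)) (Om : set pt).
Hypothesis sr : shape_regular F.
Hypothesis qu : quasi_uniform F.

Lemma mesh_reg : exists kap : R, forall T, F T -> conforming Om T ->
  forall i : 'I_(size T), reg kap (meshsize T) (va (nth_tri i)) (vb (nth_tri i)) (vc (nth_tri i)).
Proof.
have [sg sg0 hs] := sr; have [tau tau0 ht] := qu.
(* A disc with [4 r >= inball_diam] has [r >= meshsize T / (4 sg tau)] by the two mesh hypotheses,
   and [inball_jac] bounds the Jacobian below by [2 r^2]. *)
exists (8^-1 / (sg * tau) ^+ 2) => T FT conf i; set K := nth_tri i; have KT : K \in T := nth_triT i.
have J := jacT conf i; rewrite -/K in J.
have cK : compact (hull K) by exact: compact_hull.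
have hK : hull K = hull [:: va K; vb K; vc K] by exact: hull_triE.
have [ka kb kc] : [/\ hull K (va K), hull K (vb K) & hull K (vc K)].
  by rewrite hK; split; [exact: hull3_v1|exact: hull3_v2|exact: hull3_v3].
have dm := diam_meshsize KT.
have [b1 b2] := abs_le_eucl (va K) (vb K); have [c1 c2] := abs_le_eucl (va K) (vc K).
have db := diam_ub cK ka kb; have dc := diam_ub cK ka kc.
have d0 : 0 < diam (hull K).
  apply: lt_le_trans db; rewrite eucl_distE sqrtr_gt0; apply: nrm2_gt0.
  by have [] := jac_neq J.
have m0 : 0 < meshsize T by exact: lt_le_trans dm.
split=> //.
- by rewrite divr_gt0 ?invr_gt0// exprn_gt0// mulr_gt0.
- by split; [apply: le_trans b1 _|apply: le_trans b2 _|apply: le_trans c1 _|apply: le_trans c2 _];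
    exact: le_trans dm.
have H := hs T FT K KT; have H' := ht T FT K KT.
have i0 : 0 < inball_diam (hull K) by rewrite -(pmulr_rgt0 _ sg0); exact: lt_le_trans H.
(* The supremum defining [inball_diam] may not be attained; half of it is always reached by some
   disc. *)
have [x [r [r0 sub r2]]] : exists x r, [/\ 0 <= r, [set y | eucl_dist x y <= r] `<=` hull K & inball_diam (hull K) / 2 <= r *+ 2].
  apply: contrapT => hn; have : inball_diam (hull K) <= inball_diam (hull K) / 2.
    apply: ge_sup.
      exists 0, (va K), 0; split=> //; last by rewrite mul0rn.
      move=> y /= h; have [<-//|ne] := eqVneq (va K : pt) y.
      by move: h; rewrite eucl_distE leNgt sqrtr_gt0 (nrm2_gt0 ne).
    move=> _ [x [r [r0 sub ->]]]; rewrite leNgt; apply/negP => h; apply: hn.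
    by exists x, r; split=> //; exact: ltW.
  by rewrite -subr_le0 (_ : _ - _ = inball_diam (hull K) / 2); [rewrite leNgt divr_gt0|field].
have JJ : 2 * r ^+ 2 <= `|jac (va K) (vb K) (vc K)| by apply: (inball_jac (x := x) J r0); rewrite -hK.
have st : 0 < sg * tau by rewrite mulr_gt0.
have h1 : meshsize T <= (sg * tau) * (4 * r).
  have h2 : tau * diam (hull K) <= tau * (sg * inball_diam (hull K)) by rewrite ler_pM2l.
  have h3 : tau * (sg * inball_diam (hull K)) <= tau * (sg * (4 * r)).
    by rewrite !ler_pM2l//; move: r2; rewrite -mulr_natr; lra.
  by apply: le_trans H' (le_trans h2 (le_trans h3 _)); rewrite (_ : tau * _ = sg * tau * (4 * r)); [|ring].
have h2 : meshsize T / (sg * tau) <= 4 * r by rewrite ler_pdivrMr// mulrC.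
have h3 : (meshsize T / (sg * tau)) ^+ 2 <= (4 * r) ^+ 2.
  by rewrite lerXn2r// nnegrE ?divr_ge0 ?mulr_ge0// ltW.
apply: le_trans JJ.
have -> : 8^-1 / (sg * tau) ^+ 2 * meshsize T ^+ 2 = 8^-1 * (meshsize T / (sg * tau)) ^+ 2.
  by rewrite expr_div_n [RHS]mulrA [LHS]mulrAC.
have gen (y z : R) : y ^+ 2 <= (4 * z) ^+ 2 -> 8^-1 * y ^+ 2 <= 2 * z ^+ 2.
  by move: (y ^+ 2) => Y; rewrite exprMn; move: (z ^+ 2) => Z; lra.
exact: gen h3.
Qed.

End MeshConst.

(** * Essential suprema and broken norms *)

Section Norms.
Variable R : realType.
Local Notation pt := (R * R)%type.
Local Notation R2 := (mplane R).

Lemma area_box_gt0 (x : pt) (d : R) : 0 < d ->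
  (0 < Defs.area R (`](x.1 - d)%R, (x.1 + d)%R[%classic `*` `](x.2 - d)%R, (x.2 + d)%R[%classic : set R2))%E.
Proof.
move=> d0; rewrite /Defs.area product_measure1E//.
have L (t : R) : (0 < lebesgue_measure (`](t - d)%R, (t + d)%R[%classic : set (measurableTypeR R)))%E.
  by rewrite lebesgue_measure_itv /= lte_fin ifT ?lte_fin ?sube_gt0 ?lte_fin; lra.
by apply: mule_gt0; exact: L.
Qed.

(** A continuous function exceeding the essential bound at [x] does so on a box around [x], which
    has positive area. *)
Lemma Linfty_bound (D E : set pt) (w G : pt -> R) (M : R) x (e : R) : 0 < e -> cont E G -> E x ->
  (forall y, `|y.1 - x.1| < e -> `|y.2 - x.2| < e -> [/\ D y, E y & w y = G y]) ->
  (Linfty_norm D w <= M%:E)%E -> `|G x| <= M.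
Proof.
move=> e0 cG Dx h hM; rewrite leNgt; apply/negP => Mx.
have g0 : 0 < `|G x| - M by rewrite subr_gt0.
have [d d0 hd] := cont_box cG Dx g0.
pose m : R := Num.min d e; have m0 : 0 < m by rewrite lt_min d0.
pose B : set R2 := `](x.1 - m), (x.1 + m)[%classic `*` `](x.2 - m), (x.2 + m)[%classic.
have B0 : (0 < Defs.area R B)%E by exact: area_box_gt0.
have inB (y : R2) : B y -> `|y.1 - x.1| < m /\ `|y.2 - x.2| < m.
  by move=> [] /=; rewrite !in_itv /= => /andP[? ?] /andP[? ?]; split; rewrite ltr_norml; apply/andP; split; lra.
have mB : measurable B by apply: measurableX; exact: measurable_itv.
have T0 : (0 < Defs.area R [set: R2])%E by apply: lt_le_trans B0 _; apply: le_measure; rewrite ?inE.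
move: hM; rewrite /Linfty_norm unlock T0 => /ess_supP[N [mN N0 sN]].
have : (Defs.area R B <= Defs.area R N)%E.
  apply: le_measure; rewrite ?inE// => y By; apply: sN => /=.
  have [y1 y2] := inB y By; move: y1 y2; rewrite /m !lt_min => /andP[y1 y1'] /andP[y2 y2'].
  have [Dy Ey wy] := h y y1' y2'.
  rewrite patchE mem_set// lee_fin wy => hle.
  have := hd y Ey y1 y2; have := lerB_dist (G x) (G y); rewrite (distrC (G x)); lra.
by move=> h1; have := lt_le_trans B0 h1; rewrite [X in (_ < X)%E -> _]N0 ltxx.
Qed.

Lemma Linfty_le (D : set pt) (w : pt -> R) (M : R) : 0 <= M -> (forall x, D x -> `|w x| <= M) ->
  (Linfty_norm D w <= M%:E)%E.
Proof.
move=> M0 h; rewrite /Linfty_norm unlock; case: ifPn => _; last by rewrite lee_fin.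
apply/ess_supP; apply: aeW => x /=; rewrite patchE; case: ifPn => [|_].
  by rewrite inE => Dx; rewrite lee_fin h.
by rewrite normr0.
Qed.

End Norms.

Section BrokenNorms.
Variable R : realType.
Variable k : nat.
Hypothesis k0 : (0 < k)%N.
Local Notation pt := (R * R)%type.
Local Notation R2 := (mplane R).
Variables (Om : set pt) (s : seq pt) (T : mesh R).
Hypothesis OmE : Om = (hull s)°.
Hypothesis conf : conforming Om T.

Lemma closure_le (i : 'I_(size T)) (F : pt -> R) (M : R) : cont (HT i) F -> (forall x, (HT i)° x -> F x <= M) ->
  forall x, HT i x -> F x <= M.
Proof.
move=> cF h x hx; rewrite leNgt; apply/negP => Mx.
have g0 : 0 < F x - M by rewrite subr_gt0.
have [d d0 hd] := cont_box cF hx g0.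
have : closure (HT i)° x by rewrite (closure_HT conf).
move=> /(_ [set y | `|y.1 - x.1| < d /\ `|y.2 - x.2| < d])[].
  by apply/near2P; exists d.
move=> y [yi [y1 y2]]; have := hd y (interior_subset yi) y1 y2; have := h y yi.
by rewrite ltr_norml => ? /andP[? ?]; lra.
Qed.

Lemma Linfty_HT (w : pt -> R) (G : 'I_(size T) -> pt -> R) (M : R) :
  (forall i, cont (HT i) (G i)) -> (forall i x, (HT i)° x -> w x = G i x) ->
  (Linfty_norm (broken Om T) w <= M%:E)%E -> forall i x, HT i x -> `|G i x| <= M.
Proof.
move=> cG wG hM i; apply: closure_le; first exact: cont_norm.
move=> x hx; have hx' : ((HT i)°)° x by rewrite (interior_id _).1//; exact: open_interior.
have [e e0 he] := (interior2P _ _).1 hx'.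
apply: (@Linfty_bound _ (broken Om T) (HT i) w (G i) M x e e0 (cG i) (interior_subset hx) _ hM) => y y1 y2.
have hy := he y y1 y2; split; [|exact: interior_subset|exact: wG].
by rewrite (brokenE OmE conf); exists i => //; rewrite HTE.
Qed.

Lemma Linfty_HT_le (w : pt -> R) (G : 'I_(size T) -> pt -> R) (M : R) : 0 <= M ->
  (forall i x, (HT i)° x -> w x = G i x) -> (forall i x, HT i x -> `|G i x| <= M) ->
  (Linfty_norm (broken Om T) w <= M%:E)%E.
Proof.
move=> M0 wG h; apply: Linfty_le => // x; rewrite (brokenE OmE conf) => -[i _]; rewrite HTE => hx.
by rewrite (wG i)//; apply: h; exact: interior_subset.
Qed.

Lemma H1_norm_le (w : pt -> R) (W W0 W1 : 'I_(size T) -> pt -> R) (c : R) : 0 <= c -> pw w W0 W1 ->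
  (forall i, cont (HT i) (W i)) -> (forall i x, (HT i)° x -> w x = W i x) ->
  \sum_i IKi i (fun x => W i x ^+ 2 + (W0 i x ^+ 2 + W1 i x ^+ 2)) <= c ^+ 2 ->
  (H1_norm Om T w <= c%:E)%E.
Proof.
move=> c0 hw cW wW h.
pose F x := (w x) ^+ 2 + dot (grad w x) (grad w x).
have [|i x hx|I1 I2] := @broken_int R Om s T OmE conf F (fun i x => W i x ^+ 2 + (W0 i x ^+ 2 + W1 i x ^+ 2)).
- by move=> i; have [c1 c2 _] := hw i; have c3 := cW i; contt.
- by rewrite /F dot2 !mxE (wW _ _ hx) (pw_dpart hw hx).1 (pw_dpart hw hx).2 !expr2.
rewrite /H1_norm -/F (_ : c%:E = sqrte (c ^+ 2)%:E); last by rewrite /= sqrtr_sqr ger0_norm.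
rewrite lee_sqrt ?lee_fin ?sqr_ge0//.
have <- : (\int[Defs.area R]_(x in broken Om T) F x)%:E = (\int[Defs.area R]_(x in broken Om T) (F x)%:E)%E.
  rewrite /Rintegral fineK//; apply: integrable_fin_num => //.
  apply: open_measurable2; rewrite (brokenE OmE conf); apply: bigcup_open => i _; exact: open_interior.
by rewrite lee_fin I2.
Qed.

End BrokenNorms.

(** * L^2 norms of vector fields on a triangle and on the mesh *)

Section CauchySchwarz.
Variable R : realType.

Lemma CS_quad (a b c : R) : 0 <= a -> 0 <= c -> (forall t : R, 0 <= c + 2 * t * b + t ^+ 2 * a) ->
  `|b| <= Num.sqrt c * Num.sqrt a.
Proof.
move=> a0 c0 /quad_disc h; apply: sqr_le_norm; first by rewrite mulr_ge0 ?sqrtr_ge0.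
by rewrite exprMn !sqr_sqrtr//; exact: h.
Qed.

Lemma CS_sum (I : finType) (a b : I -> R) :
  \sum_i a i * b i <= Num.sqrt (\sum_i a i ^+ 2) * Num.sqrt (\sum_i b i ^+ 2).
Proof.
apply: le_trans (ler_norm _) _; apply: CS_quad; try (by apply: sumr_ge0 => i _; exact: sqr_ge0).
move=> t; rewrite (_ : _ + _ = \sum_i (a i + t * b i) ^+ 2); first by apply: sumr_ge0 => i _; exact: sqr_ge0.
rewrite !mulr_sumr -!big_split /=; apply: eq_bigr => i _; ring.
Qed.

End CauchySchwarz.

Section TriangleNorm.
Variable R : realType.
Local Notation pt := (R * R)%type.
Variables a b c : pt.
Hypothesis J : jac a b c != 0.
Local Notation H := (hull [:: a; b; c]).
Local Notation IK := (IK a b c).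
Implicit Types P Q : pt -> R.

Definition vn P0 P1 := Num.sqrt (IK (fun x => P0 x ^+ 2 + P1 x ^+ 2)).

Lemma vn_ge0 P0 P1 : 0 <= vn P0 P1. Proof. exact: sqrtr_ge0. Qed.

Lemma vn_sqr P0 P1 : vn P0 P1 ^+ 2 = IK (fun x => P0 x ^+ 2 + P1 x ^+ 2).
Proof. by rewrite sqr_sqrtr//; apply: IK_ge0 => x _; rewrite addr_ge0 ?sqr_ge0. Qed.

Lemma IK_sqr_lin P0 P1 Q0 Q1 (l m : R) : cont H P0 -> cont H P1 -> cont H Q0 -> cont H Q1 ->
  IK (fun x => (l * P0 x + m * Q0 x) ^+ 2 + (l * P1 x + m * Q1 x) ^+ 2) =
  l ^+ 2 * vn P0 P1 ^+ 2 + 2 * l * m * IK (fun x => P0 x * Q0 x + P1 x * Q1 x) + m ^+ 2 * vn Q0 Q1 ^+ 2.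
Proof.
move=> p0 p1 q0 q1; rewrite !vn_sqr.
have cp : cont H (fun x => P0 x ^+ 2 + P1 x ^+ 2) by contt.
have cq : cont H (fun x => Q0 x ^+ 2 + Q1 x ^+ 2) by contt.
have cpq : cont H (fun x => P0 x * Q0 x + P1 x * Q1 x) by contt.
have cst (t : R) : cont H (fun=> t) by exact: cont_cst.
rewrite -(IKZ (l ^+ 2) cp) -(IKZ (2 * l * m) cpq) -(IKZ (m ^+ 2) cq) -!IKD; [|by contt..].
by apply: IK_eq => x _; ring.
Qed.

Lemma vn_CS P0 P1 Q0 Q1 : cont H P0 -> cont H P1 -> cont H Q0 -> cont H Q1 ->
  `|IK (fun x => P0 x * Q0 x + P1 x * Q1 x)| <= vn P0 P1 * vn Q0 Q1.
Proof.
move=> p0 p1 q0 q1; apply: CS_quad; try by rewrite -vn_sqr sqr_ge0.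
move=> t; have := IK_sqr_lin 1 t p0 p1 q0 q1; rewrite !vn_sqr expr1n mul1r mulr1 => <-.
by apply: IK_ge0 => x _; rewrite addr_ge0 ?sqr_ge0.
Qed.

Lemma vn_le (l : R) P0 P1 Q0 Q1 : 0 <= l -> cont H P0 -> cont H P1 -> cont H Q0 -> cont H Q1 ->
  (forall x, H x -> P0 x ^+ 2 + P1 x ^+ 2 <= l ^+ 2 * (Q0 x ^+ 2 + Q1 x ^+ 2)) -> vn P0 P1 <= l * vn Q0 Q1.
Proof.
move=> l0 p0 p1 q0 q1 h; have ln : 0 <= l * vn Q0 Q1 by rewrite mulr_ge0// vn_ge0.
rewrite -(ger0_norm (vn_ge0 P0 P1)); apply: sqr_le_norm => //.
rewrite exprMn !vn_sqr -IKZ; last by contt.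
have cst (t : R) : cont H (fun=> t) by exact: cont_cst.
by apply: IK_le => //; contt.
Qed.

Lemma vn_bound (M h : R) P0 P1 : `|jac a b c| <= 2 * h ^+ 2 -> 0 <= h -> cont H P0 -> cont H P1 ->
  (forall x, H x -> `|P0 x| <= M) -> (forall x, H x -> `|P1 x| <= M) -> vn P0 P1 <= 2 * h * M.
Proof.
move=> Jh h0 p0 p1 b0 b1; have M0 : 0 <= M by apply: le_trans (b0 a (hull3_v1 a b c)).
rewrite -(ger0_norm (vn_ge0 P0 P1)); apply: sqr_le_norm; first by rewrite !mulr_ge0.
have c2 : cont H (fun x => P0 x ^+ 2 + P1 x ^+ 2) by contt.
have bd x : H x -> `|P0 x ^+ 2 + P1 x ^+ 2| <= 2 * M ^+ 2.
  move=> hx; rewrite ger0_norm ?addr_ge0 ?sqr_ge0// mulrDl !mul1r -!(sqr_absE (P0 x)) -!(sqr_absE (P1 x)).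
  by rewrite lerD// lerXn2r ?nnegrE ?b0 ?b1.
rewrite vn_sqr; apply: le_trans (ler_norm _) _; apply: le_trans (IK_bound J c2 bd) _.
rewrite (_ : (2 * h * M) ^+ 2 = 2 * M ^+ 2 * (2 * h ^+ 2)); last by ring.
by rewrite ler_wpM2l// mulr_ge0// sqr_ge0.
Qed.

Lemma IK_le3 (l m : R) F G E : cont H F -> cont H G -> cont H E ->
  (forall x, H x -> l * F x <= G x + m * E x) -> l * IK F <= IK G + m * IK E.
Proof.
move=> cF cG cE h; have cst (t : R) : cont H (fun=> t) by exact: cont_cst.
by rewrite -(IKZ l cF) -(IKZ m cE) -IKD; [apply: IK_le => //; contt|contt..].
Qed.

End TriangleNorm.

(** The right-hand side contains the divergence of [y^2 V]. Its cross term [2 y (V . g)] is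
    absorbed, by completing a square, in half of [mx y^2] and in [2 K |g|^2], since [|V|^2 <= K mx];
    where [mx = 0] the field vanishes. *)
Lemma hardy_pointwise (R : realType) (K v1 v2 v11 v22 mx y g0 g1 : R) : 0 <= K -> v1 ^+ 2 + v2 ^+ 2 <= K * mx ->
  0 <= mx <= v11 + v22 -> 2^-1 * (mx * y ^+ 2) <=
  v11 * (y * y) + v1 * (g0 * y + y * g0) + (v22 * (y * y) + v2 * (g1 * y + y * g1)) + 2 * K * (g0 ^+ 2 + g1 ^+ 2).
Proof.
move=> K0 vK /andP[mx0 mv].
pose a := v1 * g0 + v2 * g1; pose g := g0 ^+ 2 + g1 ^+ 2.
have g_ge0 : 0 <= g by rewrite addr_ge0 ?sqr_ge0.
have ag : a ^+ 2 <= K * mx * g.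
  apply: (@le_trans _ _ ((v1 ^+ 2 + v2 ^+ 2) * g)); last by rewrite ler_wpM2r.
  rewrite -subr_ge0 (_ : _ - _ = (v1 * g1 - v2 * g0) ^+ 2) ?sqr_ge0//; rewrite /a /g; ring.
have yy : 0 <= (v11 + v22 - mx) * y ^+ 2 by rewrite mulr_ge0 ?sqr_ge0 ?subr_ge0.
suff Q : 0 <= 2^-1 * mx * y ^+ 2 + 2 * K * g + 2 * y * a by rewrite /a /g in Q; lra.
have [mz|mp] := eqVneq mx 0.
  have -> : a = 0 by apply/eqP; rewrite -sqrf_eq0 eq_le sqr_ge0 andbT; apply: le_trans ag _; rewrite mz mulr0 mul0r.
  by rewrite mz mulr0 mul0r add0r mulr0 addr0 !mulr_ge0.
have m1 : 0 < mx by rewrite lt_neqAle eq_sym mp.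
rewrite -(pmulr_rge0 _ m1); have := sqr_ge0 (mx * y + 2 * a); move: ag; clearbody a g; nra.
Qed.

Section MeshNorm.
Variable R : realType.
Local Notation pt := (R * R)%type.
Variable T : mesh R.
Local Notation A i := (va (nth_tri (T := T) i)).
Local Notation B i := (vb (nth_tri (T := T) i)).
Local Notation C i := (vc (nth_tri (T := T) i)).
Implicit Types P Q : 'I_(size T) -> pt -> R.

Definition pwc P := forall i, cont (HT i) (P i).

Definition ne P0 P1 i := vn (A i) (B i) (C i) (P0 i) (P1 i).

Definition nn P0 P1 := Num.sqrt (\sum_i ne P0 P1 i ^+ 2).

Lemma ne_ge0 P0 P1 i : 0 <= ne P0 P1 i. Proof. exact: vn_ge0. Qed.
Lemma nn_ge0 P0 P1 : 0 <= nn P0 P1. Proof. exact: sqrtr_ge0. Qed.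

Lemma nn_sqr P0 P1 : nn P0 P1 ^+ 2 = \sum_i ne P0 P1 i ^+ 2.
Proof. by rewrite sqr_sqrtr//; apply: sumr_ge0 => i _; exact: sqr_ge0. Qed.

Lemma ne_le_nn P0 P1 i : ne P0 P1 i <= nn P0 P1.
Proof.
rewrite -(ger0_norm (ne_ge0 P0 P1 i)); apply: sqr_le_norm; first exact: nn_ge0.
by rewrite nn_sqr (bigD1 i)//= lerDl; apply: sumr_ge0 => j _; exact: sqr_ge0.
Qed.

Lemma nn_le (l : R) (X : 'I_(size T) -> R) P0 P1 : 0 <= l -> (forall i, 0 <= X i) ->
  (forall i, ne P0 P1 i <= l * X i) -> nn P0 P1 <= l * Num.sqrt (\sum_i X i ^+ 2).
Proof.
move=> l0 X0 h; rewrite -(ger0_norm (nn_ge0 P0 P1)); apply: sqr_le_norm; first by rewrite mulr_ge0 ?sqrtr_ge0.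
rewrite nn_sqr exprMn sqr_sqrtr; last by apply: sumr_ge0 => i _; exact: sqr_ge0.
by rewrite mulr_sumr; apply: ler_sum => i _; rewrite -exprMn lerXn2r ?nnegrE ?mulr_ge0 ?ne_ge0.
Qed.

Lemma nn_lin (l m : R) P0 P1 Q0 Q1 : pwc P0 -> pwc P1 -> pwc Q0 -> pwc Q1 ->
  nn (fun i x => l * P0 i x + m * Q0 i x) (fun i x => l * P1 i x + m * Q1 i x) <= `|l| * nn P0 P1 + `|m| * nn Q0 Q1.
Proof.
move=> p0 p1 q0 q1; set N := nn _ _; have N0 : 0 <= N by exact: nn_ge0.
have N1 := nn_ge0 P0 P1; have N2 := nn_ge0 Q0 Q1.
rewrite -(ger0_norm N0); apply: sqr_le_norm; first by rewrite addr_ge0 ?mulr_ge0.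
pose X i := IKi i (fun x => P0 i x * Q0 i x + P1 i x * Q1 i x).
have XB : `|\sum_i X i| <= nn P0 P1 * nn Q0 Q1.
  apply: le_trans (ler_norm_sum _ _ _) _; apply: le_trans (CS_sum (ne P0 P1) (ne Q0 Q1)).
  by apply: ler_sum => i _; apply: vn_CS; [exact: p0|exact: p1|exact: q0|exact: q1].
rewrite /N nn_sqr (eq_bigr (fun i => l ^+ 2 * ne P0 P1 i ^+ 2 + 2 * l * m * X i + m ^+ 2 * ne Q0 Q1 i ^+ 2)); last first.
  by move=> i _; rewrite {1}/ne vn_sqr; apply: IK_sqr_lin; [exact: p0|exact: p1|exact: q0|exact: q1].
rewrite !big_split /= -!mulr_sumr -!nn_sqr sqrrD !exprMn !sqr_absE.
have gen (u v x y : R) : `|x| <= y -> u ^+ 2 + 2 * l * m * x + v ^+ 2 <= u ^+ 2 + `|l| * `|m| * y *+ 2 + v ^+ 2.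
  move=> xy; have h1 : l * m * x <= `|l| * `|m| * y by rewrite (le_trans (ler_norm _))// !normrM ler_wpM2l// mulr_ge0.
  by move: h1; clear; lra.
rewrite -!exprMn (_ : `|l| * nn P0 P1 * (`|m| * nn Q0 Q1) = `|l| * `|m| * (nn P0 P1 * nn Q0 Q1)); last by ring.
exact: gen.
Qed.

Lemma nn_CS P0 P1 Q0 Q1 (F : 'I_(size T) -> pt -> R) (M : R) : 0 <= M ->
  (forall i, `|IKi i (F i)| <= M * (ne P0 P1 i * ne Q0 Q1 i)) ->
  `|\sum_i IKi i (F i)| <= M * (nn P0 P1 * nn Q0 Q1).
Proof.
move=> M0 h; apply: le_trans (ler_norm_sum _ _ _) _.
apply: (@le_trans _ _ (M * \sum_i ne P0 P1 i * ne Q0 Q1 i)); last by rewrite ler_wpM2l//; exact: CS_sum.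
by rewrite mulr_sumr; apply: ler_sum.
Qed.

End MeshNorm.

(** * Hardy inequalities from vector fields *)

Section HardyGen.
Variable R : realType.
Variable k : nat.
Hypothesis k0 : (0 < k)%N.
Local Notation pt := (R * R)%type.
Variables (Om : set pt) (s : seq pt) (T : mesh R).
Hypothesis OmE : Om = (hull s)°.
Hypothesis conf : conforming Om T.
Local Notation A i := (va (nth_tri (T := T) i)).
Local Notation B i := (vb (nth_tri (T := T) i)).
Local Notation C i := (vc (nth_tri (T := T) i)).
Local Notation D0 := (D0 k (T := T)).
Local Notation D1 := (D1 k (T := T)).
Local Notation loc := (@loc R k T).

Variables (V1 V11 V12 V2 V21 V22 m : pt -> R) (K : R).
Hypothesis cV1 : C1on (closure Om) V1 V11 V12.
Hypothesis cV2 : C1on (closure Om) V2 V21 V22.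
Hypothesis cm : cont (closure Om) m.
Hypothesis m0 : forall x, closure Om x -> 0 <= m x <= V11 x + V22 x.
Hypothesis K0 : 0 <= K.
Hypothesis VK : forall x, closure Om x -> V1 x ^+ 2 + V2 x ^+ 2 <= K * m x.

(* Integrate the divergence of [w^2 V] over the domain: no boundary term. *)
Lemma hardy_gen w : Vh0 Om T k w ->
  \sum_i IKi i (fun x => m x * loc w i x ^+ 2) <= 4 * K * nn (D0 w) (D1 w) ^+ 2.
Proof.
move=> Vw0; have [Vw w0] := Vw0.
pose Psi i (p q nu : pt) x := nu.1 * (V1 x * (loc w i x * loc w i x)) + nu.2 * (V2 x * (loc w i x * loc w i x)).
have pl i := loc_pol k conf w i.
have cl i : cont (HT i) (loc w i) by exact: pol_cont (pl i).
have c1 i : cont (HT (T := T) i) V1 by have [h _ _ _] := cV1; exact: contW (HT_sub conf (i := i)) h.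
have c2 i : cont (HT (T := T) i) V2 by have [h _ _ _] := cV2; exact: contW (HT_sub conf (i := i)) h.
have c11 i : cont (HT (T := T) i) V11 by have [_ h _ _] := cV1; exact: contW (HT_sub conf (i := i)) h.
have c22 i : cont (HT (T := T) i) V22 by have [_ _ h _] := cV2; exact: contW (HT_sub conf (i := i)) h.
have cmi i : cont (HT (T := T) i) m := contW (HT_sub conf (i := i)) cm.
have Z : \sum_i edge3 (Num.sg (jac (A i) (B i) (C i))) (fun p q nu => seg p q (Psi i p q nu)) (A i) (B i) (C i) = 0.
  apply: (edge_cancel OmE conf) => //.
  - by move=> i p q r nu x vi hb hx; rewrite /Psi (bdry_phi k0 conf Vw0 vi hb hx) !mulr0 addr0.
  - by move=> i p q nu; have := c1 i; have := c2 i; have := cl i; rewrite /Psi => *; contt.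
  - move=> i j p q r r' nu x vi vj ij /hull2_line[t _ ->]; rewrite /Psi.
    by rewrite (edge_loc k0 conf w t vi vj ij).
  - by move=> i p q sg x; rewrite /Psi /enu /=; ring.
pose dv i x := V11 x * (loc w i x * loc w i x) + V1 x * (D0 w i x * loc w i x + loc w i x * D0 w i x) +
  (V22 x * (loc w i x * loc w i x) + V2 x * (D1 w i x * loc w i x + loc w i x * D1 w i x)).
have S0 : \sum_i IKi i (dv i) = 0.
  rewrite -[RHS]Z; apply: eq_bigr => i _.
  have cw := pol_C1on (HT i) (pl i); have cww := C1onM cw cw.
  have h1 := C1onM (C1onW (HT_sub conf (i := i)) cV1) cww.
  have h2 := C1onM (C1onW (HT_sub conf (i := i)) cV2) cww.
  exact: div_tri (jacT conf i) h1 h2.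
have cd0 i : cont (HT i) (D0 w i) := pol_cont (D := HT i) (pol_dpart o0 (pl i)).
have cd1 i : cont (HT i) (D1 w i) := pol_cont (D := HT i) (pol_dpart o1 (pl i)).
have cst i (t : R) : cont (HT (T := T) i) (fun=> t) by exact: cont_cst.
suff H i : 2^-1 * IKi i (fun x => m x * loc w i x ^+ 2) <= IKi i (dv i) + 2 * K * ne (D0 w) (D1 w) i ^+ 2.
  have : \sum_i 2^-1 * IKi i (fun x => m x * loc w i x ^+ 2) <= \sum_i (IKi i (dv i) + 2 * K * ne (D0 w) (D1 w) i ^+ 2).
    by apply: ler_sum => i _; exact: H.
  rewrite big_split /= S0 add0r -!mulr_sumr -nn_sqr.
  by move: (\sum_i _) (nn _ _ ^+ 2) => X Y; lra.
have cI (F F' G E : pt -> R) : cont (HT i) F -> cont (HT i) F' -> cont (HT i) G -> cont (HT i) E -> cont (HT i) (fun x =>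
    F x * (E x * E x) + V1 x * (G x * E x + E x * G x) + (V22 x * (E x * E x) + V2 x * (F' x * E x + E x * F' x))).
  by have := c1 i; have := c2 i; have := c22 i => *; contt.
rewrite /ne vn_sqr; apply: (IK_le3 (l := 2^-1) (m := 2 * K)).
- by have := cmi i; have := cl i => *; contt.
- exact: (cI _ _ _ _ (c11 i) (cd1 i) (cd0 i) (cl i)).
- by have := cd0 i; have := cd1 i; move: (D0 w i) (D1 w i) => *; contt.
move=> x hx; have cx := HT_sub conf hx; have := m0 cx; have := VK cx; rewrite /dv.
by move=> vK mm; exact: (hardy_pointwise _ _ _ K0 vK mm).
Qed.

End HardyGen.

Section C1Comp.
Variable R : realType.
Local Notation pt := (R * R)%type.
Implicit Types (D : set pt) (F : pt -> R).

Lemma C1on_coord D (z : pt) : C1on D (fun x => x.1 - z.1) (fun=> 1) (fun=> 0) /\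
  C1on D (fun x => x.2 - z.2) (fun=> 0) (fun=> 1).
Proof.
have c (t : R) : cont D (fun=> t) by exact: cont_cst.
split; (split; [by contt|by contt|by contt|]) => x v l _ _ _ t _ _; rewrite ?mul1r ?mul0r ?addr0 ?add0r.
  by have := path_is_derive (is_deriveB (is_derive_fst (x + t *: v) v) (is_derive_cst z.1 _ _)); rewrite subr0.
by have := path_is_derive (is_deriveB (is_derive_snd (x + t *: v) v) (is_derive_cst z.2 _ _)); rewrite subr0.
Qed.

Lemma contV D F : (forall x, D x -> F x != 0) -> cont D F -> cont D (fun x => (F x)^-1).
Proof. by move=> F0 /contP f; apply/contP => x Dx; apply: cvgV; [exact: F0|exact: f]. Qed.

Lemma cont_ln D F : (forall x, D x -> 0 < F x) -> cont D F -> cont D (fun x => ln (F x)).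
Proof.
move=> F0 /contP f; apply/contP => x Dx; exact: (cvg_comp _ _ (f x Dx) (continuous_ln (F0 x Dx))).
Qed.

Lemma C1onV D F F1 F2 : cvx D -> (forall x, D x -> F x != 0) -> C1on D F F1 F2 ->
  C1on D (fun x => (F x)^-1) (fun x => - (F x)^-1 ^+ 2 * F1 x) (fun x => - (F x)^-1 ^+ 2 * F2 x).
Proof.
move=> cD F0 [f f1 f2 df]; have cV := contV F0 f; split; [exact: cV|by contt|by contt|].
move=> x v l l0 Dx Dy t t0 tl.
have Dt : D (x + t *: v).
  have -> : x + t *: v = x + (t / l) *: (x + l *: v - x).
    by rewrite addrAC subrr add0r scalerA divfK ?gt_eqF.
  by apply: cD => //; rewrite ?divr_ge0 ?ler_pdivrMr ?mul1r // ltW.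
have := is_deriveV (F0 _ Dt) (df x v l l0 Dx Dy t t0 tl).
by rewrite scaleRE -!mulrA -mulrDr exprVn.
Qed.

Lemma C1on_ln D F F1 F2 : cvx D -> (forall x, D x -> 0 < F x) -> C1on D F F1 F2 ->
  C1on D (fun x => ln (F x)) (fun x => (F x)^-1 * F1 x) (fun x => (F x)^-1 * F2 x).
Proof.
move=> cD F0 [f f1 f2 df]; have cl := cont_ln F0 f.
have cV : cont D (fun x => (F x)^-1) by apply: contV f => x Dx; rewrite gt_eqF ?F0.
split; [exact: cl|by contt|by contt|].
move=> x v l l0 Dx Dy t t0 tl.
have Dt : D (x + t *: v).
  have -> : x + t *: v = x + (t / l) *: (x + l *: v - x).
    by rewrite addrAC subrr add0r scalerA divfK ?gt_eqF.
  by apply: cD => //; rewrite ?divr_ge0 ?ler_pdivrMr ?mul1r // ltW.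
have := is_derive1_comp (is_derive1_ln (F0 _ Dt)) (df x v l l0 Dx Dy t t0 tl).
by rewrite mulrDr !mulrA.
Qed.

End C1Comp.

Section HardyField.
Variable R : realType.
Local Notation pt := (R * R)%type.
Variables (D : set pt) (z : pt) (h B : R).
Hypothesis cD : cvx D.
Hypothesis h0 : 0 < h.
Hypothesis sB : forall x, D x -> nrm2 (x - z) + h ^+ 2 <= B.

(** The squared distance to [z], regularized at the scale [h]. In [hL] the logarithm is that of
    [sqrt (B / hs)]: at least 1 in total, and of order |ln h| at [z]. *)
Definition hs x : R := nrm2 (x - z) + h ^+ 2.
Definition hL x : R := 1 + 2^-1 * (ln B - ln (hs x)).

Lemma hs_gt0 x : 0 < hs x.
Proof. by rewrite ltr_wpDl ?exprn_gt0// nrm2_ge0. Qed.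

Lemma hL_ge1 x : D x -> 1 <= hL x.
Proof.
move=> Dx; have s0 := hs_gt0 x; rewrite lerDl mulr_ge0// subr_ge0 ler_ln ?posrE//; first exact: sB.
by apply: lt_le_trans s0 _; exact: sB.
Qed.

(** With [s = hs] and [L = hL] the field is [V = (x - z) / (s L)]. Its divergence is
    [1 / (s L^2) + h^2 (2 L - 1) / (s L)^2], and [|V|^2 <= 1 / (s L^2)]: the two-dimensional Hardy
    weight with its logarithm. *)
Lemma hardy_field : exists V1 V11 V12 V2 V21 V22 : pt -> R, [/\ C1on D V1 V11 V12, C1on D V2 V21 V22,
  cont D (fun x => (hs x * hL x ^+ 2)^-1),
  forall x, D x -> 0 <= (hs x * hL x ^+ 2)^-1 <= V11 x + V22 x &
  forall x, D x -> V1 x ^+ 2 + V2 x ^+ 2 <= 1 * (hs x * hL x ^+ 2)^-1].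
Proof.
have [X1 X2] := C1on_coord D z.
have cs := C1onD (C1onD (C1onM X1 X1) (C1onM X2 X2)) (C1on_cst D (h ^+ 2)).
have hsE : (fun x : pt => (x.1 - z.1) * (x.1 - z.1) + (x.2 - z.2) * (x.2 - z.2) + h ^+ 2) = hs.
  by apply/funext => x; rewrite /hs /nrm2 !expr2.
rewrite hsE in cs; have s0 x (_ : D x) := hs_gt0 x.
have cL := C1onD (C1on_cst D 1) (C1onZ 2^-1 (C1onB (C1on_cst D (ln B)) (C1on_ln cD s0 cs))).
rewrite -/hL in cL; have cP := C1onM cs cL.
have P0 x : D x -> hs x * hL x != 0.
  by move=> Dx; rewrite mulf_neq0 ?gt_eqF ?hs_gt0// (lt_le_trans ltr01 (hL_ge1 Dx)).
have cV := C1onV cD P0 cP; have V1 := C1onM X1 cV; have V2 := C1onM X2 cV.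
have csL : cont D hs /\ cont D hL by have [? _ _ _] := cs; have [? _ _ _] := cL.
eexists _, _, _, _, _, _; split; [exact: V1|exact: V2| | |].
- apply: contV; first by move=> x Dx; rewrite mulf_neq0 ?expf_neq0 ?gt_eqF ?hs_gt0// (lt_le_trans ltr01 (hL_ge1 Dx)).
  by have [c1 c2] := csL; contt.
- move=> x Dx; have := hs_gt0 x; have := hL_ge1 Dx; have : hs x = (x.1 - z.1) ^+ 2 + (x.2 - z.2) ^+ 2 + h ^+ 2 by [].
  move: (hs x) (hL x) (x.1 - z.1) (x.2 - z.2) h0 => s L a b h0' sE L1 sp.
  have L0 : 0 < L by lra.
  apply/andP; split; first by rewrite invr_ge0 mulr_ge0 ?sqr_ge0 ?ltW.
  rewrite -subr_ge0.
  rewrite (_ : _ - _ = (s * L)^-1 ^+ 2 * (h ^+ 2 * (2 * L - 1))).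
    by rewrite mulr_ge0 ?sqr_ge0// mulr_ge0 ?sqr_ge0//; lra.
  by rewrite (_ : h ^+ 2 = s - a ^+ 2 - b ^+ 2); [field; rewrite ?gt_eqF|rewrite sE; ring].
- move=> x Dx; have := hs_gt0 x; have := hL_ge1 Dx; have : hs x = (x.1 - z.1) ^+ 2 + (x.2 - z.2) ^+ 2 + h ^+ 2 by [].
  move: (hs x) (hL x) (x.1 - z.1) (x.2 - z.2) h0 => s L a b h0' sE L1 sp.
  have L0 : 0 < L by lra.
  rewrite mul1r -subr_ge0 (_ : _ - _ = (s * L)^-1 ^+ 2 * h ^+ 2); first by rewrite mulr_ge0 ?sqr_ge0.
  by rewrite (_ : h ^+ 2 = s - a ^+ 2 - b ^+ 2); [field; rewrite ?gt_eqF|rewrite sE; ring].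
Qed.

End HardyField.

(** * The logarithmic weight on the scale of one element *)

Section Weights.
Variable R : realType.
Local Notation pt := (R * R)%type.
Variables (D : set pt) (z : pt) (h B : R).
Hypothesis h0 : 0 < h.
Hypothesis sB : forall x, D x -> nrm2 (x - z) + h ^+ 2 <= B.
Local Notation dst := (hs z h).
Local Notation lgw := (hL z h B).

Lemma ln_le_sub1 (x : R) : 0 < x -> ln x <= x - 1.
Proof. by move=> x0; rewrite -{1}(subrK 1 x) addrC le_ln1Dx//; lra. Qed.

Lemma ln_diff (x y : R) : 0 < x -> 0 < y -> ln y - ln x <= (y - x) / x.
Proof.
move=> x0 y0; rewrite -ln_div ?posrE//; apply: le_trans (ln_le_sub1 _) _; first by rewrite divr_gt0.
by rewrite mulrBl divff ?gt_eqF.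
Qed.

Lemma ln_diff_sqr (x y m : R) : 0 < m -> m <= x -> m <= y -> (ln x - ln y) ^+ 2 <= (x - y) ^+ 2 / m ^+ 2.
Proof.
move=> m0 mx my; have x0 := lt_le_trans m0 mx; have y0 := lt_le_trans m0 my.
rewrite -expr_div_n -(sqr_absE (ln x - _)) -(sqr_absE (_ / _)) lerXn2r ?nnegrE//.
rewrite normrM normfV (gtr0_norm m0) ler_norml.
have im : 0 <= m^-1 by rewrite invr_ge0 ltW.
have i1 : x^-1 <= m^-1 by rewrite lef_pV2 ?posrE.
have i2 : y^-1 <= m^-1 by rewrite lef_pV2 ?posrE.
have ix : 0 < x^-1 by rewrite invr_gt0.
have iy : 0 < y^-1 by rewrite invr_gt0.
have gen (e i : R) : 0 < i -> i <= m^-1 -> e * i <= `|e| * m^-1.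
  move=> i0 im'; apply: le_trans (ler_norm _) _; rewrite normrM (gtr0_norm i0); apply: ler_wpM2l => //.
apply/andP; split.
  rewrite lerNl opprB; apply: le_trans (ln_diff x0 y0) _; rewrite distrC; exact: gen.
apply: le_trans (ln_diff y0 x0) _; exact: gen.
Qed.

(** Points of one element are at most [2 h] apart in each coordinate, and the regularization by
    [h ^+ 2] absorbs such a displacement. *)
Lemma hs_comp x y : `|x.1 - y.1| <= 2 * h -> `|x.2 - y.2| <= 2 * h ->
  dst x <= 17 * dst y /\ (dst x - dst y) ^+ 2 <= 288 * h ^+ 2 * dst y.
Proof.
rewrite /hs /nrm2 /=; move=> h1 h2.
have q (e : R) : `|e| <= 2 * h -> e ^+ 2 <= 4 * h ^+ 2.
  move=> he; have n2 : 0 <= 2 * h by rewrite mulr_ge0// ltW.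
  rewrite (_ : 4 * _ = (2 * h) ^+ 2); last by ring.
  by rewrite -[e ^+ 2]sqr_absE lerXn2r ?nnegrE.
have q1 := q _ h1; have q2 := q _ h2; clear q.
move: q1 q2; rewrite (_ : x.1 - y.1 = (x.1 - z.1) - (y.1 - z.1)); last by ring.
rewrite (_ : x.2 - y.2 = (x.2 - z.2) - (y.2 - z.2)); last by ring.
move: (x.1 - z.1) (x.2 - z.2) (y.1 - z.1) (y.2 - z.2) => a b c d q1 q2.
have H := sqr_ge0 h.
have A1 : a ^+ 2 <= 2 * c ^+ 2 + 8 * h ^+ 2 by have := sqr_ge0 (a - 2 * c); lra.
have A2 : b ^+ 2 <= 2 * d ^+ 2 + 8 * h ^+ 2 by have := sqr_ge0 (b - 2 * d); lra.
have c0 := sqr_ge0 c; have d0 := sqr_ge0 d.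
split; first by lra.
have E : (a ^+ 2 + b ^+ 2 + h ^+ 2 - (c ^+ 2 + d ^+ 2 + h ^+ 2)) ^+ 2 <=
  ((a - c) ^+ 2 + (b - d) ^+ 2) * ((a + c) ^+ 2 + (b + d) ^+ 2).
  rewrite -subr_ge0 (_ : _ - _ = ((a - c) * (b + d) - (b - d) * (a + c)) ^+ 2) ?sqr_ge0//; ring.
apply: le_trans E _; apply: (@le_trans _ _ (8 * h ^+ 2 * (36 * (c ^+ 2 + d ^+ 2 + h ^+ 2)))); last by rewrite -subr_ge0 (_ : _ - _ = 0)//; ring.
apply: ler_pM; rewrite ?addr_ge0 ?sqr_ge0//; first lra.
have := sqr_ge0 (a - c); have := sqr_ge0 (b - d); lra.
Qed.

Lemma hL_comp x y : `|x.1 - y.1| <= 2 * h -> `|x.2 - y.2| <= 2 * h -> D y -> lgw x <= 9 * lgw y.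
Proof.
move=> h1 h2 Dy; have L1 := hL_ge1 h0 sB Dy; have sx := hs_gt0 z h0 x; have sy := hs_gt0 z h0 y.
have [c1 _] : dst y <= 17 * dst x /\ (dst y - dst x) ^+ 2 <= 288 * h ^+ 2 * dst x by apply: hs_comp; rewrite distrC.
have : ln (dst y) - ln (dst x) <= 16.
  rewrite -ln_div ?posrE//; apply: le_trans (ln_le_sub1 _) _; first by rewrite divr_gt0.
  have : dst y / dst x <= 17 by rewrite ler_pdivrMr.
  by lra.
by move: L1; rewrite /hL; lra.
Qed.

Definition hclose (x y : pt) := `|x.1 - y.1| <= 2 * h /\ `|x.2 - y.2| <= 2 * h.

(** The reciprocal of the Hardy weight of [hardy_field]. *)
Definition hP x : R := dst x * lgw x ^+ 2.

Lemma hP_gt0 x : D x -> 0 < hP x.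
Proof. by move=> Dx; rewrite mulr_gt0 ?hs_gt0// exprn_gt0// (lt_le_trans ltr01)// (hL_ge1 h0 sB Dx). Qed.

Lemma hP_comp x y : `|x.1 - y.1| <= 2 * h -> `|x.2 - y.2| <= 2 * h -> D x -> D y -> hP x <= 1377 * hP y.
Proof.
move=> h1 h2 Dx Dy; have [c1 _] := hs_comp h1 h2; have c2 := hL_comp h1 h2 Dy.
have Lx := hL_ge1 h0 sB Dx; have Ly := hL_ge1 h0 sB Dy.
rewrite /hP (_ : 1377 * _ = (17 * dst y) * (9 * lgw y) ^+ 2); last by ring.
apply: ler_pM => //; [by rewrite ltW ?hs_gt0|exact: sqr_ge0|].
by rewrite lerXn2r ?nnegrE//; lra.
Qed.

(** The gradient of [ln L] has size at most [1 / (L sqrt s)], the square root of the Hardy weight,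
    so over one element [ln L] varies by [h] times that. *)
Lemma sigma_osc x y v : hclose x y -> hclose v x -> hclose v y ->
  D x -> D y -> D v -> (ln (lgw x) - ln (lgw y)) ^+ 2 <= 72 * 1377 * h ^+ 2 / hP v.
Proof.
move=> [xy1 xy2] [x1 x2] [y1 y2] Dx Dy Dv.
have [yx1 yx2] : hclose y x by rewrite /hclose !(distrC (y : pt).1) !(distrC (y : pt).2).
have Lx := hL_ge1 h0 sB Dx; have Ly := hL_ge1 h0 sB Dy; have Lv := hL_ge1 h0 sB Dv.
have lx := hL_comp x1 x2 Dx; have ly := hL_comp y1 y2 Dy.
have [sx _] := hs_comp x1 x2; have [sy _] := hs_comp y1 y2; have sv := hs_gt0 z h0 v.
have [_ d1] := hs_comp xy1 xy2; have [_ d2] := hs_comp yx1 yx2.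
(* By comparability these bound [hs] and [hL] from below at both [x] and [y], in terms of the third
   point [v]. *)
pose m : R := dst v / 17; pose n : R := lgw v / 9.
have m0 : 0 < m by rewrite divr_gt0.
have n0 : 0 < n by rewrite divr_gt0//; lra.
have D1 : (dst x - dst y) ^+ 2 <= 288 * h ^+ 2 * Num.min (dst x) (dst y).
  by rewrite minEle; case: ifP => // _; rewrite -sqrrN opprB.
pose mm : R := Num.min (dst x) (dst y).
have mm0 : 0 < mm by rewrite lt_min !hs_gt0.
have mmm : m <= mm by rewrite le_min /m; apply/andP; split; lra.
have E1 : (ln (dst x) - ln (dst y)) ^+ 2 <= 288 * h ^+ 2 / m.
  apply: le_trans (ln_diff_sqr mm0 _ _) _; rewrite ?ge_min ?lexx ?orbT//.
  apply: (@le_trans _ _ (288 * h ^+ 2 / mm)).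
    rewrite ler_pdivrMr ?exprn_gt0// expr2 mulrA divfK ?gt_eqF//.
  have im : mm^-1 <= m^-1 by rewrite lef_pV2 ?posrE.
  have c0 : 0 <= 288 * h ^+ 2 :> R by rewrite mulr_ge0 ?ler0n ?sqr_ge0.
  exact: (ler_wpM2l c0 im).
have E2 : (lgw x - lgw y) ^+ 2 <= 72 * h ^+ 2 / m.
  have -> : lgw x - lgw y = - 2^-1 * (ln (dst x) - ln (dst y)) by rewrite /hL; ring.
  by rewrite exprMn; move: E1; rewrite -!mulrA; move: (_ ^+ 2) (h ^+ 2 / m) => X Y; lra.
have E3 : (ln (lgw x) - ln (lgw y)) ^+ 2 <= (lgw x - lgw y) ^+ 2 / n ^+ 2.
  by apply: ln_diff_sqr => //; rewrite /n; lra.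
apply: le_trans E3 _; rewrite ler_pdivrMr ?exprn_gt0//; apply: le_trans E2 _.
rewrite (_ : 72 * 1377 * h ^+ 2 / hP v * n ^+ 2 = 72 * h ^+ 2 / m)//.
rewrite /hP /n /m; move: (dst v) (lgw v) (h ^+ 2) sv Lv => t L H t0 L1.
by field; rewrite !gt_eqF//; lra.
Qed.

(** Since [s = B exp (- 2 (L - 1))], a fixed power of [L] is beaten by [1 / s]; with [ln L <= L] the
    product [s L^4] has to be bounded. This controls the L^2 norm of functions multiplied by
    [ln L]. *)
Lemma sigma_sqr x : D x -> 0 <= ln (lgw x) /\ ln (lgw x) ^+ 2 <= 16 * B / hP x.
Proof.
move=> Dx; have L1 := hL_ge1 h0 sB Dx; have sx := hs_gt0 z h0 x.
have l0 : 0 <= ln (lgw x) by exact: ln_ge0.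
have B0 : 0 < B by apply: lt_le_trans sx _; exact: sB.
split=> //; rewrite ler_pdivlMr ?hP_gt0// /hP mulrCA -exprMn.
have lL : ln (lgw x) <= lgw x by apply/ltW/ln_sublinear; lra.
have e1 : lgw x / 2 <= expR ((lgw x - 1) / 2) by apply: le_trans (expR_ge1Dx _); lra.
have e4 : (lgw x / 2) ^+ 4 <= expR (2 * (lgw x - 1)).
  have -> : expR (2 * (lgw x - 1)) = expR ((lgw x - 1) / 2) ^+ 4 by rewrite -expRM_natl; congr expR; field.
  by rewrite lerXn2r ?nnegrE ?expR_ge0// divr_ge0//; lra.
have sE : dst x * expR (2 * (lgw x - 1)) = B.
  rewrite -{1}(lnK sx) -expRD (_ : _ + _ = ln B) ?lnK//.
  by rewrite /hL; field.
have : (ln (lgw x) * lgw x) ^+ 2 <= 16 * (lgw x / 2) ^+ 4.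
  rewrite (_ : 16 * _ = (lgw x * lgw x) ^+ 2); last by field.
  by rewrite lerXn2r ?nnegrE ?mulr_ge0 ?ler_wpM2r//; lra.
have gen (X Y E t b : R) : X <= 16 * Y -> Y <= E -> t * E = b -> 0 < t -> t * X <= 16 * b.
  by move=> XY YE <- t0; rewrite mulrCA ler_pM2l//; lra.
move=> e5; exact: gen e5 e4 sE sx.
Qed.

End Weights.

Lemma weight_const (R : realType) : exists2 c : R, 0 < c & forall (D : set (R * R)) z (h B : R), 0 < h ->
  (forall x, D x -> nrm2 (x - z) + h ^+ 2 <= B) ->
  (forall x y, hclose h x y -> D x -> D y -> hP z h B x <= c * hP z h B y) /\
  (forall x y v, hclose h x y -> hclose h v x -> hclose h v y -> D x -> D y -> D v ->
    (ln (hL z h B x) - ln (hL z h B y)) ^+ 2 <= c * h ^+ 2 / hP z h B v).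
Proof.
have c0 (n : nat) : 0 < n.+1%:R :> R by rewrite ltr0n.
have [c1 c2] : 0 < 72 :> R /\ 0 < 1377 :> R by split; exact: c0.
exists (72 * 1377) => [|D z h B h0 sB]; first exact: mulr_gt0.
split=> [x y [n1 n2] Dx Dy|]; last exact: (sigma_osc h0 sB).
apply: le_trans (hP_comp h0 sB n1 n2 Dx Dy) _; have Py := hP_gt0 h0 sB Dy.
have one : 1 <= 72 :> R by rewrite ler1n.
by rewrite (ler_pM2r Py); exact: (ler_peMl (ltW c2) one).
Qed.

(** * Interpolation of products with the logarithmic weight *)

Section ElementEstimates.
Variable R : realType.
Local Notation pt := (R * R)%type.

Lemma reg_jac_le (kap h : R) (a b c : pt) : reg kap h a b c -> `|jac a b c| <= 2 * h ^+ 2.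
Proof.
move=> [_ h0 [b1 b2 c1 c2] _]; rewrite /jac; apply: le_trans (ler_normB _ _) _.
rewrite !normrM mulrDl !mul1r expr2; apply: lerD; exact: ler_pM.
Qed.

Lemma hull3_range (a b c x : pt) (h : R) : `|(b - a).1| <= h -> `|(b - a).2| <= h -> `|(c - a).1| <= h -> `|(c - a).2| <= h ->
  hull [:: a; b; c] x -> `|x.1 - a.1| <= h /\ `|x.2 - a.2| <= h.
Proof.
move=> b1 b2 c1 c2 /hull3P[s [t [u [[s0 t0 u0] e ->]]]].
have gen (l m al be : R) : 0 <= l -> 0 <= m -> l + m <= 1 -> `|al| <= h -> `|be| <= h -> `|l * al + m * be| <= h.
  move=> l0 m0 lm ha hb; have h0 : 0 <= h := le_trans (normr_ge0 _) ha.
  apply: le_trans (ler_normD _ _) _; rewrite !normrM (ger0_norm l0) (ger0_norm m0).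
  have := ler_wpM2l l0 ha; have := ler_wpM2l m0 hb; have : 0 <= (1 - l - m) * h by rewrite mulr_ge0//; lra.
  by lra.
have -> : s = 1 - t - u by lra.
split; [rewrite (_ : _ - a.1 = t * (b - a).1 + u * (c - a).1)|rewrite (_ : _ - a.2 = t * (b - a).2 + u * (c - a).2)];
  try (by apply: gen => //; lra); rewrite /= !scaleRE; ring.
Qed.

Lemma hull3_close (kap h : R) (a b c x y : pt) : reg kap h a b c -> hull [:: a; b; c] x -> hull [:: a; b; c] y -> hclose h x y.
Proof.
move=> [_ h0 [b1 b2 c1 c2] _] /(hull3_range b1 b2 c1 c2)[x1 x2] /(hull3_range b1 b2 c1 c2)[y1 y2].
have gen (u v w : R) : `|u - w| <= h -> `|v - w| <= h -> `|u - v| <= 2 * h.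
  by move=> h1 h2; apply: le_trans (ler_distD w u v) _; rewrite (distrC w); lra.
by split; [exact: gen x1 y1|exact: gen x2 y2].
Qed.

Definition inv_const (n : nat) (Ci h : R) (a b c : pt) := forall p, pol n p ->
  [/\ forall x, hull [:: a; b; c] x -> `|p x| <= Ci / h * L2 a b c p,
      forall i x, hull [:: a; b; c] x -> `|dpart [:: i] p x| <= Ci / h * vn a b c (dpart [:: o0] p) (dpart [:: o1] p),
      vn a b c (dpart [:: o0] p) (dpart [:: o1] p) <= Ci / h * L2 a b c p &
      forall M : R, (forall x, hull [:: a; b; c] x -> `|p x| <= M) -> L2 a b c p <= 2 * h * M].

Lemma L2_ge0 (a b c : pt) F : 0 <= L2 a b c F. Proof. exact: sqrtr_ge0. Qed.

Lemma L2_sqr (a b c : pt) F : L2 a b c F ^+ 2 = IK a b c (fun x => F x ^+ 2).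
Proof. by rewrite sqr_sqrtr//; apply: IK_ge0 => x _; exact: sqr_ge0. Qed.

Lemma L2_vn (a b c : pt) F : L2 a b c F = vn a b c F (fun=> 0).
Proof. by rewrite /L2 /vn; congr (Num.sqrt _); apply: IK_eq => x _; rewrite expr0n addr0. Qed.

Lemma vn_L2 (a b c : pt) F G : cont (hull [:: a; b; c]) F -> cont (hull [:: a; b; c]) G ->
  vn a b c F G ^+ 2 = L2 a b c F ^+ 2 + L2 a b c G ^+ 2.
Proof.
move=> cF cG; have c1 : cont (hull [:: a; b; c]) (fun x => F x ^+ 2) by contt.
have c2 : cont (hull [:: a; b; c]) (fun x => G x ^+ 2) by contt.
by rewrite vn_sqr !L2_sqr IKD.
Qed.

Lemma inverse_const n (kap : R) : exists2 Ci : R, 0 < Ci & forall h a b c, reg kap h a b c -> inv_const n Ci h a b c.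
Proof.
have [C C0 hC] := inverse_bounds n kap; have [C' C'0 hC'] := inverse_bounds n.-1 kap.
have cc1 : C <= 2 * C + C' by lra.
have cc2 : C' <= 2 * C + C' by lra.
have cc3 : 2 * C <= 2 * C + C' by lra.
exists (2 * C + C'); first by lra.
have gen (u v m : R) : 0 <= u -> 0 <= v -> 0 <= m -> u <= m -> v <= m -> u ^+ 2 + v ^+ 2 <= (2 * m) ^+ 2.
  by move=> u0 v0' m0 um vm; nra.
move=> h a b c rg p pp; have [kap0 h0 _ _] := rg; have J := reg_jac rg.
have hV : 0 < h^-1 by rewrite invr_gt0.
pose d i := dpart [:: i] p; have pd i : pol n.-1 (d i) by exact: pol_dpart.
have cd i : cont (hull [:: a; b; c]) (d i) by exact: pol_cont (pd i).
have vs := vn_L2 (cd o0) (cd o1); have v0 := vn_ge0 a b c (d o0) (d o1).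
have le_v (X Y Z : R) : 0 <= X -> 0 <= Z -> Z ^+ 2 = X ^+ 2 + Y ^+ 2 -> X <= Z.
  by move=> X0 Z0 e; rewrite -(ger0_norm X0); apply: sqr_le_norm => //; rewrite e lerDl sqr_ge0.
have Ld0 := le_v _ _ _ (L2_ge0 a b c (d o0)) v0 vs.
have Ld1 := le_v _ _ _ (L2_ge0 a b c (d o1)) v0 (etrans vs (addrC _ _)).
have Ld := I2P (P := fun i => L2 a b c (d i) <= vn a b c (d o0) (d o1)) Ld0 Ld1.
have mono (X Y Z : R) : 0 <= Z -> X <= Y -> X / h * Z <= Y / h * Z.
  by move=> Z0 XY; rewrite ler_wpM2r// ler_pM2r.
have h1 := hC h a b c p rg pp.
split.
- by move=> x hx; have [k1 _ _] := h1 x hx; exact: le_trans k1 (mono _ _ _ (L2_ge0 a b c p) cc1).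
- move=> i x hx; have [k1 _ _] := hC' h a b c _ rg (pd i) x hx; apply: le_trans k1 _.
  have cp : 0 <= C' / h by rewrite divr_ge0 ?ltW.
  exact: le_trans (ler_wpM2l cp (Ld i)) (mono _ _ _ v0 cc2).
- have [_ _ k3] := h1 a (hull3_v1 a b c).
  apply: le_trans (mono _ _ _ (L2_ge0 a b c p) cc3).
  have b0 : 0 <= C / h * L2 a b c p by rewrite mulr_ge0 ?L2_ge0 ?divr_ge0 ?ltW.
  rewrite -(ger0_norm v0); apply: sqr_le_norm; first by rewrite -!mulrA mulr_ge0// mulrA.
  rewrite vs -!mulrA (mulrA C); exact: (gen _ _ _ (L2_ge0 _ _ _ _) (L2_ge0 _ _ _ _) b0 (k3 o0) (k3 o1)).
- move=> M hM; rewrite L2_vn; have cp : cont (hull [:: a; b; c]) p by exact: pol_cont pp.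
  have hM0 x : hull [:: a; b; c] x -> `|(fun=> 0 : R) x| <= M by move=> hx; rewrite normr0; exact: le_trans (hM x hx).
  have c0 : cont (hull [:: a; b; c]) (fun=> 0) by exact: cont_cst.
  have := vn_bound J (reg_jac_le rg) (ltW h0) cp c0 hM hM0; exact.
Qed.

(** Interpolation is stable in the maximum norm and reads [g] only at the nodes, so a bound on [g]
    over the element suffices. *)
Lemma LI_prod k : (0 < k)%N -> exists2 C : R, 0 < C & forall (a b c : pt) (g w : pt -> R) (G W : R), jac a b c != 0 -> 0 <= G -> 0 <= W ->
  (forall x, hull [:: a; b; c] x -> `|g x| <= G) -> (forall x, hull [:: a; b; c] x -> `|w x| <= W) ->
  forall x, hull [:: a; b; c] x -> `|LI k a b c (fun x => g x * w x) x| <= C * (G * W).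
Proof.
move=> k0; have [C C0 hC] := lagr_bound R k0; exists (C *+ (size (adm k)).+1); first by rewrite pmulrn_lgt0.
move=> a b c g w G W J G0 W0 hg hw x hx; rewrite /LI; apply: le_trans (ler_norm_sum _ _ _) _.
have GW : 0 <= G * W by rewrite mulr_ge0.
apply: (@le_trans _ _ (\sum_(t <- adm k) G * W * C)).
  rewrite big_seq [leRHS]big_seq; apply: ler_sum => t; rewrite mem_filter => /andP[ta _].
  have hn := nd_hull k0 J ta.
  rewrite normrM (normrM (g _)); have e1 := ler_pM (normr_ge0 _) (normr_ge0 _) (hg _ hn) (hw _ hn).
  exact: (ler_pM (mulr_ge0 (normr_ge0 _) (normr_ge0 _)) (normr_ge0 _) e1 (hC _ _ _ _ _ _ J ta hx)).
by rewrite big_const_seq count_predT iter_addr_0 mulrnAl (mulrC C) [leRHS]mulrS lerDr mulr_ge0// ltW.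
Qed.

End ElementEstimates.

Lemma gain_arith (R : realType) (Ci Cp c1 c3 h q L H : R) : 0 < Ci -> 0 < Cp -> 0 <= c1 -> 0 <= c3 -> 0 < h -> 0 < q ->
  0 <= H -> L <= c1 * (q * H) -> let C := 1 + 2 * Cp * c3 * Ci * c1 + 2 * Cp * Ci ^+ 2 * c1 * c1 + c1 in
  [/\ 2 * h * (Cp * (c3 / q * (Ci / h * L))) <= C * H, Ci / h * (2 * h * (Cp * (c1 * h / q * (Ci / h * L)))) <= C * H &
    c1 * (q * H) <= C * (q * H)].
Proof.
move=> Ci0 Cp0 c10 c30 h0 q0 H0 Lw C.
have hn : h != 0 by rewrite gt_eqF.
have qn : q != 0 by rewrite gt_eqF.
have Lq : L / q <= c1 * H by rewrite ler_pdivrMr// -mulrA (mulrC H).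
have d1 : 0 <= 2 * Cp * c3 * Ci by rewrite !mulr_ge0// ltW.
have d2 : 0 <= 2 * Cp * Ci ^+ 2 * c1 by rewrite !mulr_ge0 ?sqr_ge0// ltW.
have d1' := mulr_ge0 d1 c10; have d2' := mulr_ge0 d2 c10.
have fin (Y : R) : Y <= C -> Y * H <= C * H by move=> *; rewrite ler_wpM2r.
split.
- rewrite [leLHS](_ : _ = 2 * Cp * c3 * Ci * (L / q)); last by field; rewrite hn qn.
  by apply: le_trans (ler_wpM2l d1 Lq) _; rewrite mulrA; apply: fin; rewrite /C; lra.
- rewrite [leLHS](_ : _ = 2 * Cp * Ci ^+ 2 * c1 * (L / q)); last by field; rewrite hn qn.
  by apply: le_trans (ler_wpM2l d2 Lq) _; rewrite mulrA; apply: fin; rewrite /C; lra.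
- by apply: ler_wpM2r; [rewrite mulr_ge0// ltW|rewrite /C; lra].
Qed.

Section GainLocal.
Variable R : realType.
Local Notation pt := (R * R)%type.
Variables (k : nat) (kap B : R).
Hypothesis k0 : (0 < k)%N.
Hypothesis B0 : 0 < B.

Definition hd (z : pt) (h : R) (a b c : pt) (w : pt -> R) := Num.sqrt (IK a b c (fun x => (hP z h B x)^-1 * w x ^+ 2)).

Lemma hd_sqr (D : set pt) (z : pt) (h : R) (a b c : pt) (w : pt -> R) : 0 < h -> hull [:: a; b; c] `<=` D ->
  (forall x, D x -> nrm2 (x - z) + h ^+ 2 <= B) -> hd z h a b c w ^+ 2 = IK a b c (fun x => (hP z h B x)^-1 * w x ^+ 2).
Proof.
move=> h0 HD hB; rewrite sqr_sqrtr//; apply: IK_ge0 => x hx; rewrite mulr_ge0 ?sqr_ge0// invr_ge0 ltW//.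
by apply: (hP_gt0 h0 hB); apply: HD; exact: interior_subset hx.
Qed.

(** Superapproximation for the weight [sg = ln L]. Freezing it at the vertex [a] splits the
    interpolant of [sg w] into [sg a * w] and [E]; as [sg - sg a] is [h] times the root of the Hardy
    weight ([sigma_osc]), the factor h^-1 lost in differentiating [E] is recovered. The L^2 bound
    rests on [sigma_sqr]. *)
Lemma gain_local : exists2 C : R, 0 < C & forall (h : R) (a b c z : pt) (D : set pt) (w : pt -> R), reg kap h a b c ->
  hull [:: a; b; c] `<=` D -> (forall x, D x -> nrm2 (x - z) + h ^+ 2 <= B) ->
  cont D (fun x => (hP z h B x)^-1) -> pol k w ->
  let sg x := ln (hL z h B x) in
  let E := LI k a b c (fun x => (sg x - sg a) * w x) in
  [/\ pol k E, forall x, LI k a b c (fun x => sg x * w x) x = sg a * w x + E x,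
      L2 a b c (LI k a b c (fun x => sg x * w x)) <= C * hd z h a b c w,
      vn a b c (dpart [:: o0] E) (dpart [:: o1] E) <= C * hd z h a b c w &
      L2 a b c w <= C * (Num.sqrt (hP z h B a) * hd z h a b c w)].
Proof.
have [Ci Ci0 hCi] := inverse_const k kap; have [Cp Cp0 hCp] := LI_prod R k0.
have [cc cc0 wc] := weight_const R.
pose c1 : R := Num.sqrt cc; pose c3 : R := Num.sqrt (16 * B * cc).
have [c10 c30] : 0 <= c1 /\ 0 <= c3 by split; exact: sqrtr_ge0.
have s1 : c1 ^+ 2 = cc by rewrite sqr_sqrtr// ltW.
have s3 : c3 ^+ 2 = 16 * B * cc by rewrite sqr_sqrtr// !mulr_ge0// ltW.
exists (1 + 2 * Cp * c3 * Ci * c1 + 2 * Cp * Ci ^+ 2 * c1 * c1 + c1).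
  by rewrite -!addrA ltr_wpDr// !addr_ge0// !mulr_ge0 ?sqr_ge0// ltW.
move=> h a b c z D w rg HD hB cV pw sg E; have [kap0 h0 _ _] := rg; have J := reg_jac rg.
have Ha : hull [:: a; b; c] a := hull3_v1 a b c; have Da := HD _ Ha.
have cw : cont (hull [:: a; b; c]) w by exact: pol_cont pw.
have P0 x : D x -> 0 < hP z h B x by exact: hP_gt0.
have [hPc hosc] := wc D z h B h0 hB; have Pa := P0 _ Da; pose q : R := Num.sqrt (hP z h B a).
have q0 : 0 < q by rewrite sqrtr_gt0.
have q2 : q ^+ 2 = hP z h B a by rewrite sqr_sqrtr// ltW.
have hd0 : 0 <= hd z h a b c w by exact: sqrtr_ge0.
have cl x y : hull [:: a; b; c] x -> hull [:: a; b; c] y -> hclose h x y by move=> hx hy; exact: hull3_close rg hx hy.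
have Lw : L2 a b c w <= c1 * (q * hd z h a b c w).
  rewrite -(ger0_norm (L2_ge0 a b c w)); apply: sqr_le_norm; first by rewrite !mulr_ge0// ltW.
  rewrite L2_sqr !exprMn s1 q2 (hd_sqr w h0 HD hB) mulrA.
  have cm : cont (hull [:: a; b; c]) (fun x => (hP z h B x)^-1 * w x ^+ 2).
    by have := contW HD cV => cV'; contt.
  rewrite -IKZ//; have cst (t : R) : cont (hull [:: a; b; c]) (fun=> t) by exact: cont_cst.
  apply: IK_le; [by contt|exact: contM (cst _) cm|].
  move=> x hx; have Dx := HD _ hx; have xa := cl _ _ hx Ha.
  rewrite mulrA ler_peMl ?sqr_ge0// ler_pdivlMr ?P0// mul1r; exact: (hPc _ _ xa Dx Da).
have I := hCi h a b c rg; have [w1 _ _ _] := I w pw.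
set L : R := L2 a b c w in Lw w1 *; have L0 : 0 <= L := L2_ge0 a b c w.
have W0 : 0 <= Ci / h * L by apply: mulr_ge0 => //; exact: divr_ge0 (ltW _) (ltW _).
have pE : pol k E by exact: LI_pol.
have pF : pol k (LI k a b c (fun x => sg x * w x)) by exact: LI_pol.
have g1 : 0 <= c1 * h / q := divr_ge0 (mulr_ge0 c10 (ltW h0)) (ltW q0).
have g2 : 0 <= c3 / q := divr_ge0 c30 (ltW q0).
have G1 x : hull [:: a; b; c] x -> `|sg x - sg a| <= c1 * h / q.
  move=> hx; apply: sqr_le_norm => //.
  rewrite expr_div_n exprMn s1 q2; by apply: hosc; try exact: cl; exact: HD.
have G2 x : hull [:: a; b; c] x -> `|sg x| <= c3 / q.
  move=> hx; apply: sqr_le_norm => //.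
  have [_ l2] := sigma_sqr h0 hB (HD _ hx); apply: le_trans l2 _.
  rewrite expr_div_n s3 q2.
  have gen (X p p' : R) : 0 < p -> 0 < p' -> p <= cc * p' -> 0 <= X -> X / p' <= X * cc / p.
    move=> p0 p'0 pp X0; rewrite -mulrA ler_wpM2l// ler_pdivlMr// ler_pdivrMl//; lra.
  have n16 : 0 <= 16 * B by rewrite mulr_ge0// ltW.
  exact: (gen _ _ _ Pa (P0 _ (HD _ hx)) (hPc _ _ (cl _ _ Ha hx) Da (HD _ hx)) n16).
have BE := hCp a b c (fun x => sg x - sg a) w _ _ J g1 W0 G1 w1.
have BF := hCp a b c sg w _ _ J g2 W0 G2 w1.
have [_ _ e3 e4] := I E pE; have [_ _ _ f4] := I _ pF.
have [K1 K2 K3] := gain_arith Ci0 Cp0 c10 c30 h0 q0 hd0 Lw.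
split=> //.
- move=> x; rewrite -[in RHS](LI_id k0 J pw) /E /LI mulr_sumr -big_split /=; apply: eq_bigr => t _; ring.
- exact: le_trans (f4 _ BF) K1.
- have e5 := e4 _ BE; have cp : 0 <= Ci / h := divr_ge0 (ltW Ci0) (ltW h0).
  exact: le_trans e3 (le_trans (ler_wpM2l cp e5) K2).
- exact: le_trans Lw K3.
Qed.

End GainLocal.

(** * Energy, Hardy and maximum norm estimates in the discrete space *)

Section Global.
Variable R : realType.
Local Notation pt := (R * R)%type.
Variable k : nat.
Hypothesis k0 : (0 < k)%N.
Variables (Om : set pt) (s : seq pt).
Hypothesis OmE : Om = (hull s)°.
Hypothesis Om0 : Om !=set0.
Variable kap : R.

Definition dw (T : mesh R) w := nn (D0 k (T := T) w) (D1 k (T := T) w).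
Definition lw (T : mesh R) w := nn (@loc R k T w) (fun _ _ => 0).
Definition de (T : mesh R) w (i : 'I_(size T)) := ne (D0 k w) (D1 k w) i.
Definition le2 (T : mesh R) w (i : 'I_(size T)) := L2 (va (nth_tri i)) (vb (nth_tri i)) (vc (nth_tri i)) (loc k w i).

Definition regT (h : R) (T : mesh R) := forall i : 'I_(size T), reg kap h (va (nth_tri i)) (vb (nth_tri i)) (vc (nth_tri i)).

Lemma lw_sqr T w : lw T w ^+ 2 = \sum_i le2 (T := T) w i ^+ 2.
Proof. by rewrite /lw nn_sqr; apply: eq_bigr => i _; rewrite /le2 L2_vn. Qed.

Lemma dw_ge0 T w : 0 <= dw T w. Proof. exact: nn_ge0. Qed.
Lemma lw_ge0 T w : 0 <= lw T w. Proof. exact: nn_ge0. Qed.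
Lemma de_ge0 T w i : 0 <= de (T := T) w i. Proof. exact: ne_ge0. Qed.
Lemma le2_ge0 T w i : 0 <= le2 (T := T) w i. Proof. exact: L2_ge0. Qed.

Lemma D_cont T w i : conforming Om T -> cont (HT i) (loc k w i) /\ cont (HT (T := T) i) (D0 k w i) /\ cont (HT i) (D1 k w i).
Proof.
move=> conf; have pl := loc_pol k conf w i.
by split; [exact: pol_cont pl|split; [exact: pol_cont (pol_dpart o0 pl)|exact: pol_cont (pol_dpart o1 pl)]].
Qed.

(** [hardy_gen] with the field [V = x], of divergence 2. *)
Lemma friedrichs : exists2 C : R, 0 < C & forall T w, conforming Om T -> Vh0 Om T k w -> lw T w <= C * dw T w.
Proof.
have [M M0 hM] := compact_box (compact_closure OmE Om0).
exists (2 * M) => [|T w conf Vw]; first by rewrite mulr_gt0.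
have [c1 c2] := C1on_coord (closure Om) (0 : pt).
have c3 : cont (closure Om) (fun=> 2 : R) by exact: cont_cst.
have K0 : 0 <= M ^+ 2 by exact: sqr_ge0.
have m0 (x : pt) : closure Om x -> 0 <= (2 : R) <= 1 + 1 by rewrite ler0n /= (_ : 1 + 1 = 2).
have VK x : closure Om x -> (x.1 - (0 : pt).1) ^+ 2 + (x.2 - (0 : pt).2) ^+ 2 <= M ^+ 2 * 2.
  move=> /hM[x1 x2]; rewrite /= !subr0 mulr_natr mulr2n lerD//.
    by rewrite -[leLHS]sqr_absE lerXn2r ?nnegrE// ltW.
  by rewrite -[leLHS]sqr_absE lerXn2r ?nnegrE// ltW.
have H := hardy_gen k0 OmE conf c1 c2 c3 m0 K0 VK Vw.
have l0 : 0 <= 2 * M * dw T w by rewrite mulr_ge0 ?dw_ge0// mulr_ge0// ltW.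
rewrite -(ger0_norm (lw_ge0 T w)); apply: sqr_le_norm l0 _.
rewrite lw_sqr exprMn; have E : \sum_i IKi (T := T) i (fun x => 2 * loc k w i x ^+ 2) = 2 * \sum_i le2 (T := T) w i ^+ 2.
  rewrite mulr_sumr; apply: eq_bigr => i _; rewrite /le2 L2_sqr /IKi IKZ//.
  by have [cl _] := D_cont w i conf; exact: contX cl.
have gen (X Y Q : R) : 0 <= Y -> 0 <= Q -> 2 * X <= 4 * Q * Y -> X <= 4 * Q * Y.
  by move=> Y0 Q0; have := mulr_ge0 Q0 Y0; lra.
by rewrite exprMn (_ : 2 ^+ 2 = 4); [apply: gen; rewrite ?sqr_ge0// -E|ring].
Qed.

Lemma weight_size : exists2 B : R, 0 < B & forall x z (h : R), closure Om x -> closure Om z -> 0 < h -> h <= 1 ->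
  nrm2 (x - z) + h ^+ 2 <= B.
Proof.
have [M M0 hM] := compact_box (compact_closure OmE Om0).
exists (2 * (2 * M) ^+ 2 + 1) => [|x z h cx cz h0 h1]; first by rewrite ltr_wpDl// mulr_ge0// sqr_ge0.
have [x1 x2] := hM x cx; have [z1 z2] := hM z cz.
have q (a b : R) : `|a| <= M -> `|b| <= M -> (a - b) ^+ 2 <= (2 * M) ^+ 2.
  move=> ha hb; have M2 : 0 <= 2 * M by rewrite mulr_ge0// ltW.
  rewrite -[leLHS]sqr_absE lerXn2r ?nnegrE//; apply: le_trans (ler_normB _ _) _; lra.
have hh : h ^+ 2 <= 1 by rewrite expr_le1// ltW.
by rewrite /nrm2 /=; have := q _ _ x1 z1; have := q _ _ x2 z2; lra.
Qed.

Variable B : R.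
Hypothesis B0 : 0 < B.
Hypothesis hB : forall x z (h : R), closure Om x -> closure Om z -> 0 < h -> h <= 1 -> nrm2 (x - z) + h ^+ 2 <= B.

Lemma weight_cont z (h : R) : closure Om z -> 0 < h -> h <= 1 -> cont (closure Om) (fun x => (hP z h B x)^-1).
Proof.
move=> cz h0 h1; have hz x (cx : closure Om x) := hB cx cz h0 h1.
have [V1 [V11 [V12 [V2 [V21 [V22 [_ _ cm _ _]]]]]]] := hardy_field (cvx_closure OmE Om0) h0 hz.
exact: cm.
Qed.

Definition hde z h (T : mesh R) w (i : 'I_(size T)) := hd B z h (va (nth_tri i)) (vb (nth_tri i)) (vc (nth_tri i)) (loc k w i).

Lemma hardy_mesh T w z (h : R) : conforming Om T -> Vh0 Om T k w -> closure Om z -> 0 < h -> h <= 1 ->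
  Num.sqrt (\sum_i hde z h (T := T) w i ^+ 2) <= 2 * dw T w.
Proof.
move=> conf Vw cz h0 h1; have hz x (cx : closure Om x) := hB cx cz h0 h1.
have [V1 [V11 [V12 [V2 [V21 [V22 [c1 c2 cm m0 VK]]]]]]] := hardy_field (cvx_closure OmE Om0) h0 hz.
have H := hardy_gen k0 OmE conf c1 c2 cm m0 ler01 VK Vw.
rewrite -(ger0_norm (sqrtr_ge0 _)); apply: sqr_le_norm; first by rewrite mulr_ge0// dw_ge0.
rewrite sqr_sqrtr; last by apply: sumr_ge0 => i _; exact: sqr_ge0.
rewrite exprMn; move: H; rewrite -/(dw T w) mulr1 => H.
rewrite (_ : 2 ^+ 2 = 4); last by ring.
apply: le_trans H; rewrite le_eqVlt; apply/orP; left; apply/eqP; apply: eq_bigr => i _.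
by rewrite /hde (hd_sqr _ h0 (HT_sub conf (i := i)) hz).
Qed.

Variables (U11 U12 U22 : pt -> R) (M al : R).
Hypothesis cU : [/\ cont (closure Om) U11, cont (closure Om) U12 & cont (closure Om) U22].
Hypothesis M0 : 0 < M.
Hypothesis al0 : 0 < al.
Hypothesis UM : forall x, closure Om x -> [/\ `|U11 x| <= M, `|U12 x| <= M & `|U22 x| <= M].
Hypothesis Uel : forall x (a b : R), closure Om x -> al * (a ^+ 2 + b ^+ 2) <= U22 x * a ^+ 2 - 2 * U12 x * a * b + U11 x * b ^+ 2.
Local Notation aint := (cof_form U11 U12 U22).

Lemma aint_C T (i : 'I_(size T)) : conforming Om T ->
  [/\ cont (HT i) U11, cont (HT i) U12 & cont (HT i) U22].
Proof. by move=> conf; have [c1 c2 c3] := cU; split; apply: contW (HT_sub conf (i := i)) _. Qed.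

Lemma aint_CS T (i : 'I_(size T)) (W0 W1 P0 P1 : pt -> R) : conforming Om T ->
  cont (HT i) W0 -> cont (HT i) W1 -> cont (HT i) P0 -> cont (HT i) P1 ->
  `|IKi i (aint W0 W1 P0 P1)| <= 2 * M *
    (vn (va (nth_tri i)) (vb (nth_tri i)) (vc (nth_tri i)) W0 W1 * vn (va (nth_tri i)) (vb (nth_tri i)) (vc (nth_tri i)) P0 P1).
Proof.
move=> conf w0 w1 p0 p1; have [c1 c2 c3] := aint_C i conf.
have V0 : cont (HT i) (fun x => U22 x * W0 x - U12 x * W1 x) by contt.
have V1 : cont (HT i) (fun x => U11 x * W1 x - U12 x * W0 x) by contt.
apply: le_trans (vn_CS V0 V1 p0 p1) _; rewrite mulrA; apply: ler_wpM2r; first exact: vn_ge0.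
apply: vn_le => //; first by rewrite mulr_ge0// ltW.
move=> x hx; have [u1 u2 u3] := UM (HT_sub conf hx).
have sq (u : R) : `|u| <= M -> u ^+ 2 <= M ^+ 2.
  by move=> hu; rewrite -[leLHS]sqr_absE lerXn2r ?nnegrE// ltW.
move: (U11 x) (U12 x) (U22 x) (W0 x) (W1 x) (sq _ u1) (sq _ u2) (sq _ u3) => a b c y z a2 b2 c2'.
have e (p q y' z' : R) : p ^+ 2 <= M ^+ 2 -> q ^+ 2 <= M ^+ 2 -> (p * y' - q * z') ^+ 2 <= 2 * M ^+ 2 * (y' ^+ 2 + z' ^+ 2).
  move=> hp hq; have := sqr_ge0 (p * y' + q * z').
  have := ler_wpM2r (sqr_ge0 y') hp; have := ler_wpM2r (sqr_ge0 z') hq.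
  by rewrite -!exprMn sqrrB sqrrD; lra.
by have := e _ _ y z c2' b2; have := e _ _ z y a2 b2; rewrite exprMn; lra.
Qed.

Lemma aint_coer T (i : 'I_(size T)) (W0 W1 : pt -> R) : conforming Om T ->
  cont (HT i) W0 -> cont (HT i) W1 ->
  al * vn (va (nth_tri i)) (vb (nth_tri i)) (vc (nth_tri i)) W0 W1 ^+ 2 <= IKi i (aint W0 W1 W0 W1).
Proof.
move=> conf w0 w1; have [c1 c2 c3] := aint_C i conf; rewrite vn_sqr -IKZ; last by contt.
have ca (t : R) : cont (HT i) (fun=> t) by exact: cont_cst.
apply: IK_le; [by contt|by rewrite /cof_form; contt|] => x hx.
by have := Uel (W0 x) (W1 x) (HT_sub conf hx); rewrite /cof_form; lra.
Qed.

Lemma aint_lin T (i : 'I_(size T)) (l : R) (W0 W1 P0 P1 Q0 Q1 : pt -> R) : conforming Om T ->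
  cont (HT i) W0 -> cont (HT i) W1 -> cont (HT i) P0 -> cont (HT i) P1 -> cont (HT i) Q0 -> cont (HT i) Q1 ->
  IKi i (aint W0 W1 (fun x => l * P0 x + Q0 x) (fun x => l * P1 x + Q1 x)) =
  l * IKi i (aint W0 W1 P0 P1) + IKi i (aint W0 W1 Q0 Q1).
Proof.
move=> conf w0 w1 p0 p1 q0 q1; have [c1 c2 c3] := aint_C i conf.
have cP : cont (HT i) (aint W0 W1 P0 P1) by rewrite /cof_form; contt.
have cQ : cont (HT i) (aint W0 W1 Q0 Q1) by rewrite /cof_form; contt.
rewrite /IKi -IKZ// -IKD//; last by have cl : cont (HT i) (fun=> l) := @cont_cst _ _ _; contt.
by apply: IK_eq => x _; rewrite /cof_form; ring.
Qed.

Definition LL (h : R) := 1 + 2^-1 * (ln B - ln (h ^+ 2)).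

Lemma hL_center z h : hL z h B z = LL h /\ hs z h z = h ^+ 2.
Proof.
have e : hs z h z = h ^+ 2 by rewrite /hs subrr /nrm2 /= expr0n /= !add0r.
by rewrite /hL /LL e.
Qed.

Lemma loc_gI T w i : conforming Om T -> loc (T := T) k (gI k T w) i = loc k w i :> (pt -> R).
Proof.
move=> conf; rewrite (loc_eq k0 conf (w' := loc k w i)); first exact: (loc_id k0 conf i (loc_pol k conf w i)).
by move=> x hx; exact: (gI_loc k0 conf w hx).
Qed.

(** Coercivity below, Friedrichs above; one factor of the energy norm cancels. The right-hand side
    is thus measured in the dual of the L^2 norm. *)
Lemma energy : exists2 C : R, 0 < C & forall T w (rho : R), conforming Om T -> Vh0 Om T k w -> 0 <= rho ->
  cof_sum U11 U12 U22 (D0 k (T := T) w) (D1 k w) (D0 k w) (D1 k w) <= rho * lw T w -> dw T w <= C * rho.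
Proof.
have [CF CF0 hCF] := friedrichs; exists (CF / al); first exact: divr_gt0.
move=> T w rho conf Vw r0 H.
have h1 : al * dw T w ^+ 2 <= cof_sum U11 U12 U22 (D0 k (T := T) w) (D1 k w) (D0 k w) (D1 k w).
  rewrite /dw nn_sqr mulr_sumr; apply: ler_sum => i _; have [_ [c1 c2]] := D_cont w i conf.
  exact: aint_coer.
have h2 : rho * lw T w <= rho * (CF * dw T w) by apply: ler_wpM2l r0 _ _ (hCF _ _ conf Vw).
have := le_trans h1 (le_trans H h2); have := dw_ge0 T w; move: (dw T w) => d d0 h3.
have [->|dn] := eqVneq d 0; first by rewrite mulr_ge0// divr_ge0 ?ltW.
have d1 : 0 < d by rewrite lt_neqAle eq_sym dn.
rewrite mulrAC ler_pdivlMr// -(ler_pM2r d1); move: h3; rewrite expr2; lra.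
Qed.

(** The test function is the interpolant of [sg w], with [sg = ln hL] centred at a vertex of element
    [j]. By [gain_local] the form is on each element [sg (a i)] times the coercive form, up to
    products of energy and Hardy norms; these, like the L^2 norm of the test function, are
    controlled by the energy of [w], hence by [rho]. All main terms are nonnegative and the one of
    element [j] carries the factor [ln (LL h)], so the squared energy on that element is smaller by
    this factor. *)
Lemma gain : exists2 C : R, 0 < C & forall T w (h rho : R), conforming Om T -> regT h T -> 0 < h -> h <= 1 ->
  Vh0 Om T k w -> 0 <= rho ->
  (forall phi, Vh0 Om T k phi ->
    cof_sum U11 U12 U22 (D0 k (T := T) w) (D1 k w) (D0 k phi) (D1 k phi) <= rho * lw T phi) ->
  forall i, de (T := T) w i * Num.sqrt (ln (LL h)) <= C * rho.
Proof.
have [Cg Cg0 hg] := gain_local kap k0 B0; have [Ce Ce0 he] := energy.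
pose C2 : R := (2 * Cg * Ce + 4 * M * Cg * Ce ^+ 2) / al.
have C20 : 0 < C2 by rewrite divr_gt0// addr_gt0// !mulr_gt0// exprn_gt0.
exists (Num.sqrt C2); first by rewrite sqrtr_gt0.
move=> T w h rho conf rg h0 h1 Vw r0 H j.
have hd1 : dw T w <= Ce * rho by apply: he => //; exact: H.
have gen1 (x1 x2 x3 d e : R) : x1 <= x2 -> - (2 * M * (d * (Cg * e))) <= x3 -> x1 <= x2 + x3 + 2 * M * Cg * (d * e) by lra.
have gen2 (X Y D2 L : R) : X <= rho * (Cg * (2 * (Ce * rho))) -> Y <= 2 * M * Cg * ((Ce * rho) * (2 * (Ce * rho))) ->
    L * (al * D2) <= X + Y -> D2 * L <= C2 * rho ^+ 2.
  by move=> hX hY hL; rewrite /C2 mulrAC ler_pdivlMr//; lra.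
have gen3 (d r : R) : 0 <= r -> d ^+ 2 * r <= C2 * rho ^+ 2 -> (d * Num.sqrt r) ^+ 2 <= (Num.sqrt C2 * rho) ^+ 2.
  by move=> r0' H'; rewrite !exprMn !sqr_sqrtr// ltW.
pose z := va (nth_tri j).
have cz : closure Om z by apply: (HT_sub conf (i := j)); exact: hull3_v1.
have hz x (cx : closure Om x) := hB cx cz h0 h1; have cm := weight_cont cz h0 h1.
pose sg x := ln (hL z h B x).
pose phi := gI k T (fun x => sg x * w x).
have Vp : Vh0 Om T k phi by apply: (gI_Vh0 k0 OmE conf) => x bx; rewrite Vw.2 ?mulr0.
pose a i := va (nth_tri (T := T) i).
pose E i := LI k (va (nth_tri (T := T) i)) (vb (nth_tri i)) (vc (nth_tri i)) (fun x => (sg x - sg (a i)) * loc k w i x).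
have G i := hg h _ _ _ z (closure Om) (loc k w i) (rg i) (HT_sub conf (i := i)) hz cm (loc_pol k conf w i).
have locp i : loc k phi i = LI k (va (nth_tri (T := T) i)) (vb (nth_tri i)) (vc (nth_tri i)) (fun x => sg x * loc k w i x) :> (pt -> R).
  rewrite loc_gI//; apply: (loc_eq k0 conf) => x hx; congr (_ * _); exact: (vh_loc k0 conf Vw.1 hx).
have pE i : pol k (E i) by have [] := G i.
have dec i : loc k phi i = (fun x => sg (a i) * loc k w i x + 1 * E i x) :> (pt -> R).
  by rewrite locp; apply/funext => x; rewrite mul1r; have [_ -> _ _ _] := G i.
have Dp i (l : 'I_2) x : dpart [:: l] (loc k phi i) x = sg (a i) * dpart [:: l] (loc k w i) x + dpart [:: l] (E i) x.
  have := dpart_lin l (sg (a i)) 1 (loc_pol k conf w i) (pE i).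
  by rewrite dec => ->; rewrite mul1r.
have sp x : closure Om x -> 0 <= sg x by move=> cx; have [] := sigma_sqr h0 hz cx.
pose S := Num.sqrt (\sum_i hde z h (T := T) w i ^+ 2).
have S2 : S <= 2 * dw T w := hardy_mesh conf Vw cz h0 h1.
have lp : lw T phi <= Cg * S.
  apply: nn_le (ltW Cg0) _ _; first by move=> i; exact: sqrtr_ge0.
  by move=> i; rewrite /ne -L2_vn locp; have [_ _ l _ _] := G i.
have H1 := H phi Vp.
have I1 i : IKi i (aint (D0 k w i) (D1 k w i) (D0 k phi i) (D1 k phi i)) =
    sg (a i) * IKi i (aint (D0 k w i) (D1 k w i) (D0 k w i) (D1 k w i)) +
    IKi i (aint (D0 k w i) (D1 k w i) (dpart [:: o0] (E i)) (dpart [:: o1] (E i))).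
  have [_ [c1 c2]] := D_cont w i conf; have e0 := pol_cont (D := HT i) (pol_dpart o0 (pE i)).
  have e1 := pol_cont (D := HT i) (pol_dpart o1 (pE i)).
  rewrite -(aint_lin (sg (a i)) conf c1 c2 c1 c2 e0 e1).
  by congr (IKi i (aint _ _ _ _)); apply/funext => x; exact: Dp.
have I2 i : - (2 * M * (de w i * (Cg * hde z h w i))) <= IKi i (aint (D0 k w i) (D1 k w i) (dpart [:: o0] (E i)) (dpart [:: o1] (E i))).
  have [_ [c1 c2]] := D_cont w i conf; have e0 := pol_cont (D := HT i) (pol_dpart o0 (pE i)).
  have e1 := pol_cont (D := HT i) (pol_dpart o1 (pE i)); have := aint_CS conf c1 c2 e0 e1.
  have [_ _ _ l _] := G i; rewrite ler_norml => /andP[n _]; apply: le_trans n; rewrite lerN2.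
  apply: ler_wpM2l; first by rewrite mulr_ge0// ltW.
  by apply: ler_wpM2l l; exact: vn_ge0.
have I3 i : sg (a i) * (al * de w i ^+ 2) <= sg (a i) * IKi i (aint (D0 k w i) (D1 k w i) (D0 k w i) (D1 k w i)).
  have [_ [c1 c2]] := D_cont w i conf; apply: ler_wpM2l; last exact: aint_coer.
  by apply: sp; apply: (HT_sub conf (i := i)); exact: hull3_v1.
have CS := CS_sum (de (T := T) w) (hde z h (T := T) w); rewrite -/S in CS.
have I4 : \sum_i sg (a i) * (al * de (T := T) w i ^+ 2) <= rho * lw T phi + 2 * M * Cg * (dw T w * S).
  apply: (@le_trans _ _ (\sum_i (IKi i (aint (D0 k w i) (D1 k w i) (D0 k phi i) (D1 k phi i)) + 2 * M * Cg * (de (T := T) w i * hde z h w i)))).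
    apply: ler_sum => i _; rewrite I1; have := I2 i; have := I3 i.
    exact: gen1.
  rewrite big_split /= -mulr_sumr; apply: lerD; first exact: H1.
  apply: ler_wpM2l; first by rewrite !mulr_ge0// ltW.
  exact: CS.
have I5 : sg (a j) * (al * de (T := T) w j ^+ 2) <= \sum_i sg (a i) * (al * de (T := T) w i ^+ 2).
  rewrite (bigD1 j)//= lerDl; apply: sumr_ge0 => i _; apply: mulr_ge0.
    by apply: sp; apply: (HT_sub conf (i := i)); exact: hull3_v1.
  by rewrite mulr_ge0 ?sqr_ge0// ltW.
have sj : sg (a j) = ln (LL h) by rewrite /sg /a (hL_center z h).1.
have sj0 : 0 <= ln (LL h) by rewrite -sj; apply: sp.
have dj := de_ge0 (T := T) w j; have d0 := dw_ge0 T w.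
rewrite -(ger0_norm (mulr_ge0 dj (sqrtr_ge0 _))); apply: sqr_le_norm; first by rewrite mulr_ge0// sqrtr_ge0.
apply: (gen3 _ _ sj0); rewrite sj in I5; have := le_trans I5 I4.
have b1 : rho * lw T phi <= rho * (Cg * (2 * (Ce * rho))).
  apply: ler_wpM2l r0 _ _ _; apply: le_trans lp _; apply: ler_wpM2l (ltW Cg0) _ _ _.
  by apply: le_trans S2 _; rewrite ler_pM2l.
have b2 : 2 * M * Cg * (dw T w * S) <= 2 * M * Cg * ((Ce * rho) * (2 * (Ce * rho))).
  apply: ler_wpM2l; first by rewrite !mulr_ge0// ltW.
  apply: ler_pM => //; first exact: sqrtr_ge0.
  by apply: le_trans S2 _; rewrite ler_pM2l.
exact: gen2 b1 b2.
Qed.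

(** At the centre [z] the Hardy weight is [1 / (h LL)^2], so on an element at [z] the L^2 norm is at
    most [h LL] times the global energy norm, and the inverse estimate divides by [h]. *)
Lemma supbound : exists2 C : R, 0 < C & forall T w (h : R), conforming Om T -> regT h T -> 0 < h -> h <= 1 ->
  Vh0 Om T k w -> forall (i : 'I_(size T)) x, HT i x -> `|loc k w i x| <= C * LL h * dw T w.
Proof.
have [Cg Cg0 hg] := gain_local kap k0 B0; have [Ci Ci0 hi] := inverse_const k kap.
exists (2 * Ci * Cg); first by rewrite !mulr_gt0.
move=> T w h conf rg h0 h1 Vw j x hx; pose z := va (nth_tri j).
have cz : closure Om z by apply: (HT_sub conf (i := j)); exact: hull3_v1.
have hz y (cy : closure Om y) := hB cy cz h0 h1; have cm := weight_cont cz h0 h1.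
have [_ _ _ _ G] := hg h _ _ _ z (closure Om) (loc k w j) (rg j) (HT_sub conf (i := j)) hz cm (loc_pol k conf w j).
have [I _ _ _] := hi h _ _ _ (rg j) _ (loc_pol k conf w j).
have := I x hx; rewrite -/z in G; have L1 : 1 <= LL h by rewrite -(hL_center z h).1; apply: hL_ge1 hz _ cz.
have q : Num.sqrt (hP z h B z) = h * LL h.
  rewrite /hP (hL_center z h).1 (hL_center z h).2 -exprMn sqrtr_sqr ger0_norm// mulr_ge0 ?(ltW h0)//; lra.
rewrite q in G; have hj : hde z h (T := T) w j <= 2 * dw T w.
  apply: le_trans (hardy_mesh conf Vw cz h0 h1); have hde0 : 0 <= hde z h (T := T) w j by exact: sqrtr_ge0.
  rewrite -(ger0_norm hde0); apply: sqr_le_norm; first exact: sqrtr_ge0.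
  rewrite [leRHS]sqr_sqrtr; last by apply: sumr_ge0 => i _; exact: sqr_ge0.
  by rewrite (bigD1 j)//= lerDl; apply: sumr_ge0 => i _; exact: sqr_ge0.
have gen (N Lw H d : R) : 0 <= Lw -> N <= Ci / h * Lw -> Lw <= Cg * (h * LL h * H) -> H <= 2 * d -> N <= 2 * Ci * Cg * LL h * d.
  move=> Lw0 n1 n2 n3; apply: le_trans n1 _.
  have n4 : Lw <= Cg * (h * LL h * (2 * d)).
    by apply: le_trans n2 _; rewrite ler_pM2l// ler_pM2l// mulr_gt0//; lra.
  apply: (@le_trans _ _ (Ci / h * (Cg * (h * LL h * (2 * d))))).
    by apply: ler_wpM2l n4; rewrite divr_ge0 ?ltW.
  by rewrite le_eqVlt; apply/orP; left; apply/eqP; field; rewrite gt_eqF.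
move=> I'; exact: gen (le2_ge0 w j) I' G hj.
Qed.

End Global.

(** * Linear structure and fixed points in the discrete space *)

Lemma cvgn_geometric (R : realType) (u : nat -> R) (K q : R) : 0 <= q < 1 ->
  (forall n, `|u n.+1 - u n| <= K * q ^+ n) -> cvgn u.
Proof.
move=> /andP[q0 q1] h; have K0 : 0 <= K by have := h 0%N; rewrite expr0 mulr1; exact: le_trans.
have cs : cvgn (series (telescope u)).
  apply: normed_cvg; apply: (@series_le_cvg _ _ (geometric K q)).
  - by move=> n; exact: normr_ge0.
  - by move=> n; rewrite /geometric /= mulr_ge0// exprn_ge0.
  - by move=> n; exact: h.
  - by apply: is_cvg_geometric_series; rewrite ger0_norm.
rewrite telescopeK in cs; have c0 : cvgn (fun=> u 0%N : R) by exact: is_cvg_cst.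
have E : (fun n => u n - u 0%N) + (fun=> u 0%N) = u by apply/funext => n; rewrite fctE subrK.
by rewrite -E; exact: is_cvgD.
Qed.

Lemma cvgn_sum (R : realType) (I : Type) (r : seq I) (u : I -> nat -> R) (l : I -> R) :
  (forall i, u i n @[n --> \oo] --> l i) -> (\sum_(i <- r) u i n) @[n --> \oo] --> \sum_(i <- r) l i.
Proof.
move=> h; elim: r => [|i r IH].
  by rewrite big_nil; under eq_fun do rewrite big_nil; exact: cvg_cst.
by rewrite big_cons; under eq_fun do rewrite big_cons; apply: cvgD (h i) IH.
Qed.

Section Linear.
Variable R : realType.
Local Notation pt := (R * R)%type.
Variable k : nat.
Hypothesis k0 : (0 < k)%N.
Variables (Om : set pt) (s : seq pt).
Hypothesis OmE : Om = (hull s)°.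
Hypothesis Om0 : Om !=set0.

Lemma loc_lin (T : mesh R) (l m : R) v w (i : 'I_(size T)) :
  loc k (fun x => l * v x + m * w x) i = (fun x => l * loc k v i x + m * loc k w i x) :> (pt -> R).
Proof.
apply/funext => x; rewrite /loc /LI !mulr_sumr -big_split /=; apply: eq_bigr => t _; ring.
Qed.

Lemma D_lin (T : mesh R) (l m : R) v w : conforming Om T ->
  D0 k (T := T) (fun x => l * v x + m * w x) = (fun i x => l * D0 k v i x + m * D0 k w i x) /\
  D1 k (T := T) (fun x => l * v x + m * w x) = (fun i x => l * D1 k v i x + m * D1 k w i x).
Proof.
move=> conf; split; apply/funext => i; rewrite /D0 /D1 loc_lin;
  exact: dpart_lin (loc_pol k conf v i) (loc_pol k conf w i).
Qed.

Lemma D_eq (T : mesh R) v w : conforming Om T -> (forall x, closure Om x -> v x = w x) ->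
  D0 k (T := T) v = D0 k w /\ D1 k (T := T) v = D1 k w.
Proof.
move=> conf e; have E (i : 'I_(size T)) : loc k v i = loc k w i :> (pt -> R).
  by apply: (loc_eq k0 conf) => x hx; apply: e; exact: (HT_sub conf hx).
by split; apply/funext => i; rewrite /D0 /D1 E.
Qed.

Lemma D_pwc (T : mesh R) v : conforming Om T -> pwc (D0 k (T := T) v) /\ pwc (D1 k (T := T) v).
Proof. by move=> conf; split=> i; have [_ [c1 c2]] := D_cont k v i conf. Qed.

Lemma dw_lin (T : mesh R) (l m : R) v w : conforming Om T ->
  dw k T (fun x => l * v x + m * w x) <= `|l| * dw k T v + `|m| * dw k T w.
Proof.
move=> conf; rewrite /dw; have [-> ->] := D_lin l m v w conf.
have [v0 v1] := D_pwc v conf; have [w0 w1] := D_pwc w conf; exact: nn_lin v0 v1 w0 w1.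
Qed.

Lemma dw_sub (T : mesh R) v w : conforming Om T ->
  dw k T (fun x => 1 * v x + -1 * w x) <= dw k T v + dw k T w /\
  dw k T (fun x => -1 * v x + 1 * w x) <= dw k T v + dw k T w.
Proof.
have g1 (a b : R) : `|1| * a + `|-1| * b <= a + b by rewrite normrN normr1 !mul1r.
have g2 (a b : R) : `|-1| * a + `|1| * b <= a + b by rewrite normrN normr1 !mul1r.
move=> conf; split; [exact: le_trans (dw_lin _ _ _ _ conf) (g1 _ _)|exact: le_trans (dw_lin _ _ _ _ conf) (g2 _ _)].
Qed.

Lemma dw_eq (T : mesh R) v w : conforming Om T -> (forall x, closure Om x -> v x = w x) -> dw k T v = dw k T w.
Proof. by move=> conf e; rewrite /dw; have [-> ->] := D_eq conf e. Qed.

Lemma dw0 (T : mesh R) : conforming Om T -> dw k T (fun=> 0) = 0.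
Proof.
move=> conf; apply/le_anti; rewrite dw_ge0 andbT.
have := dw_lin 0 0 (fun=> 0) (fun=> 0) conf (T := T); rewrite normr0 !mul0r addr0.
by rewrite (@dw_eq T _ (fun=> 0))// => x _; rewrite !mul0r addr0.
Qed.

Lemma dw_sum (T : mesh R) (I : Type) (r : seq I) (l : I -> R) (w : I -> pt -> R) : conforming Om T ->
  dw k T (fun x => \sum_(j <- r) l j * w j x) <= \sum_(j <- r) `|l j| * dw k T (w j).
Proof.
move=> conf; elim: r => [|i r IH].
  by rewrite big_nil (@dw_eq T _ (fun=> 0))// ?dw0// => x _; rewrite big_nil.
rewrite big_cons (@dw_eq T _ (fun x => l i * w i x + 1 * \sum_(j <- r) l j * w j x))//; last first.
  by move=> x _; rewrite big_cons mul1r.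
by apply: le_trans (dw_lin _ _ _ _ conf) _; rewrite lerD2l normr1 mul1r.
Qed.

Lemma Vh0_lin2 (T : mesh R) (l m : R) v w : conforming Om T -> Vh0 Om T k v -> Vh0 Om T k w ->
  Vh0 Om T k (fun x => l * v x + m * w x).
Proof.
move=> conf Vv Vw; have V0 := Vh0_cst0 k Om T.
have := Vh0_lin l Vv (Vh0_lin m Vw V0).
by rewrite (_ : (fun x => _) = (fun x => l * v x + m * w x))//; apply/funext => x; rewrite addr0.
Qed.

(* The values of the iterates at the nodes form Cauchy sequences. *)
Lemma fixpoint (T : mesh R) (Phi : (pt -> R) -> pt -> R) (r q K : R) : conforming Om T ->
  0 <= q < 1 -> 0 <= r -> 0 <= K ->
  (forall v x, Vh0 Om T k v -> closure Om x -> `|v x| <= K * dw k T v) ->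
  (forall v, Vh0 Om T k v -> dw k T v <= r -> Vh0 Om T k (Phi v) /\ dw k T (Phi v) <= r) ->
  (forall v w, Vh0 Om T k v -> Vh0 Om T k w -> dw k T v <= r -> dw k T w <= r ->
    dw k T (fun x => 1 * Phi v x + -1 * Phi w x) <= q * dw k T (fun x => 1 * v x + -1 * w x)) ->
  exists v, [/\ Vh0 Om T k v, dw k T v <= r & dw k T (fun x => 1 * Phi v x + -1 * v x) = 0].
Proof.
move=> conf hq r0 K0 hK hP hc; have [q0 q1] := andP hq.
have g1 (a b e1 e2 e3 : R) : a <= r -> b <= e1 -> 0 <= e2 -> 0 <= e3 -> a + b <= r + (e2 + e3 + e1) by lra.
have g2 (a b c e1 e2 e3 : R) : a <= b -> b <= e1 -> c <= e2 -> 0 <= e3 -> a + c <= e1 + e2 + e3 by lra.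
have gr (a b c : R) : 1 * a + -1 * b = -1 * (1 * c + -1 * a) + 1 * (1 * c + -1 * b) by ring.
pose y n := iter n Phi (fun=> 0).
have hy n : Vh0 Om T k (y n) /\ dw k T (y n) <= r.
  elim: n => [|n [IH1 IH2]]; last exact: hP.
  by split; [exact: Vh0_cst0|rewrite dw0].
pose d0 := dw k T (fun x => 1 * y 1%N x + -1 * y 0%N x).
have hd n : dw k T (fun x => 1 * y n.+1 x + -1 * y n x) <= d0 * q ^+ n.
  elim: n => [|n IH]; first by rewrite expr0 mulr1.
  have [v1 r1] := hy n.+1; have [v2 r2] := hy n.
  apply: le_trans (hc _ _ v1 v2 r1 r2) _; rewrite exprS mulrCA; exact: ler_wpM2l.
pose nd := @node R k Om T.
(* The constant [K] turns geometric decay in energy into geometric decay of each nodal value, where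
   completeness of the reals applies. *)
have cu j : cvgn (fun n => y n (nd j) : R).
  apply: (@cvgn_geometric _ _ (K * d0) q hq) => n.
  have [v1 _] := hy n.+1; have [v2 _] := hy n.
  have cn : closure Om (nd j) by apply: subset_closure; exact: node_Om.
  have := hK _ _ (Vh0_lin2 1 (-1) conf v1 v2) cn; rewrite mul1r mulN1r => h.
  apply: le_trans h _; rewrite -mulrA; exact: ler_wpM2l.
pose c j : R := limn (fun n => y n (nd j) : R).
pose ys x := \sum_j c j * @nodal R k Om T j x.
have Vs : Vh0 Om T k ys by apply: Vh0_sum => j; exact: (nodal_Vh0 k0 OmE conf).
pose E n := \sum_j `|y n (nd j) - c j| * dw k T (@nodal R k Om T j).
have hE n : dw k T (fun x => 1 * y n x + -1 * ys x) <= E n.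
  rewrite (dw_eq (w := fun x => \sum_j (y n (nd j) - c j) * @nodal R k Om T j x) conf); first exact: dw_sum.
  move=> x cx; have [v1 _] := hy n; rewrite (nodal_span k0 OmE conf v1 cx) mul1r mulN1r /ys -sumrB.
  by apply: eq_bigr => j _; rewrite mulrBl.
have E0 : E n @[n --> \oo] --> (0 : R).
  rewrite (_ : 0 = \sum_(j < size (nodes k Om T)) 0 * dw k T (@nodal R k Om T j)); last first.
    by rewrite big1// => j _; rewrite mul0r.
  apply: cvgn_sum => j; apply: cvgM; last exact: cvg_cst.
  rewrite -(normr0 R); apply: cvg_norm; rewrite -(subrr (c j)); apply: cvgB; [exact: cu|exact: cvg_cst].
(* Passage to the limit: [E n] bounds the energy distance from the iterate to [ys] and tends to
   zero, so an inequality up to such terms is exact. *)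
have small (a b : R) : (forall n, a <= b + (q * E n + E n.+1 + E n)) -> a <= b.
  move=> h; apply/ler_addgt0Pr => e e0.
  have E1 : (q * E n + E n.+1 + E n) @[n --> \oo] --> (0 : R).
    rewrite (_ : 0 = q * 0 + 0 + 0 :> R); last by rewrite mulr0 !addr0.
    apply: (cvgD _ E0); apply: cvgD; first by apply: (cvgM _ E0); exact: cvg_cst.
    by have := E0; rewrite -(cvg_shiftS E).
  move/cvgrPdist_lt: E1 => /(_ e e0)[N _ hN].
  apply: le_trans (h N) _; rewrite lerD2l; apply: le_trans (ler_norm _) _.
  by have := hN N (leqnn N); rewrite /= sub0r normrN => /ltW.
have Ege n : 0 <= E n by apply: sumr_ge0 => j _; rewrite mulr_ge0// dw_ge0.
have rs : dw k T ys <= r.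
  apply: small => n; have [v1 r1] := hy n.
  have e x : closure Om x -> ys x = 1 * y n x + -1 * (1 * y n x + -1 * ys x).
    by move=> _; rewrite !mul1r !mulN1r opprB addrC subrK.
  rewrite (dw_eq conf e); apply: le_trans (dw_sub _ _ conf).1 _.
  exact: g1 r1 (hE n) (mulr_ge0 q0 (Ege n)) (Ege n.+1).
have [VP rP] := hP _ Vs rs.
exists ys; split=> //; apply/le_anti; rewrite dw_ge0 andbT; apply: small => n; rewrite add0r.
have [v1 r1] := hy n; have [v2 r2] := hy n.+1.
have e x : closure Om x -> 1 * Phi ys x + -1 * ys x = -1 * (1 * Phi (y n) x + -1 * Phi ys x) + 1 * (1 * y n.+1 x + -1 * ys x).
  by move=> _; exact: gr.
rewrite (dw_eq conf e); apply: le_trans (dw_sub _ _ conf).2 _.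
exact: g2 (hc _ _ v1 Vs r1 rs) (ler_wpM2l q0 (hE n)) (hE n.+1) (Ege n).
Qed.

Variables (U11 U12 U22 : pt -> R).
Hypothesis cU : [/\ cont (closure Om) U11, cont (closure Om) U12 & cont (closure Om) U22].
Local Notation asum := (cof_sum U11 U12 U22).

Lemma asum_sym (T : mesh R) (W0 W1 P0 P1 : 'I_(size T) -> pt -> R) : asum W0 W1 P0 P1 = asum P0 P1 W0 W1.
Proof. by apply: eq_bigr => i _; congr (IKi i _); apply/funext => x; rewrite /cof_form; ring. Qed.

Lemma asum_lin (T : mesh R) (l : R) (W0 W1 V0 V1 P0 P1 : 'I_(size T) -> pt -> R) : conforming Om T ->
  pwc W0 -> pwc W1 -> pwc V0 -> pwc V1 -> pwc P0 -> pwc P1 ->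
  asum P0 P1 (fun i x => l * W0 i x + V0 i x) (fun i x => l * W1 i x + V1 i x) = l * asum P0 P1 W0 W1 + asum P0 P1 V0 V1.
Proof.
move=> conf w0 w1 v0 v1 p0 p1; rewrite /cof_sum mulr_sumr -big_split; apply: eq_bigr => i _.
exact: (aint_lin cU).
Qed.

End Linear.

(** * The quadratic remainder on the mesh *)

Section Quad.
Variable R : realType.
Local Notation pt := (R * R)%type.

(** The remainder is quadratic, so its increment is a sum of products of one difference, at most
    [d], and one value, at most [m]; the factor 2 counts the two products. *)
Lemma quad_diff n (kap : R) : exists2 C : R, 0 < C & forall (h m d : R) (a b c : pt) (f p0 p1 q0 q1 : pt -> R),
  reg kap h a b c -> pol n f -> let H := hull [:: a; b; c] in
  cont H p0 -> cont H p1 -> cont H q0 -> cont H q1 ->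
  (forall x, H x -> [/\ `|p0 x| <= m, `|p1 x| <= m, `|q0 x| <= m & `|q1 x| <= m]) ->
  (forall x, H x -> `|p0 x - q0 x| <= d /\ `|p1 x - q1 x| <= d) ->
  `|ellp a b c (pX p0 p0) (pY p0 p1 p0 p1) (pZ p1 p1) f - ellp a b c (pX q0 q0) (pY q0 q1 q0 q1) (pZ q1 q1) f| <=
  C * (m * d) / h * L2 a b c f.
Proof.
have [C C0 hC] := ell_bound n kap; exists (C * 2); first exact: mulr_gt0.
have pr (u v u' v' m d : R) : `|u| <= m -> `|v'| <= m -> `|u - u'| <= d -> `|v - v'| <= d -> `|u * v - u' * v'| <= 2 * (m * d).
  move=> hu hv du dv; rewrite (_ : _ - _ = u * (v - v') + (u - u') * v'); last by ring.
  have e1 := ler_pM (normr_ge0 u) (normr_ge0 (v - v')) hu dv.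
  have e2 := ler_pM (normr_ge0 (u - u')) (normr_ge0 v') du hv.
  by apply: le_trans (ler_normD _ _) _; rewrite !normrM; lra.
move=> h m d a b c f p0 p1 q0 q1 rg pf H cp0 cp1 cq0 cq1 hm hd.
have k1 : cont H (fun x => p0 x * p0 x) by contt.
have k2 : cont H (fun x => 2^-1 * (p0 x * p1 x + p1 x * p0 x)) by contt.
have k3 : cont H (fun x => p1 x * p1 x) by contt.
have k1' : cont H (fun x => q0 x * q0 x) by contt.
have k2' : cont H (fun x => 2^-1 * (q0 x * q1 x + q1 x * q0 x)) by contt.
have k3' : cont H (fun x => q1 x * q1 x) by contt.
pose X x := 1 * pX p0 p0 x + -1 * pX q0 q0 x.
pose Y x := 1 * pY p0 p1 p0 p1 x + -1 * pY q0 q1 q0 q1 x.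
pose Z x := 1 * pZ p1 p1 x + -1 * pZ q1 q1 x.
have cX : cont H X by rewrite /X /pX; contt.
have cY : cont H Y by rewrite /Y /pY; contt.
have cZ : cont H Z by rewrite /Z /pZ; contt.
have bd x : H x -> [/\ `|X x| <= 2 * (m * d), `|Y x| <= 2 * (m * d) & `|Z x| <= 2 * (m * d)].
  move=> hx; have [m1 m2 m3 m4] := hm x hx; have [d1 d2] := hd x hx; split.
  - by rewrite /X /pX mul1r mulN1r; exact: pr.
  - have g (u v u' v' : R) : 1 * (2^-1 * (u * v + v * u)) + -1 * (2^-1 * (u' * v' + v' * u')) = u * v - u' * v' by field.
    by rewrite /Y /pY g; exact: pr.
  - by rewrite /Z /pZ mul1r mulN1r; exact: pr.
have := hC h _ a b c X Y Z f rg pf cX cY cZ bd.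
rewrite mulrA /ellp.
have g1 (u v : R) : u - v = 1 * u + -1 * v by ring.
rewrite [in X in _ -> X]g1.
have D1 (i : 'I_2) : cont H (dpart [:: i] f) := pol_cont (D := H) (pol_dpart i pf).
have D2 (i j : 'I_2) : cont H (dpart [:: i; j] f) := pol_cont (D := H) (pol_dpart2 i j pf).
rewrite -(ell_lin 1 (-1) f k1 k2 k3 k1' k2' k3' (D1 o0) (D1 o1) (D2 o0 o0) (D2 o0 o1) (D2 o1 o1)).
exact.
Qed.

End Quad.

Section QuadMesh.
Variable R : realType.
Local Notation pt := (R * R)%type.
Variable k : nat.
Hypothesis k0 : (0 < k)%N.
Variables (Om : set pt) (s : seq pt).
Hypothesis OmE : Om = (hull s)°.
Hypothesis Om0 : Om !=set0.
Variable kap : R.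
Variables (U1 U2 : pt -> R).
Hypothesis cU1 : cont (closure Om) U1.
Hypothesis cU2 : cont (closure Om) U2.

Definition quad (T : mesh R) v phi := \sum_(i < size T) ellp (va (nth_tri i)) (vb (nth_tri i)) (vc (nth_tri i))
  (pX (e0 k U1 v i) (e0 k U1 v i)) (pY (e0 k U1 v i) (e1 k U2 v i) (e0 k U1 v i) (e1 k U2 v i))
  (pZ (e1 k U2 v i) (e1 k U2 v i)) (loc k phi i).

Definition ebound (T : mesh R) v (i : 'I_(size T)) (m : R) := forall x, HT i x -> `|e0 k U1 v i x| <= m /\ `|e1 k U2 v i x| <= m.

Lemma e_cont (T : mesh R) v (i : 'I_(size T)) : conforming Om T ->
  cont (HT i) (e0 k U1 v i) /\ cont (HT i) (e1 k U2 v i).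
Proof.
move=> conf; have [_ [c1 c2]] := D_cont k v i conf; have d1 := contW (HT_sub conf (i := i)) cU1.
have d2 := contW (HT_sub conf (i := i)) cU2; split; [exact: contB c1 d1|exact: contB c2 d2].
Qed.

(** One factor h^-1 comes from [ell_bound], the other from the inverse estimate that turns the
    maximum of the gradient of [v - w] on an element into its energy there. Only the difference has
    to be discrete for this. *)
Lemma quad_lip : exists2 C : R, 0 < C & forall T v w phi (h m : R), conforming Om T -> regT kap h T -> 0 < h ->
  (forall i, ebound (T := T) v i m) -> (forall i, ebound (T := T) w i m) -> 0 <= m ->
  `|quad T v phi - quad T w phi| <= C * m / h ^+ 2 * (dw k T (fun x => 1 * v x + -1 * w x) * lw k T phi).
Proof.
have [C C0 hC] := quad_diff k kap; have [Ci Ci0 hi] := inverse_const k kap.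
exists (C * Ci); first exact: mulr_gt0.
move=> T v w phi h m conf rg h0 hv hw m0; rewrite /quad -sumrB.
pose dl x := 1 * v x + -1 * w x.
have E (i : 'I_(size T)) x : e0 k U1 v i x - e0 k U1 w i x = D0 k dl i x /\ e1 k U2 v i x - e1 k U2 w i x = D1 k dl i x.
  rewrite /e0 /e1; have [-> ->] := D_lin k 1 (-1) v w conf.
  have gen (a b c : R) : a - c - (b - c) = 1 * a + -1 * b by ring.
  by split; exact: gen.
have L (i : 'I_(size T)) : `|ellp (va (nth_tri i)) (vb (nth_tri i)) (vc (nth_tri i))
  (pX (e0 k U1 v i) (e0 k U1 v i)) (pY (e0 k U1 v i) (e1 k U2 v i) (e0 k U1 v i) (e1 k U2 v i))
  (pZ (e1 k U2 v i) (e1 k U2 v i)) (loc k phi i) - ellp (va (nth_tri i)) (vb (nth_tri i)) (vc (nth_tri i))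
  (pX (e0 k U1 w i) (e0 k U1 w i)) (pY (e0 k U1 w i) (e1 k U2 w i) (e0 k U1 w i) (e1 k U2 w i))
  (pZ (e1 k U2 w i) (e1 k U2 w i)) (loc k phi i)| <= C * Ci * m / h ^+ 2 * (de k dl i * le2 k phi i).
  have [v0 v1] := e_cont v i conf; have [w0 w1] := e_cont w i conf.
  have bd x : HT i x -> [/\ `|e0 k U1 v i x| <= m, `|e1 k U2 v i x| <= m, `|e0 k U1 w i x| <= m & `|e1 k U2 w i x| <= m].
    by move=> hx; have [a1 a2] := hv i x hx; have [b1 b2] := hw i x hx; split.
  have [_ I _ _] := hi h _ _ _ (rg i) _ (loc_pol k conf dl i).
  have dd x : HT i x -> `|e0 k U1 v i x - e0 k U1 w i x| <= Ci / h * de k dl i /\ `|e1 k U2 v i x - e1 k U2 w i x| <= Ci / h * de k dl i.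
    by move=> hx; have [-> ->] := E i x; split; [exact: (I o0 x hx)|exact: (I o1 x hx)].
  have := hC h m _ _ _ _ _ _ _ _ _ (rg i) (loc_pol k conf phi i) v0 v1 w0 w1 bd dd.
  have gen (X Y Z : R) : C * (m * (Ci / h * X)) / h * Y = C * Ci * m / h ^+ 2 * (X * Y) by field; rewrite gt_eqF.
  by rewrite gen.
apply: le_trans (ler_norm_sum _ _ _) _.
apply: (@le_trans _ _ (\sum_(i < size T) C * Ci * m / h ^+ 2 * (de k dl i * le2 k phi i))).
  by apply: ler_sum => i _; exact: L.
rewrite -mulr_sumr; apply: ler_wpM2l.
  by apply: divr_ge0; [apply: mulr_ge0 => //; apply: ltW; exact: mulr_gt0|exact: sqr_ge0].
have := CS_sum (de k (T := T) dl) (le2 k (T := T) phi).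
by rewrite -lw_sqr sqrtr_sqr (ger0_norm (lw_ge0 _ _ _)).
Qed.

(** One factor of the error is estimated uniformly by [m], the other elementwise by [mi], to be
    summed in squares: with [m] in both places a second logarithm would appear. *)
Lemma quad_bound : exists2 C : R, 0 < C & forall T v phi (h m : R) (mi : 'I_(size T) -> R), conforming Om T ->
  regT kap h T -> 0 < h -> (forall i, ebound (T := T) v i (mi i)) -> 0 <= m -> (forall i, 0 <= mi i <= m) ->
  `|quad T v phi| <= C * m / h * (Num.sqrt (\sum_i mi i ^+ 2) * lw k T phi).
Proof.
have [C C0 hC] := ell_bound k kap; exists C => //.
move=> T v phi h m mi conf rg h0 hv m0 hm.
have L (i : 'I_(size T)) : `|ellp (va (nth_tri i)) (vb (nth_tri i)) (vc (nth_tri i))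
  (pX (e0 k U1 v i) (e0 k U1 v i)) (pY (e0 k U1 v i) (e1 k U2 v i) (e0 k U1 v i) (e1 k U2 v i))
  (pZ (e1 k U2 v i) (e1 k U2 v i)) (loc k phi i)| <= C * m / h * (mi i * le2 k phi i).
  have [v0 v1] := e_cont v i conf; have /andP[i0 im] := hm i.
  have pr (a b : R) : `|a| <= mi i -> `|b| <= mi i -> `|a * b| <= m * mi i.
    by move=> ha hb; rewrite normrM; apply: ler_pM => //; exact: le_trans ha im.
  have k1 : cont (HT i) (pX (e0 k U1 v i) (e0 k U1 v i)) by rewrite /pX; contt.
  have k2 : cont (HT i) (pY (e0 k U1 v i) (e1 k U2 v i) (e0 k U1 v i) (e1 k U2 v i)) by rewrite /pY; contt.
  have k3 : cont (HT i) (pZ (e1 k U2 v i) (e1 k U2 v i)) by rewrite /pZ; contt.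
  have bd x : HT i x -> [/\ `|pX (e0 k U1 v i) (e0 k U1 v i) x| <= m * mi i,
      `|pY (e0 k U1 v i) (e1 k U2 v i) (e0 k U1 v i) (e1 k U2 v i) x| <= m * mi i & `|pZ (e1 k U2 v i) (e1 k U2 v i) x| <= m * mi i].
    move=> hx; have [a1 a2] := hv i x hx; split; [exact: pr| |exact: pr].
    have g (a b : R) : 2^-1 * (a * b + b * a) = a * b by field.
    by rewrite /pY g; exact: pr.
  have := hC h _ _ _ _ _ _ _ _ (rg i) (loc_pol k conf phi i) k1 k2 k3 bd.
  have gen (X Y : R) : C * (m * X) / h * Y = C * m / h * (X * Y) by field; rewrite gt_eqF.
  by rewrite gen.
apply: le_trans (ler_norm_sum _ _ _) _.
apply: (@le_trans _ _ (\sum_(i < size T) C * m / h * (mi i * le2 k phi i))).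
  by apply: ler_sum => i _; exact: L.
rewrite -mulr_sumr; apply: ler_wpM2l.
  by apply: divr_ge0; [apply: mulr_ge0 => //; exact: ltW|exact: ltW].
have := CS_sum mi (le2 k (T := T) phi).
by rewrite -lw_sqr sqrtr_sqr (ger0_norm (lw_ge0 _ _ _)).
Qed.

(** The inverse estimate for the constant 1 bounds the area of an element from below by a multiple
    of [h ^+ 2], and the areas add up to at most that of the domain. *)
Lemma mesh_count : exists2 C : R, 0 < C & forall T (h : R), conforming Om T -> regT kap h T -> 0 < h ->
  (size T)%:R * h ^+ 2 <= C.
Proof.
have [Ci Ci0 hi] := inverse_const 0 kap.
have oO : open Om := open_Om OmE.
have [M M0 hM] := compact_box (compact_closure OmE Om0).
have aO : (Defs.area R Om < +oo)%E.
  by apply: (area_bounded_fin oO) => x Ox; apply: hM; exact: subset_closure.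
exists (Ci ^+ 2 * (1 + fine (Defs.area R Om))).
  by rewrite mulr_gt0 ?exprn_gt0// ltr_wpDr// fine_ge0.
move=> T h conf rg h0.
have c1 i : cont (HT (T := T) i) (fun=> 1 : R) by exact: cont_cst.
have [I1 I2] := @broken_int R Om s T OmE conf (fun=> 1) (fun _ _ => 1) c1 (fun _ _ _ => erefl).
have oB : open (broken Om T) by rewrite (brokenE OmE conf); apply: bigcup_open => i _; exact: open_interior.
have B1 : \sum_i IKi (T := T) i (fun=> 1) <= fine (Defs.area R Om).
  rewrite -I2 Rintegral_cst ?mul1r//; last exact: open_measurable2.
  have sub : (Defs.area R (broken Om T) <= Defs.area R Om)%E.
    apply: le_measure; rewrite ?inE; [exact: open_measurable2|exact: open_measurable2|by move=> x []].
  apply: fine_le => //; rewrite ge0_fin_numE//; exact: le_lt_trans sub aO.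
have B2 (i : 'I_(size T)) : h ^+ 2 <= Ci ^+ 2 * IKi i (fun=> 1).
  have p1 : pol 0 (fun=> 1 : R) by exact: pol_cst.
  have [I _ _ _] := hi h _ _ _ (rg i) _ p1.
  have := I _ (hull3_v1 _ _ _); rewrite normr1 => h1.
  have L0 := L2_ge0 (va (nth_tri i)) (vb (nth_tri i)) (vc (nth_tri i)) (fun=> 1).
  have h2 : h <= Ci * L2 (va (nth_tri i)) (vb (nth_tri i)) (vc (nth_tri i)) (fun=> 1).
    by move: h1; rewrite mulrAC ler_pdivlMr// mul1r.
  have h3 : h ^+ 2 <= (Ci * L2 (va (nth_tri i)) (vb (nth_tri i)) (vc (nth_tri i)) (fun=> 1)) ^+ 2.
    by rewrite lerXn2r ?nnegrE ?mulr_ge0// ltW.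
  apply: le_trans h3 _; rewrite exprMn L2_sqr /IKi.
  by rewrite (IK_eq (G := fun=> 1)) // => x _; rewrite expr1n.
have : \sum_(i < size T) h ^+ 2 <= \sum_(i < size T) Ci ^+ 2 * IKi i (fun=> 1) by apply: ler_sum => i _; exact: B2.
rewrite (_ : \sum_(i < size T) h ^+ 2 = (size T)%:R * h ^+ 2); last by rewrite sumr_const card_ord mulr_natl.
rewrite -mulr_sumr => h4; apply: le_trans h4 _.
by rewrite ler_pM2l ?exprn_gt0//; lra.
Qed.

End QuadMesh.

Section EllTest.
Variable R : realType.
Local Notation pt := (R * R)%type.

Lemma ell_lin_test (a b c : pt) (l m : R) (X Y Z f f1 f2 f11 f12 f22 g g1 g2 g11 g12 g22 : pt -> R) : let H := hull [:: a; b; c] in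
  cont H X -> cont H Y -> cont H Z -> cont H f1 -> cont H f2 -> cont H f11 -> cont H f12 -> cont H f22 ->
  cont H g1 -> cont H g2 -> cont H g11 -> cont H g12 -> cont H g22 ->
  ell a b c X Y Z (fun x => l * f x + m * g x) (fun x => l * f1 x + m * g1 x) (fun x => l * f2 x + m * g2 x)
    (fun x => l * f11 x + m * g11 x) (fun x => l * f12 x + m * g12 x) (fun x => l * f22 x + m * g22 x) =
  l * ell a b c X Y Z f f1 f2 f11 f12 f22 + m * ell a b c X Y Z g g1 g2 g11 g12 g22.
Proof.
move=> H cX cY cZ c1 c2 c11 c12 c22 d1 d2 d11 d12 d22.
have [ha hb hc] : [/\ H a, H b & H c] by split; [exact: hull3_v1|exact: hull3_v2|exact: hull3_v3].
have cH : cvx H by exact: cvx_hull.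
have E p q nu : H p -> H q -> eform X Y Z (fun x => l * f x + m * g x) (fun x => l * f1 x + m * g1 x) (fun x => l * f2 x + m * g2 x) p q nu =
    l * eform X Y Z f f1 f2 p q nu + m * eform X Y Z g g1 g2 p q nu.
  move=> hp hq; rewrite /eform.
  rewrite (@seg_ext _ p q (fun x => (Y x * nu.2 - Z x * nu.1) * (l * f1 x + m * g1 x) + (Y x * nu.1 - X x * nu.2) * (l * f2 x + m * g2 x))
     (fun x => l * ((Y x * nu.2 - Z x * nu.1) * f1 x + (Y x * nu.1 - X x * nu.2) * f2 x) + m * ((Y x * nu.2 - Z x * nu.1) * g1 x + (Y x * nu.1 - X x * nu.2) * g2 x))); last by move=> x; ring.
  rewrite (@seg_ext _ p q (fun x => Mf (q - p) nu (X x) (Y x) (Z x) * ((l * f1 x + m * g1 x) * (q - p).1 + (l * f2 x + m * g2 x) * (q - p).2))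
    (fun x => l * (Mf (q - p) nu (X x) (Y x) (Z x) * (f1 x * (q - p).1 + f2 x * (q - p).2)) + m * (Mf (q - p) nu (X x) (Y x) (Z x) * (g1 x * (q - p).1 + g2 x * (q - p).2)))); last by move=> x; rewrite /Mf; ring.
  rewrite (segL _ _ cH hp hq); [|by contt..].
  rewrite (segL _ _ cH hp hq); [|by rewrite /Mf; contt..].
  rewrite /Mf; ring.
rewrite /ell /edge3 !E//.
rewrite (@IK_eq _ a b c (fun x => 2 * Y x * (l * f12 x + m * g12 x) - Z x * (l * f11 x + m * g11 x) - X x * (l * f22 x + m * g22 x))
  (fun x => l * (2 * Y x * f12 x - Z x * f11 x - X x * f22 x) + m * (2 * Y x * g12 x - Z x * g11 x - X x * g22 x))); last by move=> x _; ring.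
rewrite IKD; [|by contt..].
rewrite IKZ; [|by contt]; rewrite IKZ; [|by contt].
ring.
Qed.

Lemma ellp_lin n (a b c : pt) (l m : R) (X Y Z f g : pt -> R) : let H := hull [:: a; b; c] in
  cont H X -> cont H Y -> cont H Z -> pol n f -> pol n g ->
  ellp a b c X Y Z (fun x => l * f x + m * g x) = l * ellp a b c X Y Z f + m * ellp a b c X Y Z g.
Proof.
move=> H cX cY cZ pf pg; rewrite /ellp.
have D1 (i : 'I_2) f' : pol n f' -> cont H (dpart [:: i] f') by move=> p'; exact: pol_cont (pol_dpart i p').
have D2 (i j : 'I_2) f' : pol n f' -> cont H (dpart [:: i; j] f') by move=> p'; exact: pol_cont (pol_dpart2 i j p').
have L1 i : dpart [:: i] (fun x => l * f x + m * g x) = fun x => l * dpart [:: i] f x + m * dpart [:: i] g x.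
  exact: dpart_lin pf pg.
have L2 i j : dpart [:: i; j] (fun x => l * f x + m * g x) = fun x => l * dpart [:: i; j] f x + m * dpart [:: i; j] g x.
  rewrite (dpartS i [:: j]) L1 (dpart_lin i l m (pol_dpart j pf) (pol_dpart j pg)).
  by rewrite (dpartS i [:: j] f) (dpartS i [:: j] g).
rewrite (L1 o0) (L1 o1) (L2 o0 o0) (L2 o0 o1) (L2 o1 o1).
exact: (ell_lin_test l m f g cX cY cZ (D1 o0 f pf) (D1 o1 f pf) (D2 o0 o0 f pf) (D2 o0 o1 f pf) (D2 o1 o1 f pf)
  (D1 o0 g pg) (D1 o1 g pg) (D2 o0 o0 g pg) (D2 o0 o1 g pg) (D2 o1 o1 g pg)).
Qed.

End EllTest.

(** * Smallness of [h |ln h|] *)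

Section Small.
Variable R : realType.

Lemma ln_lower (h : R) : 0 < h -> h <= 1 -> h * `|ln h| <= 2 * Num.sqrt h.
Proof.
move=> h0 h1; have l0 : ln h <= 0 by exact: ln_le0.
have t0 : 0 < Num.sqrt h by rewrite sqrtr_gt0.
rewrite (ler0_norm l0); move: (Num.sqrt h) t0 (esym (sqr_sqrtr (ltW h0))) => t t0 e.
have l1 : - ln t <= t^-1 by rewrite -lnV ?posrE//; apply/ltW/ln_sublinear; rewrite invr_gt0.
have el : ln h = 2 * ln t by rewrite e lnXn// mulr_natl.
have l2 : t * - ln t <= 1 by rewrite mulrC -ler_pdivlMr// mul1r.
have := ler_wpM2l (ltW t0) l2; rewrite el e expr2; lra.
Qed.

Lemma small_hln (c : R) : 0 < c -> exists2 d : R, 0 < d & forall h, 0 < h -> h <= 1 -> h <= d -> c * (h * `|ln h|) <= 1.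
Proof.
move=> c0; exists ((2 * c)^-1 ^+ 2); first by rewrite exprn_gt0// invr_gt0 mulr_gt0.
move=> h h0 h1 hd; have := ler_wpM2l (ltW c0) (ln_lower h0 h1) => h2.
have c2 : 0 < (2 * c)^-1 by rewrite invr_gt0 mulr_gt0.
have s1 : Num.sqrt h <= (2 * c)^-1 by rewrite -(ger0_norm (ltW c2)) -sqrtr_sqr ler_wsqrtr.
apply: le_trans h2 _; rewrite mulrA (mulrC c); rewrite -ler_pdivlMl ?mulr_gt0//.
by rewrite mulr1.
Qed.

Lemma ln_large (c : R) : exists2 d : R, 0 < d & forall h, 0 < h -> h <= d -> c <= `|ln h|.
Proof.
exists (expR (- c)) => [|h h0 hd]; first exact: expR_gt0.
have : ln h <= - c by rewrite -(expRK (- c)) ler_ln ?posrE ?expR_gt0.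
by move=> l; have := ler_norm (- ln h); rewrite normrN; lra.
Qed.

End Small.

(** * Solvability of the linearized discrete problem *)

Section Riesz0.
Variable R : realType.
Local Notation pt := (R * R)%type.
Variable k : nat.
Hypothesis k0 : (0 < k)%N.
Variables (Om : set pt) (s : seq pt).
Hypothesis OmE : Om = (hull s)°.
Hypothesis Om0 : Om !=set0.
Variable kap : R.
Variables (U1 U2 U11 U12 U22 : pt -> R) (M al : R).
Hypothesis cU1 : cont (closure Om) U1.
Hypothesis cU2 : cont (closure Om) U2.
Hypothesis cU : [/\ cont (closure Om) U11, cont (closure Om) U12 & cont (closure Om) U22].
Hypothesis al0 : 0 < al.
Hypothesis Uel : forall x (a b : R), closure Om x -> al * (a ^+ 2 + b ^+ 2) <= U22 x * a ^+ 2 - 2 * U12 x * a * b + U11 x * b ^+ 2.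
Local Notation asum := (cof_sum U11 U12 U22).

Definition vh_form (T : mesh R) v w := asum (D0 k (T := T) v) (D1 k v) (D0 k w) (D1 k w).

Lemma quad_lin0 T v : conforming Om T -> lin0 k Om T (quad k U1 U2 T v).
Proof.
move=> conf; split=> [l f g Vf Vg|f Vf f0].
- rewrite /quad mulr_sumr -big_split; apply: eq_bigr => i _ /=.
  have [v0 v1] := e_cont k cU1 cU2 v i conf.
  have k1 : cont (HT i) (pX (e0 k U1 v i) (e0 k U1 v i)) by rewrite /pX; contt.
  have k2 : cont (HT i) (pY (e0 k U1 v i) (e1 k U2 v i) (e0 k U1 v i) (e1 k U2 v i)) by rewrite /pY; contt.
  have k3 : cont (HT i) (pZ (e1 k U2 v i) (e1 k U2 v i)) by rewrite /pZ; contt.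
  have := ellp_lin l 1 k1 k2 k3 (loc_pol k conf f i) (loc_pol k conf g i); rewrite mul1r => <-.
  rewrite -loc_lin; congr (ellp _ _ _ _ _ _ (loc k _ i)); apply/funext => x; by rewrite mul1r.
- rewrite /quad big1// => i _.
  have [v0 v1] := e_cont k cU1 cU2 v i conf.
  have k1 : cont (HT i) (pX (e0 k U1 v i) (e0 k U1 v i)) by rewrite /pX; contt.
  have k2 : cont (HT i) (pY (e0 k U1 v i) (e1 k U2 v i) (e0 k U1 v i) (e1 k U2 v i)) by rewrite /pY; contt.
  have k3 : cont (HT i) (pZ (e1 k U2 v i) (e1 k U2 v i)) by rewrite /pZ; contt.
  have := ellp_lin 0 0 k1 k2 k3 (loc_pol k conf f i) (loc_pol k conf f i).
  have z (a : R) : 0 * a + 0 * a = 0 by rewrite mul0r addr0.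
  rewrite z => <-; congr (ellp _ _ _ _ _ _ _); rewrite -loc_lin.
  by apply: (loc_eq k0 conf) => x hx; rewrite z f0//; exact: (HT_sub conf hx).
Qed.

Lemma aD_lin (T : mesh R) (W0 W1 : 'I_(size T) -> pt -> R) : conforming Om T -> pwc W0 -> pwc W1 ->
  lin0 k Om T (fun phi => asum W0 W1 (D0 k phi) (D1 k phi)).
Proof.
move=> conf w0 w1; split=> [l f g Vf Vg|f Vf f0].
- have [f0 f1] := D_pwc k f conf; have [g0 g1] := D_pwc k g conf.
  rewrite -(asum_lin cU l conf f0 f1 g0 g1 w0 w1).
  have [E0 E1] := D_lin k l 1 f g conf.
  have e1 (a b : R) : l * a + 1 * b = l * a + b by rewrite mul1r.
  have -> : (fun x => l * f x + g x) = (fun x => l * f x + 1 * g x) by apply/funext => x; rewrite e1.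
  by rewrite E0 E1; congr (asum _ _ _ _); apply/funext => i; apply/funext => x; rewrite e1.
- have z0 (X0 X1 P0 P1 : pt -> R) x : cof_form U11 U12 U22 X0 X1 (fun x => 0 * P0 x + 0 * P0 x) (fun x => 0 * P1 x + 0 * P1 x) x = 0.
    by rewrite /cof_form; ring.
  have [E0 E1] := D_eq (T := T) k0 conf (v := f) (w := fun x => 0 * f x + 0 * f x) (fun x cx => etrans (f0 x cx) (esym (etrans (congr2 +%R (mul0r _) (mul0r _)) (addr0 0)))).
  rewrite E0 E1; have [-> ->] := D_lin k 0 0 f f conf.
  rewrite /cof_sum big1// => i _; rewrite /IKi (IK_eq (G := fun=> 0)); last first.
    by move=> x _; exact: z0.
  have [c0 [c1 c2]] := D_cont k f i conf; have e := etrans (IKZ 0 c0) (mul0r _).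
  by rewrite -[RHS]e; apply: IK_eq => x _; rewrite (mul0r (loc k f i x)).
Qed.

(** [riesz_vh] for the linearized form. Definiteness: [energy] with [rho = 0] kills the energy norm,
    and [supbound] then kills the function. *)
Lemma aD_riesz T (h : R) (L : (pt -> R) -> R) : conforming Om T -> regT kap h T -> 0 < h -> h <= 1 ->
  lin0 k Om T L -> exists2 v, Vh0 Om T k v & forall phi, Vh0 Om T k phi -> vh_form T v phi = L phi.
Proof.
move=> conf rg h0 h1 LL.
have [B B0 hB] := weight_size OmE Om0.
apply: (riesz_vh k0 OmE conf (B := vh_form T) _ _ _ LL).
- by move=> v w _ _; rewrite /vh_form asum_sym.
- by move=> v Vv; have [c0 c1] := D_pwc k v conf; exact: aD_lin.
- move=> v Vv a0 x /(mesh_closureE conf)[i hx].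
  have [Ce Ce0 he] := energy k0 OmE Om0 cU al0 Uel.
  have d0 : dw k T v = 0.
    apply/le_anti; rewrite dw_ge0 andbT -(mulr0 Ce); apply: (he T v 0 conf Vv) => //.
    by rewrite mul0r; move: a0; rewrite /vh_form => ->.
  have [Cs Cs0 hs] := supbound k0 OmE Om0 kap B0 hB.
  have := hs T v h conf rg h0 h1 Vv i x hx; rewrite d0 mulr0 normr_le0 (vh_loc k0 conf Vv.1 hx).
  by move/eqP.
Qed.

End Riesz0.

(** * Choice of constants for the fixed point argument *)

Section NewtonArith.
Variable R : realType.

Lemma LL_bounds (B h : R) : 0 < h -> h <= 1 -> 1 <= `|ln h| ->
  LL B h <= (2 + `|ln B|) * `|ln h| /\ `|ln h| - `|ln B| <= LL B h.
Proof.
move=> h0 h1 l1; have l0 : ln h <= 0 by exact: ln_le0.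
have e : ln (h ^+ 2) = 2 * ln h by rewrite lnXn// mulr_natl.
rewrite /LL e; move: l1; rewrite (ler0_norm l0); move: (ln h) l0 => t t0 t1.
have b1 := ler_norm (ln B); have b2 := ler_norm (- ln B); rewrite normrN in b2.
have b0 := normr_ge0 (ln B); move: (ln B) `|ln B| b0 b1 b2 => b c c0 bc bc'.
have : 0 <= c * (- t - 1) by rewrite mulr_ge0//; lra.
by split; lra.
Qed.

(** Here [3 <= k] acts. At [k = 3] the last inequality is an equality: no power of [h] is left over,
    and smallness has to come from elsewhere. *)
Lemma pow_bounds (h l : R) (k : nat) : (3 <= k)%N -> 0 < h -> h <= 1 -> 0 <= l ->
  [/\ 0 < h ^+ k, h ^+ k * l / h ^+ 2 <= h * l & h ^+ k * l / h ^+ 3 <= l].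
Proof.
move=> k3 h0 h1 l0; have k4 := exprn_gt0 k h0.
have hk : h ^+ k <= h ^+ 3 by exact: (ler_wiXn2l (ltW h0) h1 k3).
have a2 : 0 < h ^+ 2 by rewrite exprn_gt0.
have a3 : 0 < h ^+ 3 by rewrite exprn_gt0.
have m : h ^+ k * l <= h ^+ 3 * l by rewrite ler_wpM2r.
split=> //; rewrite ler_pdivrMr//; first by move: m; rewrite !exprS expr0; lra.
by rewrite mulrC in m; rewrite mulrC; lra.
Qed.

Lemma sum_sqr_bound (I : finType) (a c S : R) (b m : I -> R) : 0 <= S ->
  (forall i, 0 <= m i <= a + c * b i) ->
  2 * a ^+ 2 * #|I|%:R + 2 * c ^+ 2 * \sum_i b i ^+ 2 <= S ^+ 2 ->
  Num.sqrt (\sum_i m i ^+ 2) <= S.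
Proof.
move=> S0 hm h; rewrite -(ger0_norm S0) -sqrtr_sqr ler_wsqrtr//; apply: le_trans h.
rewrite (_ : 2 * a ^+ 2 * #|I|%:R = \sum_(i : I) 2 * a ^+ 2); last by rewrite sumr_const mulr_natr.
rewrite mulr_sumr -big_split; apply: ler_sum => i _ /=; have /andP[m0 m1] := hm i.
apply: (@le_trans _ _ ((a + c * b i) ^+ 2)); first by rewrite lerXn2r ?nnegrE// (le_trans m0).
by have := sqr_ge0 (a - c * b i); move: (b i) => t; lra.
Qed.

(** With [H = h^k] and [l = |ln h|], the sum [S] of squares has order [H / h], the dual norm [rho]
    and the radius [r] have order [H^2 l / h^2], and the maximum bound [m] has order [H l]. The
    conditions [r <= H], contraction and the bound by [eps] on values all contain a spare factor
    [h l] or better. The bound by [eps] on gradients contains none at [k = 3]; there the gain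
    through [sqrt (ln LL)] is spent. *)
Lemma newton_consts (B CE CL CQ Cn Cs Cg Ci C1 C4 Ce eps : R) : 0 < B -> 0 < CE -> 0 < CL -> 0 < CQ -> 0 < Cn -> 0 < Cs ->
  0 < Cg -> 0 < Ci -> 0 < C1 -> 0 < C4 -> 0 < Ce -> 0 < eps -> exists2 hm : R, 0 < hm &
  forall (h N : R) (k : nat), (3 <= k)%N -> 0 < h -> h <= 1 -> h <= hm -> N * h ^+ 2 <= Cn ->
  let l := `|ln h| in let H := h ^+ k in let m0 := (C1 + C4) * (H * l) in
  exists r rho m S : R, [/\ [/\ 0 <= rho, 0 <= r, 0 <= m0, m0 <= m & 0 <= S],
    [/\ H <= H * l, r <= H, m0 + Ci / h * r <= m & CE * (CL * m / h ^+ 2) <= 2^-1],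
    [/\ CL * m / h ^+ 2 * r <= rho, CQ * m0 / h * S <= rho, CE * (2 * rho) = r &
      2 * (C1 * H) ^+ 2 * N + 2 * (Ci / h) ^+ 2 * (Ce * H) ^+ 2 <= S ^+ 2],
    forall d, 0 <= d -> d * Num.sqrt (ln (LL B h)) <= Cg * (2 * rho) -> Ci / h * d <= eps * (H * l) &
    Cs * LL B h * r <= eps * (H * l)].
Proof.
move=> B0 CE0 CL0 CQ0 Cn0 Cs0 Cg0 Ci0 C10 C40 Ce0 eps0.
have ltr0Sn2 : 0 < 2 :> R by rewrite ltr0n.
pose C5 : R := Num.sqrt (2 * C1 ^+ 2 * Cn + 2 * Ci ^+ 2 * Ce ^+ 2).
have C5s : C5 ^+ 2 = 2 * C1 ^+ 2 * Cn + 2 * Ci ^+ 2 * Ce ^+ 2.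
  by rewrite sqr_sqrtr// addr_ge0// !mulr_ge0 ?sqr_ge0// ltW.
have C50 : 0 < C5 by rewrite sqrtr_gt0 ltr_wpDl ?mulr_gt0 ?exprn_gt0// !mulr_ge0 ?sqr_ge0// ltW.
pose C6 : R := CQ * (C1 + C4) * C5; have C60 : 0 < C6 by rewrite !mulr_gt0// addr_gt0.
pose K7 : R := 2 * Ci * CE * C6; have K70 : 0 < K7 := mulr_gt0 (mulr_gt0 (mulr_gt0 ltr0Sn2 Ci0) CE0) C60.
pose Cm : R := C1 + C4 + K7; have Cm0 : 0 < Cm by rewrite !addr_gt0.
(* The threshold for [sqrt (ln (LL B h))] beyond which the constant in the gradient bound is at most
   [eps]. *)
pose G : R := 2 * Ci * Cg * C6 / eps; have G0 : 0 < G := divr_gt0 (mulr_gt0 (mulr_gt0 (mulr_gt0 ltr0Sn2 Ci0) Cg0) C60) eps0.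
pose CB : R := 2 + `|ln B|; have CB0 : 0 < CB by rewrite ltr_pwDl.
pose cc : R := 2 * CE * C6 + 2 * CE * CL * Cm + Cs * CB * (2 * CE * C6) / eps.
have [p1 p2 p3] : [/\ 0 < 2 * CE * C6, 0 < 2 * CE * CL * Cm & 0 < Cs * CB * (2 * CE * C6) / eps].
  have q1 := mulr_gt0 (mulr_gt0 ltr0Sn2 CE0) C60; split; first exact: q1.
    exact: mulr_gt0 (mulr_gt0 (mulr_gt0 ltr0Sn2 CE0) CL0) Cm0.
  exact: divr_gt0 (mulr_gt0 (mulr_gt0 Cs0 CB0) q1) eps0.
have cc0 : 0 < cc := addr_gt0 (addr_gt0 p1 p2) p3.
have [d1 d10 hd1] := small_hln cc0.
(* For such [h], [LL B h] is at least [expR (G ^+ 2)]; the summand 1 ensures [|ln h| >= 1]. *)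
have [d2 d20 hd2] := ln_large (1 + expR (G ^+ 2) + `|ln B|).
exists (Num.min d1 d2); first by rewrite lt_min d10.
move=> h N k k3 h0 h1; rewrite le_min => /andP[hd1' hd2'] hN.
have sm := hd1 h h0 h1 hd1'; have lg := hd2 h h0 hd2'.
have l1 : 1 <= `|ln h|.
  by have := expR_gt0 (G ^+ 2); have := normr_ge0 (ln B); move: lg; move: (expR _) => *; lra.
have l0 : 0 <= `|ln h| := normr_ge0 _.
have [LL1 LL2] := LL_bounds B h0 h1 l1; have [H0 X1 X2] := pow_bounds k3 h0 h1 l0.
have LLe : G ^+ 2 <= ln (LL B h).
  have le : expR (G ^+ 2) <= LL B h by apply: le_trans LL2; lra.
  by rewrite -[leLHS](expRK (G ^+ 2)) ler_ln// posrE ?expR_gt0// (lt_le_trans (expR_gt0 _) le).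
have GL : G <= Num.sqrt (ln (LL B h)) by rewrite -(ger0_norm (ltW G0)) -sqrtr_sqr ler_wsqrtr.
move: `|ln h| (h ^+ k) LL1 LL2 H0 X1 X2 l1 l0 sm lg => l H LL1 LL2 H0 X1 X2 l1 l0 sm lg.
pose X : R := H * l / h ^+ 2; have hn0 : h != 0 by rewrite gt_eqF.
have h2 : 0 < h ^+ 2 by rewrite exprn_gt0.
have Hl0 : 0 <= H * l := mulr_ge0 (ltW H0) l0.
have X0 : 0 <= X := divr_ge0 Hl0 (ltW h2).
have HHl : H <= H * l := ler_peMr (ltW H0) l1.
have [s1 s2 s3] : [/\ 2 * CE * C6 * X <= 1, 2 * CE * CL * Cm * X <= 1 & Cs * CB * (2 * CE * C6) / eps * X <= 1].
  have a1 := ler_wpM2l (ltW p1) X1; have a2 := ler_wpM2l (ltW p2) X1; have a3 := ler_wpM2l (ltW p3) X1.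
  have Y0 : 0 <= h * l := mulr_ge0 (ltW h0) l0.
  have b1 := mulr_ge0 (ltW p1) Y0; have b2 := mulr_ge0 (ltW p2) Y0; have b3 := mulr_ge0 (ltW p3) Y0.
  move: sm a1 a2 a3 b1 b2 b3; rewrite /cc -/X !mulrDl.
  by move: (2 * CE * C6 * (h * l)) (2 * CE * CL * Cm * (h * l)) (_ / eps * (h * l)) => *; split; lra.
pose rho0 : R := C6 * X * H; have rho00 : 0 <= rho0 := mulr_ge0 (mulr_ge0 (ltW C60) X0) (ltW H0).
pose r : R := 2 * CE * rho0; have r0 : 0 <= r := mulr_ge0 (mulr_ge0 (ltW ltr0Sn2) (ltW CE0)) rho00.
pose m0 : R := (C1 + C4) * (H * l); pose m : R := Cm * (H * l).
have m00 : 0 <= m0 := mulr_ge0 (addr_ge0 (ltW C10) (ltW C40)) Hl0.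
have mm0 : 0 <= m := mulr_ge0 (ltW Cm0) Hl0.
have m0m : m0 <= m by rewrite /m0 /m /Cm ler_wpM2r// lerDl ltW.
have rH : r <= H.
  rewrite /r /rho0 (_ : 2 * CE * _ = (2 * CE * C6 * X) * H); last by ring.
  by rewrite -[leRHS]mul1r; apply: ler_wpM2r s1; exact: ltW.
have Cir : Ci / h * r <= K7 * (H * l).
  rewrite (_ : Ci / h * r = K7 * (H * (H * l / h ^+ 3))); last by rewrite /r /rho0 /X /K7; field; rewrite hn0.
  by rewrite ler_pM2l// ler_pM2l.
pose qq : R := CL * m / h ^+ 2; have qq0 : 0 <= qq := divr_ge0 (mulr_ge0 (ltW CL0) mm0) (ltW h2).
have CEq : CE * qq <= 2^-1.
  by move: s2; rewrite (_ : 2 * CE * CL * Cm * X = 2 * (CE * qq)); [lra|rewrite /qq /m /X; field; rewrite hn0].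
have qr : qq * r <= rho0.
  have := ler_wpM2r rho00 CEq; rewrite /r; lra.
have E1 : CQ * m0 / h * (C5 * H / h) = rho0 by rewrite /rho0 /C6 /m0 /X; field; rewrite hn0.
have E2 : CE * (2 * rho0) = r by rewrite /r; ring.
have E3 : Ci / h * (Cg * (2 * rho0) / G) <= eps * (H * l).
  rewrite (_ : Ci / h * _ = eps * (H * (H * l / h ^+ 3))); last first.
    by rewrite /G /rho0 /X; field; rewrite hn0 !gt_eqF.
  by rewrite ler_pM2l// ler_pM2l.
have E4 : Cs * (CB * l) * r <= eps * (H * l).
  rewrite (_ : Cs * _ * r = (Cs * CB * (2 * CE * C6) / eps * X) * (eps * (H * l))); last first.
    by rewrite /r /rho0; field; rewrite gt_eqF.
  by rewrite -[leRHS]mul1r; apply: ler_wpM2r s3; exact: mulr_ge0 (ltW eps0) Hl0.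
have E5 : 2 * (C1 * H) ^+ 2 * N + 2 * (Ci / h) ^+ 2 * (Ce * H) ^+ 2 <= (C5 * H / h) ^+ 2.
  rewrite [leRHS](_ : _ = C5 ^+ 2 * H ^+ 2 / h ^+ 2); last by field; rewrite hn0.
  rewrite C5s ler_pdivlMr// [leLHS](_ : _ = 2 * C1 ^+ 2 * H ^+ 2 * (N * h ^+ 2) + 2 * Ci ^+ 2 * Ce ^+ 2 * H ^+ 2); last by field; rewrite hn0.
  rewrite [leRHS](_ : _ = 2 * C1 ^+ 2 * H ^+ 2 * Cn + 2 * Ci ^+ 2 * Ce ^+ 2 * H ^+ 2); last by ring.
  have c0 : 0 <= 2 * C1 ^+ 2 * H ^+ 2 := mulr_ge0 (mulr_ge0 (ltW ltr0Sn2) (sqr_ge0 _)) (sqr_ge0 _).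
  by rewrite lerD2r; exact: ler_wpM2l c0 _ _ hN.
have Cih : 0 < Ci / h by rewrite divr_gt0.
exists r, rho0, m, (C5 * H / h); split; first by split=> //; exact: divr_ge0 (mulr_ge0 (ltW C50) (ltW H0)) (ltW h0).
- split=> //; rewrite /m (_ : Cm * (H * l) = m0 + K7 * (H * l)); first by rewrite lerD2l.
  by rewrite /m0 /Cm; ring.
- by split=> //; rewrite -/m0 E1.
- move=> d dd0 hd; apply: le_trans E3; rewrite ler_pM2l// ler_pdivlMr//.
  by apply: le_trans hd; exact: ler_wpM2l.
- apply: le_trans E4; rewrite ler_wpM2r// ler_pM2l//.
Qed.

End NewtonArith.

(** * The nonlinear discrete problem as a fixed point equation *)

Section Newton.
Variable R : realType.
Local Notation pt := (R * R)%type.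
Variable k : nat.
Hypothesis k0 : (0 < k)%N.
Hypothesis k3 : (3 <= k)%N.
Variables (Om : set pt) (s : seq pt).
Hypothesis OmE : Om = (hull s)°.
Hypothesis Om0 : Om !=set0.
Variable kap : R.
Variables (u U1 U2 U11 U12 U22 : pt -> R) (M al : R).
Hypothesis Ujet : jet3 (closure Om) u U1 U2 U11 U12 U22.
Hypothesis cU1 : cont (closure Om) U1.
Hypothesis cU2 : cont (closure Om) U2.
Hypothesis cU : [/\ cont (closure Om) U11, cont (closure Om) U12 & cont (closure Om) U22].
Hypothesis M0 : 0 < M.
Hypothesis al0 : 0 < al.
Hypothesis UM : forall x, closure Om x -> [/\ `|U11 x| <= M, `|U12 x| <= M & `|U22 x| <= M].
Hypothesis Uel : forall x (a b : R), closure Om x -> al * (a ^+ 2 + b ^+ 2) <= U22 x * a ^+ 2 - 2 * U12 x * a * b + U11 x * b ^+ 2.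
Variable f : pt -> R.
Hypothesis cf : cont (closure Om) f.
Hypothesis fE : forall x, Om x -> f x = U11 x * U22 x - U12 x ^+ 2.
Local Notation asum := (cof_sum U11 U12 U22).
Local Notation aD := (vh_form k U11 U12 U22).
Local Notation quad := (quad k U1 U2).
Local Notation ebound := (ebound k U1 U2).

Definition err_form (T : mesh R) v phi := asum (e0 k U1 (T := T) v) (e1 k U2 v) (D0 k phi) (D1 k phi).

Lemma AformE T v phi : conforming Om T -> Vh Om T k v -> Vh0 Om T k phi ->
  Aform f T v phi = err_form T v phi + quad T v phi.
Proof. by move=> conf Vv Vp; exact: (A_identity k0 OmE conf Ujet cf fE Vv Vp). Qed.

Lemma aE_diff T v w phi : conforming Om T ->
  err_form T v phi = aD T (fun x => 1 * v x + -1 * w x) phi + err_form T w phi.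
Proof.
move=> conf; rewrite /err_form /vh_form (asum_sym _ _ _ (e0 k U1 v)) (asum_sym _ _ _ (D0 k (fun x => 1 * v x + -1 * w x))).
rewrite (asum_sym _ _ _ (e0 k U1 w)); set dl := fun x => 1 * v x + -1 * w x.
have [d0 d1] := D_pwc k dl conf; have [p0 p1] := D_pwc k phi conf.
have w0 : pwc (e0 k U1 (T := T) w) by move=> i; have [] := e_cont k cU1 cU2 w i conf.
have w1 : pwc (e1 k U2 (T := T) w) by move=> i; have [] := e_cont k cU1 cU2 w i conf.
have gen (a b c : R) : a - c = 1 * (1 * a + -1 * b) + (b - c) by ring.
have E0 : e0 k U1 (T := T) v = (fun i x => 1 * D0 k dl i x + e0 k U1 w i x).
  by apply/funext => i; apply/funext => x; rewrite /e0; have [-> _] := D_lin k 1 (-1) v w conf; exact: gen.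
have E1 : e1 k U2 (T := T) v = (fun i x => 1 * D1 k dl i x + e1 k U2 w i x).
  by apply/funext => i; apply/funext => x; rewrite /e1; have [_ ->] := D_lin k 1 (-1) v w conf; exact: gen.
have h := asum_lin cU 1 conf d0 d1 w0 w1 p0 p1.
by rewrite E0 E1 h mul1r.
Qed.

Lemma aD_sub T v w phi : conforming Om T ->
  aD T (fun x => 1 * v x + -1 * w x) phi = aD T v phi - aD T w phi.
Proof.
have gen (a b c d : R) : a + d = c + (b + d) -> c = a - b by lra.
move=> conf; have z (v' : pt -> R) : (fun x => 1 * v' x + -1 * (fun=> 0 : R) x) = v'.
  by apply/funext => x; rewrite mul1r mulr0 addr0.
have e1 := aE_diff v w phi conf; have e2 := aE_diff v (fun=> 0) phi conf; have e3 := aE_diff w (fun=> 0) phi conf.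
rewrite z in e2; rewrite z in e3; move: e1; rewrite e2 e3.
exact: gen.
Qed.

(** Both equations are subtracted and tested with the difference; by [quad_lip] and [energy] its
    energy norm is at most half of itself. *)
Lemma discrete_unique : exists2 C : R, 0 < C & forall T v w (h m : R), conforming Om T -> regT kap h T -> 0 < h -> 0 <= m ->
  Vh Om T k v -> Vh Om T k w -> Vh0 Om T k (fun x => 1 * v x + -1 * w x) ->
  (forall i : 'I_(size T), ebound v i m) -> (forall i : 'I_(size T), ebound w i m) -> C * m / h ^+ 2 <= 2^-1 ->
  (forall phi, Vh0 Om T k phi -> Aform f T v phi = 0) -> (forall phi, Vh0 Om T k phi -> Aform f T w phi = 0) ->
  dw k T (fun x => 1 * v x + -1 * w x) = 0.
Proof.
have [CE CE0 hE] := energy k0 OmE Om0 cU al0 Uel; have [CL CL0 hL] := quad_lip k kap cU1 cU2.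
exists (CE * CL); first exact: mulr_gt0.
have fin (d c : R) : 0 <= d -> CE * CL * c <= 2^-1 -> d <= CE * (CL * c * d) -> d <= 0.
  by move=> d0 c1 dd; have := ler_wpM2r d0 c1; lra.
have gen (a e q q' X : R) : a + e + q = 0 -> e + q' = 0 -> `|q - q'| <= X -> a <= X.
  by move=> h1 h2; rewrite ler_norml => /andP[h3 h4]; lra.
move=> T v w h m conf rg h0 m0 Vv Vw Vd bv bw sm Av Aw.
set dl := fun x => 1 * v x + -1 * w x in Vd *.
have r0 : 0 <= CL * m / h ^+ 2 * dw k T dl.
  apply: mulr_ge0; last exact: dw_ge0.
  by apply: divr_ge0; [apply: mulr_ge0 => //; exact: ltW|exact: sqr_ge0].
have H : aD T dl dl <= CL * m / h ^+ 2 * dw k T dl * lw k T dl.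
  have Lq := hL T v w dl h m conf rg h0 bv bw m0; rewrite -/dl mulrA in Lq.
  have A1 := Av dl Vd; have A2 := Aw dl Vd.
  rewrite (AformE conf Vv Vd) (aE_diff v w dl conf) -/dl in A1; rewrite (AformE conf Vw Vd) in A2.
  exact: gen A1 A2 Lq.
have := hE T dl _ conf Vd r0 H; rewrite -(mulrA CL) => h4.
apply/le_anti; rewrite dw_ge0 andbT; apply: fin h4; [exact: dw_ge0|by rewrite mulrA].
Qed.

(** Newton's method with the derivative frozen at [u]: [Phi y] has linearized form [- q(v0 + y, .)],
    and since [v0] annihilates the linear part, a fixed point solves the scheme. [quad_bound] at
    [v0] gives the dual norm and [quad_lip] the contraction. Inside the iteration the plain inverse
    estimate, with a large constant, is enough; the sharp bound on the gradient of [y] is obtained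
    afterwards, by [gain] applied to the equation that [y] satisfies. *)
Lemma newton (C1 C4 Ce eps : R) : 0 < C1 -> 0 < C4 -> 0 < Ce -> 0 < eps -> exists2 hm : R, 0 < hm &
  forall T (h : R) v0 e, conforming Om T -> regT kap h T -> 0 < h -> h <= 1 -> h <= hm ->
  Vh Om T k v0 -> Vh0 Om T k e -> (forall phi, Vh0 Om T k phi -> err_form T v0 phi = 0) ->
  dw k T e <= Ce * h ^+ k ->
  (forall i x, HT (T := T) i x -> `|D0 k e i x| <= C4 * (h ^+ k * `|ln h|) /\ `|D1 k e i x| <= C4 * (h ^+ k * `|ln h|)) ->
  (forall i x, HT (T := T) i x -> `|e0 k U1 v0 i x + D0 k e i x| <= C1 * h ^+ k /\ `|e1 k U2 v0 i x + D1 k e i x| <= C1 * h ^+ k) ->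
  exists y, [/\ Vh0 Om T k y, dw k T y <= h ^+ k,
    forall phi, Vh0 Om T k phi -> Aform f T (fun x => 1 * v0 x + 1 * y x) phi = 0,
    forall i x, HT (T := T) i x -> `|loc k y i x| <= eps * (h ^+ k * `|ln h|) &
    forall i x, HT (T := T) i x -> `|D0 k y i x| <= eps * (h ^+ k * `|ln h|) /\ `|D1 k y i x| <= eps * (h ^+ k * `|ln h|)].
Proof.
move=> C10 C40 Ce0 eps0.
have [B B0 hB] := weight_size OmE Om0.
have [CE CE0 hE] := energy k0 OmE Om0 cU al0 Uel; have [CL CL0 hL] := quad_lip k kap cU1 cU2.
have [CQ CQ0 hQ] := quad_bound k kap cU1 cU2; have [Cn Cn0 hn] := mesh_count OmE Om0 kap.
have [Cs Cs0 hs] := supbound k0 OmE Om0 kap B0 hB; have [Cg Cg0 hg] := gain k0 OmE Om0 kap B0 hB cU M0 al0 UM Uel.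
have [Ci Ci0 hi] := inverse_const k kap.
have [hm hm0 hc] := newton_consts B0 CE0 CL0 CQ0 Cn0 Cs0 Cg0 Ci0 C10 C40 Ce0 eps0.
have gen0 (a b : R) : 0 = a - b -> b = a by lra.
have g3 (a b c : R) : 1 * a + 1 * b - c = 1 * b + (a - c) by ring.
have dy (w y y' : pt -> R) x : 1 * (1 * w x + 1 * y x) + -1 * (1 * w x + 1 * y' x) = 1 * y x + -1 * y' x by ring.
have dy0 (w y : pt -> R) x : 1 * (1 * w x + 1 * y x) + -1 * w x = y x by ring.
have gN (q1 q2 X : R) : `|q1 - q2| <= X -> - q1 - - q2 <= X by rewrite ler_norml => /andP[]; lra.
have half1 (q : R) : q <= 2^-1 -> q < 1 by lra.
exists hm => // T h v0 e conf rg h0 h1 hhm Vv Ve Ev he heD hw.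
have [r [rho [m [S [F1 F2 F3 F4 F5]]]]] := hc h (size T)%:R k k3 h0 h1 hhm (hn T h conf rg h0).
move: heD F1 F2 F3 F4 F5 => /=; move: `|ln h| (h ^+ k) he hw => l H he hw heD.
set m0 : R := (C1 + C4) * (H * l) => -[rho0 r0 m00 m0m S0] [HHl rH mr qm] [qr E1 E2 E3] F4 F5.
have Cih : 0 <= Ci / h by rewrite divr_ge0 ?ltW.
have LLge0 : 0 <= LL B h.
  have [z Oz] := Om0; have cz := subset_closure Oz.
  have hz x (cx : closure Om x) := hB x z h cx cz h0 h1.
  have L1 := hL_ge1 h0 hz cz; have [e1 _] := hL_center B z h; rewrite e1 in L1; exact: le_trans ler01 L1.
have Iy y i x : HT (T := T) i x -> `|D0 k y i x| <= Ci / h * de k y i /\ `|D1 k y i x| <= Ci / h * de k y i.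
  move=> hx; have [_ I _ _] := hi h _ _ _ (rg i) _ (loc_pol k conf y i).
  by split; [exact: (I o0 x hx)|exact: (I o1 x hx)].
have tri (a b A B' : R) : `|a + b| <= A -> `|b| <= B' -> `|a| <= A + B'.
  by move=> h1' h2'; rewrite -(addrK b a); apply: le_trans (ler_normB _ _) _; exact: lerD.
have tri' (a b A B' : R) : `|a| <= A -> `|b| <= B' -> `|1 * b + a| <= A + B'.
  by move=> h1' h2'; rewrite mul1r addrC; apply: le_trans (ler_normD _ _) _; exact: lerD.
have m0E : C1 * H + C4 * (H * l) <= m0 by rewrite /m0 mulrDl lerD2r ler_pM2l.
(* The maximum bound on the gradient of [e] has a logarithm, its energy has none. The minimum keeps
   the uniform bound [m0] and at the same time a sum of squares free of logarithms. *)
pose mi (i : 'I_(size T)) : R := Num.min m0 (C1 * H + Ci / h * de k e i).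
have hmi i : ebound v0 i (mi i).
  move=> x hx; have [a1 a2] := hw i x hx; have [b1 b2] := heD i x hx; have [c1 c2] := Iy e i x hx.
  by rewrite /mi !le_min (tri _ _ _ _ a1 c1) (tri _ _ _ _ a2 c2) (le_trans (tri _ _ _ _ a1 b1) m0E) (le_trans (tri _ _ _ _ a2 b2) m0E).
have HH0 : 0 <= C1 * H.
  by rewrite mulr_ge0 ?(ltW C10)//; exact: le_trans rH.
have mi0 i : 0 <= mi i <= m0.
  have q : 0 <= C1 * H + Ci / h * de k e i := addr_ge0 HH0 (mulr_ge0 Cih (de_ge0 _ _ _)).
  by rewrite /mi le_min m00 q ge_min lexx.
have Sm : Num.sqrt (\sum_i mi i ^+ 2) <= S.
  apply: (sum_sqr_bound (a := C1 * H) (c := Ci / h) (b := de k e)) => //.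
    by move=> i; have /andP[-> _] := mi0 i; rewrite /mi ge_min lexx orbT.
  rewrite card_ord -nn_sqr; apply: le_trans E3; rewrite lerD2l; apply: ler_wpM2l; first by rewrite mulr_ge0 ?sqr_ge0.
  by rewrite lerXn2r ?nnegrE// ?dw_ge0//; exact: le_trans (dw_ge0 _ _ _) he.
have Q0 phi : `|quad T v0 phi| <= rho * lw k T phi.
  apply: le_trans (hQ T v0 phi h m0 mi conf rg h0 hmi m00 mi0) _; rewrite mulrA; apply: ler_wpM2r; first exact: lw_ge0.
  apply: le_trans E1; exact: ler_wpM2l (divr_ge0 (mulr_ge0 (ltW CQ0) m00) (ltW h0)) _ _ Sm.
(* The plain inverse estimate keeps [v0 + y] in the range of [quad_lip] for every [y] in the energy
   ball. *)
have bd y : Vh0 Om T k y -> dw k T y <= r -> forall i : 'I_(size T), ebound (fun x => 1 * v0 x + 1 * y x) i m.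
  move=> Vy yr i x hx; have [c1 c2] := Iy y i x hx.
  have dr : Ci / h * de k y i <= Ci / h * r by apply: ler_wpM2l => //; exact: le_trans (ne_le_nn _ _ i) yr.
  have [b1 b2] := hmi i x hx; have /andP[_ mm] := mi0 i.
  have E0 : e0 k U1 (fun x => 1 * v0 x + 1 * y x) i x = 1 * D0 k y i x + e0 k U1 v0 i x.
    by rewrite /e0 (D_lin k 1 1 v0 y conf).1; exact: g3.
  have E4 : e1 k U2 (fun x => 1 * v0 x + 1 * y x) i x = 1 * D1 k y i x + e1 k U2 v0 i x.
    by rewrite /e1 (D_lin k 1 1 v0 y conf).2; exact: g3.
  rewrite E0 E4; split.
    exact: le_trans (tri' _ _ _ _ (le_trans b1 mm) (le_trans c1 dr)) mr.
  exact: le_trans (tri' _ _ _ _ (le_trans b2 mm) (le_trans c2 dr)) mr.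
have m_ge0 : 0 <= m := le_trans m00 m0m.
have qq0 : 0 <= CL * m / h ^+ 2 := divr_ge0 (mulr_ge0 (ltW CL0) m_ge0) (sqr_ge0 _).
have v0b (i : 'I_(size T)) : ebound v0 i m.
  by move=> x hx; have [b1 b2] := hmi i x hx; have /andP[_ mm] := mi0 i; split; exact: le_trans (le_trans _ mm) m0m.
have Q2 y phi : Vh0 Om T k y -> dw k T y <= r -> `|quad T (fun x => 1 * v0 x + 1 * y x) phi| <= 2 * rho * lw k T phi.
  move=> Vy yr; have q := hL T _ v0 phi h m conf rg h0 (bd y Vy yr) v0b m_ge0.
  rewrite (dw_eq k0 conf (fun x _ => dy0 v0 y x)) mulrA in q.
  have q' : CL * m / h ^+ 2 * dw k T y <= rho by apply: le_trans qr; exact: ler_wpM2l.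
  have g (a b L : R) : 0 <= L -> `|a - b| <= CL * m / h ^+ 2 * dw k T y * L -> `|b| <= rho * L -> `|a| <= 2 * rho * L.
    move=> L0 h1' h2'; have h3' := ler_wpM2r L0 q'; rewrite -(subrK b a) (_ : 2 * rho * L = rho * L + rho * L); last by ring.
    by apply: le_trans (ler_normD _ _) _; apply: lerD => //; exact: le_trans h1' h3'.
  exact: (g _ _ _ (lw_ge0 _ _ _) q (Q0 phi)).
have /choice[Phi hPhi] : forall y : pt -> R, exists z, Vh0 Om T k z /\ forall phi, Vh0 Om T k phi ->
    aD T z phi = - quad T (fun x => 1 * v0 x + 1 * y x) phi.
  move=> y; have [L1 L2] := quad_lin0 k0 cU1 cU2 (fun x => 1 * v0 x + 1 * y x) conf (T := T).
  have LL' : lin0 k Om T (fun phi => - quad T (fun x => 1 * v0 x + 1 * y x) phi).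
    split=> [l' f' g' Vf Vg|f' Vf f0]; last by rewrite L2// oppr0.
    by rewrite L1// opprD mulrN.
  by have [z Vz Hz] := aD_riesz k0 OmE Om0 cU al0 Uel conf rg h0 h1 LL'; exists z.
have lr (a b : R) : `|a| <= b -> - a <= b by rewrite -normrN; exact: le_trans (ler_norm _).
have hq : 0 <= CE * (CL * m / h ^+ 2) < 1 by rewrite (mulr_ge0 (ltW CE0) qq0); exact: half1.
have hK v x : Vh0 Om T k v -> closure Om x -> `|v x| <= Cs * LL B h * dw k T v.
  by move=> Vv' /(mesh_closureE conf)[i hx]; rewrite (vh_loc k0 conf Vv'.1 hx); exact: (hs T v h conf rg h0 h1 Vv' i x hx).
have rh2 : 0 <= 2 * rho := mulr_ge0 (ler0n _ 2) rho0.
have hself v : Vh0 Om T k v -> dw k T v <= r -> Vh0 Om T k (Phi v) /\ dw k T (Phi v) <= r.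
  move=> Vv' vr; have [Vz Hz] := hPhi v; split; first exact: Vz.
  rewrite -E2; apply: (hE T (Phi v) (2 * rho) conf Vz rh2).
  rewrite -/(aD T (Phi v) (Phi v)) (Hz _ Vz); apply: lr; exact: (Q2 v (Phi v) Vv' vr).
have hcon v w : Vh0 Om T k v -> Vh0 Om T k w -> dw k T v <= r -> dw k T w <= r ->
    dw k T (fun x => 1 * Phi v x + -1 * Phi w x) <= CE * (CL * m / h ^+ 2) * dw k T (fun x => 1 * v x + -1 * w x).
  move=> Vv' Vw vr wr; have [Vz Hz] := hPhi v; have [Vz' Hz'] := hPhi w.
  have Vd := Vh0_lin2 1 (-1) conf Vz Vz'; rewrite -mulrA; apply: (hE T _ _ conf Vd (mulr_ge0 qq0 (dw_ge0 _ _ _))).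
  set dl := fun x => 1 * Phi v x + -1 * Phi w x in Vd *.
  have q := hL T _ _ dl h m conf rg h0 (bd v Vv' vr) (bd w Vw wr) m_ge0.
  rewrite (dw_eq k0 conf (fun x _ => dy v0 v w x)) mulrA in q.
  have e1 := Hz dl Vd; have e2 := Hz' dl Vd.
  have e3 := aD_sub (Phi v) (Phi w) dl conf; rewrite -/dl e1 e2 in e3.
  rewrite -/(aD T dl dl) e3; exact: gN q.
have [y [Vy yr yfix]] := fixpoint k0 OmE conf hq r0 (mulr_ge0 (ltW Cs0) LLge0) hK hself hcon.
have solv phi : Vh0 Om T k phi -> aD T y phi = - quad T (fun x => 1 * v0 x + 1 * y x) phi.
  move=> Vp; have [Vz Hz] := hPhi y; have e1 := Hz phi Vp.
  have e2 := aD_sub (Phi y) y phi conf.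
  have [d0 d1] := D_pwc k (fun x => 1 * Phi y x + -1 * y x) conf; have [f0 f1] := D_pwc k phi conf.
  have MM : 0 <= 2 * M := mulr_ge0 (ler0n _ 2) (ltW M0).
  (* The fixed point is known up to energy norm zero; boundedness of the form carries the equation
     over from [Phi y] to [y]. *)
  have e3 : `|aD T (fun x => 1 * Phi y x + -1 * y x) phi| <= 2 * M * (dw k T (fun x => 1 * Phi y x + -1 * y x) * dw k T phi).
    by apply: (nn_CS MM) => i; apply: (aint_CS cU M0 UM conf (d0 i) (d1 i) (f0 i) (f1 i)).
  rewrite yfix mul0r mulr0 normr_le0 in e3; rewrite (eqP e3) e1 in e2; exact: gen0 e2.
have Vv0y : Vh Om T k (fun x => 1 * v0 x + 1 * y x).
  have h1' := Vh_lin 1 Vv Vy.1.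
  rewrite (_ : (fun x => 1 * v0 x + 1 * y x) = (fun x => 1 * v0 x + y x)); first exact: h1'.
  by apply/funext => x; rewrite (mul1r (y x)).
have Ey : (fun x => 1 * (1 * v0 x + 1 * y x) + -1 * v0 x) = y by apply/funext => x; exact: dy0.
exists y; split.
- exact: Vy.
- exact: le_trans yr rH.
- move=> phi Vp; have e4 := aE_diff (fun x => 1 * v0 x + 1 * y x) v0 phi conf; cbv beta in e4.
  by rewrite Ey (Ev phi Vp) addr0 (solv phi Vp) in e4; rewrite (AformE conf Vv0y Vp) e4 addNr.
- move=> i x hx; apply: le_trans F5; apply: le_trans (hs T y h conf rg h0 h1 Vy i x hx) _.
  exact: ler_wpM2l (mulr_ge0 (ltW Cs0) LLge0) _ _ yr.
- move=> i x hx; have [c1 c2] := Iy y i x hx.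
  have Hy phi : Vh0 Om T k phi -> aD T y phi <= 2 * rho * lw k T phi.
    by move=> Vp; rewrite (solv phi Vp); apply: lr; exact: (Q2 y phi Vy yr).
  have di : Ci / h * de k y i <= eps * (H * l).
    apply: (F4 (de k y i) (de_ge0 k y i)); exact: (hg T y h (2 * rho) conf rg h0 h1 Vy rh2 Hy i).
  by split; [exact: le_trans c1 di|exact: le_trans c2 di].
Qed.

End Newton.

(** * Passage between the norms of the statement and elementwise bounds *)

Section Pieces.
Variable R : realType.
Local Notation pt := (R * R)%type.
Variable k : nat.
Hypothesis k0 : (0 < k)%N.
Variables (Om : set pt) (s : seq pt).
Hypothesis OmE : Om = (hull s)°.
Hypothesis Om0 : Om !=set0.
Variable kap : R.

Lemma HT_broken T (i : 'I_(size T)) x : conforming Om T -> (HT i)° x -> broken Om T x.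
Proof. by move=> conf hx; rewrite (brokenE OmE conf); exists i => //; rewrite HTE. Qed.

Lemma pw_C T w W1 W2 : conforming Om T -> cont (closure Om) W1 -> cont (closure Om) W2 ->
  (forall x, Om x -> is_derive x (basis2 R o0) w (W1 x) /\ is_derive x (basis2 R o1) w (W2 x)) ->
  pw (T := T) w (fun=> W1) (fun=> W2).
Proof.
move=> conf c1 c2 d i; split; [exact: contW (HT_sub conf (i := i)) c1|exact: contW (HT_sub conf (i := i)) c2|].
by move=> x hx; apply: d; have [] := HT_broken conf hx.
Qed.

Lemma pwc_lin (T : mesh R) (l m : R) (W V : 'I_(size T) -> pt -> R) : pwc W -> pwc V -> pwc (fun i x => l * W i x + m * V i x).
Proof. by move=> cW cV i; have := cW i; have := cV i => h1 h2; contt. Qed.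

Lemma pw_pwc (T : mesh R) w (W0 W1 : 'I_(size T) -> pt -> R) : pw w W0 W1 -> pwc W0 /\ pwc W1.
Proof. by move=> hw; split=> i; case: (hw i). Qed.

Lemma pw_sub T w (W0 W1 : 'I_(size T) -> pt -> R) v V0 V1 : pw w W0 W1 -> pw v V0 V1 ->
  pw (w \- v) (fun i x => 1 * W0 i x + -1 * V0 i x) (fun i x => 1 * W1 i x + -1 * V1 i x).
Proof. by move=> hw hv; apply: (pw_eq (pw_lin 1 (-1) hw hv)) => x; rewrite mul1r mulN1r. Qed.

Lemma W1_HT T w (W W0 W1 : 'I_(size T) -> pt -> R) (c : R) : conforming Om T -> pw w W0 W1 -> pwc W ->
  (forall i x, (HT i)° x -> w x = W i x) -> (W1infty_norm Om T w <= c%:E)%E ->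
  forall i x, HT i x -> [/\ `|W i x| <= c, `|W0 i x| <= c & `|W1 i x| <= c].
Proof.
move=> conf hw cW wW; rewrite /W1infty_norm -o_ord.1 -o_ord.2 !ge_max => /andP[n /andP[n0 n1]] i x hx.
have [c0 c1] := pw_pwc hw; split; first exact: (Linfty_HT OmE conf cW wW n hx).
  by apply: (Linfty_HT OmE conf c0 _ n0 hx) => j y hy; exact: (pw_dpart hw hy).1.
by apply: (Linfty_HT OmE conf c1 _ n1 hx) => j y hy; exact: (pw_dpart hw hy).2.
Qed.

Lemma W1_HT_le T w (W W0 W1 : 'I_(size T) -> pt -> R) (c : R) : conforming Om T -> pw w W0 W1 -> 0 <= c ->
  (forall i x, (HT i)° x -> w x = W i x) ->
  (forall i x, HT i x -> [/\ `|W i x| <= c, `|W0 i x| <= c & `|W1 i x| <= c]) ->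
  (W1infty_norm Om T w <= c%:E)%E.
Proof.
move=> conf hw c0 wW h; rewrite /W1infty_norm -o_ord.1 -o_ord.2 !ge_max; apply/andP; split; last (apply/andP; split).
- by apply: (Linfty_HT_le OmE conf c0 wW) => i x hx; have [] := h i x hx.
- apply: (Linfty_HT_le OmE conf c0 (G := W0)); last by move=> i x hx; have [] := h i x hx.
  by move=> j y hy; exact: (pw_dpart hw hy).1.
- apply: (Linfty_HT_le OmE conf c0 (G := W1)); last by move=> i x hx; have [] := h i x hx.
  by move=> j y hy; exact: (pw_dpart hw hy).2.
Qed.

(** Each element contributes at most a multiple of [h m] to the L^2 norm, and [mesh_count] bounds
    the number of elements. *)
Lemma nn_sup : exists2 C : R, 0 < C & forall T (h m : R) (Y0 Y1 : 'I_(size T) -> pt -> R), conforming Om T ->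
  regT kap h T -> 0 < h -> 0 <= m -> pwc Y0 -> pwc Y1 -> (forall i x, HT i x -> `|Y0 i x| <= m) ->
  (forall i x, HT i x -> `|Y1 i x| <= m) -> nn Y0 Y1 <= C * m.
Proof.
have [Cn Cn0 hn] := mesh_count OmE Om0 kap; exists (2 * Num.sqrt Cn); first by rewrite mulr_gt0// sqrtr_gt0.
move=> T h m Y0 Y1 conf rg h0 m0 c0 c1 b0 b1.
have n1 i : ne Y0 Y1 i <= 2 * h * m * 1.
  by rewrite mulr1; exact: (vn_bound (jacT conf i) (reg_jac_le (rg i)) (ltW h0) (c0 i) (c1 i) (b0 i) (b1 i)).
have l0 : 0 <= 2 * h * m by rewrite !mulr_ge0// ltW.
apply: le_trans (nn_le l0 (fun=> ler01) n1) _.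
have -> : \sum_(i < size T) (1 : R) ^+ 2 = (size T)%:R.
  by rewrite (eq_bigr (fun=> 1)); [rewrite sumr_const card_ord|move=> i _; exact: expr1n].
have hN : h * Num.sqrt (size T)%:R <= Num.sqrt Cn.
  rewrite -{1}(ger0_norm (ltW h0)) -sqrtr_sqr -sqrtrM ?sqr_ge0// ler_wsqrtr// mulrC; exact: (hn T h conf rg h0).
have := ler_wpM2l m0 hN; move: (Num.sqrt _) (Num.sqrt _) => a b; lra.
Qed.

Lemma H1_nn T w (W W0 W1 : 'I_(size T) -> pt -> R) (c : R) : conforming Om T -> pw w W0 W1 -> pwc W -> 0 <= c ->
  (forall i x, (HT i)° x -> w x = W i x) -> nn W (fun _ _ => 0) <= c -> nn W0 W1 <= c ->
  (H1_norm Om T w <= (2 * c)%:E)%E.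
Proof.
move=> conf hw cW c0 wW n n'; have [c1 c2] := pw_pwc hw.
apply: (H1_norm_le OmE conf _ hw cW wW); first exact: mulr_ge0.
have -> : \sum_i IKi i (fun x => W i x ^+ 2 + (W0 i x ^+ 2 + W1 i x ^+ 2)) = nn W (fun _ _ => 0) ^+ 2 + nn W0 W1 ^+ 2.
  rewrite !nn_sqr -big_split; apply: eq_bigr => i _; rewrite /= /ne !vn_sqr /IKi.
  have cz : cont (HT i) (fun=> 0) by exact: cont_cst.
  have h1 := cW i; have h2 := c1 i; have h3 := c2 i.
  rewrite -IKD; [|by apply: contD; exact: contX|by apply: contD; exact: contX].
  by apply: IK_eq => x _; rewrite (expr0n R 2) addr0.
have sq (a : R) : 0 <= a -> a <= c -> a ^+ 2 <= c ^+ 2 by move=> a0 ac; rewrite lerXn2r ?nnegrE.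
have h1 := sq _ (nn_ge0 _ _) n; have h2 := sq _ (nn_ge0 _ _) n'; have h3 := sqr_ge0 c.
rewrite exprMn; move: (nn _ _ ^+ 2) (nn _ _ ^+ 2) (c ^+ 2) h1 h2 h3 => a b d; lra.
Qed.

Lemma nn_tri T (S0 S1 E0 E1 Y0 Y1 : 'I_(size T) -> pt -> R) : pwc S0 -> pwc S1 -> pwc E0 -> pwc E1 -> pwc Y0 -> pwc Y1 ->
  nn (fun i x => 1 * S0 i x + 1 * (1 * E0 i x + -1 * Y0 i x)) (fun i x => 1 * S1 i x + 1 * (1 * E1 i x + -1 * Y1 i x)) <=
  nn S0 S1 + (nn E0 E1 + nn Y0 Y1).
Proof.
move=> s0 s1 e0 e1 y0 y1.
apply: le_trans (nn_lin 1 1 s0 s1 (pwc_lin (l := 1) (m := -1) e0 y0) (pwc_lin (l := 1) (m := -1) e1 y1)) _.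
have := nn_lin 1 (-1) e0 e1 y0 y1; rewrite normrN normr1 !mul1r => h; by rewrite lerD2l.
Qed.

Lemma loc_ext_lin T (l : R) v w (i : 'I_(size T)) : loc k (fun x => l * v x + w x) i = (fun x => l * loc k v i x + 1 * loc k w i x) :> (pt -> R).
Proof.
rewrite -(loc_lin k l 1 v w i); congr (loc k _ i); apply/funext => x; by rewrite (mul1r (w x)).
Qed.

Lemma dpart_loc_lin0 T (i : 'I_(size T)) (j : 'I_2) z : conforming Om T -> (HT i)° z ->
  lin0 k Om T (fun phi => dpart [:: j] phi z).
Proof.
move=> conf hz; have L (l m : R) v w : dpart [:: j] (fun x => l * loc k v i x + m * loc k w i x) z =
    l * dpart [:: j] (loc k v i) z + m * dpart [:: j] (loc k w i) z.
  by rewrite (dpart_lin j l m (loc_pol k conf v i) (loc_pol k conf w i)).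
have g (a b c : R) : a = 0 * b + 0 * c -> a = 0 by rewrite !mul0r addr0.
have g1 (a l b c : R) : a = l * b + 1 * c -> a = l * b + c by rewrite mul1r.
split=> [l v w [Vv _] [Vw _]|v [Vv _] v0].
  have V := Vh_lin l Vv Vw.
  rewrite (dpart_loc k0 conf _ V hz) (dpart_loc k0 conf _ Vv hz) (dpart_loc k0 conf _ Vw hz) loc_ext_lin; apply: g1; exact: L.
rewrite (dpart_loc k0 conf _ Vv hz).
have -> : loc k v i = loc k (fun x => 0 * v x + 0 * v x) i.
  by apply: (loc_eq k0 conf) => x hx; rewrite (v0 x (HT_sub conf hx)) mulr0 addr0.
rewrite loc_lin; apply: g; exact: L.
Qed.

Lemma eval_lin0 T z : closure Om z -> lin0 k Om T (fun phi => phi z).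
Proof. by move=> cz; split=> // v _; apply. Qed.

Lemma closure_abs_le T (i : 'I_(size T)) (F : pt -> R) (M : R) : conforming Om T -> cont (HT i) F ->
  (forall x, (HT i)° x -> `|F x| <= M) -> forall x, HT i x -> `|F x| <= M.
Proof.
move=> conf cF h x hx; rewrite ler_norml; apply/andP; split.
  rewrite lerNl; apply: (closure_le conf (contN cF) _ hx) => y hy; have := h y hy; rewrite ler_norml => /andP[+ _].
  by rewrite lerNl.
by apply: (closure_le conf cF _ hx) => y hy; exact: le_trans (ler_norm _) (h y hy).
Qed.

End Pieces.

(** * Construction of the discrete solution and its estimates *)

Section Final.
Variable R : realType.
Local Notation pt := (R * R)%type.
Variable k : nat.
Hypothesis k0 : (0 < k)%N.
Hypothesis k3 : (3 <= k)%N.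
Variables (Om : set pt) (s : seq pt).
Hypothesis OmE : Om = (hull s)°.
Hypothesis Om0 : Om !=set0.
Variable kap : R.
Variables (u U1 U2 U11 U12 U22 : pt -> R) (M al : R).
Hypothesis Ujet : jet3 (closure Om) u U1 U2 U11 U12 U22.
Hypothesis Uhess : forall x, Om x -> [/\ dpart [:: o0; o0] u x = U11 x, dpart [:: o0; o1] u x = U12 x,
  dpart [:: o1; o0] u x = U12 x & dpart [:: o1; o1] u x = U22 x].
Hypothesis dU : forall x, Om x -> is_derive x (basis2 R o0) u (U1 x) /\ is_derive x (basis2 R o1) u (U2 x).
Hypothesis cu : cont (closure Om) u.
Hypothesis cU1 : cont (closure Om) U1.
Hypothesis cU2 : cont (closure Om) U2.
Hypothesis cU : [/\ cont (closure Om) U11, cont (closure Om) U12 & cont (closure Om) U22].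
Hypothesis M0 : 0 < M.
Hypothesis al0 : 0 < al.
Hypothesis UM : forall x, closure Om x -> [/\ `|U11 x| <= M, `|U12 x| <= M & `|U22 x| <= M].
Hypothesis Uel : forall x (a b : R), closure Om x -> al * (a ^+ 2 + b ^+ 2) <= U22 x * a ^+ 2 - 2 * U12 x * a * b + U11 x * b ^+ 2.
Variable f : pt -> R.
Hypothesis cf : cont (closure Om) f.
Hypothesis fE : forall x, Om x -> f x = U11 x * U22 x - U12 x ^+ 2.
Variables (G G1 G2 : pt -> R).
Hypothesis cG1 : cont (closure Om) G1.
Hypothesis cG2 : cont (closure Om) G2.
Hypothesis dG : forall x, Om x -> is_derive x (basis2 R o0) G (G1 x) /\ is_derive x (basis2 R o1) G (G2 x).
Local Notation asum := (cof_sum U11 U12 U22).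
Local Notation aD := (vh_form k U11 U12 U22).
Local Notation aE := (err_form k U1 U2 U11 U12 U22).

Lemma asum_lin2 T (l m : R) (W0 W1 V0 V1 P0 P1 : 'I_(size T) -> pt -> R) : conforming Om T ->
  pwc W0 -> pwc W1 -> pwc V0 -> pwc V1 -> pwc P0 -> pwc P1 ->
  asum (fun i x => l * W0 i x + m * V0 i x) (fun i x => l * W1 i x + m * V1 i x) P0 P1 = l * asum W0 W1 P0 P1 + m * asum V0 V1 P0 P1.
Proof.
move=> conf w0 w1 v0 v1 p0 p1; rewrite !(asum_sym _ _ _ _ _ P0 P1).
have cz : pwc (fun _ _ => 0 : R) (T := T) by move=> i; exact: cont_cst.
have mv0 : pwc (fun i x => m * V0 i x) by move=> i; have := v0 i => h; contt.
have mv1 : pwc (fun i x => m * V1 i x) by move=> i; have := v1 i => h; contt.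
have E1 := asum_lin cU l conf w0 w1 mv0 mv1 p0 p1; rewrite E1.
have E2 := asum_lin cU m conf v0 v1 cz cz p0 p1; have E3 := asum_lin cU 1 conf cz cz cz cz p0 p1.
have z (V : 'I_(size T) -> pt -> R) : (fun i x => m * V i x + 0) = (fun i x => m * V i x).
  by apply/funext => i; apply/funext => x; rewrite addr0.
have z1 : (fun (i : 'I_(size T)) (x : pt) => 1 * (0 : R) + 0) = (fun _ _ => 0).
  by apply/funext => i; apply/funext => x; rewrite addr0 mulr0.
rewrite !z in E2; rewrite z1 in E3; rewrite E2.
suff -> : asum P0 P1 (fun _ _ => 0) (fun _ _ => 0) = 0 by rewrite addr0.
by move: E3; rewrite mul1r; set q := asum _ _ _ _ => h; apply: (@addrI _ q); rewrite addr0 -h.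
Qed.

Lemma Aprime_sub T v (V0 V1 : 'I_(size T) -> pt -> R) w W0 W1 phi : conforming Om T ->
  pw v V0 V1 -> pw w W0 W1 -> Vh Om T k phi ->
  Aprime Om T u (v \- w) phi = asum V0 V1 (D0 k (T := T) phi) (D1 k phi) - asum W0 W1 (D0 k (T := T) phi) (D1 k phi).
Proof.
move=> conf hv hw Vp; have [p0 p1] := D_pwc k phi conf.
have [v0 v1] := pw_pwc hv; have [w0 w1] := pw_pwc hw.
rewrite (Aprime_sum OmE conf Ujet Uhess (pw_sub hv hw) (pw_Vh k0 conf Vp)).
by rewrite (asum_lin2 1 (-1) conf v0 v1 w0 w1 p0 p1) mul1r mulN1r.
Qed.

(** The projection and the Green's functions are chosen by [xget]; [aD_riesz] supplies a solution,
    so a function chosen in this way does satisfy its equation. *)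
Lemma riesz_xget T (h : R) (L : (pt -> R) -> R) g : conforming Om T -> regT kap h T -> 0 < h -> h <= 1 ->
  lin0 k Om T L -> g = xget (fun=> 0) [set v | Vh0 Om T k v /\ forall phi, Vh0 Om T k phi -> Aprime Om T u v phi = L phi] ->
  Vh0 Om T k g /\ forall phi, Vh0 Om T k phi -> aD T g phi = L phi.
Proof.
move=> conf rg h0 h1 hL ->; have [v Vv hv] := aD_riesz k0 OmE Om0 cU al0 Uel conf rg h0 h1 hL.
have eq w phi : Vh0 Om T k w -> Vh0 Om T k phi -> Aprime Om T u w phi = aD T w phi.
  by move=> Vw Vp; rewrite (Aprime_sum OmE conf Ujet Uhess (pw_Vh k0 conf Vw.1) (pw_Vh k0 conf Vp.1)).
have [Vg hg] := @xgetPex _ (fun=> 0) [set v | Vh0 Om T k v /\ forall phi, Vh0 Om T k phi -> Aprime Om T u v phi = L phi]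
  (ex_intro _ v (conj Vv (fun phi Vp => etrans (eq v phi Vv Vp) (hv phi Vp)))).
by split; [exact: Vg|move=> phi Vp; exact: etrans (esym (eq _ phi Vg Vp)) (hg phi Vp)].
Qed.

(** [P_h u] projects [u - G] only and leaves [I_h G - G] in the linear equation. The response [e]
    has linearized form equal to that of [I_h G - G], and [v0 = P_h u - e] has the right boundary
    values and no linear residual. In the energy estimate of [e], [I_h G - G] is replaced by
    [P_h u - u], from which it differs by a term orthogonal to the test space: this gives h^k
    without a logarithm. The maximum bounds come from the Green's functions. *)
Lemma start (C1 C4 : R) : 0 < C1 -> exists2 Ce : R, 0 < Ce & forall T (h : R), conforming Om T -> regT kap h T -> 0 < h -> h <= 1 ->
  (W1infty_norm Om T (u \- Ph Om T k u G)%R <= (C1 * h ^+ k)%:E)%E ->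
  (forall z, broken Om T z -> `|Aprime Om T u (interp Om T k G \- G) (green Om T k u z)| <= C4 * (h ^+ k * `|ln h|) /\
     forall i, `|Aprime Om T u (interp Om T k G \- G) (dgreen Om T k u i z)| <= C4 * (h ^+ k * `|ln h|)) ->
  exists v0 e, [/\ [/\ Vh Om T k v0, Vh0 Om T k e & forall x, bdry Om x -> v0 x = interp Om T k G x],
    forall phi, Vh0 Om T k phi -> aE T v0 phi = 0,
    dw k T e <= Ce * h ^+ k,
    forall (i : 'I_(size T)) x, HT i x -> [/\ `|loc k e i x| <= C4 * (h ^+ k * `|ln h|), `|D0 k e i x| <= C4 * (h ^+ k * `|ln h|) &
      `|D1 k e i x| <= C4 * (h ^+ k * `|ln h|)] &
    forall (i : 'I_(size T)) x, HT i x -> [/\ `|u x - (loc k v0 i x + loc k e i x)| <= C1 * h ^+ k,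
      `|e0 k U1 v0 i x + D0 k e i x| <= C1 * h ^+ k & `|e1 k U2 v0 i x + D1 k e i x| <= C1 * h ^+ k]].
Proof.
move=> C10; have [Cs Cs0 hs] := nn_sup OmE Om0 kap.
exists (2 * M * Cs * C1 / al); first by rewrite divr_gt0// !mulr_gt0.
have gen1 (a b : R) : a + b = 1 * a + 1 * b by ring.
have gen2 (a b c p q : R) : 1 * (1 * a + 1 * b) + -1 * c - p = 1 * (1 * a + -1 * (1 * p + -1 * q)) + 1 * (1 * (1 * b + -1 * q) + -1 * c) by ring.
have gen3 (a b p q B' : R) : `|1 * p + -1 * (1 * a + 1 * b)| <= B' -> `|1 * (1 * b + -1 * q) + 1 * (1 * a + -1 * (1 * p + -1 * q))| <= B'.
  by have -> : 1 * (1 * b + -1 * q) + 1 * (1 * a + -1 * (1 * p + -1 * q)) = - (1 * p + -1 * (1 * a + 1 * b)) by [ring]; rewrite normrN.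
have gen4 (a b c p B' : R) : `|1 * p + -1 * (1 * a + 1 * b)| <= B' -> `|1 * (1 * a + 1 * b) + -1 * c - p + c| <= B'.
  by have -> : 1 * (1 * a + 1 * b) + -1 * c - p + c = - (1 * p + -1 * (1 * a + 1 * b)) by [ring]; rewrite normrN.
have gen5 (a b c p B' : R) : `|p - (1 * a + 1 * b)| <= B' -> `|p - (1 * (1 * a + 1 * b) + -1 * c + c)| <= B'.
  by have -> : 1 * (1 * a + 1 * b) + -1 * c + c = 1 * a + 1 * b by [ring].
have gen6 (a b c d : R) : a = b -> c = d -> 1 * (a - b) + 1 * (c - d) = 0 by move=> -> ->; ring.
have gen7 (X Y d S : R) : 0 <= S -> 0 <= d -> al * d ^+ 2 <= X -> X <= 2 * M * (Y * d) -> Y <= Cs * S -> d <= 2 * M * Cs * (S / al).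
  move=> S0 d0 h1 h2 h3; have [->|dn] := eqVneq d 0; first by rewrite mulr_ge0 ?divr_ge0 ?(ltW al0)// !mulr_ge0 ?ltW.
  have d1 : 0 < d by rewrite lt_neqAle eq_sym dn.
  rewrite mulrA ler_pdivlMr// mulrC -(ler_pM2r d1); apply: le_trans (_ : X <= _); first by rewrite -mulrA -expr2.
  by apply: le_trans h2 _; rewrite !mulrA; apply: ler_wpM2r d0 _ _ _; rewrite -!mulrA; do 2! (apply: ler_wpM2l => //); exact: ltW.
move=> T h conf rg h0 h1 hW hg.
set IG := interp Om T k G in hg *; have [VIG _] := interpP k0 conf G; rewrite -/IG in VIG.
have pu := pw_C OmE conf cU1 cU2 dU; have pG := pw_C OmE conf cG1 cG2 dG.
pose UG0 (i : 'I_(size T)) x := 1 * U1 x + -1 * G1 x; pose UG1 (i : 'I_(size T)) x := 1 * U2 x + -1 * G2 x.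
have pUG : pw (u \- G) UG0 UG1 := pw_sub pu pG; have [cUG0 cUG1] := pw_pwc pUG.
pose X0 (i : 'I_(size T)) x := 1 * D0 k IG i x + -1 * G1 x; pose X1 (i : 'I_(size T)) x := 1 * D1 k IG i x + -1 * G2 x.
have pX : pw (IG \- G) X0 X1 := pw_sub (pw_Vh k0 conf VIG) pG; have [cX0 cX1] := pw_pwc pX.
pose P := Phat Om T k u (u \- G).
have [VP HP] : Vh0 Om T k P /\ forall phi, Vh0 Om T k phi -> asum (D0 k (T := T) P) (D1 k P) (D0 k phi) (D1 k phi) = asum UG0 UG1 (D0 k (T := T) phi) (D1 k phi).
  have eq w phi : Vh0 Om T k w -> Vh0 Om T k phi -> Aprime Om T u (w \- (u \- G)) phi = asum (D0 k (T := T) w) (D1 k w) (D0 k phi) (D1 k phi) - asum UG0 UG1 (D0 k (T := T) phi) (D1 k phi).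
    by move=> Vw Vp; exact: (Aprime_sub conf (pw_Vh k0 conf Vw.1) pUG Vp.1).
  have [v Vv hv] := aD_riesz k0 OmE Om0 cU al0 Uel conf rg h0 h1 (aD_lin k0 cU conf cUG0 cUG1).
  have ex : exists v, [set v | Vh0 Om T k v /\ forall phi, Vh0 Om T k phi -> Aprime Om T u (v \- (u \- G)) phi = 0] v.
    exists v; split; first exact: Vv.
    move=> phi Vp; rewrite (eq v phi Vv Vp); have := hv phi Vp => E; apply/eqP; rewrite subr_eq0; apply/eqP; exact: E.
  have [V1 V2] := @xgetPex _ (fun=> 0) _ ex; split; first exact: V1.
  move=> phi Vp; have E := V2 phi Vp; rewrite (eq _ phi V1 Vp) in E; apply/eqP; rewrite -subr_eq0; apply/eqP; exact: E.
have [e Ve He] := aD_riesz k0 OmE Om0 cU al0 Uel conf rg h0 h1 (aD_lin k0 cU conf cX0 cX1).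
pose Q x := 1 * P x + 1 * IG x; pose v0 x := 1 * Q x + -1 * e x.
have EPh : Ph Om T k u G = Q by apply/funext => x; exact: gen1.
have VQ : Vh Om T k Q.
  have := Vh_lin 1 VP.1 VIG; rewrite (_ : (fun x => 1 * P x + IG x) = Q); first exact.
  by apply/funext => x; rewrite /Q (mul1r (IG x)).
have Vv0 : Vh Om T k v0.
  have := Vh_lin (-1) Ve.1 VQ; rewrite (_ : (fun x => -1 * e x + Q x) = v0); first exact.
  by apply/funext => x; rewrite /v0 (mul1r (Q x)) addrC.
have [DQ0 DQ1] := D_lin k 1 1 P IG conf; rewrite -/Q in DQ0 DQ1.
have [Dv0 Dv1] := D_lin k 1 (-1) Q e conf; rewrite -/v0 in Dv0 Dv1.
have [cP0 cP1] := D_pwc k P conf; have [ce0 ce1] := D_pwc k e conf.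
pose A0 (i : 'I_(size T)) x := 1 * D0 k P i x + -1 * UG0 i x; pose A1 (i : 'I_(size T)) x := 1 * D1 k P i x + -1 * UG1 i x.
have cA0 : pwc A0 := pwc_lin cP0 cUG0; have cA1 : pwc A1 := pwc_lin cP1 cUG1.
have HA phi : Vh0 Om T k phi -> asum A0 A1 (D0 k (T := T) phi) (D1 k phi) = 0.
  move=> Vp; have [p0 p1] := D_pwc k phi conf; have E := asum_lin2 1 (-1) conf cP0 cP1 cUG0 cUG1 p0 p1.
  by rewrite (HP phi Vp) mul1r mulN1r subrr in E.
have bQ i x : HT (T := T) i x -> [/\ `|u x - loc k Q i x| <= C1 * h ^+ k, `|1 * U1 x + -1 * D0 k Q i x| <= C1 * h ^+ k & `|1 * U2 x + -1 * D1 k Q i x| <= C1 * h ^+ k].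
  rewrite EPh in hW; apply: (W1_HT OmE conf (pw_sub pu (pw_Vh k0 conf VQ)) _ _ hW (W := fun i x => u x - loc k Q i x)).
    by move=> j; have [cl _] := D_cont k Q j conf; apply: contB => //; exact: contW (HT_sub conf (i := j)) cu.
  by move=> j y hy; rewrite -(vh_loc k0 conf VQ (interior_subset hy)).
have Hk : 0 <= C1 * h ^+ k := mulr_ge0 (ltW C10) (exprn_ge0 k (ltW h0)).
exists v0, e; split.
- split=> // x bx; rewrite /v0 /Q (VP.2 x bx) (Ve.2 x bx); by rewrite !mulr0 addr0 add0r !mul1r.
- move=> phi Vp; have [p0 p1] := D_pwc k phi conf.
  pose B0 (i : 'I_(size T)) x := 1 * X0 i x + -1 * D0 k e i x; pose B1 (i : 'I_(size T)) x := 1 * X1 i x + -1 * D1 k e i x.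
  have cB0 : pwc B0 := pwc_lin cX0 ce0; have cB1 : pwc B1 := pwc_lin cX1 ce1.
  have HB : asum B0 B1 (D0 k (T := T) phi) (D1 k phi) = 0.
    have E := asum_lin2 1 (-1) conf cX0 cX1 ce0 ce1 p0 p1.
    by have E' := He phi Vp; rewrite /vh_form in E'; rewrite E' mul1r mulN1r subrr in E.
  have E0 : e0 k U1 (T := T) v0 = (fun i x => 1 * A0 i x + 1 * B0 i x).
    by apply/funext => i; apply/funext => x; rewrite /e0 Dv0 DQ0; exact: gen2.
  have E1 : e1 k U2 (T := T) v0 = (fun i x => 1 * A1 i x + 1 * B1 i x).
    by apply/funext => i; apply/funext => x; rewrite /e1 Dv1 DQ1; exact: gen2.
  by rewrite /err_form E0 E1 (asum_lin2 1 1 conf cA0 cA1 cB0 cB1 p0 p1) (HA phi Vp) HB !mulr0 addr0.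
(* [Y0], [Y1] form the gradient of [P_h u - u], which [C1 * h ^+ k] bounds pointwise. *)
- pose Y0 (i : 'I_(size T)) x := 1 * X0 i x + 1 * A0 i x; pose Y1 (i : 'I_(size T)) x := 1 * X1 i x + 1 * A1 i x.
  have cY0 : pwc Y0 := pwc_lin cX0 cA0; have cY1 : pwc Y1 := pwc_lin cX1 cA1.
  have bY0 i x : HT i x -> `|Y0 i x| <= C1 * h ^+ k.
    by move=> hx; have [_ b _] := bQ i x hx; rewrite DQ0 in b; exact: gen3 b.
  have bY1 i x : HT i x -> `|Y1 i x| <= C1 * h ^+ k.
    by move=> hx; have [_ _ b] := bQ i x hx; rewrite DQ1 in b; exact: gen3 b.
  have nY := hs T h (C1 * h ^+ k) Y0 Y1 conf rg h0 Hk cY0 cY1 bY0 bY1.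
  have EY : aD T e e = asum Y0 Y1 (D0 k (T := T) e) (D1 k e).
    rewrite (asum_lin2 1 1 conf cX0 cX1 cA0 cA1 ce0 ce1) (HA e Ve) mulr0 addr0 mul1r; exact: He e Ve.
  have lo : al * dw k T e ^+ 2 <= aD T e e.
    rewrite /dw nn_sqr mulr_sumr; apply: ler_sum => i _; exact: (aint_coer cU Uel conf (ce0 i) (ce1 i)).
  have MM : 0 <= 2 * M := mulr_ge0 (ler0n _ 2) (ltW M0).
  have up : aD T e e <= 2 * M * (nn Y0 Y1 * dw k T e).
    rewrite EY; apply: le_trans (ler_norm _) _.
    by apply: (nn_CS MM) => i; exact: (aint_CS cU M0 UM conf (cY0 i) (cY1 i) (ce0 i) (ce1 i)).
  have := gen7 _ _ _ _ Hk (dw_ge0 k T e) lo up nY; move/le_trans; apply.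
  by rewrite -!mulrA (mulrC (h ^+ k)).
(* By symmetry of the form, [L e = a(g, e) = a(e, g) = a(I_h G - G, g)] when [g] represents [L]. *)
- have gr L z : lin0 k Om T L -> `|Aprime Om T u (IG \- G) (xget (fun=> 0) [set v | Vh0 Om T k v /\ forall phi, Vh0 Om T k phi -> Aprime Om T u v phi = L phi])| <= z ->
      `|L e| <= z.
    move=> hL; set g := xget _ _; have [Vg Hg] := riesz_xget conf rg h0 h1 hL (erefl g).
    rewrite (Aprime_sum OmE conf Ujet Uhess pX (pw_Vh k0 conf Vg.1)) -(Hg e Ve) => b.
    have E := He g Vg; rewrite /vh_form asum_sym in E; rewrite -E in b; exact: b.
  move=> i x hx; have [cl [c0 c1]] := D_cont k e i conf.
  have B z : (HT i)° z -> [/\ `|loc k e i z| <= C4 * (h ^+ k * `|ln h|), `|D0 k e i z| <= C4 * (h ^+ k * `|ln h|) & `|D1 k e i z| <= C4 * (h ^+ k * `|ln h|)].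
    move=> hz; have bz := HT_broken OmE conf hz; have [g1 g2] := hg z bz.
    have cz := HT_sub conf (interior_subset hz); split.
    + by have := gr _ _ (eval_lin0 k T cz) g1; rewrite (vh_loc k0 conf Ve.1 (interior_subset hz)).
    + by have := gr _ _ (dpart_loc_lin0 k0 o0 conf hz) (g2 o0); rewrite (dpart_loc k0 conf _ Ve.1 hz).
    + by have := gr _ _ (dpart_loc_lin0 k0 o1 conf hz) (g2 o1); rewrite (dpart_loc k0 conf _ Ve.1 hz).
  split; [apply: (closure_abs_le conf cl _ hx)|apply: (closure_abs_le conf c0 _ hx)|apply: (closure_abs_le conf c1 _ hx)] => z hz; have [b1 b2 b3] := B z hz.
  + exact: b1.
  + exact: b2.
  + exact: b3.
- move=> i x hx; have [b1 b2 b3] := bQ i x hx; split.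
  + rewrite /v0 (loc_lin k 1 (-1) Q e i); rewrite (loc_lin k 1 1 P IG i) in b1 *; exact: gen5 b1.
  + by rewrite /e0 Dv0 DQ0; rewrite DQ0 in b2; exact: gen4 b2.
  + by rewrite /e1 Dv1 DQ1; rewrite DQ1 in b3; exact: gen4 b3.
Qed.

Lemma nn_le_eq T (P0 P1 Q0 Q1 : 'I_(size T) -> pt -> R) (c : R) : (forall i x, P0 i x = Q0 i x) -> (forall i x, P1 i x = Q1 i x) ->
  nn Q0 Q1 <= c -> nn P0 P1 <= c.
Proof.
move=> h0 h1; rewrite (_ : P0 = Q0); first by rewrite (_ : P1 = Q1)//; apply/funext => i; exact/funext/h1.
by apply/funext => i; exact/funext/h0.
Qed.

(** The radius splits into three shares of [C4 h^k |ln h|]: for [u - P_h u], where [C1 <= C4] and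
    [|ln h| >= 1] are used, for [e], and for the correction [y], obtained from [newton] with
    [eps = C4]. The H^1 bound is free of logarithms because [P_h u - u] is of order h^k pointwise
    and [e], [y] are so in energy. *)
Lemma scheme (C1 C4 : R) : 0 < C1 -> C1 <= C4 -> exists h0 C : R, [/\ 0 < h0, 0 < C & forall T (h : R),
  conforming Om T -> regT kap h T -> 0 < h -> h <= 1 -> h <= h0 ->
  (W1infty_norm Om T (u \- Ph Om T k u G)%R <= (C1 * h ^+ k)%:E)%E ->
  (forall z, broken Om T z -> `|Aprime Om T u (interp Om T k G \- G) (green Om T k u z)| <= C4 * (h ^+ k * `|ln h|) /\
     forall i, `|Aprime Om T u (interp Om T k G \- G) (dgreen Om T k u i z)| <= C4 * (h ^+ k * `|ln h|)) ->
  exists uh, [/\ [/\ Vh Om T k uh, forall x, bdry Om x -> uh x = interp Om T k G x &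
      forall phi, Vh0 Om T k phi -> Aform f T uh phi = 0],
    (W1infty_norm Om T (uh \- u)%R <= (3 * C4 * (h ^+ k * `|ln h|))%:E)%E,
    forall w, Vh Om T k w -> (forall x, bdry Om x -> w x = interp Om T k G x) ->
      (forall phi, Vh0 Om T k phi -> Aform f T w phi = 0) ->
      (W1infty_norm Om T (w \- u)%R <= (3 * C4 * (h ^+ k * `|ln h|))%:E)%E -> forall x, closure Om x -> w x = uh x &
    (H1_norm Om T (u \- uh)%R <= (C * h ^+ k)%:E)%E]].
Proof.
move=> C10 C14; have C40 : 0 < C4 := lt_le_trans C10 C14.
have [Ce Ce0 hstart] := start C4 C10.
have [hm hm0 hnewton] := newton k0 k3 OmE Om0 kap Ujet cU1 cU2 cU M0 al0 UM Uel cf fE C10 C40 Ce0 C40.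
have [Cu Cu0 huniq] := discrete_unique k0 OmE Om0 kap Ujet cU1 cU2 cU al0 Uel cf fE.
have [B B0 hB] := weight_size OmE Om0.
have [Cp Cp0 hsup] := supbound k0 OmE Om0 kap B0 hB.
have [Cs Cs0 hs] := nn_sup OmE Om0 kap; have [CF CF0 hF] := friedrichs k0 OmE Om0.
have [d1 d10 hd1] := ln_large 1 : exists2 d : R, 0 < d & _.
(* The factor 6 is 3, from the radius, times 2, for a contraction factor of one half in
   [discrete_unique]. *)
have c60 : 0 < 6 * (Cu * C4) by rewrite !mulr_gt0.
have [d2 d20 hd2] := small_hln c60.
have gS (a c H l : R) : 0 <= H -> 1 <= l -> `|a| <= C1 * H -> `|c| <= C4 * (H * l) -> forall b, `|b| <= C4 * (H * l) -> `|a + (c - b)| <= 3 * C4 * (H * l).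
  move=> H0 l1 ha hc b hb; apply: le_trans (ler_normD _ _) _.
  have h1 : C1 * H <= C4 * (H * l) by apply: ler_pM => //; [exact: ltW|rewrite ler_peMr].
  apply: le_trans (lerD (le_trans ha h1) (le_trans (ler_normB _ _) (lerD hc hb))) _.
  by rewrite -mulrA; move: (C4 * (H * l)) => X; lra.
have r1 (a b y p : R) : 1 * (1 * a + 1 * y) + -1 * p = (a - p + b) + (y - b) by ring.
have e2 (a b y p : R) : 1 * a + 1 * y - p = - (p - (a + b)) + (y - b) by ring.
have e3 (a b y p : R) : p - (1 * a + 1 * y) = 1 * (p - (a + b)) + 1 * (1 * b + -1 * y) by ring.
have e4 (a b y p : R) : 1 * p + -1 * (1 * a + 1 * y) = 1 * (-1 * (a - p + b) + 0) + 1 * (1 * b + -1 * y) by ring.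
have e4' (a b : R) : `|a| <= b -> `|-1 * a + 0| <= b by rewrite addr0 mulN1r normrN.
have e5 (a p m : R) : `|1 * a + -1 * p| <= m -> `|a - p| <= m by rewrite mul1r mulN1r.
have e5' (a p m : R) : `|a - p| <= m -> `|1 * a + -1 * p| <= m by rewrite mul1r mulN1r.
have e6 (a b : R) : -1 * b + a = 1 * a + -1 * b by rewrite mul1r addrC.
have e7 (a b : R) : `|1 * a + -1 * b| <= 0 -> a = b.
  by rewrite normr_le0 mul1r mulN1r subr_eq0 => /eqP.
have r9 : 0 = 1 * 0 + 1 * (1 * 0 + -1 * 0) :> R by ring.
have r8 (X : R) : 6 * (Cu * C4) * X <= 1 -> Cu * (3 * C4) * X <= 2^-1 by lra.
pose c : R := Cs * C1 + (CF + 1) * (Ce + 1).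
have c0 : 0 < c by rewrite addr_gt0// mulr_gt0// addr_gt0.
have f1 (S le ly de' dy H : R) : 0 <= H -> S <= Cs * (C1 * H) -> le <= CF * de' -> ly <= CF * dy -> de' <= Ce * H -> dy <= H -> S + (le + ly) <= c * H.
  move=> H0 hS hl hy hd hdy; have h1 := ler_wpM2l (ltW CF0) hd; have h2 := ler_wpM2l (ltW CF0) hdy.
  have h3 : 0 <= Ce * H := mulr_ge0 (ltW Ce0) H0; rewrite /c; lra.
have f2 (S de' dy H : R) : 0 <= H -> S <= Cs * (C1 * H) -> de' <= Ce * H -> dy <= H -> S + (de' + dy) <= c * H.
  move=> H0 hS hd hdy; have h1 := mulr_ge0 (ltW CF0) (mulr_ge0 (ltW Ce0) H0); have h2 := mulr_ge0 (ltW CF0) H0; rewrite /c; lra.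
exists (Num.min hm (Num.min d1 d2)), (2 * c); split; [by rewrite !lt_min hm0 d10|exact: mulr_gt0|].
move=> T h conf rg h0 h1; rewrite !le_min => /andP[hhm /andP[hhd1 hhd2]] hW hg.
have [v0 [e [[Vv0 Ve v0b] Ev heD hew hv]]] := hstart T h conf rg h0 h1 hW hg.
have H0 : 0 <= h ^+ k := exprn_ge0 k (ltW h0); have l1 := hd1 h h0 hhd1.
have he' i x : HT (T := T) i x -> `|D0 k e i x| <= C4 * (h ^+ k * `|ln h|) /\ `|D1 k e i x| <= C4 * (h ^+ k * `|ln h|).
  by move=> hx; have [_ b1 b2] := hew i x hx; split.
have hv' i x : HT (T := T) i x -> `|e0 k U1 v0 i x + D0 k e i x| <= C1 * h ^+ k /\ `|e1 k U2 v0 i x + D1 k e i x| <= C1 * h ^+ k.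
  by move=> hx; have [_ b1 b2] := hv i x hx; split.
have [y [Vy dy solv ysup yD]] := hnewton T h v0 e conf rg h0 h1 hhm Vv0 Ve Ev heD he' hv'.
pose uh x := 1 * v0 x + 1 * y x.
have Vuh : Vh Om T k uh.
  have := Vh_lin 1 Vv0 Vy.1; rewrite (_ : (fun x => 1 * v0 x + y x) = uh); first exact.
  by apply/funext => x; rewrite /uh (mul1r (y x)).
have [Du0 Du1] := D_lin k 1 1 v0 y conf; rewrite -/uh in Du0 Du1.
have ub x : bdry Om x -> uh x = interp Om T k G x.
  by move=> bx; rewrite /uh (Vy.2 x bx) (v0b x bx) mulr0 addr0 mul1r.
have pu := pw_C OmE conf cU1 cU2 dU.
have clw w i : cont (HT (T := T) i) (loc k w i) by have [] := D_cont k w i conf.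
have cuT i : cont (HT (T := T) i) u := contW (HT_sub conf (i := i)) cu.
have m0 : 0 <= 3 * C4 * (h ^+ k * `|ln h|).
  by rewrite mulr_ge0// mulr_ge0// ltW.
have wint w (i : 'I_(size T)) x : Vh Om T k w -> (HT i)° x -> (w \- u) x = loc k w i x - u x.
  by move=> Vw hx; rewrite -(vh_loc k0 conf Vw (interior_subset hx)).
have bnd i x : HT (T := T) i x -> [/\ `|loc k uh i x - u x| <= 3 * C4 * (h ^+ k * `|ln h|),
    `|1 * D0 k uh i x + -1 * U1 x| <= 3 * C4 * (h ^+ k * `|ln h|) & `|1 * D1 k uh i x + -1 * U2 x| <= 3 * C4 * (h ^+ k * `|ln h|)].
  move=> hx; have [a1 a2 a3] := hew i x hx; have [b1 b2 b3] := hv i x hx; have [y2 y3] := yD i x hx; have y1 := ysup i x hx; split.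
  - rewrite (loc_lin k 1 1 v0 y i) (e2 _ (loc k e i x)); apply: (gS _ _ _ _ H0 l1) => //; rewrite normrN; exact: b1.
  - rewrite Du0 (r1 _ (D0 k e i x)); exact: (gS _ _ _ _ H0 l1 b2 y2 _ a2).
  - rewrite Du1 (r1 _ (D1 k e i x)); exact: (gS _ _ _ _ H0 l1 b3 y3 _ a3).
exists uh; split; first by split.
- exact: (W1_HT_le OmE conf (pw_sub (pw_Vh k0 conf Vuh) pu) m0 (fun i x => wint uh i x Vuh) bnd).
- move=> w Vw wb wsol wn.
  have bw : forall i x, HT (T := T) i x -> [/\ `|loc k w i x - u x| <= 3 * C4 * (h ^+ k * `|ln h|),
      `|1 * D0 k w i x + -1 * U1 x| <= 3 * C4 * (h ^+ k * `|ln h|) & `|1 * D1 k w i x + -1 * U2 x| <= 3 * C4 * (h ^+ k * `|ln h|)].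
    apply: (W1_HT OmE conf (pw_sub (pw_Vh k0 conf Vw) pu) _ (fun i x => wint w i x Vw) wn).
    by move=> i; exact: contB (clw w i) (cuT i).
  have Vd : Vh0 Om T k (fun x => 1 * w x + -1 * uh x).
    split; last by move=> x bx; rewrite (wb x bx) (ub x bx) mul1r mulN1r subrr.
    have := Vh_lin (-1) Vuh Vw; rewrite (_ : (fun x => -1 * uh x + w x) = (fun x => 1 * w x + -1 * uh x)); first exact.
    by apply/funext => x; exact: e6.
  have sm : Cu * (3 * C4 * (h ^+ k * `|ln h|)) / h ^+ 2 <= 2^-1.
    have [_ p1 _] := pow_bounds k3 h0 h1 (normr_ge0 (ln h)).
    have q := hd2 h h0 h1 hhd2; have q' := ler_wpM2l (mulr_ge0 (ltW Cu0) (mulr_ge0 (ler0n _ 3) (ltW C40))) p1.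
    have -> : Cu * (3 * C4 * (h ^+ k * `|ln h|)) / h ^+ 2 = Cu * (3 * C4) * (h ^+ k * `|ln h| / h ^+ 2) by rewrite !mulrA.
    apply: le_trans q' _; exact: r8 q.
  have eb (v : pt -> R) : (forall i x, HT (T := T) i x -> [/\ `|loc k v i x - u x| <= 3 * C4 * (h ^+ k * `|ln h|),
      `|1 * D0 k v i x + -1 * U1 x| <= 3 * C4 * (h ^+ k * `|ln h|) & `|1 * D1 k v i x + -1 * U2 x| <= 3 * C4 * (h ^+ k * `|ln h|)]) ->
    forall i : 'I_(size T), ebound k U1 U2 v i (3 * C4 * (h ^+ k * `|ln h|)).
    by move=> hb i x hx; have [_ b1 b2] := hb i x hx; split; [exact: e5 b1|exact: e5 b2].
  have dz := huniq T w uh h _ conf rg h0 m0 Vw Vuh Vd (eb w bw) (eb uh bnd) sm wsol solv.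
  move=> x cx; have [i hx] := (mesh_closureE conf x).1 cx.
  have := hsup T _ h conf rg h0 h1 Vd i x hx; rewrite dz mulr0 -(vh_loc k0 conf Vd.1 hx); exact: e7.
- rewrite -mulrA.
  have cz : pwc (fun _ _ => 0 : R) (T := T) by move=> i; exact: cont_cst.
  have cle : pwc (@loc R k T e) by move=> i; exact: clw.
  have cly : pwc (@loc R k T y) by move=> i; exact: clw.
  have [ce0 ce1] := D_pwc k e conf; have [cy0 cy1] := D_pwc k y conf.
  have cH : 0 <= c * h ^+ k := mulr_ge0 (ltW c0) H0.
  have HC : 0 <= C1 * h ^+ k := mulr_ge0 (ltW C10) H0.
  pose S (i : 'I_(size T)) x := u x - (loc k v0 i x + loc k e i x).
  have cS : pwc (T := T) S by move=> i; exact: contB (cuT i) (contD (clw v0 i) (clw e i)).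
  pose S0 (i : 'I_(size T)) x := -1 * (e0 k U1 v0 i x + D0 k e i x) + 0.
  pose S1 (i : 'I_(size T)) x := -1 * (e1 k U2 v0 i x + D1 k e i x) + 0.
  have cS0 : pwc S0.
    move=> i; have [h2 h3] := e_cont k cU1 cU2 v0 i conf; have h4 := ce0 i; have hc : cont (HT i) (fun=> 0) by exact: cont_cst.
    have hc1 : cont (HT i) (fun=> -1) by exact: cont_cst.
    exact: contD (contM hc1 (contD h2 h4)) hc.
  have cS1 : pwc S1.
    move=> i; have [h2 h3] := e_cont k cU1 cU2 v0 i conf; have h4 := ce1 i; have hc : cont (HT i) (fun=> 0) by exact: cont_cst.
    have hc1 : cont (HT i) (fun=> -1) by exact: cont_cst.
    exact: contD (contM hc1 (contD h3 h4)) hc.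
  have nS : nn S (fun _ _ => 0) <= Cs * (C1 * h ^+ k).
    apply: (hs T h _ S _ conf rg h0 HC cS cz) => i x hx; last by rewrite normr0.
    by have [b1 _ _] := hv i x hx.
  have nS01 : nn S0 S1 <= Cs * (C1 * h ^+ k).
    by apply: (hs T h _ S0 S1 conf rg h0 HC cS0 cS1) => i x hx; have [_ b1 b2] := hv i x hx; [exact: e4' b1|exact: e4' b2].
  apply: (H1_nn OmE conf (pw_sub pu (pw_Vh k0 conf Vuh)) (W := fun i x => u x - loc k uh i x) _ cH).
  + by move=> i; exact: contB (cuT i) (clw uh i).
  + by move=> i x hx; rewrite -(vh_loc k0 conf Vuh (interior_subset hx)).
  + have B1 := le_trans (nn_tri cS cz cle cz cly cz) (f1 _ _ _ _ _ _ H0 nS (hF T e conf Ve) (hF T y conf Vy) heD dy).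
    apply: (nn_le_eq _ _ B1) => j x; [rewrite (loc_lin k 1 1 v0 y j); exact: e3|exact: r9].
  + have B1 := le_trans (nn_tri cS0 cS1 ce0 ce1 cy0 cy1) (f2 _ _ _ _ H0 nS01 heD dy).
    by apply: (nn_le_eq _ _ B1) => j x; [rewrite Du0; exact: e4|rewrite Du1; exact: e4].
Qed.

End Final.

(** * Transfer of the hypotheses and conclusion *)

(** The traces in the hypothesis are the values of the continuous extensions of the second
    derivatives, and the quadratic form of the cofactor matrix is written out with the symmetry of
    the mixed ones. *)
Lemma hess_elliptic (R : realType) (Om : set (R * R)) (s : seq (R * R)) (u U11 U12 U22 : R * R -> R) (al al1 : R) :
  Om = (hull s)° -> Om !=set0 ->
  [/\ cont (closure Om) U11, cont (closure Om) U12 & cont (closure Om) U22] ->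
  (forall x, Om x -> [/\ dpart [:: o0; o0] u x = U11 x, dpart [:: o0; o1] u x = U12 x,
     dpart [:: o1; o0] u x = U12 x & dpart [:: o1; o1] u x = U22 x]) ->
  (forall x (r : 'cV[R]_2), closure Om x -> al * dot r r <= dot r (cof (hess_from Om u x) *m r) /\
     dot r (cof (hess_from Om u x) *m r) <= al1 * dot r r) ->
  forall x (a b : R), closure Om x -> al * (a ^+ 2 + b ^+ 2) <= U22 x * a ^+ 2 - 2 * U12 x * a * b + U11 x * b ^+ 2.
Proof.
move=> OmE Om0 [c11 c12 c22] Uh hcof x a b cx.
have gen (p q r t a' b' : R) : p * (a' * a' + b' * b') <= a' * (t * a' + - q * b') + b' * (- q * a' + r * b') ->
    p * (a' ^+ 2 + b' ^+ 2) <= t * a' ^+ 2 - 2 * q * a' * b' + r * b' ^+ 2 by lra.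
have [h _] := hcof x (\col_i (if i == ord0 then a else b)) cx; move: h.
have t00 : trace_from Om (dpart [:: o0; o0] u) x = U11 x.
  by apply: (trace_fromE c11 _ cx) => y oy; have [-> _ _ _] := Uh y oy.
have t01 : trace_from Om (dpart [:: o0; o1] u) x = U12 x.
  by apply: (trace_fromE c12 _ cx) => y oy; have [_ -> _ _] := Uh y oy.
have t10 : trace_from Om (dpart [:: o1; o0] u) x = U12 x.
  by apply: (trace_fromE c12 _ cx) => y oy; have [_ _ -> _] := Uh y oy.
have t11 : trace_from Om (dpart [:: o1; o1] u) x = U22 x.
  by apply: (trace_fromE c22 _ cx) => y oy; have [_ _ _ ->] := Uh y oy.
set r := \col_i _; have r0 : r o0 ord0 = a by rewrite mxE o_ord.1.
have r1 : r o1 ord0 = b by rewrite mxE o_ord.2.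
have [k1 k2 k3 k4] := cof2 (hess_from Om u x); have [m1 m2] := mulmx2 (cof (hess_from Om u x)) r.
have h00 : hess_from Om u x o0 o0 = U11 x by rewrite mxE.
have h01 : hess_from Om u x o0 o1 = U12 x by rewrite mxE.
have h10 : hess_from Om u x o1 o0 = U12 x by rewrite mxE.
have h11 : hess_from Om u x o1 o1 = U22 x by rewrite mxE.
rewrite k1 k2 h11 h10 r0 r1 in m1; rewrite k3 k4 h00 h01 r0 r1 in m2.
by rewrite (dot2 r r) (dot2 r (_ *m r)) m1 m2 r0 r1; exact: gen.
Qed.

Theorem theorem3p7 (R : realType) (k : nat) (Om : set (R * R))
    (f g G gext u : R * R -> R) (c0 alpha0 alpha1 : R)
    (F : set (mesh R)) (C1 C2 C3 : R)
    (hk : (3 <= k)%N)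
    (hOm : convex_polygonal_domain Om)
    (hf : Cm_closure Om 1 f) (hc0 : 0 < c0)
    (hfc0 : forall x, closure Om x -> c0 <= f x)
    (hg : {within bdry Om, continuous g})
    (hG : Cm_closure Om 3 G) (hGg : forall x, bdry Om x -> G x = g x)
    (hgext : {within closure Om, continuous gext})
    (hgextg : forall x, bdry Om x -> gext x = g x)
    (hu : Cm_closure Om 3 u) (hucvx : strictly_convex_on Om u)
    (hMA : forall x, Om x -> \det (hess u x) = f x)
    (hug : forall x, bdry Om x -> u x = g x)
    (halpha0 : 0 < alpha0) (halpha1 : 0 < alpha1)
    (hcof : forall x (r : 'cV[R]_2), closure Om x ->
       alpha0 * dot r r <= dot r (cof (hess_from Om u x) *m r) /\
       dot r (cof (hess_from Om u x) *m r) <= alpha1 * dot r r)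
    (huW : Wminfty Om k.+1 u) (hGW : Wminfty Om k.+1 G)
    (hconf : forall T, F T -> conforming_triangulation Om T)
    (hsize : forall T, F T -> meshsize T <= 1)
    (hreg : shape_regular F) (hqu : quasi_uniform F)
    (hC1 : 0 < C1) (hC2 : 0 < C2) (hC3 : 0 < C3)
    (hC : exists2 h1 : R, 0 < h1 &
       forall T, F T -> meshsize T <= h1 ->
         let h := meshsize T in
         (W1infty_norm Om T (u \- Ph Om T k u G)%R <= (C1 * h ^+ k)%:E)%E /\
         forall z, broken Om T z ->
           `|Aprime Om T u (interp Om T k G \- G) (green Om T k u z)|
             <= C2 * h ^+ k * `|ln h| /\
           forall i : 'I_2,
             `|Aprime Om T u (interp Om T k G \- G) (dgreen Om T k u i z)|
               <= C3 * h ^+ k * `|ln h|) :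
  let C4 := Num.max C1 (Num.max C2 C3) in
  exists h0 C : R, [/\ 0 < h0, 0 < C &
    forall T, F T -> meshsize T <= h0 ->
      let gh := interp Om T k gext in
      exists uh : R * R -> R,
        [/\ discrete_solution Om f T k gh uh,
            Bh Om T k u gh C4 uh,
            forall w, discrete_solution Om f T k gh w -> Bh Om T k u gh C4 w ->
              forall x, closure Om x -> w x = uh x &
            (H1_norm Om T (u \- uh)%R <= (C * meshsize T ^+ k)%:E)%E]].
Proof.
move=> C4; have [Om0 [s OmE]] := hOm; have k0 : (0 < k)%N by exact: leq_trans hk.
have [U1 [U2 [U11 [U12 [U22 [Ujet Uh dU]]]]]] := jets3 OmE Om0 hu.
have [G1 [G2 [G11 [G12 [G22 [Gjet Gh dG]]]]]] := jets3 OmE Om0 hG.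
have [[[cu cU1 cU2 _] [_ c11 c12 _] [_ _ c22 _]] _] := Ujet.
have [[[cG cG1 cG2 _] _ _] _] := Gjet.
have cU : [/\ cont (closure Om) U11, cont (closure Om) U12 & cont (closure Om) U22] by [].
have Uel := hess_elliptic OmE Om0 cU Uh hcof.
have cpt := compact_closure OmE Om0.
have [M1 M10 hM1] := cont_bounded cpt c11; have [M2 M20 hM2] := cont_bounded cpt c12; have [M3 M30 hM3] := cont_bounded cpt c22.
pose M : R := M1 + M2 + M3; have M0 : 0 < M by rewrite !addr_gt0.
have UM x : closure Om x -> [/\ `|U11 x| <= M, `|U12 x| <= M & `|U22 x| <= M].
  move=> cx; have := hM1 x cx; have := hM2 x cx; have := hM3 x cx; rewrite /M => b3 b2 b1.
  by split; lra.
have fE x : Om x -> f x = U11 x * U22 x - U12 x ^+ 2.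
  by move=> ox; rewrite -hMA// det2 !mxE; have [-> -> -> ->] := Uh x ox; rewrite expr2.
have cf : cont (closure Om) f := hf.1.
have [kap hkap] := mesh_reg Om hreg hqu.
have C14 : C1 <= C4 by rewrite /C4 le_max lexx.
have C24 : C2 <= C4 by rewrite /C4 !le_max lexx orbT.
have C34 : C3 <= C4 by rewrite /C4 !le_max lexx !orbT.
have [h0 [C [h00 C0 hS]]] := scheme k0 hk OmE Om0 kap Ujet Uh dU cu cU1 cU2 cU M0 halpha0 UM Uel cf fE cG1 cG2 dG hC1 C14.
have [h1 h10 hCT] := hC.
exists (Num.min h0 h1), C; split; [by rewrite lt_min h00|exact: C0|].
move=> T FT; rewrite le_min => /andP[hT0 hT1] gh.
have conf := hconf T FT; have rg := hkap T FT conf.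
(* A nonempty domain forces the mesh to have an element, and with it [meshsize T > 0]. *)
have [z Oz] := Om0; have [i _] := (mesh_closureE conf z).1 (subset_closure Oz).
have h0' : 0 < meshsize T by have [] := rg i.
have [hW hg'] := hCT T FT hT1.
have le4 (c a b x : R) : c <= C4 -> 0 <= a * b -> x <= c * a * b -> x <= C4 * (a * b).
  by move=> c4 ab /le_trans; apply; rewrite -mulrA; exact: ler_wpM2r.
have ab0 : 0 <= meshsize T ^+ k * `|ln (meshsize T)| := mulr_ge0 (exprn_ge0 k (ltW h0')) (normr_ge0 _).
have hgr y : broken Om T y ->
    `|Aprime Om T u (interp Om T k G \- G) (green Om T k u y)| <= C4 * (meshsize T ^+ k * `|ln (meshsize T)|) /\
    forall i, `|Aprime Om T u (interp Om T k G \- G) (dgreen Om T k u i y)| <= C4 * (meshsize T ^+ k * `|ln (meshsize T)|).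
  move=> by'; have [a1 a2] := hg' y by'; split; first exact: le4 C24 ab0 a1.
  by move=> j; exact: le4 C34 ab0 (a2 j).
have [uh [[Vuh ub usol] uB uU uH]] := hS T (meshsize T) conf rg h0' (hsize T FT) hT0 hW hgr.
(* [G] and [gext] both restrict to [g] on the boundary, and there interpolants depend on boundary
   values only. *)
have bE x : bdry Om x -> interp Om T k G x = gh x.
  move=> bx; apply: (interp_bdry k0 OmE conf _ bx) => y b'; by rewrite hGg// hgextg.
have EB : 3 * C4 * (meshsize T ^+ k * `|ln (meshsize T)|) = 3 * C4 * meshsize T ^+ k * `|ln (meshsize T)| by rewrite !mulrA.
have ub' x : bdry Om x -> uh x = gh x by move=> bx; rewrite -bE//; exact: ub.
rewrite EB in uB; exists uh; split; [by split|by split| |exact: uH].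
move=> w [Vw wb wsol] [_ _ wn]; apply: uU => //; last by rewrite EB.
by move=> x bx; rewrite bE//; exact: wb.
Qed.
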